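(* Let $f=0$ and $v\in D(\Delta)=H_0^1(\Omega)\cap H^2(\Omega)$. Let $u_h$ be the semidiscrete Galerkin solution with $u_h(0)=v_h$, and let $U_h^n$, $1\le n\le N$, be the solution of the corrected fractional Crank–Nicolson scheme with $U_h^0=v_h$, where $v_h:=R_hv$ (and $f_h=0$, $F_h^n=0$). Then there is a constant $c$, independent of the mesh size $h$ and the time step size $\tau$, such that $$\|u_h(t_n)-U_h^n\|_{L^2(\Omega)}\le c\,\tau^2 t_n^{\alpha-2}\|\Delta v\|_{L^2(\Omega)},\qquad n\ge 1 .$$
   Context: Setting. $\Omega\subset\mathbb R^d$ ($d=1,2,3$) is a bounded convex polygonal domain, $T>0$ is fixed, $0<\alpha<1$. The problem is $\partial_t^\alpha u(t)-\Delta u(t)=f(t)$ for $t\in(0,T)$, $u(0)=v$, with zero Dirichlet boundary condition, where $\partial_t^\alpha u(t)=\frac1{\Gamma(1-\alpha)}\int_0^t(t-s)^{-\alpha}\frac{d}{ds}u(s)\,ds$ is the Caputo derivative. Space discretization. $\mathcal T_h$ is a shape regular quasi-uniform triangulation of $\Omega$ into $d$-simplexes with mesh size $h$; $X_h\subset H_0^1(\Omega)$ is the space of continuous piecewise linear functions over $\mathcal T_h$ vanishing on $\partial\Omega$. $P_h:L^2(\Omega)\to X_h$ is the $L^2(\Omega)$-projection, $R_h:H_0^1(\Omega)\to X_h$ is the Ritz projection, $(\nabla R_h\varphi,\nabla\chi_h)=(\nabla\varphi,\nabla\chi_h)$ for all $\chi_h\in X_h$, and $\Delta_h:X_h\to X_h$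 is defined by $-(\Delta_h\varphi_h,\chi_h)=(\nabla\varphi_h,\nabla\chi_h)$ for all $\varphi_h,\chi_h\in X_h$. The semidiscrete solution $u_h(t)\in X_h$ satisfies $\partial_t^\alpha u_h(t)-\Delta_hu_h(t)=f_h(t)$, $t>0$, $u_h(0)=v_h\in X_h$, where $f_h=P_hf$. Time discretization. $\tau=T/N$, $N\in\mathbb N$, $t_n=n\tau$, $F_h^n=f_h(t_n)$. For a sequence $\varphi^n$, $\bar\partial_\tau^\alpha\varphi^n:=\tau^{-\alpha}\sum_{j=0}^n b_{n-j}\varphi^j$ with $\sum_{j=0}^\infty b_j\xi^j=(1-\xi)^\alpha$. The corrected fractional Crank–Nicolson scheme is: $U_h^0=v_h$ and $$\bar\partial_\tau^\alpha(U_h-v_h)^1-(1-\tfrac\alpha2)\Delta_hU_h^1-(\tfrac12-\tfrac\alpha4)\Delta_hv_h=(1-\tfrac\alpha2)(F_h^1+\tfrac12F_h^0),$$ $$\bar\partial_\tau^\alpha(U_h-v_h)^2-(1-\tfrac\alpha2)\Delta_hU_h^2-\tfrac\alpha2\Delta_hU_h^1-\tfrac\alpha4\Delta_hv_h=(1-\tfrac\alpha2)F_h^2+\tfrac\alpha2F_h^1+\tfrac\alpha4F_h^0,$$ $$\bar\partial_\tau^\alpha(U_h-v_h)^n-(1-\tfrac\alpha2)\Delta_hU_h^n-\tfrac\alpha2\Delta_hU_h^{n-1}=(1-\tfrac\alpha2)F_h^n+\tfrac\alpha2F_h^{n-1},\quad 3\le n\le N.$$ *)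

(* Defs.v *)
From HB Require Import structures.
From mathcomp Require Import all_boot all_order all_algebra.
From mathcomp Require Import all_classical all_reals all_analysis.
Import Order.TTheory GRing.Theory Num.Theory.
Import numFieldNormedType.Exports.

Set Implicit Arguments.
Unset Strict Implicit.
Unset Printing Implicit Defensive.

Local Open Scope classical_set_scope.
Local Open Scope ring_scope.

Definition rV_display : measure_display. Proof. exact: default_measure_display. Qed.

(* 'rV[R]_d carries the Borel sigma-algebra, as the smallest one making the
   coordinates measurable (the same construction as the library's on tuples). *)
Section measurable_rV.
Context {R : realType} (d : nat).

Definition rV_coord (i : 'I_d) (x : 'rV[R]_d) : R := x ord0 i.

Let rV_measurable : set (set 'rV[R]_d) := g_sigma_preimage rV_coord.

Let rV_set0 : rV_measurable set0.
Proof. exact: sigma_algebra0. Qed.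

Let rV_setC A : rV_measurable A -> rV_measurable (~` A).
Proof. exact: sigma_algebraC. Qed.

Let rV_bigcup (F : (set 'rV[R]_d)^nat) :
  (forall i, rV_measurable (F i)) -> rV_measurable (\bigcup_i F i).
Proof. exact: sigma_algebra_bigcup. Qed.

HB.instance Definition _ := @isMeasurable.Build rV_display 'rV[R]_d
  rV_measurable rV_set0 rV_setC rV_bigcup.

End measurable_rV.

Lemma measurable_rV_coord (R : realType) d (i : 'I_d) :
  measurable_fun [set: 'rV[R]_d] (rV_coord i).
Proof.
move=> _ Y mY; rewrite setTI; apply: sub_sigma_algebra => /=.
rewrite -bigcup_seq/=; exists i => /=; first by rewrite mem_index_enum.
by exists Y => //; rewrite setTI.
Qed.

Lemma measurable_fun_rV (R : realType) d d0 (T : measurableType d0)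
    (f : T -> 'rV[R]_d) :
  (forall i, measurable_fun [set: T] (rV_coord i \o f)) ->
  measurable_fun [set: T] f.
Proof.
move=> mf.
have H : g_sigma_preimage (fun i => rV_coord i \o f) `<=` measurable.
  apply: smallest_sub; first exact: sigma_algebra_measurable.
  by rewrite -bigcup_seq => A /= [i _ [B mB <-]]; exact: mf.
move: H; rewrite g_sigma_preimage_comp => H _ A mA.
by apply: H; exists A.
Qed.

(* (x, t) |-> (x_1, ..., x_d, t) *)
Definition rV_snoc (R : realType) d (p : 'rV[R]_d * R) : 'rV[R]_d.+1 :=
  \row_i (if unlift ord_max i is Some j then p.1 ord0 j else p.2).

Lemma measurable_rV_snoc (R : realType) d :
  measurable_fun setT (@rV_snoc R d).
Proof.
apply: measurable_fun_rV => i.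
case: (unliftP ord_max i) => [j ->|->].
  rewrite (_ : _ \o _ = rV_coord j \o fst).
    by apply: measurableT_comp => //; exact: measurable_rV_coord.
  by apply/funext => p; rewrite /= /rV_coord mxE liftK.
rewrite (_ : _ \o _ = snd) //.
by apply/funext => p; rewrite /= /rV_coord mxE unlift_none.
Qed.


Definition lebesgue_rVS (R : realType) d (mu : {measure set 'rV[R]_d -> \bar R}) :=
  pushforward (mu \x @lebesgue_measure R)%E (@rV_snoc R d).

Section lebesgue_rVS.
Context (R : realType) (d : nat) (mu : {measure set 'rV[R]_d -> \bar R}).
Let prod_mu : {measure set ('rV[R]_d * measurableTypeR R) -> \bar R} :=
  (mu \x @lebesgue_measure R)%E.
HB.instance Definition _ := Measure.copy (lebesgue_rVS mu)
  (measure_function_pushforward__canonical__measure_function_Measure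
    prod_mu (@measurable_rV_snoc R d)).
End lebesgue_rVS.

Fixpoint lebesgue_rV (R : realType) (d : nat) : {measure set 'rV[R]_d -> \bar R} :=
  if d is d'.+1 then lebesgue_rVS (lebesgue_rV R d') else \d_(0 : 'rV[R]_0).

Lemma lebesgue_rV_prod (R : realType) d (A : 'I_d -> set (measurableTypeR R)) :
  (forall i, measurable (A i)) ->
  lebesgue_rV R d [set x | forall i, A i (x ord0 i)] =
    (\prod_(i < d) lebesgue_measure (A i))%E.
Proof.
elim: d A => [A _|d IH A mA].
  by rewrite big_ord0 /= diracE mem_set //= => -[].
rewrite big_ord_recr /= /lebesgue_rVS /pushforward.
set B := [set x : 'rV[R]_d | forall i, A (widen_ord (leqnSn d) i) (x ord0 i)].
have lw i : lift ord_max i = widen_ord (leqnSn d) i.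
  by apply/val_inj; rewrite /= /bump leqNgt ltn_ord.
have mB : measurable B.
  rewrite (_ : B = \bigcap_(i in [set: 'I_d])
      (rV_coord i @^-1` A (widen_ord (leqnSn d) i))).
    apply: fin_bigcap_measurable => //= i _; rewrite -[X in measurable X]setTI.
    by apply: measurable_rV_coord => //; exact: mA.
  apply/seteqP; split => x Bx i; first by move=> _; exact: Bx.
  exact: (Bx i Logic.I).
rewrite (_ : _ @^-1` _ = B `*` A ord_max).
  rewrite [LHS](product_measure1E (lebesgue_rV R d)) //.
  by rewrite /B (IH (fun i => A (widen_ord (leqnSn d) i))).
apply/seteqP; split => [[x t] /= Axt|[x t] /= [Bx At] i].
  split; last by have := Axt ord_max; rewrite mxE unlift_none.
  by move=> i; have := Axt (lift ord_max i); rewrite mxE liftK -lw.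
case: (unliftP ord_max i) => [j ->|->]; rewrite mxE ?liftK ?unlift_none //=.
by rewrite lw.
Qed.

Section geometry.
Context {R : realType} {d : nat}.
Implicit Types (x y : 'rV[R]_d) (A Om : set 'rV[R]_d) (K L : 'M[R]_(d.+1, d)).

Definition rdot x y : R := \sum_(i < d) x ord0 i * y ord0 i.

(* the library's norm on 'rV[R]_d is the sup-norm *)
Definition enorm x : R := Num.sqrt (rdot x x).

Definition diameter A : R :=
  sup [set r | exists x y, [/\ A x, A y & r = enorm (x - y)]].

Definition inradius A : R :=
  sup [set r | 0 <= r /\ exists x, [set y | enorm (y - x) <= r] `<=` A].

Definition convex_polygonal_domain Om : Prop :=
  [/\ Om !=set0, bounded_set Om &
      exists m (a : 'I_m -> 'rV[R]_d) (c : 'I_m -> R),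
        Om = [set x | forall k, rdot (a k) x < c k]].

(* The rows of K : 'M_(d.+1, d) are the vertices of a simplex; [face K S] is the
   convex hull of the vertices with index in S. *)
Definition face K (S : {pred 'I_d.+1}) : set 'rV[R]_d :=
  [set x | exists l : 'rV[R]_d.+1,
     [/\ forall k, 0 <= l ord0 k,
         forall k, k \notin S -> l ord0 k = 0,
         \sum_(k < d.+1) l ord0 k = 1 &
         x = l *m K]].

Definition hull K : set 'rV[R]_d := face K predT.

Definition affinely_independent K : bool :=
  row_free (row_mx K (const_mx 1 : 'cV[R]_d.+1)).

(* The last clause is conformity: two simplices meet in the face spanned by
   their common vertices (the empty set if there are none). *)
Definition triangulation Om (Th : seq 'M[R]_(d.+1, d)) : Prop :=
  [/\ forall K, K \in Th -> affinely_independent K,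
      closure Om = [set x | exists2 K, K \in Th & hull K x] &
      forall K L, K \in Th -> L \in Th ->
        hull K `&` hull L =
        face K [pred k | [exists m, row k K == row m L]]].

Definition mesh_size (Th : seq 'M[R]_(d.+1, d)) : R :=
  \big[Num.max/0]_(K <- Th) diameter (hull K).

Definition shape_regular (I : Type) (Th : I -> seq 'M[R]_(d.+1, d)) : Prop :=
  exists sigma : R, forall i K, K \in Th i ->
    diameter (hull K) <= sigma * inradius (hull K).

Definition quasi_uniform (I : Type) (Th : I -> seq 'M[R]_(d.+1, d)) : Prop :=
  exists q : R, forall i K, K \in Th i ->
    mesh_size (Th i) <= q * diameter (hull K).

End geometry.

Section sobolev.
Context {R : realType} {d : nat}.
Variable Om : set 'rV[R]_d.
Local Notation mu := (lebesgue_rV R d).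
Implicit Types u v w g phi : 'rV[R]_d -> R.

Definition L2 u : Prop := (u \_ Om) \in Lfun mu 2%:E.

Definition L2norm u : R := fine ('N[mu]_2%:E [EFin \o (u \_ Om)])%E.

Definition L2dot u w : R := \int[mu]_(x in Om) (u x * w x).

Definition partial (i : 'I_d) u : 'rV[R]_d -> R :=
  fun x => 'D_(delta_mx ord0 i) u x.

Definition smooth u : Prop := forall s : seq 'I_d,
  continuous (foldr partial u s) /\
  forall i x, derivable (foldr partial u s) x (delta_mx ord0 i).

Definition test_function phi : Prop :=
  smooth phi /\
  exists K, [/\ compact K, K `<=` Om & forall x, ~ K x -> phi x = 0].

Definition is_weak_partial (i : 'I_d) u g : Prop :=
  forall phi, test_function phi -> L2dot u (partial i phi) = - L2dot g phi.

(* a representative of the weak derivative of u, defined up to null sets *)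
Definition weak_partial (i : 'I_d) u : 'rV[R]_d -> R :=
  xget (cst 0) [set g | L2 g /\ is_weak_partial i u g].

Definition H1 u : Prop :=
  L2 u /\ forall i, exists g, L2 g /\ is_weak_partial i u g.

Definition H2 u : Prop := H1 u /\ forall i, H1 (weak_partial i u).

Definition H10 u : Prop :=
  H1 u /\ exists phi : nat -> 'rV[R]_d -> R,
    [/\ forall n, test_function (phi n),
        (fun n => L2norm (phi n - u)) @ \oo --> (0 : R) &
        forall i, (fun n => L2norm (partial i (phi n) - weak_partial i u))
                    @ \oo --> (0 : R)].

Definition grad_dot u w : R :=
  \sum_(i < d) L2dot (weak_partial i u) (weak_partial i w).

Definition laplacian u : 'rV[R]_d -> R :=
  \sum_(i < d) weak_partial i (weak_partial i u).

End sobolev.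

Section finite_elements.
Context {R : realType} {d : nat}.
Variables (Om : set 'rV[R]_d) (Th : seq 'M[R]_(d.+1, d)).
Local Notation fn := ('rV[R]_d -> R).

(* Elements are extended by zero outside Om, so that they are determined
   pointwise and equality in X_h is equality of functions.  The inclusion of X_h
   in H10 Om, automatic for such functions, is recorded in the definition. *)
Definition fe_space (chi : fn) : Prop :=
  [/\ H10 Om chi,
      continuous chi,
      forall x, ~ Om x -> chi x = 0 &
      forall K, K \in Th -> exists (a : 'rV[R]_d) (c : R),
        forall x, hull K x -> chi x = rdot a x + c].

Definition ritz_projection (Rh : fn -> fn) : Prop :=
  forall phi, H10 Om phi ->
    fe_space (Rh phi) /\
    forall chi, fe_space chi ->
      grad_dot Om (Rh phi) chi = grad_dot Om phi chi.

Definition discrete_laplacian (Dh : fn -> fn) : Prop :=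
  forall phi, fe_space phi ->
    fe_space (Dh phi) /\
    forall chi, fe_space chi ->
      - L2dot Om (Dh phi) chi = grad_dot Om phi chi.

End finite_elements.

Section caputo.
Context {R : realType}.
Local Notation leb := (@lebesgue_measure R).

Definition Gamma (a : R) : R :=
  \int[leb]_(t in `]0, +oo[) (t `^ (a - 1) * expR (- t)).

Definition caputo (alpha : R) (w : R -> R) (t : R) : R :=
  (Gamma (1 - alpha))^-1 *
  \int[leb]_(s in `]0, t[) ((t - s) `^ (- alpha) * derive1 w s).

(* Absolute continuity on [0, T], in the form given by the fundamental theorem
   of calculus. *)
Definition abs_continuous (T : R) (w : R -> R) : Prop :=
  leb.-integrable `]0, T[ (EFin \o derive1 w) /\
  forall t, 0 <= t <= T -> w t = w 0 + \int[leb]_(s in `]0, t[) derive1 w s.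

End caputo.

Section schemes.
Context {R : realType} {d : nat}.
Variables (Om : set 'rV[R]_d) (Th : seq 'M[R]_(d.+1, d)).
Local Notation fn := ('rV[R]_d -> R).
Variables (Dh : fn -> fn) (alpha : R).

(* X_h is finite dimensional, so regularity and the Caputo derivative of an
   X_h-valued map are taken pointwise in x. *)
Definition semidiscrete_solution (T : R) (fh : R -> fn) (vh : fn)
    (uh : R -> fn) : Prop :=
  [/\ forall t, 0 <= t <= T -> fe_space Om Th (uh t),
      uh 0 = vh,
      forall x, abs_continuous T (fun t => uh t x) &
      forall t x, 0 < t < T ->
        caputo alpha (fun s => uh s x) t - Dh (uh t) x = fh t x].

Definition cq_weights (b : nat -> R) : Prop :=
  forall xi : R, `|xi| < 1 ->
    series (fun j => b j * xi ^+ j) @ \oo --> (1 - xi) `^ alpha.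

Definition cq_derivative (b : nat -> R) (tau : R) (phi : nat -> fn) (n : nat) :
    fn :=
  tau `^ (- alpha) *: \sum_(0 <= j < n.+1) b (n - j)%N *: phi j.

Definition corrected_crank_nicolson (b : nat -> R) (tau : R) (N : nat)
    (F : nat -> fn) (vh : fn) (U : nat -> fn) : Prop :=
  let dU := cq_derivative b tau (fun n => U n - vh) in
  [/\ U 0%N = vh /\ (forall n, (n <= N)%N -> fe_space Om Th (U n)),
      (1 <= N)%N ->
        dU 1%N - (1 - alpha / 2) *: Dh (U 1%N)
             - (1 / 2 - alpha / 4) *: Dh vh
        = (1 - alpha / 2) *: (F 1%N + (1 / 2) *: F 0%N),
      (2 <= N)%N ->
        dU 2%N - (1 - alpha / 2) *: Dh (U 2%N) - (alpha / 2) *: Dh (U 1%N)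
             - (alpha / 4) *: Dh vh
        = (1 - alpha / 2) *: F 2%N + (alpha / 2) *: F 1%N + (alpha / 4) *: F 0%N &
      forall n, (3 <= n <= N)%N ->
        dU n - (1 - alpha / 2) *: Dh (U n) - (alpha / 2) *: Dh (U n.-1)
        = (1 - alpha / 2) *: F n + (alpha / 2) *: F n.-1].

End schemes.

(* Main.v *)
Require Import Defs.
From HB Require Import structures.
From mathcomp Require Import all_boot all_order all_algebra.
From mathcomp Require Import all_classical all_reals all_analysis.
From mathcomp Require Import measurable_realfun.
From mathcomp Require Import complex.
From mathcomp Require Import ring lra zify.
Import Order.TTheory GRing.Theory Num.Theory.
Import numFieldNormedType.Exports.

(** Why the estimate holds.

    Reduction to scalars.  An element of X_h is determined by its values at the
    finitely many vertices, the form (u, w) is positive definite on X_h and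
    (grad u, grad w) is symmetric and nonnegative.  Diagonalizing both forms at
    once gives finitely many functionals l_k, weighted sums of point values,
    with l_k (Delta_h u) = - lam_k l_k u and |u|^2 = sum_k (l_k u)^2
    ([spectral_functionals]).  Applied to the semidiscrete solution and to the
    scheme they give, for every k, the relaxation equation
    (d/dt)^alpha c = - lam c and its own corrected Crank-Nicolson scheme, which
    depends on lam and tau through z = lam tau^alpha only.  The theorem follows
    from a scalar bound that is uniform in z:
        |c(t_n) - C_n| <= K z n^(alpha - 2) |c(0)|        ([functional_error]).
    Summing the squares bounds the error by
    K tau^alpha n^(alpha - 2) |Delta_h R_h v|, where
    tau^alpha n^(alpha - 2) = tau^2 t_n^(alpha - 2), and
    |Delta_h R_h v| <= |Delta v| by the definitions of Delta_h and R_h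
    ([discrete_laplacian_ritz_le]).

    The scalar bound, by comparison of step sizes.  Let B(xi) = (1 - xi)^alpha
    and beta(xi) = 1 - (alpha/2)(1 - xi).  The corrections in the first two
    steps make C_n = c(0) (1 - g_n / 2), where g = [deficit z] has the generating
    function z kappa / (B + z beta) with kappa ~ 2 / (1 - xi).  Halving the step
    replaces z by z / 2^alpha and n by 2 n.  The heart of the proof is
        |deficit z n - deficit (z / 2^alpha) (2 n)| <= K z n^(alpha - 2)
    ([deficit_two_scale]).  Iterating it multiplies the bound by
    2^(-alpha) 2^(alpha - 2) = 1/4 at each level, so the differences between all
    levels are summable ([deficit_telescope]), and it remains to know that the fine
    schemes converge, without any rate ([fine_limit]).

    The two-scale bound.  Write G and F for the two generating functions and
    theta = xi d/dxi.  The coefficient of xi^(2n) in theta^2 (G(xi^2) - F(xi)) is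
    (2n)^2 times the difference, and is a mean over the circle of radius
    1 - 1/(4n).  Pairing the points eta and - eta, the integrand is bounded by
    z |1 - eta|^(-1-alpha) where Re eta >= 0, plus O(z); since |1 - eta| is at
    least of size 1/n the mean is O(z n^alpha).  The bound of the integrand is
    where second-order consistency enters: B(eta^2) = B(eta) B(- eta), and
    B(- eta) = 2^alpha beta(eta) + O(|1 - eta|^2) ([cq_at_minus1]), so that the
    principal parts of 2 G(eta^2) and F(eta) cancel.  Values and two
    theta-derivatives are carried together as jets, and symbol classes record
    that each derivative costs one factor |1 - eta|^(-1).

    Convergence of the fine schemes.  The solution c is only known to be
    absolutely continuous.  The equation, integrated once, is compared with the
    scheme, summed twice: the error of the cumulative sums is then bounded by
    the total variation of c through a discrete maximum principle
    ([cumulative_error], [consistency]), and averaging over a window shorter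
    and shorter in time but longer and longer in steps recovers the error at
    one point ([pointwise_error]).  The two equations match because the partial
    sums of the weights are asymptotic to n^(-alpha) / Gamma(1 - alpha)
    ([cq_sum_asymp], [gamma_cq_limit]). *)

Set Implicit Arguments.
Unset Strict Implicit.
Unset Printing Implicit Defensive.

Local Open Scope classical_set_scope.
Local Open Scope ring_scope.

(** * Real power series and the weights *)

Section tame.
Context {R : realType}.
Implicit Types (a b c : nat -> R) (x r : R).

(** The coefficient sequences of functions analytic in the unit disc. In this form
    the class is visibly closed under shifts, differentiation and products. *)
Definition tame c := forall r, 0 <= r < 1 -> exists C : R, forall n, `|c n| * r ^+ n <= C.

(** Bernoulli's inequality for 1/q. *)
Lemma natmul_exp_bounded (q : R) : 0 <= q < 1 ->
  exists C : R, forall n, n%:R * q ^+ n <= C.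
Proof.
case/andP => q0 q1; have [->|qn0] := eqVneq q 0.
  by exists 0 => -[|n]; rewrite ?mul0r// expr0n/= mulr0.
have qp : 0 < q by rewrite lt_neqAle eq_sym qn0.
have [h h0 qh] : exists2 h, 0 < h & q = (1 + h)^-1.
  exists (q^-1 - 1); first by rewrite subr_gt0 invf_gt1.
  by rewrite addrCA subrr addr0 invrK.
exists h^-1 => n; rewrite qh exprVn ler_pdivrMr ?exprn_gt0 ?addr_gt0 ?ltr01//.
rewrite mulrC ler_pdivlMr//.
suff : 1 + n%:R * h <= (1 + h) ^+ n by apply: le_trans; rewrite lerDr.
elim: n => [|n IH]; first by rewrite mul0r addr0 expr0.
rewrite exprSr.
apply: (@le_trans _ _ ((1 + n%:R * h) * (1 + h))); last first.
  by rewrite ler_pM2r// addr_gt0 ?ltr01.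
have : 0 <= n%:R * h * h by rewrite !mulr_ge0 ?(ltW h0).
rewrite -natr1; lra.
Qed.

Lemma tame_bounded c K : (forall n, `|c n| <= K) -> tame c.
Proof.
move=> cK r /andP[r0 r1]; exists K => n.
rewrite -[leRHS]mulr1 ler_pM ?exprn_ge0//.
by rewrite exprn_ile1// ltW.
Qed.

Lemma tameD a b : tame a -> tame b -> tame (fun n => a n + b n).
Proof.
move=> ta tb r r01; have [A hA] := ta _ r01; have [B hB] := tb _ r01.
exists (A + B) => n; apply: le_trans (lerD (hA n) (hB n)).
by rewrite -mulrDl ler_wpM2r ?ler_normD// exprn_ge0//; case/andP: r01.
Qed.

Lemma tameZ k a : tame a -> tame (fun n => k * a n).
Proof.
move=> ta r r01; have [A hA] := ta _ r01.
by exists (`|k| * A) => n; rewrite normrM -mulrA ler_wpM2l.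
Qed.

(** A factor n is absorbed by enlarging the radius from r to (1 + r) / 2, which
    gains a geometric factor. *)
Lemma tame_natmul a : tame a -> tame (fun n => n%:R * a n).
Proof.
move=> ta r /andP[r0 r1].
pose r' := (1 + r) / 2; have r'0 : 0 < r' by rewrite /r'; lra.
have r'1 : r' < 1 by rewrite /r'; lra.
have rr' : r < r' by rewrite /r'; lra.
have r'01 : 0 <= r' < 1 by rewrite (ltW r'0) r'1.
have [A hA] := ta r' r'01.
have q01 : 0 <= r / r' < 1 by rewrite divr_ge0// ?(ltW r'0)//= ltr_pdivrMr// mul1r.
have [B hB] := natmul_exp_bounded q01.
exists (B * A) => n.
rewrite normrM normr_nat.
have -> : r ^+ n = (r / r') ^+ n * r' ^+ n by rewrite -exprMn divfK// gt_eqF.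
by rewrite mulrACA ler_pM// mulr_ge0// exprn_ge0// ?(ltW r'0)//; case/andP: q01.
Qed.

Lemma tame_pred a : tame a -> tame (fun n => if n is m.+1 then a m else 0).
Proof.
move=> ta r r01; have [A hA] := ta r r01; exists (Num.max A 0) => -[|n].
  by rewrite normr0 mul0r le_max lexx orbT.
case/andP: r01 => r0 r1.
rewrite le_max exprS mulrCA (le_trans _ (hA n))// ler_piMl ?(ltW r1)//.
by rewrite mulr_ge0// exprn_ge0.
Qed.

Lemma tame_succ a : tame a -> tame (fun n => a n.+1).
Proof.
move=> ta r /andP[r0 r1]; pose r' := (1 + r) / 2.
have r'0 : 0 < r' by rewrite /r'; lra.
have r'1 : r' < 1 by rewrite /r'; lra.
have rr' : r < r' by rewrite /r'; lra.
have r'01 : 0 <= r' < 1 by rewrite (ltW r'0) r'1.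
have [A hA] := ta r' r'01.
exists (A / r') => n; rewrite ler_pdivlMr// -mulrA.
apply: le_trans (hA n.+1); rewrite ler_wpM2l// exprSr ler_pM// ?exprn_ge0 ?(ltW r'0)//.
by rewrite lerXn2r// ?nnegrE ?(ltW r'0)// ltW.
Qed.

Lemma tame_summable a r : tame a -> 0 <= r < 1 ->
  exists C : R, forall N, \sum_(0 <= n < N) `|a n| * r ^+ n <= C.
Proof.
move=> ta /andP[r0 r1].
pose r' := (1 + r) / 2; have r'0 : 0 < r' by rewrite /r'; lra.
have r'1 : r' < 1 by rewrite /r'; lra.
have rr' : r < r' by rewrite /r'; lra.
have r'01 : 0 <= r' < 1 by rewrite (ltW r'0) r'1.
have [A hA] := ta r' r'01.
pose q := r / r'.
have q0 : 0 <= q by rewrite divr_ge0// ltW.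
have q1 : q < 1 by rewrite ltr_pdivrMr// mul1r.
exists (A / (1 - q)) => N.
have A0 : 0 <= A by apply: le_trans (hA 0%N); rewrite mulr_ge0// exprn_ge0// ltW.
apply: (@le_trans _ _ (\sum_(0 <= n < N) A * q ^+ n)).
  apply: ler_sum => n _.
  have -> : r ^+ n = r' ^+ n * q ^+ n by rewrite -exprMn mulrC divfK// gt_eqF.
  by rewrite mulrA ler_wpM2r ?exprn_ge0.
rewrite -mulr_sumr ler_wpM2l//.
have q1' : 0 < 1 - q by lra.
rewrite -[leLHS](mulfK (lt0r_neq0 q1')) ler_pdivrMr// mulVf ?gt_eqF//.
have -> : (\sum_(0 <= i < N) q ^+ i) * (1 - q) = 1 - q ^+ N.
  by rewrite mulrC big_mkord -(opprB q 1) mulNr -subrX1 opprB.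
by rewrite lerBlDr lerDl exprn_ge0.
Qed.

Lemma tame_cvg c x : tame c -> `|x| < 1 -> cvgn (pseries c x).
Proof.
move=> tc x1; apply: normed_cvg.
have x01 : 0 <= `|x| < 1 by rewrite normr_ge0.
have [C hC] := tame_summable tc x01.
apply: nondecreasing_is_cvgn.
  by apply: nondecreasing_series => n _ _; exact: normr_ge0.
exists C => _ [N _ <-] /=.
apply: le_trans (hC N); rewrite /series/=.
by apply: ler_sum => i _; rewrite normrM normrX.
Qed.

Lemma cvg_tame c : (forall x, `|x| < 1 -> cvgn (pseries c x)) -> tame c.
Proof.
move=> cc r /andP[r0 r1]; have := cc r; rewrite ger0_norm// => /(_ r1)/cvg_series_bounded.
move=> [K [_ hK]]; exists (K + 1) => n.
have KK : K < K + 1 by rewrite ltrDl.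
have := hK (K + 1) KK n Logic.I.
by rewrite /= normrM normrX (ger0_norm r0).
Qed.

Lemma tame_diffs c : tame c -> tame (pseries_diffs c).
Proof. by move=> /tame_natmul/tame_succ. Qed.

Lemma is_derive_pseries c x : tame c -> `|x| < 1 ->
  is_derive x (1 : R) (fun x => limn (pseries c x)) (limn (pseries (pseries_diffs c) x)).
Proof.
move=> tc x1; pose K := (1 + `|x|) / 2.
have K0 : 0 <= K by rewrite /K divr_ge0// addr_ge0.
have K1 : `|K| < 1 by rewrite ger0_norm// /K; lra.
apply: (@pseries_snd_diffs _ _ K).
- exact: tame_cvg.
- by apply: tame_cvg => //; exact: tame_diffs.
- by apply: tame_cvg => //; do 2 apply: tame_diffs.
- by rewrite (ger0_norm K0) /K; lra.
Qed.

(** A power series that vanishes on the interval has a vanishing constant term; the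
    differentiated series vanishes as well, so induction reaches all coefficients. *)
Lemma pseries_eq0 c : (forall x, `|x| < 1 -> pseries c x @ \oo --> 0) ->
  forall n, c n = 0.
Proof.
move=> hc n; elim: n c hc => [|n IH] c hc.
  have := hc 0; rewrite normr0 ltr01 => /(_ isT) h0.
  have : pseries c 0 @ \oo --> c 0%N.
    apply: cvg_near_cst; exists 1%N => // -[//|m] _ /=.
    rewrite /pseries/series/= big_nat_recl// expr0 mulr1 big1 ?addr0//.
    by move=> i _; rewrite expr0n mulr0.
  by move/cvg_lim => <- //; move/cvg_lim : h0 => ->.
have tc : tame c.
  by apply: cvg_tame => x x1; apply/cvg_ex; exists 0; exact: hc.
suff /IH : forall x, `|x| < 1 -> pseries (pseries_diffs c) x @ \oo --> 0.
  by rewrite /pseries_diffs => /eqP; rewrite mulf_eq0 pnatr_eq0/= => /eqP.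
move=> x x1.
have /cvg_ex[l cl] := tame_cvg (tame_diffs tc) x1.
have D := is_derive_pseries tc x1.
suff : is_derive x (1 : R) (fun x => limn (pseries c x)) 0.
  move=> D0; have := @derive_val _ _ _ _ _ _ _ D; rewrite (@derive_val _ _ _ _ _ _ _ D0).
  by rewrite (cvg_lim _ cl)// => ->.
apply: (@near_eq_is_derive _ _ _ (cst 0)).
near=> y; rewrite (cvg_lim _ (hc y _))//.
near: y.
have /open_nbhs_nbhs : open_nbhs x [set y : R | `|y| < 1].
  split => //; exact: (open_comp (fun x _ => @norm_continuous _ _ x) (@open_lt _ 1)).
by [].
Unshelve. all: end_near.
Qed.

End tame.

Section weights.
Context {R : realType} (alpha : R) (b : nat -> R).
Hypotheses (alpha01 : 0 < alpha < 1) (hb : cq_weights alpha b).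

Let a0 : 0 < alpha. Proof. by case/andP: alpha01. Qed.
Let a1 : alpha < 1. Proof. by case/andP: alpha01. Qed.

Lemma cq_tame : tame b.
Proof.
apply: cvg_tame => x x1; apply/cvg_ex; exists ((1 - x) `^ alpha); exact: hb.
Qed.

Lemma cq_weights0 : b 0%N = 1.
Proof.
have /hb h0 : `|0 : R| < 1 by rewrite normr0.
have : pseries b 0 @ \oo --> b 0%N.
  apply: cvg_near_cst; exists 1%N => // -[//|m] _ /=.
  rewrite /pseries/series/= big_nat_recl// expr0 mulr1 big1 ?addr0//.
  by move=> i _; rewrite expr0n mulr0.
move/cvg_lim => <- //; rewrite (cvg_lim _ h0)//.
by rewrite subr0 powR1.
Qed.

(** The recursion is the differential equation
    (1 - x) f' = - alpha f of f = (1 - x)^alpha, read off coefficientwise. *)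
Lemma cq_weightsS n : n.+1%:R * b n.+1 = (n%:R - alpha) * b n.
Proof.
have tb := cq_tame.
apply/eqP; rewrite -subr_eq0; apply/eqP.
pose c n := n.+1%:R * b n.+1 - (n%:R - alpha) * b n.
rewrite -/(c n); apply: pseries_eq0 => x x1.
have := is_derive_pseries tb x1.
set f' := limn _ => D1.
have xlt1 : x < 1 by apply: le_lt_trans x1; exact: ler_norm.
have y0 : 0 < 1 - x by rewrite subr_gt0.
have D2 : is_derive x (1 : R) (fun x => limn (pseries b x)) (- alpha * (1 - x) `^ (alpha - 1)).
  have := @is_derive1_comp R (fun y => y `^ alpha) (fun y => 1 - y) x _ (-1)
    (is_derive1_powR alpha y0).
  have d1 : is_derive x (1 : R) (fun y => 1 - y) (-1).
    have := @is_deriveB R R R (cst 1) id x 1 0 1 (is_derive_cst _ _ _) (is_derive_id _ _).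
    by rewrite sub0r.
  move=> /(_ d1); rewrite mulrN1 -mulNr => D.
  apply: near_eq_is_derive D.
  near=> y; rewrite (cvg_lim _ (hb _))//.
  near: y; suff /open_nbhs_nbhs : open_nbhs x [set y : R | `|y| < 1] by [].
  split => //; exact: (open_comp (fun x _ => @norm_continuous _ _ x) (@open_lt _ 1)).
have E : f' = - alpha * (1 - x) `^ (alpha - 1).
  by rewrite -(@derive_val _ _ _ _ _ _ _ D1) (@derive_val _ _ _ _ _ _ _ D2).
have c1 := tame_cvg (tame_diffs tb) x1.
have c2 := pseries_diffs_equiv c1.
rewrite (_ : pseries c x = fun N => pseries (pseries_diffs b) x N
  - x * series (fun i => i%:R * b i * x ^+ i.-1) N + alpha * pseries b x N); last first.
  apply/funext => N; rewrite /pseries /series /= !mulr_sumr -sumrB -big_split/=.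
  apply: eq_bigr => i _; rewrite /c /pseries_diffs.
  case: i => [|i]; last by rewrite /= [x ^+ i.+1]exprS; ring.
  by rewrite !mul0r mulr0; ring.
rewrite (_ : 0 = f' - x * f' + alpha * (1 - x) `^ alpha); last first.
  have -> : (1 - x) `^ alpha = (1 - x) `^ (alpha - 1) * (1 - x).
    have -> : (1 - x) `^ (alpha - 1) * (1 - x) = (1 - x) `^ (alpha - 1) * (1 - x) `^ 1.
      by rewrite powRr1// ltW.
    by rewrite -powRD ?subrK//; apply/implyP => _; rewrite gt_eqF.
  by rewrite E; ring.
apply: cvgD; last by apply: cvgMr; exact: hb.
by apply: cvgB => //; apply: cvgMr.
Unshelve. all: end_near.
Qed.

Definition cq_sum n := \sum_(0 <= j < n.+1) b j.

Lemma cq_sum0 : cq_sum 0 = 1.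
Proof. by rewrite /cq_sum big_nat1 cq_weights0. Qed.

Lemma cq_sumS n : cq_sum n.+1 = cq_sum n + b n.+1.
Proof. by rewrite /cq_sum big_nat_recr. Qed.

(** The partial sums are the coefficients of (1 - x)^(alpha - 1). Through this
    identity their monotonicity and asymptotics control the weights themselves. *)
Lemma cq_weights_sum n : b n.+1 = - (alpha / n.+1%:R) * cq_sum n.
Proof.
elim: n => [|n IH].
  by have := cq_weightsS 0; rewrite cq_sum0 cq_weights0 !mulr1 mul1r sub0r divr1.
have n1 : (n.+1%:R : R) != 0 by rewrite pnatr_eq0.
have n2 : (n.+2%:R : R) != 0 by rewrite pnatr_eq0.
have an0 : alpha != 0 by rewrite gt_eqF.
apply: (mulfI n2); rewrite cq_weightsS cq_sumS.
have -> : cq_sum n = - (n.+1%:R / alpha) * b n.+1.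
  by rewrite IH; move: (n.+1%:R) n1 => x x0; field; rewrite an0 x0.
have -> : n.+1%:R = n.+2%:R - 1 :> R by rewrite -[n.+2%:R]natr1 addrK.
move: (n.+2%:R) n2 => x x0.
by field; rewrite an0 x0.
Qed.

Lemma cq_sum_rec n : cq_sum n.+1 = (1 - alpha / n.+1%:R) * cq_sum n.
Proof. by rewrite cq_sumS cq_weights_sum; ring. Qed.

Lemma alpha_div_lt1 n : alpha / n.+1%:R < 1.
Proof. by rewrite ltr_pdivrMr// mul1r (lt_le_trans a1)// ler1n. Qed.

Lemma cq_sum_gt0 n : 0 < cq_sum n.
Proof.
elim: n => [|n IH]; first by rewrite cq_sum0.
by rewrite cq_sum_rec mulr_gt0// subr_gt0 alpha_div_lt1.
Qed.

Lemma cq_weights_le0 n : b n.+1 <= 0.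
Proof.
by rewrite cq_weights_sum mulNr oppr_le0 mulr_ge0 ?divr_ge0 ?(ltW a0)// ltW ?cq_sum_gt0.
Qed.

Lemma cq_sum_nincr m n : (m <= n)%N -> cq_sum n <= cq_sum m.
Proof.
elim: n => [|n IH]; first by rewrite leqn0 => /eqP ->.
rewrite leq_eqVlt => /orP[/eqP->//|]; rewrite ltnS => /IH; apply: le_trans.
by rewrite cq_sumS gerDl cq_weights_le0.
Qed.

Lemma cq_sum_le1 n : cq_sum n <= 1.
Proof. by rewrite -cq_sum0 cq_sum_nincr. Qed.

(** All weights but the first are nonpositive, so their absolute values telescope. *)
Lemma sum_norm_cq n : \sum_(0 <= j < n.+1) `|b j| = 2 - cq_sum n.
Proof.
elim: n => [|n IH]; first by rewrite big_nat1 cq_sum0 cq_weights0 normr1; ring.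
rewrite big_nat_recr//= IH cq_sumS ler0_norm ?cq_weights_le0//; ring.
Qed.

(** The coefficients of (1 - x)^(alpha - 2). *)
Lemma sum_cq_sum n : \sum_(0 <= j < n.+1) cq_sum j = (n.+1%:R - alpha) / (1 - alpha) * cq_sum n.
Proof.
have a1' : 1 - alpha != 0 by rewrite subr_eq0 gt_eqF.
elim: n => [|n IH]; first by rewrite big_nat1 cq_sum0 divff// mulr1.
rewrite big_nat_recr//= IH cq_sum_rec -[n.+2%:R]natr1.
have n1 : (n.+1%:R : R) != 0 by rewrite pnatr_eq0.
by move: (n.+1%:R) n1 => x x0; field; rewrite a1' x0.
Qed.

(** Young's inequality for y^alpha and 1, with exponents 1/alpha and 1/(1 - alpha). *)
Lemma powR_bernoulli (y : R) : 0 <= y -> y `^ alpha <= 1 + alpha * (y - 1).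
Proof.
move=> y0.
have an0 : alpha != 0 by rewrite gt_eqF.
have a1' : 1 - alpha != 0 by rewrite subr_eq0 gt_eqF.
have a1'' : 0 < 1 - alpha by rewrite subr_gt0.
have := @conjugate_powR R (y `^ alpha) 1 alpha^-1 (1 - alpha)^-1 (powR_ge0 _ _) ler01.
rewrite !invrK mulr1 powR1 => /(_ _ _ _)/le_trans; apply.
- by rewrite invr_gt0.
- by rewrite invr_gt0.
- by rewrite addrC subrK.
- by rewrite -powRrM mulfV// powRr1//; lra.
Qed.

(** With u_j = (j+1)^alpha a_(j+1) and w_j = (j+1)^alpha a_j, Bernoulli's inequality
    makes u nondecreasing and w nonincreasing, and u <= w; the supremum l of u
    separates them. The value of l is found in [gamma_cq_limit]. *)
Lemma cq_sum_asymp : exists2 l, 0 < l & forall j,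
  l * j.+1%:R `^ (- alpha) <= cq_sum j /\ cq_sum j.+1 <= l * j.+1%:R `^ (- alpha).
Proof.
pose u j := j.+1%:R `^ alpha * cq_sum j.+1.
pose w j := j.+1%:R `^ alpha * cq_sum j.
have jp j : 0 < (j.+1%:R : R) by [].
have pg0 j : 0 < j.+1%:R `^ alpha by rewrite powR_gt0.
have uw j : u j <= w j by rewrite /u /w ler_wpM2l ?(ltW (pg0 _))// cq_sum_nincr.
have uS j : u j <= u j.+1.
  rewrite /u [cq_sum j.+2]cq_sum_rec mulrA ler_pM2r ?cq_sum_gt0//.
  have -> : j.+1%:R = j.+2%:R * (1 - j.+2%:R^-1) :> R.
    by rewrite mulrBr mulr1 mulfV ?pnatr_eq0// -[j.+2%:R]natr1 addrK.
  have x0 : 0 <= 1 - j.+2%:R^-1 :> R by rewrite subr_ge0 invf_le1// ler1n.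
  rewrite powRM// ler_wpM2l ?(ltW (pg0 _))//.
  apply: le_trans (powR_bernoulli x0) _.
  by rewrite (_ : 1 - _ - 1 = - j.+2%:R^-1) ?mulrN//; ring.
have wS j : w j.+1 <= w j.
  rewrite /w cq_sum_rec mulrA ler_pM2r ?cq_sum_gt0//.
  have -> : j.+2%:R = j.+1%:R * (1 + j.+1%:R^-1) :> R.
    by rewrite mulrDr mulr1 mulfV ?pnatr_eq0// natr1.
  have x0 : 0 <= 1 + j.+1%:R^-1 :> R by rewrite addr_ge0.
  rewrite powRM// -mulrA ler_piMr ?(ltW (pg0 _))//.
  apply: (@le_trans _ _ ((1 + alpha * j.+1%:R^-1) * (1 - alpha * j.+1%:R^-1))).
    rewrite ler_wpM2r ?subr_ge0 ?(ltW (alpha_div_lt1 _))//.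
    apply: le_trans (powR_bernoulli x0) _.
    by rewrite (_ : 1 + _ - 1 = j.+1%:R^-1)//; ring.
  have -> : forall x : R, (1 + x) * (1 - x) = 1 - x ^+ 2 by move=> x; ring.
  by rewrite gerBl sqr_ge0.
have mu m n : (m <= n)%N -> u m <= u n.
  by elim: n => [|n IH]; rewrite leq_eqVlt => /orP[/eqP->//|]//; rewrite ltnS => /IH/le_trans; exact.
have mw m n : (m <= n)%N -> w n <= w m.
  elim: n => [|n IH]; rewrite leq_eqVlt => /orP[/eqP->//|]//; rewrite ltnS => /IH.
  exact: le_trans.
have uww m n : u m <= w n.
  apply: (le_trans (mu m (maxn m n) (leq_maxl _ _))).
  by apply: (le_trans (uw _)); apply: mw; exact: leq_maxr.
have hs : has_sup (range u).
  split; first by exists (u 0%N); exists 0%N.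
  by exists (w 0%N) => _ [m _ <-].
have ul m : u m <= sup (range u) by apply: sup_upper_bound => //; exists m.
exists (sup (range u)) => [|j].
  by apply: lt_le_trans (ul 0%N); rewrite /u mulr_gt0// cq_sum_gt0.
rewrite powRN; split.
  rewrite ler_pdivrMr// mulrC; apply: ge_sup; first by exists (u 0%N); exists 0%N.
  by move=> _ [m _ <-]; exact: uww.
by rewrite ler_pdivlMr// mulrC; exact: ul.
Qed.

End weights.

(** * Generating functions in the unit disc *)

Local Open Scope complex_scope.

Section complex_limits.
Context {R : realType}.
Implicit Types (x y z : R[i]) (u v : nat -> R[i]).

(** The modulus with values in R: the norm of R[i] is itself a complex number. *)
Definition cabs x : R := complex.Re `|x|.

Lemma cabsE x : `|x| = (cabs x)%:C.
Proof. by rewrite /cabs normc_def. Qed.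

Lemma cabs_ge0 x : 0 <= cabs x.
Proof. by rewrite -lecR -cabsE normr_ge0. Qed.

Lemma cabsM x y : cabs (x * y) = cabs x * cabs y.
Proof. by apply: complexI; rewrite rmorphM/= -!cabsE normrM. Qed.

Lemma cabs0 : cabs 0 = 0.
Proof. by apply: complexI; rewrite -cabsE normr0. Qed.

Lemma cabs1 : cabs 1 = 1.
Proof. by apply: complexI; rewrite -cabsE normr1. Qed.

Lemma cabsX x n : cabs (x ^+ n) = cabs x ^+ n.
Proof. by elim: n => [|n IH]; rewrite ?expr0 ?cabs1// !exprS cabsM IH. Qed.

Lemma cabsN x : cabs (- x) = cabs x.
Proof. by apply: complexI; rewrite -!cabsE normrN. Qed.

Lemma cabsV x : cabs (x^-1) = (cabs x)^-1.
Proof. by apply: complexI; rewrite fmorphV/= -!cabsE normfV. Qed.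

Lemma cabsD x y : cabs (x + y) <= cabs x + cabs y.
Proof. by rewrite -lecR rmorphD/= -!cabsE ler_normD. Qed.

Lemma cabsB x y : cabs (x - y) <= cabs x + cabs y.
Proof. by rewrite -(cabsN y) cabsD. Qed.

Lemma cabs_distC x y : cabs (x - y) = cabs (y - x).
Proof. by rewrite -cabsN opprB. Qed.

Lemma cabs_real (a : R) : cabs a%:C = `|a|.
Proof. by rewrite /cabs normc_def/= expr0n/= addr0 sqrtr_sqr. Qed.

Lemma cabs_eq0 x : (cabs x == 0) = (x == 0).
Proof. by rewrite -(inj_eq (@complexI R)) -cabsE normr_eq0. Qed.

Lemma Re_le_cabs x : `|complex.Re x| <= cabs x.
Proof.
rewrite /cabs normc_def/= -sqrtr_sqr ler_wsqrtr// lerDl sqr_ge0//.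
Qed.

Lemma Im_le_cabs x : `|complex.Im x| <= cabs x.
Proof.
rewrite /cabs normc_def/= -sqrtr_sqr ler_wsqrtr// lerDr sqr_ge0//.
Qed.

Lemma cabs_le x : cabs x <= `|complex.Re x| + `|complex.Im x|.
Proof.
rewrite [x in cabs x]complexE (le_trans (cabsD _ _))//.
rewrite cabsM !cabs_real /cabs normc_def/= expr0n/= expr1n add0r sqrtr1 mul1r lexx//.
Qed.

Lemma cabs_sum (I : Type) (r : seq I) (P : pred I) (F : I -> R[i]) :
  cabs (\sum_(i <- r | P i) F i) <= \sum_(i <- r | P i) cabs (F i).
Proof.
elim/big_rec2: _ => [|i y1 y2 _ le]; first by rewrite cabs0.
by rewrite (le_trans (cabsD _ _))// lerD2l.
Qed.

(** Convergence is expressed through the modulus, so that limits of complex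
    sequences are limits of real ones. *)
Definition ccvg u (l : R[i]) := (fun n => cabs (u n - l)) @ \oo --> (0 : R).

Lemma ccvg_squeeze u l (K : nat -> R) :
  (forall n, cabs (u n - l) <= K n) -> K @ \oo --> 0 -> ccvg u l.
Proof.
move=> uK K0; apply: squeeze_cvgr K0; last exact: cvg_cst.
by near=> n; rewrite cabs_ge0 uK.
Unshelve. all: end_near. Qed.

Lemma ccvg_unique u l m : ccvg u l -> ccvg u m -> l = m.
Proof.
move=> ul um; apply/eqP; rewrite -subr_eq0 -cabs_eq0 eq_le cabs_ge0 andbT.
have h : (fun n => cabs (u n - l) + cabs (u n - m)) @ \oo --> (0 : R).
  by rewrite -[X in _ --> X]addr0; exact: cvgD.
apply: (@ler_cvg_to _ _ _ _ (cst (cabs (l - m))) _ _ _ (cvg_cst _) h).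
near=> n => /=; rewrite /cst -(subrKA (u n)) addrC (le_trans (cabsD _ _))//.
by rewrite addrC lerD2r cabs_distC.
Unshelve. all: end_near. Qed.

Lemma ccvg_cst l : ccvg (fun=> l) l.
Proof. by rewrite /ccvg; under eq_fun do rewrite subrr cabs0; exact: cvg_cst. Qed.

Lemma ccvgD u v l m : ccvg u l -> ccvg v m -> ccvg (fun n => u n + v n) (l + m).
Proof.
move=> ul vm; have h : (fun n => cabs (u n - l) + cabs (v n - m)) @ \oo --> (0 : R).
  by rewrite -[X in _ --> X]addr0; exact: cvgD.
apply: ccvg_squeeze h => n.
by rewrite (_ : _ - _ = (u n - l) + (v n - m)) ?cabsD//; ring.
Qed.

Lemma ccvgM u v l m : ccvg u l -> ccvg v m -> ccvg (fun n => u n * v n) (l * m).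
Proof.
move=> ul vm.
have h : (fun n => cabs (u n - l) * (cabs (v n - m) + cabs m) + cabs l * cabs (v n - m)) @ \oo
    --> (0 : R).
  rewrite [X in _ --> X](_ : _ = 0 * (0 + cabs m) + cabs l * 0); last by ring.
  apply: cvgD; last by apply: cvgMr.
  by apply: cvgM => //; apply: cvgD => //; exact: cvg_cst.
apply: ccvg_squeeze h => n.
rewrite (_ : _ - _ = (u n - l) * ((v n - m) + m) + l * (v n - m)); last by ring.
by rewrite (le_trans (cabsD _ _))// !cabsM lerD2r ler_wpM2l ?cabs_ge0// cabsD.
Qed.

Lemma ccvg_bound u l K : ccvg u l -> (forall n, cabs (u n) <= K) -> cabs l <= K.
Proof.
move=> ul uK.
have h : (fun n => cabs (u n - l) + K) @ \oo --> 0 + K by apply: cvgD => //; exact: cvg_cst.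
rewrite add0r in h.
apply: (@ler_cvg_to _ _ _ _ (cst (cabs l)) _ _ _ (cvg_cst _) h).
near=> n; rewrite /cst -{1}(subrK (u n) l) (le_trans (cabsD _ _))//.
by rewrite cabs_distC lerD2l.
Unshelve. all: end_near. Qed.

Lemma ccvg_Re u l : ccvg u l -> (fun n => complex.Re (u n)) @ \oo --> complex.Re l.
Proof.
move=> ul; apply/cvgrPdist_le => e e0; move/cvgrPdist_le: ul => /(_ e e0) [N _ hN].
exists N => // n /hN; rewrite sub0r normrN (ger0_norm (cabs_ge0 _)); apply: le_trans.
by rewrite distrC (le_trans _ (Re_le_cabs _))// raddfB.
Qed.

Lemma ccvg_Re_ge u l K N : ccvg u l ->
  (forall n, (N <= n)%N -> K <= complex.Re (u n)) -> K <= complex.Re l.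
Proof.
move=> /ccvg_Re ul uK.
apply: (@ler_cvg_to _ _ _ _ (cst K) _ _ _ (cvg_cst _) ul).
by exists N => // n /uK.
Qed.

Lemma ccvg_ReIm (f g : nat -> R) l m : f @ \oo --> l -> g @ \oo --> m ->
  ccvg (fun n => f n +i* g n) (l +i* m).
Proof.
move=> fl gm; have h : (fun n => `|f n - l| + `|g n - m|) @ \oo --> (0 : R).
  rewrite -[X in _ --> X]addr0; apply: cvgD.
  - by rewrite -(normr0 R) -(subrr l); apply: cvg_norm; apply: cvgB => //; exact: cvg_cst.
  - by rewrite -(normr0 R) -(subrr m); apply: cvg_norm; apply: cvgB => //; exact: cvg_cst.
by apply: ccvg_squeeze h => n; exact: cabs_le.
Qed.

Lemma ccvg_ext u v l : u =1 v -> ccvg u l -> ccvg v l.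
Proof. by move=> /funext ->. Qed.

End complex_limits.

Section power_series.
Context {R : realType}.
Implicit Types (a b : nat -> R) (e : R[i]).

Definition psum a e N : R[i] := \sum_(0 <= n < N) (a n)%:C * e ^+ n.

(** The value at e of the analytic function with coefficients a. The real and
    imaginary parts are real series, whence a total function. *)
Definition ev a e : R[i] :=
  limn (series (fun n => a n * complex.Re (e ^+ n))) +i*
  limn (series (fun n => a n * complex.Im (e ^+ n))).

Lemma is_cvg_tame_series a (r : R) (w : nat -> R) : tame a -> 0 <= r < 1 ->
  (forall n, `|w n| <= r ^+ n) -> cvgn (series (fun n => a n * w n)).
Proof.
move=> ta r01 wr; apply: normed_cvg; have [C hC] := tame_summable ta r01.
apply: nondecreasing_is_cvgn.
  by apply: nondecreasing_series => n _ _; exact: normr_ge0.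
exists C => _ [N _ <-] /=; apply: le_trans (hC N); rewrite /series/=.
by apply: ler_sum => i _; rewrite normrM ler_wpM2l.
Qed.

Lemma cabs01 e : cabs e < 1 -> 0 <= cabs e < 1.
Proof. by move=> ->; rewrite cabs_ge0. Qed.

Lemma ev_ccvg a e : tame a -> cabs e < 1 -> ccvg (psum a e) (ev a e).
Proof.
move=> ta /cabs01 e1.
have c1 : cvgn (series (fun n => a n * complex.Re (e ^+ n))).
  by apply: (is_cvg_tame_series ta e1) => n; rewrite -cabsX Re_le_cabs.
have c2 : cvgn (series (fun n => a n * complex.Im (e ^+ n))).
  by apply: (is_cvg_tame_series ta e1) => n; rewrite -cabsX Im_le_cabs.
apply: ccvg_ext (ccvg_ReIm c1 c2) => N; rewrite /psum /series/=.
elim: N => [|N IH]; first by rewrite !big_nil.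
rewrite !big_nat_recr//= -IH.
have -> : (a N)%:C * e ^+ N = (a N * complex.Re (e ^+ N)) +i* (a N * complex.Im (e ^+ N)).
  by move: (e ^+ N) => -[x y]; simpc.
by simpc.
Qed.

Lemma ev_unique a e l : tame a -> cabs e < 1 -> ccvg (psum a e) l -> ev a e = l.
Proof. by move=> ta e1; apply: ccvg_unique; exact: ev_ccvg. Qed.

Lemma evD a b e : tame a -> tame b -> cabs e < 1 ->
  ev (fun n => a n + b n) e = ev a e + ev b e.
Proof.
move=> ta tb e1; apply: ev_unique => //; first exact: tameD.
apply: ccvg_ext (ccvgD (ev_ccvg ta e1) (ev_ccvg tb e1)) => N.
by rewrite /psum -big_split/=; apply: eq_bigr => i _; rewrite rmorphD mulrDl.
Qed.

Lemma evZ k a e : tame a -> cabs e < 1 -> ev (fun n => k * a n) e = k%:C * ev a e.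
Proof.
move=> ta e1; apply: ev_unique => //; first exact: tameZ.
apply: ccvg_ext (ccvgM (ccvg_cst k%:C) (ev_ccvg ta e1)) => N.
by rewrite /psum mulr_sumr; apply: eq_bigr => i _; rewrite rmorphM mulrA.
Qed.

Lemma ccvg_shift (u : nat -> R[i]) l : ccvg (fun n => u n.+1) l -> ccvg u l.
Proof. by rewrite /ccvg => h; rewrite -cvg_shiftS. Qed.

(** Multiplication by the variable, on coefficients. *)
Definition pre a n : R := if n is m.+1 then a m else 0.

Lemma ev_pre a e : tame a -> cabs e < 1 -> ev (pre a) e = e * ev a e.
Proof.
move=> ta e1; apply: ev_unique => //; first exact: tame_pred.
apply: ccvg_shift; apply: ccvg_ext (ccvgM (ccvg_cst e) (ev_ccvg ta e1)) => N.
rewrite /psum big_nat_recl//= mul0r add0r mulr_sumr; apply: eq_bigr => i _.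
by rewrite exprS mulrCA.
Qed.

(** The value of a polynomial. *)
Lemma ev_poly a e N l : (forall n, (N <= n)%N -> a n = 0) -> cabs e < 1 ->
  \sum_(0 <= n < N) (a n)%:C * e ^+ n = l -> ev a e = l.
Proof.
move=> aN e1 <-; apply: ev_unique => //.
  move=> r /andP[r0 r1]; exists (\sum_(0 <= n < N) `|a n| * r ^+ n) => n.
  have [nN|Nn] := ltnP n N; last first.
    by rewrite aN// normr0 mul0r sumr_ge0// => i _; rewrite mulr_ge0// exprn_ge0.
  rewrite (bigD1_seq n)/= ?mem_index_iota ?iota_uniq// lerDl sumr_ge0// => i _.
  by rewrite mulr_ge0// exprn_ge0.
have h : (fun n => psum a e (n + N)) = fun=> \sum_(0 <= n < N) (a n)%:C * e ^+ n.
  apply/funext => n; rewrite /psum (big_cat_nat (leq0n N) (leq_addl _ _))/=.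
  rewrite [X in _ + X]big_nat_cond [X in _ + X]big1 ?addr0// => i /andP[/andP[Ni _] _].
  by rewrite aN// mul0r.
rewrite /ccvg -(cvg_shiftn N).
rewrite [X in X @ _ --> _](_ : _ = fun=> 0); first exact: cvg_cst.
by apply/funext => n /=; have := congr1 (@^~ n) h => /= ->; rewrite subrr cabs0.
Qed.

Lemma ev_real a (x : R) : tame a -> `|x| < 1 -> ev a x%:C = (limn (pseries a x))%:C.
Proof.
move=> ta x1; apply: ev_unique; rewrite ?cabs_real//.
have h := tame_cvg ta x1.
have z : (fun _ : nat => 0 : R) @ \oo --> (0 : R) by exact: cvg_cst.
move/ccvg_ext: (ccvg_ReIm h z); apply => N.
rewrite complexr0 /psum /pseries /series/= rmorph_sum; apply: eq_bigr => i _.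
by rewrite rmorphM rmorphXn.
Qed.

(** The Cauchy product: composition of convolution quadratures. *)
Definition cvl a b n := \sum_(0 <= i < n.+1) a i * b (n - i)%N.

Lemma sum_triangle (V : nmodType) (F : nat -> nat -> V) N :
  \sum_(0 <= n < N) \sum_(0 <= i < n.+1) F i (n - i)%N =
  \sum_(0 <= i < N) \sum_(0 <= j < N - i) F i j.
Proof.
elim: N => [|N IH]; first by rewrite !big_nil.
rewrite !big_nat_recr//= IH subnn.
rewrite [X in _ = _ + X](_ : _ = F N 0%N); last by rewrite subSn// subnn big_nat1.
rewrite addrA -big_split/=; congr (_ + _).
by apply: eq_big_nat => i /andP[_ iN]; rewrite subSn ?(ltnW iN)// big_nat_recr.
Qed.

Lemma tame_cvl a b : tame a -> tame b -> tame (cvl a b).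
Proof.
move=> ta tb r r01; have [A hA] := tame_summable ta r01; have [B hB] := tame_summable tb r01.
case/andP: (r01) => r0 _.
exists (A * B) => n.
have A0 : 0 <= A by apply: le_trans (hA 0%N); rewrite big_nil.
have aA i : `|a i| * r ^+ i <= A.
  apply: le_trans (hA i.+1); rewrite big_nat_recr//= lerDr sumr_ge0// => j _.
  by rewrite mulr_ge0// exprn_ge0.
apply: (@le_trans _ _ (\sum_(0 <= i < n.+1) (`|a i| * r ^+ i) * (`|b (n - i)%N| * r ^+ (n - i)))).
  rewrite (le_trans (ler_wpM2r (exprn_ge0 n r0) (ler_norm_sum _ _ _)))// mulr_suml.
  apply: ler_sum_nat => i /andP[_ iN].
  by rewrite normrM -[in r ^+ n](subnKC (iN : i <= n)%N) exprD mulrACA.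
apply: (@le_trans _ _ (\sum_(0 <= i < n.+1) A * (`|b (n - i)%N| * r ^+ (n - i)))).
  by apply: ler_sum => i _; rewrite ler_wpM2r// mulr_ge0// exprn_ge0.
rewrite -mulr_sumr ler_wpM2l//.
by rewrite big_nat_rev/= add0n; under eq_big_nat => i /andP[_ iN] do rewrite subSS subKn//.
Qed.

(** Mertens' theorem by comparison with a larger radius: the terms with i + j >= N,
    which the product of partial sums has in excess, are bounded by q^N times an
    absolutely convergent double sum. *)
Lemma ev_cvl a b e : tame a -> tame b -> cabs e < 1 ->
  ev (cvl a b) e = ev a e * ev b e.
Proof.
move=> ta tb e1; symmetry; apply: ccvg_unique (ccvgM (ev_ccvg ta e1) (ev_ccvg tb e1)) _.
set r := cabs e in e1 *; have r0 : 0 <= r by exact: cabs_ge0.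
pose r' := (1 + r) / 2.
have r'0 : 0 < r' by rewrite /r'; lra.
have r'1 : r' < 1 by rewrite /r'; lra.
have rr' : r < r' by rewrite /r'; lra.
have r'01 : 0 <= r' < 1 by rewrite (ltW r'0) r'1.
pose q := r / r'.
have q0 : 0 <= q by rewrite divr_ge0// ltW.
have q1 : `|q| < 1 by rewrite ger0_norm// ltr_pdivrMr// mul1r.
have [A hA] := tame_summable ta r'01; have [B hB] := tame_summable tb r'01.
have A0 : 0 <= A by apply: le_trans (hA 0%N); rewrite big_nil.
have tc := tame_cvl ta tb.
suff h : ccvg (fun N => psum a e N * psum b e N - psum (cvl a b) e N) 0.
  rewrite -(add0r (ev _ _)); move/ccvg_ext: (ccvgD h (ev_ccvg tc e1)); apply=> N.
  by rewrite subrK.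
apply: (@ccvg_squeeze _ _ _ (fun N => q ^+ N * (A * B))); last first.
  rewrite -[X in _ --> X](mul0r (A * B)); apply: cvgM; last exact: cvg_cst.
  exact: cvg_expr.
move=> N; rewrite subr0.
have -> : psum (cvl a b) e N =
   \sum_(0 <= i < N) \sum_(0 <= j < N - i) ((a i)%:C * e ^+ i) * ((b j)%:C * e ^+ j).
  rewrite -sum_triangle; apply: eq_bigr => n _; rewrite /cvl rmorph_sum mulr_suml.
  apply: eq_big_nat => i /andP[_ iN].
  by rewrite mulrACA -exprD subnKC// rmorphM.
have -> : psum a e N * psum b e N =
   \sum_(0 <= i < N) \sum_(0 <= j < N) ((a i)%:C * e ^+ i) * ((b j)%:C * e ^+ j).
  by rewrite /psum mulr_suml; apply: eq_bigr => i _; rewrite mulr_sumr.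
rewrite -sumrB (le_trans (cabs_sum _ _ _))//.
apply: (@le_trans _ _ (\sum_(0 <= i < N) \sum_(0 <= j < N)
    q ^+ N * ((`|a i| * r' ^+ i) * (`|b j| * r' ^+ j)))); last first.
  under eq_bigr => i _ do rewrite -mulr_sumr -mulr_sumr.
  rewrite -mulr_sumr ler_wpM2l ?exprn_ge0// -mulr_suml ler_pM//.
  - by apply: sumr_ge0 => i _; rewrite mulr_ge0// exprn_ge0// ltW.
  - by apply: sumr_ge0 => i _; rewrite mulr_ge0// exprn_ge0// ltW.
apply: ler_sum_nat => i /andP[_ iN].
rewrite (big_cat_nat (leq0n (N - i)) (leq_subr _ _))/= [X in cabs X]addrC addKr.
rewrite (le_trans (cabs_sum _ _ _))//.
rewrite [leRHS](big_cat_nat (leq0n (N - i)) (leq_subr _ _))/=.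
rewrite -[leLHS]add0r; apply: lerD.
  by apply: sumr_ge0 => j _; rewrite !mulr_ge0 ?exprn_ge0// ltW.
apply: ler_sum_nat => j /andP[Nj _].
rewrite !cabsM !cabs_real !cabsX -/r mulrACA -exprD.
have -> : q ^+ N * (`|a i| * r' ^+ i * (`|b j| * r' ^+ j)) =
    `|a i| * `|b j| * (r' ^+ (i + j) * q ^+ N) by rewrite exprD; ring.
rewrite ler_wpM2l ?mulr_ge0//.
have -> : r = r' * q by rewrite mulrC divfK// gt_eqF.
rewrite exprMn ler_wpM2l ?exprn_ge0 ?(ltW r'0)//.
have Nij : (N <= i + j)%N by rewrite -leq_subLR.
by rewrite -(subnKC Nij) exprD ler_piMr ?exprn_ge0// exprn_ile1// ltW// -(ger0_norm q0).
Qed.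

End power_series.

(** * Second-order jets and symbol classes *)

(** Triples (f, theta f, theta^2 f) at one point, for the derivation
    theta = xi d/dxi. They form a commutative ring by the Leibniz rule, so that
    identities between symbols, proved by [ring], hold together with their first
    two derivatives. *)
Definition jet (K : fieldType) := (K * K * K)%type.

Section jets.
Context (K : fieldType).
Implicit Types J H : jet K.

HB.instance Definition _ := GRing.Zmodule.copy (jet K) (K * K * K)%type.

Definition j0 J : K := J.1.1.
Definition j1 J : K := J.1.2.
Definition j2 J : K := J.2.

Definition jone : jet K := (1, 0, 0).
Definition jmul J H : jet K :=
  (j0 J * j0 H, j1 J * j0 H + j0 J * j1 H, j2 J * j0 H + 2%:R * j1 J * j1 H + j0 J * j2 H).

Lemma jmulA : associative jmul.
Proof.
move=> [[? ?] ?] [[? ?] ?] [[? ?] ?]; rewrite /jmul /j0 /j1 /j2/=.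
by congr (_, _, _); ring.
Qed.

Lemma jmulC : commutative jmul.
Proof.
move=> [[? ?] ?] [[? ?] ?]; rewrite /jmul /j0 /j1 /j2/=.
by congr (_, _, _); ring.
Qed.

Lemma jmul1 : left_id jone jmul.
Proof.
move=> [[? ?] ?]; rewrite /jmul /j0 /j1 /j2/=.
by congr (_, _, _); ring.
Qed.

Lemma jmulDl : left_distributive jmul +%R.
Proof.
move=> [[? ?] ?] [[? ?] ?] [[? ?] ?]; rewrite /jmul /j0 /j1 /j2/=.
by congr (_, _, _); rewrite /=; ring.
Qed.

Lemma jone_neq0 : jone != 0.
Proof. by apply/eqP => -[] /eqP; rewrite oner_eq0. Qed.

HB.instance Definition _ :=
  GRing.Zmodule_isComNzRing.Build (jet K) jmulA jmulC jmul1 jmulDl jone_neq0.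

Lemma jet_eq J H : j0 J = j0 H -> j1 J = j1 H -> j2 J = j2 H -> J = H.
Proof. by case: J H => [[? ?] ?] [[? ?] ?]; rewrite /j0 /j1 /j2/= => -> -> ->. Qed.

Lemma j0D J H : j0 (J + H) = j0 J + j0 H. Proof. by []. Qed.
Lemma j1D J H : j1 (J + H) = j1 J + j1 H. Proof. by []. Qed.
Lemma j2D J H : j2 (J + H) = j2 J + j2 H. Proof. by []. Qed.
Lemma j0N J : j0 (- J) = - j0 J. Proof. by []. Qed.
Lemma j1N J : j1 (- J) = - j1 J. Proof. by []. Qed.
Lemma j2N J : j2 (- J) = - j2 J. Proof. by []. Qed.
Lemma j0M J H : j0 (J * H) = j0 J * j0 H. Proof. by []. Qed.
Lemma j1M J H : j1 (J * H) = j1 J * j0 H + j0 J * j1 H. Proof. by []. Qed.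
Lemma j2M J H : j2 (J * H) = j2 J * j0 H + 2%:R * j1 J * j1 H + j0 J * j2 H.
Proof. by []. Qed.
Lemma j0_1 : j0 1 = 1. Proof. by []. Qed.
Lemma j1_1 : j1 1 = 0. Proof. by []. Qed.
Lemma j2_1 : j2 1 = 0. Proof. by []. Qed.

Definition jE := (j0D, j1D, j2D, j0N, j1N, j2N, j0M, j1M, j2M, j0_1, j1_1, j2_1).

Definition jcst (c : K) : jet K := (c, 0, 0).

Lemma j0c c : j0 (jcst c) = c. Proof. by []. Qed.
Lemma j1c c : j1 (jcst c) = 0. Proof. by []. Qed.
Lemma j2c c : j2 (jcst c) = 0. Proof. by []. Qed.

Lemma jcstD c d : jcst (c + d) = jcst c + jcst d.
Proof. by apply: jet_eq; rewrite !jE ?j0c ?j1c ?j2c ?addr0. Qed.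
Lemma jcstN c : jcst (- c) = - jcst c.
Proof. by apply: jet_eq; rewrite !jE ?j0c ?j1c ?j2c ?oppr0. Qed.
Lemma jcstM c d : jcst (c * d) = jcst c * jcst d.
Proof. by apply: jet_eq; rewrite !jE ?j0c ?j1c ?j2c; ring. Qed.
Lemma jcst1 : jcst 1 = 1. Proof. by []. Qed.

(** The quotient rule, applied twice. *)
Definition jinv J : jet K :=
  ((j0 J)^-1, - j1 J / j0 J ^+ 2,
   (2%:R * j1 J ^+ 2 - j2 J * j0 J) / j0 J ^+ 3).

Lemma jmulV J : j0 J != 0 -> J * jinv J = 1.
Proof.
move=> J0; apply: jet_eq; rewrite !jE /jinv /j0 /j1 /j2/=.
- by rewrite mulfV.
- by field.
- by field.
Qed.

(** The effect on theta-jets of the substitution eta |-> eta^2. *)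
Definition jdil J : jet K := (j0 J, 2%:R * j1 J, 4%:R * j2 J).

Lemma jdilD J H : jdil (J + H) = jdil J + jdil H.
Proof. by apply: jet_eq; rewrite !jE /jdil /j0 /j1 /j2/=; ring. Qed.
Lemma jdilM J H : jdil (J * H) = jdil J * jdil H.
Proof. by apply: jet_eq; rewrite /jdil !jE /j0 /j1 /j2/= ; ring. Qed.
Lemma jdil_cst c : jdil (jcst c) = jcst c.
Proof. by apply: jet_eq; rewrite /jdil /j0 /j1 /j2/=; ring. Qed.

End jets.

Lemma cabs_nat (R : realType) n : cabs (n%:R : R[i]) = n%:R.
Proof.
have -> : (n%:R : R[i]) = (n%:R)%:C by rewrite rmorph_nat.
by rewrite cabs_real normr_nat.
Qed.

Section symbols.
Context {R : realType} (P : Type) (s : P -> R).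
Implicit Types (D : P -> Prop) (w : P -> R) (J : P -> jet R[i]).

(** J is a symbol of size w on D: its k-th theta-derivative is O(w s^(-k)), s being
    the distance to the singularity. As for pseudodifferential symbols, sizes
    multiply under products ([symM]) and invert for elliptic symbols ([sym_inv]). *)
Definition sym D w J := exists2 K, 0 <= K & forall p, D p ->
  [/\ 0 < s p, 0 <= w p, cabs (j0 (J p)) <= K * w p, cabs (j1 (J p)) * s p <= K * w p
    & cabs (j2 (J p)) * s p ^+ 2 <= K * w p].

Lemma symW D D' w J : (forall p, D' p -> D p) -> sym D w J -> sym D' w J.
Proof. by move=> DD [K K0 h]; exists K => // p /DD/h. Qed.

Lemma sym_le D w w' J : (exists2 c, 0 <= c & forall p, D p -> w p <= c * w' p) ->
  (forall p, D p -> 0 <= w' p) -> sym D w J -> sym D w' J.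
Proof.
move=> [c c0 hc] hw' [K K0 h]; exists (K * c); first exact: mulr_ge0.
move=> p Dp; have [s0 w0 h0 h1 h2] := h p Dp.
have le : K * w p <= K * c * w' p by rewrite -mulrA ler_wpM2l// hc.
by split; rewrite ?hw' ?(le_trans h0) ?(le_trans h1) ?(le_trans h2).
Qed.

Lemma symD D w J H : sym D w J -> sym D w H -> sym D w (fun p => J p + H p).
Proof.
move=> [K K0 hK] [L L0 hL]; exists (K + L); first exact: addr_ge0.
move=> p Dp; have [s0 w0 h0 h1 h2] := hK p Dp; have [_ _ g0 g1 g2] := hL p Dp.
split=> //; rewrite mulrDl !jE.
- by apply: le_trans (cabsD _ _) _; exact: lerD.
- rewrite (le_trans (ler_wpM2r (ltW s0) (cabsD _ _)))// mulrDl; exact: lerD.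
- rewrite (le_trans (ler_wpM2r (exprn_ge0 _ (ltW s0)) (cabsD _ _)))// mulrDl; exact: lerD.
Qed.

Lemma symN D w J : sym D w J -> sym D w (fun p => - J p).
Proof.
by move=> [K K0 hK]; exists K => // p /hK; rewrite !jE !cabsN.
Qed.

Lemma symM D w v J H : sym D w J -> sym D v H ->
  sym D (fun p => w p * v p) (fun p => J p * H p).
Proof.
move=> [K K0 hK] [L L0 hL]; exists (4 * (K * L)); first by rewrite !mulr_ge0.
move=> p Dp; have [s0 w0 h0 h1 h2] := hK p Dp; have [_ v0 g0 g1 g2] := hL p Dp.
have -> : 4 * (K * L) * (w p * v p) = 4 * ((K * w p) * (L * v p)) by ring.
have le2 (x y a b : R) : 0 <= x -> 0 <= y -> x <= a -> y <= b -> x * y <= a * b.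
  by move=> *; exact: ler_pM.
have c0 := @cabs_ge0 R.
set A := K * w p in h0 h1 h2 *; set B := L * v p in g0 g1 g2 *.
have A0 : 0 <= A by rewrite mulr_ge0.
have B0 : 0 <= B by rewrite mulr_ge0.
have AB0 : 0 <= A * B by rewrite mulr_ge0.
have sp0 := ltW s0.
split; rewrite ?mulr_ge0// !jE.
- rewrite cabsM; apply: (@le_trans _ _ (A * B)); first exact: le2.
  lra.
- apply: (@le_trans _ _ (A * B + A * B)); last lra.
  rewrite (le_trans (ler_wpM2r sp0 (cabsD _ _)))// mulrDl !cabsM.
  apply: lerD.
  + by rewrite mulrAC le2// mulr_ge0.
  + by rewrite -mulrA le2// mulr_ge0.
- apply: (@le_trans _ _ (A * B + 2 * (A * B) + A * B)); last lra.
  rewrite (le_trans (ler_wpM2r (exprn_ge0 _ sp0) (cabsD _ _)))// mulrDl.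
  apply: lerD; last by rewrite cabsM -mulrA le2// mulr_ge0// exprn_ge0.
  rewrite (le_trans (ler_wpM2r (exprn_ge0 _ sp0) (cabsD _ _)))// mulrDl.
  apply: lerD; first by rewrite cabsM mulrAC le2// mulr_ge0// exprn_ge0.
  rewrite !cabsM cabs_nat.
  have -> : 2 * cabs (j1 (J p)) * cabs (j1 (H p)) * s p ^+ 2 =
      2 * ((cabs (j1 (J p)) * s p) * (cabs (j1 (H p)) * s p)) by ring.
  by rewrite ler_pM2l// le2// mulr_ge0.
Qed.

(** The lower bound on |J| is ellipticity. The constants come from the quotient rule:
    1/c, K/c^2 and 2 K^2/c^3 + K/c^2 bound the three components. *)
Lemma sym_inv D w J c : 0 < c ->
  (forall p, D p -> 0 < w p /\ c * w p <= cabs (j0 (J p))) ->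
  sym D w J -> sym D (fun p => (w p)^-1) (fun p => jinv (J p)).
Proof.
move=> c0 hc [K K0 hK].
exists (c^-1 + K / c ^+ 2 + (2 * K ^+ 2 / c ^+ 3 + K / c ^+ 2)).
  by rewrite !addr_ge0 ?mulr_ge0 ?invr_ge0 ?exprn_ge0// ltW.
move=> p Dp; have [s0 _ h0 h1 h2] := hK p Dp; have [w0 hw] := hc p Dp.
have sp0 := ltW s0.
set W := w p in w0 hw h0 h1 h2 *.
have J0 : 0 < cabs (j0 (J p)) by apply: lt_le_trans hw; rewrite mulr_gt0.
have i0 : (cabs (j0 (J p)))^-1 <= (c * W)^-1 by rewrite lef_pV2// posrE mulr_gt0.
set I := (cabs (j0 (J p)))^-1 in i0.
have I0 : 0 <= I by rewrite invr_ge0 ltW.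
have W' : 0 <= W^-1 by rewrite invr_ge0 ltW.
have cW : (c * W)^-1 = c^-1 * W^-1 by rewrite invfM.
have c' : 0 <= c^-1 by rewrite invr_ge0 ltW.
have wn0 : W != 0 by rewrite gt_eqF.
have cn0 : c != 0 by rewrite gt_eqF.
have B0 : I <= c^-1 * W^-1 by rewrite -cW.
have KW : 0 <= K * W by rewrite mulr_ge0// ltW.
have cj := @cabs_ge0 R.
have B1 : cabs (j1 (J p)) * s p * I ^+ 2 <= K / c ^+ 2 * W^-1.
  have -> : K / c ^+ 2 * W^-1 = K * W * (c^-1 * W^-1) ^+ 2.
    by field; rewrite wn0 cn0.
  by rewrite ler_pM ?mulr_ge0 ?exprn_ge0// lerXn2r// ?nnegrE// mulr_ge0.
have B2 : (2 * (cabs (j1 (J p)) * s p) ^+ 2 + cabs (j2 (J p)) * s p ^+ 2 * cabs (j0 (J p))) * I ^+ 3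
   <= (2 * K ^+ 2 / c ^+ 3 + K / c ^+ 2) * W^-1.
  rewrite [leLHS]mulrDl [leRHS]mulrDl; apply: lerD.
    have -> : 2 * K ^+ 2 / c ^+ 3 * W^-1 = 2 * (K * W) ^+ 2 * (c^-1 * W^-1) ^+ 3.
      by field; rewrite wn0 cn0.
    rewrite ler_pM ?mulr_ge0 ?exprn_ge0 ?mulr_ge0//.
      by rewrite ler_pM2l// lerXn2r// nnegrE ?mulr_ge0.
    by rewrite lerXn2r// nnegrE ?mulr_ge0.
  have -> : cabs (j2 (J p)) * s p ^+ 2 * cabs (j0 (J p)) * I ^+ 3 =
            cabs (j2 (J p)) * s p ^+ 2 * I ^+ 2.
    by rewrite /I; field; rewrite gt_eqF.
  have -> : K / c ^+ 2 * W^-1 = K * W * (c^-1 * W^-1) ^+ 2.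
    by field; rewrite wn0 cn0.
  by rewrite ler_pM ?mulr_ge0 ?exprn_ge0// lerXn2r// ?nnegrE// mulr_ge0.
have E0 : 0 <= c^-1 * W^-1 by rewrite mulr_ge0.
have E1 : 0 <= K / c ^+ 2 * W^-1 by rewrite !mulr_ge0// invr_ge0 exprn_ge0// ltW.
have E2 : 0 <= (2 * K ^+ 2 / c ^+ 3 + K / c ^+ 2) * W^-1.
  by rewrite mulr_ge0// addr_ge0// !mulr_ge0// ?invr_ge0 ?exprn_ge0// ltW.
have DE X Y Z : (X + Y + Z) * W^-1 = X * W^-1 + Y * W^-1 + Z * W^-1 by rewrite !mulrDl.
rewrite !DE.
split=> //.
- by rewrite {1}/jinv {1}/j0/= cabsV -/I; lra.
- rewrite {1}/jinv {1}/j1/= cabsM cabsN cabsV cabsX -exprVn -/I mulrAC.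
  lra.
- rewrite {1}/jinv {1}/j2/= cabsM cabsV cabsX -exprVn -/I.
  apply: le_trans (le_trans B2 _); last lra.
  rewrite mulrAC ler_wpM2r ?exprn_ge0//.
  apply: (@le_trans _ _ ((2 * cabs (j1 (J p)) ^+ 2 + cabs (j2 (J p)) * cabs (j0 (J p))) * s p ^+ 2)).
    rewrite ler_wpM2r ?exprn_ge0// (le_trans (cabsB _ _))//.
    by rewrite (cabsM 2%:R) cabsX cabs_nat cabsM.
  by rewrite le_eqVlt; apply/orP; left; apply/eqP; ring.
Qed.

End symbols.

(** * The generating function of the weights near 1 and -1 *)

Section alternating.
Context {R : realType}.

(** The coefficients of f(- xi). *)
Definition alt (a : nat -> R) m := (-1) ^+ m * a m.

Lemma norm_alt a m : `|alt a m| = `|a m|.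
Proof. by rewrite /alt normrM normrX normrN1 expr1n mul1r. Qed.

Lemma tame_alt a : tame a -> tame (alt a).
Proof. by move=> ta r /ta[C hC]; exists C => n; rewrite norm_alt. Qed.

Lemma ev_alt a (e : R[i]) : tame a -> cabs e < 1 -> ev (alt a) e = ev a (- e).
Proof.
move=> ta e1; apply: ev_unique => //; first exact: tame_alt.
apply: ccvg_ext (ev_ccvg ta (_ : cabs (- e) < 1)) => [N|]; last by rewrite cabsN.
apply: eq_bigr => i _; rewrite /alt rmorphM rmorphXn rmorphN1 exprNn.
by rewrite mulrCA mulrA.
Qed.

End alternating.

Section powers_near_one.
Context {R : realType} (e : R[i]).
Hypothesis e1 : cabs e <= 1.

Lemma cabs_expr_le1 m : cabs (e ^+ m) <= 1.
Proof. by rewrite cabsX exprn_ile1// cabs_ge0. Qed.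

Lemma cabs_exprB1 m : cabs (e ^+ m - 1) <= m%:R * cabs (1 - e).
Proof.
elim: m => [|m IH]; first by rewrite expr0 subrr cabs0 mul0r.
have -> : e ^+ m.+1 - 1 = e * (e ^+ m - 1) + (e - 1) by rewrite exprS; ring.
rewrite (le_trans (cabsD _ _))// cabsM -natr1 mulrDl mul1r (cabs_distC e) lerD2r.
by rewrite (le_trans _ IH)// ler_piMl ?cabs_ge0.
Qed.

(** Summing e^(j+1) - e^j = (e - 1) + (e - 1) (e^j - 1) over j < m. *)
Lemma cabs_expr_taylor m :
  cabs (e ^+ m - 1 - m%:R * (e - 1)) <= m%:R * (m%:R - 1) / 2 * cabs (1 - e) ^+ 2.
Proof.
elim: m => [|m IH]; first by rewrite expr0 subrr !mul0r subrr cabs0.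
have -> : e ^+ m.+1 - 1 - m.+1%:R * (e - 1) =
   (e ^+ m - 1 - m%:R * (e - 1)) + (e - 1) * (e ^+ m - 1).
  by rewrite -natr1 exprS; ring.
rewrite (le_trans (cabsD _ _))// cabsM (cabs_distC e).
have h := ler_wpM2l (cabs_ge0 (1 - e)) (cabs_exprB1 m).
apply: le_trans (lerD IH h) _.
rewrite -natr1 le_eqVlt; apply/orP; left; apply/eqP.
by field.
Qed.

(** As long as m |1 - e| <= 1 the linear term m (e - 1) dominates the quadratic
    remainder. *)
Lemma cabs_exprB1_ge m : (m <= 1)%N \/ m%:R * cabs (1 - e) <= 1 ->
  m%:R * cabs (1 - e) / 2 <= cabs (e ^+ m - 1).
Proof.
set s := cabs (1 - e); have s0 : 0 <= s by exact: cabs_ge0.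
case=> [|ms].
  case: m => [_|[|//] _]; first by rewrite !mul0r cabs_ge0.
  by rewrite expr1 cabs_distC -/s mul1r; lra.
have h := cabs_expr_taylor m; rewrite -/s in h.
have t : cabs (m%:R * (e - 1)) <= cabs (e ^+ m - 1) + cabs (e ^+ m - 1 - m%:R * (e - 1)).
  by rewrite (le_trans _ (cabsB _ _))// opprB addrCA subrr addr0.
rewrite cabsM cabs_nat cabs_distC -/s in t.
have : m%:R * (m%:R - 1) / 2 * s ^+ 2 <= m%:R * s / 2.
  have m0 : 0 <= m%:R :> R by [].
  have u0 : 0 <= m%:R * s by rewrite mulr_ge0.
  have : (m%:R * s) * (m%:R * s) <= m%:R * s by rewrite ler_piMr.
  have : 0 <= m%:R * s ^+ 2 by rewrite mulr_ge0// sqr_ge0.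
  rewrite expr2; lra.
lra.
Qed.

(** For |w| <= 1, |w - 1|^2 = 1 + |w|^2 - 2 Re w <= 2 (1 - Re w). *)
Lemma Re_exprB1 m : cabs (e ^+ m - 1) ^+ 2 / 2 <= 1 - complex.Re (e ^+ m).
Proof.
have : cabs (e ^+ m) ^+ 2 <= 1 by rewrite exprn_ile1 ?cabs_ge0 ?cabs_expr_le1.
case: (e ^+ m) => x y; rewrite /cabs !normc_def/= !sqr_sqrtr ?addr_ge0 ?sqr_ge0//.
by rewrite subr0 => h; rewrite ler_pdivrMr//; lra.
Qed.

End powers_near_one.

Section cq_symbol.
Context {R : realType} (alpha : R) (b : nat -> R).
Hypotheses (alpha01 : 0 < alpha < 1) (hb : cq_weights alpha b).

Let a0 : 0 < alpha. Proof. by case/andP: alpha01. Qed.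
Let a1 : alpha < 1. Proof. by case/andP: alpha01. Qed.

Lemma cq_sum_le_pow : exists2 K, 0 < K & forall m, cq_sum b m <= K * m.+1%:R `^ (- alpha).
Proof.
have [l l0 hl] := cq_sum_asymp alpha01 hb.
exists (l * 2 `^ alpha + 1); first by rewrite addr_gt0// mulr_gt0// powR_gt0.
case=> [|m].
  rewrite (cq_sum0 hb) powR1 mulr1 lerDr mulr_ge0 ?powR_ge0// ltW//.
have [_ h] := hl m; apply: (le_trans h).
rewrite mulrDl ler_wpDr ?mulr_ge0 ?powR_ge0// -mulrA ler_pM2l//.
have p1 : 0 < m.+1%:R `^ alpha :> R by rewrite powR_gt0.
have p2 : 0 < m.+2%:R `^ alpha :> R by rewrite powR_gt0.
rewrite !powRN ler_pdivlMr// ler_pdivrMl// -powRM//.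
rewrite ge0_ler_powR// ?nnegrE ?(ltW a0)//.
by rewrite -natrM ler_nat; lia.
Qed.

(** The index up to which the powers of a point at distance s from 1 stay near 1. *)
Lemma nat_inverse_bracket (s : R) : 0 < s -> exists M : nat, M%:R * s <= 1 /\ 1 < M.+1%:R * s.
Proof.
move=> s0; exists (Num.trunc s^-1).
have s'0 : 0 <= s^-1 by rewrite invr_ge0 ltW.
have /andP[h1 h2] := truncn_itv s'0; split.
  by rewrite -ler_pdivlMr// div1r.
by rewrite -ltr_pdivrMr// div1r.
Qed.

Lemma pow_bracket M (s : R) : 1 < M.+1%:R * s -> 0 < s ->
  M.+1%:R `^ (- alpha) <= s `^ alpha.
Proof.
move=> M2 s0; rewrite powRN -div1r ler_pdivrMr ?powR_gt0// mulrC -powRM ?(ltW s0)//.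
have h1 : (1 : R) `^ alpha = 1 by rewrite powR1.
apply: (@le_trans _ _ (1 `^ alpha)); first by rewrite h1.
by rewrite ge0_ler_powR ?nnegrE ?(ltW a0) ?(ltW M2)// mulr_ge0 ?(ltW s0).
Qed.

Lemma ccvg_bound_near (u : nat -> R[i]) l K N : ccvg u l ->
  (forall n, (N <= n)%N -> cabs (u n) <= K) -> cabs l <= K.
Proof.
move=> ul uK; apply: (@ccvg_bound _ (fun n => u (n + N)%N)) => [|n].
  by rewrite /ccvg (cvg_shiftn N (fun n => cabs (u n - l))).
by apply: uK; exact: leq_addl.
Qed.

Lemma cabs_1B_le2 (e : R[i]) : cabs e <= 1 -> cabs (1 - e) <= 2.
Proof.
move=> e1; rewrite (le_trans (cabsB _ _))// cabs1; lra.
Qed.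

Lemma cabs_1B_gt0 (e : R[i]) : cabs e < 1 -> 0 < cabs (1 - e).
Proof.
move=> e1; rewrite lt_neqAle cabs_ge0 andbT eq_sym cabs_eq0 subr_eq0.
by apply/eqP => h; move: e1; rewrite -h cabs1 ltxx.
Qed.

Lemma psum_cqE (e : R[i]) N : psum b e N.+1 =
  (cq_sum b N)%:C + \sum_(0 <= m < N.+1) (b m)%:C * (e ^+ m - 1).
Proof.
rewrite /psum /cq_sum rmorph_sum -big_split/=; apply: eq_bigr => m _; ring.
Qed.

Lemma sum_natmul_cq M : \sum_(0 <= m < M.+1) m%:R * `|b m| =
  alpha * \sum_(0 <= j < M) cq_sum b j.
Proof.
rewrite big_nat_recl//= mul0r add0r mulr_sumr; apply: eq_bigr => m _.
rewrite ler0_norm ?(cq_weights_le0 alpha01 hb)// (cq_weights_sum alpha01 hb) mulNr opprK.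
by rewrite mulrA [_ * (_ / _)]mulrC divfK// pnatr_eq0.
Qed.

(** The bound is proved on the coefficients, where no branch of a complex power
    intervenes. Up to the index M ~ 1/s the powers e^m differ from 1 by at most
    m s; beyond it they are bounded and the weights have a small sum. Both parts,
    and the partial sum a_M, are O(M^(-alpha)) = O(s^alpha). *)
Lemma cq_symbol_le : exists2 C, 0 <= C & forall e : R[i], cabs e < 1 ->
  cabs (ev b e) <= C * cabs (1 - e) `^ alpha.
Proof.
have [K K0 hK] := cq_sum_le_pow.
exists (alpha / (1 - alpha) * K * 3 + 2 * K).
  rewrite addr_ge0// !mulr_ge0 ?invr_ge0 ?subr_ge0// ltW//.
move=> e e1; set s := cabs (1 - e).
have s0 : 0 < s by exact: cabs_1B_gt0.
have s2 : s <= 2 by apply: cabs_1B_le2; exact: ltW.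
have [M [M1 M2]] := nat_inverse_bracket s0.
have M10 : 0 < M.+1%:R :> R by [].
have Mi : M.+1%:R^-1 < s by rewrite invf_plt ?posrE// -div1r ltr_pdivrMr// .
have Mpow := pow_bracket M2 s0.
have tb := cq_tame hb.
have hN N : (M.+2 <= N)%N -> cabs (psum b e N) <= (alpha / (1 - alpha) * K * 3 + 2 * K) * s `^ alpha.
  case: N => // N; rewrite ltnS => MN.
  rewrite psum_cqE (le_trans (cabsD _ _))// cabs_real ger0_norm ?(ltW (cq_sum_gt0 alpha01 hb _))//.
  have h1 : cabs (\sum_(0 <= m < M.+1) (b m)%:C * (e ^+ m - 1)) <=
      s * (alpha * \sum_(0 <= j < M.+1) cq_sum b j).
    rewrite (le_trans (cabs_sum _ _ _))//.
    apply: (@le_trans _ _ (s * \sum_(0 <= m < M.+1) m%:R * `|b m|)).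
      rewrite mulr_sumr; apply: ler_sum => m _; rewrite cabsM cabs_real mulrC mulrA.
      by rewrite ler_wpM2r// mulrC cabs_exprB1// ltW.
    rewrite sum_natmul_cq ler_wpM2l ?(ltW s0)// ler_wpM2l ?(ltW a0)//.
    by rewrite [leRHS]big_nat_recr//= lerDl ltW// (cq_sum_gt0 alpha01 hb).
  have h2 : cabs (\sum_(M.+1 <= m < N.+1) (b m)%:C * (e ^+ m - 1)) <=
      2 * (cq_sum b M - cq_sum b N).
    rewrite (le_trans (cabs_sum _ _ _))//.
    have -> : cq_sum b M - cq_sum b N = \sum_(M.+1 <= m < N.+1) `|b m|.
      have := sum_norm_cq alpha01 hb N; rewrite (big_cat_nat (leq0n M.+1) (leqW MN))/=.
      rewrite (sum_norm_cq alpha01 hb M); lra.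
    rewrite mulr_sumr; apply: ler_sum => m _; rewrite cabsM cabs_real mulrC ler_wpM2r//.
    have : cabs (e ^+ m - 1) <= cabs (e ^+ m) + cabs 1 by exact: cabsB.
    by rewrite cabs1; have := cabs_expr_le1 (ltW e1) m; lra.
  rewrite (big_cat_nat (leq0n M.+1) (leqW MN))/=.
  have h3 := cabsD (\sum_(0 <= m < M.+1) (b m)%:C * (e ^+ m - 1))
     (\sum_(M.+1 <= m < N.+1) (b m)%:C * (e ^+ m - 1)).
  have aN := cq_sum_gt0 alpha01 hb N.
  have aM : cq_sum b M <= K * s `^ alpha by rewrite (le_trans (hK M))// ler_wpM2l ?(ltW K0).
  have h4 : s * (alpha * \sum_(0 <= j < M.+1) cq_sum b j) <=
      alpha / (1 - alpha) * K * 3 * s `^ alpha.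
    rewrite (sum_cq_sum alpha01 hb).
    have a1' : 0 < (1 - alpha)^-1 by rewrite invr_gt0 subr_gt0.
    have aM0 := cq_sum_gt0 alpha01 hb M.
    have -> : s * (alpha * ((M.+1%:R - alpha) / (1 - alpha) * cq_sum b M)) =
       alpha / (1 - alpha) * ((s * (M.+1%:R - alpha)) * cq_sum b M) by ring.
    have -> : alpha / (1 - alpha) * K * 3 * s `^ alpha =
       alpha / (1 - alpha) * (3 * (K * s `^ alpha)) by ring.
    rewrite ler_wpM2l ?mulr_ge0 ?(ltW a0) ?(ltW a1')// ler_pM ?(ltW aM0)//.
      rewrite mulr_ge0 ?(ltW s0)// subr_ge0 ltW// (lt_le_trans a1)// ler1n//.
    have -> : s * (M.+1%:R - alpha) = M%:R * s + s - s * alpha by rewrite -natr1; ring.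
    have : 0 <= s * alpha by rewrite mulr_ge0 ?ltW.
    lra.
  rewrite mulrDl; move: h1 h2 h3 h4; lra.
exact: ccvg_bound_near (ev_ccvg tb e1) hN.
Qed.

(** For m >= 1, - b_m >= 0 and 1 - Re e^m >= 0, so every term helps; those with
    m <= M ~ 1/s, for which 1 - Re e^m >= (m s)^2 / 8, suffice. *)
Lemma cq_symbol_Re_ge : exists2 c, 0 < c & forall e : R[i], cabs e < 1 ->
  c * cabs (1 - e) `^ alpha <= complex.Re (ev b e).
Proof.
have [l l0 hl] := cq_sum_asymp alpha01 hb.
exists (alpha * l / 32); first by rewrite !mulr_gt0.
move=> e e1; set s := cabs (1 - e).
have s0 : 0 < s by exact: cabs_1B_gt0.
have [M0 [M1 M2]] := nat_inverse_bracket s0.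
(* at least one term is kept when s > 1 *)
pose M := maxn M0 1.
have M3 : 1 < M.+1%:R * s.
  by rewrite (lt_le_trans M2)// ler_wpM2r ?(ltW s0)// ler_nat ltnS leq_maxl.
have tb := cq_tame hb.
apply: (ccvg_Re_ge (N := M.+2) (ev_ccvg tb e1)) => -[//|N]; rewrite ltnS => MN.
have hRe m : complex.Re ((b m)%:C * (e ^+ m - 1)) = - b m * (1 - complex.Re (e ^+ m)).
  by move: (e ^+ m) => -[x y]; simpc; rewrite /=; ring.
rewrite psum_cqE raddfD (raddf_sum (@complex.Re R))/=.
under eq_bigr do rewrite hRe.
have aN := cq_sum_gt0 alpha01 hb N.
rewrite (big_cat_nat (leq0n M.+1) (leqW MN))/=.
have t0 m : 0 <= - b m.+1 * (1 - complex.Re (e ^+ m.+1)).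
  rewrite mulr_ge0 ?oppr_ge0 ?(cq_weights_le0 alpha01 hb)//.
  by apply: le_trans (Re_exprB1 (ltW e1) _); rewrite divr_ge0// sqr_ge0.
have h2 : 0 <= \sum_(M.+1 <= m < N.+1) - b m * (1 - complex.Re (e ^+ m)).
  by rewrite big_nat_cond sumr_ge0// => -[//|m] _; exact: t0.
set aM := cq_sum b M.
have aM0 : 0 < aM by exact: (cq_sum_gt0 alpha01 hb).
have T m : (m <= M)%N -> alpha * aM * s ^+ 2 / 8 * m%:R <= - b m * (1 - complex.Re (e ^+ m)).
  case: m => [_|m mM]; first by rewrite mulr0 expr0 subrr mulr0.
  apply: (@le_trans _ _ (- b m.+1 * ((m.+1%:R * s / 2) ^+ 2 / 2))); last first.
    rewrite ler_wpM2l ?oppr_ge0 ?(cq_weights_le0 alpha01 hb)//.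
    apply: le_trans (Re_exprB1 (ltW e1) _); rewrite ler_pM2r ?invr_gt0//.
    rewrite lerXn2r ?nnegrE ?cabs_ge0 ?mulr_ge0 ?(ltW s0)//.
    apply: cabs_exprB1_ge; first exact: ltW.
    have [mm|mm] := leqP m.+1 1; [by left|right].
    rewrite (le_trans _ M1)// ler_wpM2r ?(ltW s0)// ler_nat.
    by move: mM mm; rewrite /M; clear; lia.
  have -> : - b m.+1 = alpha / m.+1%:R * cq_sum b m.
    by rewrite (cq_weights_sum alpha01 hb) mulNr opprK.
  have -> : alpha / m.+1%:R * cq_sum b m * ((m.+1%:R * s / 2) ^+ 2 / 2) =
     alpha * cq_sum b m * s ^+ 2 / 8 * m.+1%:R.
    have n0 : (m.+1%:R : R) != 0 by rewrite pnatr_eq0.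
    by move: (m.+1%:R) n0 => x n0; field.
  rewrite ler_wpM2r// ler_wpM2r ?invr_ge0// ler_wpM2r ?sqr_ge0//.
  by rewrite ler_wpM2l ?(ltW a0)// (cq_sum_nincr alpha01 hb)// ltnW.
have h1 : alpha * aM * s ^+ 2 / 8 * (M%:R * M.+1%:R / 2) <=
    \sum_(0 <= m < M.+1) - b m * (1 - complex.Re (e ^+ m)).
  have -> : M%:R * M.+1%:R / 2 = \sum_(0 <= m < M.+1) m%:R :> R.
    elim: (M) => [|k IH]; first by rewrite big_nat1 !mul0r.
    by rewrite big_nat_recr//= -IH; field.
  by rewrite mulr_sumr; apply: ler_sum_nat => m /andP[_ mM]; apply: T.
have Mle : M.+1%:R <= 2 * M%:R :> R.
  by rewrite -natrM ler_nat /M; clear; lia.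
have [laM _] := hl M; rewrite -/aM in laM.
pose X := M.+1%:R * s.
have X1 : 1 < X by [].
have X0 : 0 < X by apply: lt_trans X1.
have XX : s `^ alpha <= M.+1%:R `^ (- alpha) * X ^+ 2.
  have p0 : 0 < M.+1%:R `^ alpha :> R by rewrite powR_gt0.
  rewrite powRN mulrC ler_pdivlMr// -powRM ?(ltW s0)// mulrC -/X.
  rewrite -powR_mulrn ?(ltW X0)// ler_powR ?(ltW X1)//.
  by rewrite (le_trans (ltW a1))// ler1n.
have h3 : alpha * l / 32 * s `^ alpha <= alpha * aM * s ^+ 2 / 8 * (M%:R * M.+1%:R / 2).
  apply: (@le_trans _ _ (alpha * l / 32 * (M.+1%:R `^ (- alpha) * X ^+ 2))).
    by rewrite ler_wpM2l// !mulr_ge0 ?ltW.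
  apply: (@le_trans _ _ (alpha * aM / 32 * X ^+ 2)).
    have -> : alpha * l / 32 * (M.+1%:R `^ (- alpha) * X ^+ 2) =
      alpha * (l * M.+1%:R `^ (- alpha)) / 32 * X ^+ 2 by ring.
    by rewrite ler_wpM2r ?sqr_ge0// ler_wpM2r// ler_wpM2l ?(ltW a0).
  have -> : alpha * aM / 32 * X ^+ 2 = alpha * aM * s ^+ 2 / 32 * M.+1%:R * M.+1%:R.
    by rewrite /X; ring.
  have -> : alpha * aM * s ^+ 2 / 8 * (M%:R * M.+1%:R / 2) =
     alpha * aM * s ^+ 2 / 32 * (2 * M%:R) * M.+1%:R by field.
  by rewrite ler_wpM2r// ler_wpM2l// !mulr_ge0 ?sqr_ge0 ?ltW.
move: h1 h2 h3; lra.
Qed.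

(** The generating function of the Crank-Nicolson averaging (1 - alpha/2, alpha/2). *)
Definition cn_beta (z : R[i]) : R[i] := 1 - (alpha / 2)%:C * (1 - z).

(** B and beta both lie in the right half-plane, Re beta >= 1 - alpha, so B + z beta
    cannot be small by cancellation. This is the stability of the scheme, uniform
    in z >= 0. *)
Lemma cn_symbol_ge : exists2 c, 0 < c & forall (z : R) (e : R[i]), 0 <= z -> cabs e < 1 ->
  c * (cabs (1 - e) `^ alpha + z) <= cabs (ev b e + z%:C * cn_beta e).
Proof.
have [c c0 hc] := cq_symbol_Re_ge.
exists (Num.min c (1 - alpha)); first by rewrite lt_min c0 subr_gt0.
move=> z e z0 e1; apply: le_trans (Re_le_cabs _).
rewrite (le_trans _ (ler_norm _))// raddfD/=.
have -> : complex.Re (z%:C * cn_beta e) = z * (1 - alpha / 2 * complex.Re (1 - e)).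
  by rewrite /cn_beta; move: e {e1} => [x y]; simpc.
rewrite mulrDr; apply: lerD.
  by rewrite (le_trans _ (hc e e1))// ler_wpM2r ?powR_ge0// ge_min lexx.
rewrite mulrC ler_wpM2l//.
apply: (@le_trans _ _ (1 - alpha)); first by rewrite ge_min lexx orbT.
rewrite lerB// -[leRHS]mulr1 -mulrA ler_wpM2l ?(ltW a0)//.
have := le_trans (ler_norm _) (Re_le_cabs (1 - e)).
have := cabs_1B_le2 (ltW e1); lra.
Qed.

Lemma norm_bounded_series_cvg (a : nat -> R) : (exists C : R, forall N, \sum_(0 <= n < N) `|a n| <= C) ->
  cvgn (series a).
Proof.
move=> [C hC]; apply: normed_cvg; apply: nondecreasing_is_cvgn.
  by apply: nondecreasing_series => n _ _; exact: normr_ge0.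
by exists C => _ [N _ <-] /=; exact: hC.
Qed.

Let b' := alt b.

Lemma altS m : m.+1%:R * b' m.+1 = (alpha - m%:R) * b' m.
Proof.
rewrite /b' /alt exprS mulN1r mulNr mulrN mulrCA (cq_weightsS hb); ring.
Qed.

(** The coefficients of (1 + xi)^2 B(- xi) = (1 + xi)^(alpha + 2). Unlike those of
    B(- xi), they are so small that the second derivative converges absolutely up
    to the boundary. *)
Definition alt2 m : R := b' m + 2 * pre b' m + pre (pre b') m.

Lemma alt2_0 : alt2 0 = 1.
Proof. by rewrite /alt2 /= /b' /alt (cq_weights0 hb); ring. Qed.

(** The recursion of (1 + xi)^(alpha + 2), inherited from [altS]. *)
Lemma alt2S m : m.+1%:R * alt2 m.+1 = (alpha + 2 - m%:R) * alt2 m.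
Proof.
rewrite /alt2; case: m => [|[|m]] /=.
- have := altS 0; rewrite mul1r subr0 => ->; ring.
- have h0 := altS 0; have h1 := altS 1.
  rewrite mul1r subr0 in h0.
  have -> : 2%:R * (b' 2 + 2 * b' 1%N + b' 0%N) = 2%:R * b' 2 + 4 * b' 1%N + 2 * b' 0%N by ring.
  rewrite h1 h0; ring.
have h1 := altS m; have h2 := altS m.+1; have h3 := altS m.+2.
move: (b' m.+3) (b' m.+2) (b' m.+1) (b' m) h1 h2 h3 => x3 x2 x1 x0 h1 h2 h3.
have e3 : m.+3%:R = m%:R + 3 :> R by rewrite -!natr1; ring.
have e2 : m.+2%:R = m%:R + 2 :> R by rewrite -!natr1; ring.
have e1 : m.+1%:R = m%:R + 1 :> R by rewrite natr1.
rewrite e3 e2 e1 in h1 h2 h3 *; move: (m%:R) h1 h2 h3 => k h1 h2 h3.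
have -> : (k + 3) * (x3 + 2 * x2 + x1) = (k + 3) * x3 + 2 * ((k + 2) * x2) + ((k+1) * x1) + 2 * x2 + 2 * x1 by ring.
rewrite h3.
have -> : (alpha + 2 - (k + 2)) * (x2 + 2 * x1 + x0) =
  (alpha - (k + 2)) * x2 + 2 * x2 + 2 * ((alpha - (k + 1)) * x1) + 2 * x1 + (alpha - k) * x0 by ring.
by rewrite -h2 -h1; ring.
Qed.

(** The second derivative of (1 + xi)^(alpha + 2) is
    (alpha + 2) (alpha + 1) (1 + xi)^alpha. *)
Lemma alt2_pre2 m : m.+2%:R * m.+1%:R * alt2 m.+2 = (alpha + 2) * (alpha + 1) * b' m.
Proof.
elim: m => [|m IH].
  have h0 := alt2S 0; have h1 := alt2S 1; rewrite alt2_0 mul1r in h0.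
  rewrite mulrAC h1 h0 /b' /alt (cq_weights0 hb); ring.
have n1 : (m.+1%:R : R) != 0 by rewrite pnatr_eq0.
apply: (mulfI n1).
have -> : m.+1%:R * (m.+3%:R * m.+2%:R * alt2 m.+3) = m.+2%:R * m.+1%:R * (m.+3%:R * alt2 m.+3) by ring.
rewrite alt2S mulrCA IH [RHS]mulrCA altS.
by rewrite -[m.+2%:R]natr1 -[m.+1%:R]natr1; ring.
Qed.

Lemma sum_norm_cq_le2 N : \sum_(0 <= m < N) `|b m| <= 2.
Proof.
case: N => [|N]; first by rewrite big_nil.
by rewrite (sum_norm_cq alpha01 hb); have := cq_sum_gt0 alpha01 hb N; lra.
Qed.

(** Taylor's formula at 1, term by term. H0 and H1 are the value and the derivative
    there, and their relation is the differential equation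
    (1 + xi) f' = (alpha + 2) f at xi = 1. *)
Lemma alt2_taylor : exists2 C, 0 <= C & exists H0 H1 : R, 2 * H1 = (alpha + 2) * H0 /\
  forall e : R[i], cabs e < 1 ->
   cabs (ev alt2 e - H0%:C - H1%:C * (e - 1)) <= C * cabs (1 - e) ^+ 2.
Proof.
pose C0 := (alpha + 2) * (alpha + 1) * 2.
have C00 : 0 <= C0 by rewrite !mulr_ge0// addr_ge0// (ltW a0).
have hm m : `|alt2 m| * (m%:R * (m%:R - 1)) = if m is k.+2 then (alpha + 2) * (alpha + 1) * `|b k| else 0.
  case: m => [|[|m]]; rewrite ?mul0r ?mulr0// ?subrr ?mulr0//.
  have -> : m.+2%:R - 1 = m.+1%:R :> R by rewrite -[m.+2%:R]natr1 addrK.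
  rewrite -(ger0_norm (_ : 0 <= m.+2%:R * m.+1%:R)) ?mulr_ge0// -normrM mulrC alt2_pre2.
  by rewrite normrM norm_alt ger0_norm// mulr_ge0// addr_ge0// (ltW a0).
have S2 N : \sum_(0 <= m < N) `|alt2 m| * (m%:R * (m%:R - 1)) <= C0.
  apply: (@le_trans _ _ (\sum_(0 <= m < N.+2) `|alt2 m| * (m%:R * (m%:R - 1)))).
    rewrite [leRHS](big_cat_nat (leq0n N) (leqW (leqnSn N)))/= lerDl sumr_ge0// => m _.
    by rewrite hm; case: m => [|[|m]]//; rewrite mulr_ge0// mulr_ge0// addr_ge0// (ltW a0).
  rewrite !big_nat_recl//= !hm !add0r.
  under eq_bigr do rewrite hm.
  by rewrite -mulr_sumr /C0 ler_wpM2l ?sum_norm_cq_le2// mulr_ge0 ?addr_ge0// (ltW a0).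
have S1 N : \sum_(0 <= m < N) `|alt2 m * m%:R| <= C0 + `|alt2 1|.
  apply: (@le_trans _ _ (\sum_(0 <= m < N) `|alt2 m| * (m%:R * (m%:R - 1)) + \sum_(0 <= m < N) (m == 1%N)%:R * `|alt2 1|)).
    rewrite -big_split/=; apply: ler_sum => -[|[|m]] _.
    - by rewrite mulr0 normr0 !mul0r mulr0 addr0.
    - by rewrite mulr1 subrr mulr0 mulr0 add0r mul1r.
    - rewrite mul0r addr0 normrM normr_nat ler_wpM2l// -[leLHS]mulr1 ler_wpM2l//.
      by rewrite -[m.+2%:R]natr1 addrK ler1n.
  rewrite lerD// -mulr_suml -[leRHS]mul1r ler_wpM2r//.
  case: N => [|[|N]]; rewrite ?big_nil// ?big_nat1//.
  by rewrite !big_nat_recl//= big1// addr0 add0r.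
have S0 N : \sum_(0 <= m < N) `|alt2 m| <= C0 + `|alt2 1| + `|alt2 0|.
  apply: (@le_trans _ _ (\sum_(0 <= m < N) `|alt2 m * m%:R| + \sum_(0 <= m < N) (m == 0%N)%:R * `|alt2 0|)).
    rewrite -big_split/=; apply: ler_sum => -[|m] _.
      by rewrite mulr0 normr0 mul1r add0r.
    by rewrite mul0r addr0 normrM normr_nat -[leLHS]mulr1 ler_wpM2l// ler1n.
  rewrite lerD// -mulr_suml -[leRHS]mul1r ler_wpM2r//.
  case: N => [|N]; rewrite ?big_nil//.
  by rewrite !big_nat_recl//= big1// addr0.
have c0 : cvgn (series alt2) by apply: norm_bounded_series_cvg; exists (C0 + `|alt2 1| + `|alt2 0|).
have c1 : cvgn (series (fun m => alt2 m * m%:R)) by apply: norm_bounded_series_cvg; exists (C0 + `|alt2 1|).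
exists (C0 / 2); first by rewrite divr_ge0.
set H0 := limn (series alt2) in c0; set H1 := limn _ in c1.
exists H0, H1; split.
  have e : (fun N => series (fun m => alt2 m * m%:R) N.+1) = fun N =>
     (alpha + 2) * series alt2 N - series (fun m => alt2 m * m%:R) N.
    apply/funext => N; rewrite /series/= big_nat_recl//= mulr0 add0r mulr_sumr -sumrB.
    by apply: eq_bigr => m _; rewrite mulrC alt2S; ring.
  have l1 : (fun N => series (fun m => alt2 m * m%:R) N.+1) @ \oo --> H1 by rewrite cvg_shiftS.
  have l2 : (fun N => series (fun m => alt2 m * m%:R) N.+1) @ \oo --> (alpha + 2) * H0 - H1.
    by rewrite e; apply: cvgB => //; apply: cvgMr.
  have E : H1 = (alpha + 2) * H0 - H1 := cvg_unique (@Rhausdorff R) l1 l2.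
  by rewrite mulr_natl mulr2n {1}E subrK.
move=> e e1.
have ta2 : tame alt2.
  have tb := tame_alt (cq_tame hb).
  by apply: tameD; [apply: tameD => //; apply: tameZ; exact: tame_pred|do 2 apply: tame_pred].
have z : (fun _ : nat => 0 : R) @ \oo --> (0 : R) by exact: cvg_cst.
have k0 := ccvg_ReIm c0 z; have k1 := ccvgM (ccvg_ReIm c1 z) (ccvg_cst (e - 1)).
have k2 : ccvg (fun N => psum alt2 e N + -1 * (series alt2 N +i* 0) +
    -1 * ((series (fun m => alt2 m * m%:R) N +i* 0) * (e - 1)))
   (ev alt2 e + -1 * H0%:C + -1 * (H1%:C * (e - 1))).
  apply: ccvgD; first apply: ccvgD.
  - exact: ev_ccvg.
  - exact: ccvgM (ccvg_cst _) k0.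
  - exact: ccvgM (ccvg_cst _) k1.
have -> : ev alt2 e - H0%:C - H1%:C * (e - 1) =
  ev alt2 e + -1 * H0%:C + -1 * (H1%:C * (e - 1)) by ring.
apply: ccvg_bound k2 _ => N.
rewrite !complexr0 /psum /series/= !rmorph_sum/= mulr_suml !mulr_sumr -!big_split/=.
rewrite (le_trans (cabs_sum _ _ _))//.
apply: (@le_trans _ _ (cabs (1 - e) ^+ 2 / 2 * \sum_(0 <= m < N) `|alt2 m| * (m%:R * (m%:R - 1)))); last first.
  rewrite [leRHS](_ : _ = cabs (1 - e) ^+ 2 / 2 * C0); last by ring.
  by rewrite ler_wpM2l// divr_ge0// sqr_ge0.
rewrite mulr_sumr; apply: ler_sum => m _.
have -> : (alt2 m)%:C * e ^+ m + -1 * (alt2 m)%:C + -1 * ((alt2 m * m%:R)%:C * (e - 1)) =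
   (alt2 m)%:C * (e ^+ m - 1 - m%:R * (e - 1)).
  by rewrite rmorphM rmorph_nat; ring.
rewrite cabsM cabs_real.
have := ler_wpM2l (normr_ge0 (alt2 m)) (cabs_expr_taylor (ltW e1) m); move/le_trans; apply.
by rewrite le_eqVlt; apply/orP; left; apply/eqP; ring.
Qed.

Lemma ev_alt2 (e : R[i]) : cabs e < 1 -> ev alt2 e = (1 + e) ^+ 2 * ev b' e.
Proof.
move=> e1; have tb := tame_alt (cq_tame hb).
have t1 : tame (pre b') by exact: tame_pred.
have t2 : tame (fun m => 2 * pre b' m) by exact: tameZ.
have t3 : tame (pre (pre b')) by exact: tame_pred.
rewrite (evD (tameD tb t2) t3 e1) (evD tb t2 e1) evZ// !ev_pre//.
by rewrite rmorph_nat; ring.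
Qed.

Lemma le0_of_linear_bound (d K : R) : 0 <= K ->
  (forall y, 0 < y < 1 -> d <= K * y) -> d <= 0.
Proof.
move=> K0 h; rewrite leNgt; apply/negP => d0.
have p : 0 < d + K + 1 by lra.
have y01 : 0 < d / (d + K + 1) < 1.
  by rewrite divr_gt0//= ltr_pdivrMr// mul1r -addrA ltrDl ltr_wpDl.
have := h _ y01; rewrite mulrA ler_pdivlMr// [K * d]mulrC ler_pM2l//.
by rewrite leNgt ltr_wpDr// ?ltrDr//; lra.
Qed.

Lemma ev_cq_real (x : R) : `|x| < 1 -> ev b x%:C = ((1 - x) `^ alpha)%:C.
Proof.
by move=> x1; rewrite (ev_real (cq_tame hb) x1) (cvg_lim _ (hb x1)).
Qed.

(** The expansion (1 + eta)^alpha = 2^alpha (1 - (alpha/2) (1 - eta)) + O(|1 - eta|^2).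
    Its linear part is the Crank-Nicolson averaging symbol beta, which is why the
    scheme has order two. Dividing by (1 + eta)^2 is harmless for Re eta >= 0. *)
Lemma cq_at_minus1 : exists2 C, 0 <= C & forall e : R[i], cabs e < 1 -> 0 <= complex.Re e ->
  cabs (ev b' e - (2 `^ alpha)%:C * (1 - (alpha / 2)%:C * (1 - e))) <= C * cabs (1 - e) ^+ 2.
Proof.
have [C C0 [H0 [H1 [H01 hC]]]] := alt2_taylor.
set t := (2 : R) `^ alpha; have t0 : 0 < t by rewrite powR_gt0.
(* the constant term is found by letting a real point tend to 1 *)
have H0E : H0 = 4 * t.
  apply/eqP; rewrite -subr_eq0 -normr_le0.
  apply: (@le0_of_linear_bound _ (6 * t + `|H1| + C)).
    by rewrite !addr_ge0// mulr_ge0// ltW.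
  move=> y /andP[y0 y1]; pose x := 1 - y.
  have x1 : `|x| < 1 by rewrite ltr_norml /x; lra.
  have := hC x%:C; rewrite cabs_real => /(_ x1).
  rewrite ev_alt2 ?cabs_real// /b' ev_alt ?cabs_real//; last exact: cq_tame hb.
  rewrite -rmorphN ev_cq_real ?normrN// opprK.
  have -> : (1 : R[i]) = 1%:C by [].
  rewrite -!rmorphB -!rmorphD -rmorphXn -!rmorphM -!rmorphB !cabs_real.
  rewrite [1 - x](_ : _ = y); last by rewrite /x; ring.
  rewrite [x - 1](_ : _ = - y); last by rewrite /x; ring.
  rewrite (ger0_norm (ltW y0)).
  have -> : (1 + x) ^+ 2 = 4 - 4 * y + y ^+ 2 by rewrite /x; ring.
  set P := (1 + x) `^ alpha.
  have P1 : P <= t.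
    by rewrite ge0_ler_powR ?(ltW a0)// ?nnegrE /x; lra.
  have P2 : t * (1 - y / 2) <= P.
    have -> : P = t * (1 - y / 2) `^ alpha.
      rewrite -powRM//; last lra.
      by rewrite /P /x; congr (_ `^ _); field.
    rewrite ler_wpM2l ?(ltW t0)//.
    have z0 : 0 < 1 - y / 2 by lra.
    rewrite -[leLHS](powRr1 (ltW z0)).
    apply: ger_powR; last exact: ltW.
    by rewrite z0/=; lra.
  have yy : 0 <= y * y by rewrite mulr_ge0// ltW.
  have yy1 : y * y <= y by rewrite ler_piMl// ltW.
  move=> h.
  have e1 : `|H0 - 4 * t| <= `|(4 - 4 * y + y ^+ 2) * P - H0 - H1 * - y| +
     `|H1 * y| + `|4 * t - (4 - 4 * y + y ^+ 2) * P|.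
    have -> : H0 - 4 * t = - ((4 - 4 * y + y ^+ 2) * P - H0 - H1 * - y) + H1 * y
      - (4 * t - (4 - 4 * y + y ^+ 2) * P) by ring.
    by rewrite (le_trans (ler_normB _ _))// lerD2r (le_trans (ler_normD _ _))// normrN.
  have ty0 : 0 <= t * y by rewrite mulr_ge0 ?(ltW t0) ?(ltW y0).
  have e2 : `|4 * t - (4 - 4 * y + y ^+ 2) * P| <= 6 * t * y.
    have g0 : 0 <= 4 - 4 * y + y ^+ 2 by rewrite expr2; lra.
    have k1 : (4 - 4 * y + y ^+ 2) * P <= 4 * t.
      rewrite ler_pM ?powR_ge0//; rewrite expr2; lra.
    rewrite ger0_norm ?subr_ge0//.
    have k2 : (4 - 4 * y) * (t * (1 - y / 2)) <= (4 - 4 * y + y ^+ 2) * P.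
      apply: ler_pM => //; first lra.
      - by rewrite mulr_ge0 ?(ltW t0)//; lra.
      - by rewrite lerDl sqr_ge0.
    have tyy : 0 <= t * (y * y) by rewrite mulr_ge0 ?(ltW t0).
    have e3 : (4 - 4 * y) * (t * (1 - y / 2)) = 4 * t - 6 * (t * y) + 2 * (t * (y * y)) by field.
    rewrite e3 in k2; rewrite -mulrA; lra.
  have e4 : C * y ^+ 2 <= C * y by rewrite ler_wpM2l// expr2.
  have e5 : `|H1 * y| = `|H1| * y by rewrite normrM (ger0_norm (ltW y0)).
  apply: (le_trans e1).
  have -> : (6 * t + `|H1| + C) * y = C * y + `|H1| * y + 6 * t * y by ring.
  by rewrite -e5 lerD// lerD2r (le_trans h e4).
have H1E : H1 = (2 * alpha + 4) * t by rewrite H0E in H01; lra.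
exists (C + t * (1 + 3 * alpha)).
  by rewrite addr_ge0// mulr_ge0 ?(ltW t0)// addr_ge0// mulr_ge0// (ltW a0).
move=> e e1 Re0; have := hC e e1; rewrite ev_alt2// H0E H1E.
set X := ev b' e - _; set y := 1 - e; set s := cabs y => h.
have s2 : s <= 2 by apply: cabs_1B_le2; exact: ltW.
have s0 : 0 <= s by exact: cabs_ge0.
have n1 : 1 <= cabs (1 + e).
  apply: le_trans (Re_le_cabs _); apply: le_trans (ler_norm _).
  by rewrite raddfD/= lerDl.
have E : (1 + e) ^+ 2 * X = ((1 + e) ^+ 2 * ev b' e - (4 * t)%:C - ((2 * alpha + 4) * t)%:C * (e - 1))
   - t%:C * y ^+ 2 * ((1 + 2 * alpha)%:C - (alpha / 2)%:C * y).
  rewrite /X /y !rmorphM !rmorphD !rmorphM/= !rmorph_nat.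
  have -> : (2^-1)%:C = 2^-1 :> R[i] by rewrite fmorphV rmorph_nat.
  by field.
have : cabs ((1 + e) ^+ 2 * X) <= (C + t * (1 + 3 * alpha)) * s ^+ 2.
  rewrite E (le_trans (cabsB _ _))// [leRHS]mulrDl lerD// 2!cabsM cabs_real cabsX -/s.
  rewrite (ger0_norm (ltW t0)) mulrAC ler_wpM2r ?sqr_ge0// ler_wpM2l ?(ltW t0)//.
  rewrite (le_trans (cabsB _ _))// cabsM !cabs_real -/s !ger0_norm ?divr_ge0 ?(ltW a0)//.
    have : alpha / 2 * s <= alpha / 2 * 2 by rewrite ler_wpM2l// divr_ge0// (ltW a0).
    lra.
  by rewrite addr_ge0// mulr_ge0// (ltW a0).
apply: le_trans; rewrite cabsM cabsX -[leLHS]mul1r ler_wpM2r ?cabs_ge0//.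
by rewrite expr_ge1// cabs_ge0.
Qed.

End cq_symbol.

(** * Jets of generating functions and convolution inverses *)

Section sequences.
Context {R : realType}.
Implicit Types (a b d : nat -> R) (e : R[i]).

(** The derivation xi d/dxi, on coefficients. *)
Definition theta a n := n%:R * a n.

(** The theta-jet of the generating function of a. *)
Definition jev a e : jet R[i] := (ev a e, ev (theta a) e, ev (theta (theta a)) e).

(** The jet of the variable, which theta fixes. *)
Definition je e : jet R[i] := (e, e, e).

(** The unit of convolution. *)
Definition dlt0 (n : nat) : R := (n == 0%N)%:R.

Lemma tame_theta a : tame a -> tame (theta a).
Proof. exact: tame_natmul. Qed.

Lemma tame_pre a : tame a -> tame (pre a).
Proof. exact: tame_pred. Qed.

Lemma tame_one : tame dlt0.
Proof. by apply: (@tame_bounded _ _ 1) => n; rewrite normr_nat lern1 leq_b1. Qed.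

Lemma tame_cst (c : R) : tame (fun=> c).
Proof. exact: tame_bounded. Qed.

Lemma ev_ext a b e : a =1 b -> ev a e = ev b e.
Proof. by move=> /funext ->. Qed.

Lemma jev_ext a b e : a =1 b -> jev a e = jev b e.
Proof. by move=> /funext ->. Qed.

Lemma jevD a b e : tame a -> tame b -> cabs e < 1 ->
  jev (fun n => a n + b n) e = jev a e + jev b e.
Proof.
move=> ta tb e1; have ta1 := tame_theta ta; have tb1 := tame_theta tb.
have ta2 := tame_theta ta1; have tb2 := tame_theta tb1.
apply: jet_eq; rewrite !jE /jev /j0 /j1 /j2/= -evD//; apply: ev_ext => n;
  rewrite /theta; ring.
Qed.

Lemma jevZ k a e : tame a -> cabs e < 1 ->
  jev (fun n => k * a n) e = jcst k%:C * jev a e.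
Proof.
move=> ta e1; have ta1 := tame_theta ta; have ta2 := tame_theta ta1.
apply: jet_eq; rewrite !jE !(j0c, j1c, j2c) /jev /j0 /j1 /j2/=.
- by rewrite evZ.
- by rewrite mul0r add0r -evZ//; apply: ev_ext => n; rewrite /theta; ring.
- by rewrite mulr0 !mul0r !add0r -evZ//; apply: ev_ext => n; rewrite /theta; ring.
Qed.

Lemma theta_pre a : theta (pre a) =1 pre (fun n => theta a n + a n).
Proof. by case=> [|n]; rewrite /theta/= ?mulr0// -natr1; ring. Qed.

Lemma jev_pre a e : tame a -> cabs e < 1 -> jev (pre a) e = je e * jev a e.
Proof.
move=> ta e1; have ta1 := tame_theta ta; have ta2 := tame_theta ta1.
apply: jet_eq; rewrite !jE /jev /je /j0 /j1 /j2/=.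
- by rewrite ev_pre.
- rewrite (ev_ext _ (theta_pre a)) ev_pre ?evD//; [ring|exact: tameD].
- have -> : ev (theta (theta (pre a))) e = ev (pre (fun n => theta (fun n => theta a n + a n) n + (theta a n + a n))) e.
    apply: ev_ext => n; rewrite -theta_pre; congr (_ * _); exact: theta_pre.
  have t1 : tame (fun n => theta a n + a n) by exact: tameD.
  have t2 := tame_theta t1.
  rewrite ev_pre ?evD//; last exact: tameD.
  have -> : ev (theta (fun n => theta a n + a n)) e = ev (fun n => theta (theta a) n + theta a n) e.
    by apply: ev_ext => n; rewrite /theta; ring.
  by rewrite !evD//; ring.
Qed.

Lemma jev_one e : cabs e < 1 -> jev dlt0 e = 1.
Proof.
move=> e1; apply: jet_eq; rewrite /jev !jE /j0 /j1 /j2/=.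
- by apply: (@ev_poly _ _ _ 1) => //; [case|rewrite big_nat1 expr0 mulr1].
- by apply: (@ev_poly _ _ _ 0) => //; [case=> [|n] _; rewrite /theta ?mul0r ?mulr0|rewrite big_nil].
- by apply: (@ev_poly _ _ _ 0) => //; [case=> [|n] _; rewrite /theta ?mul0r ?mulr0|rewrite big_nil].
Qed.

Lemma theta_cvl a b : theta (cvl a b) =1 (fun n => cvl (theta a) b n + cvl a (theta b) n).
Proof.
move=> n; rewrite /theta /cvl mulr_sumr -big_split/=; apply: eq_big_nat => i /andP[_ iN].
by rewrite -{1}(subnKC (iN : i <= n)%N) natrD; ring.
Qed.

Lemma jev_cvl a b e : tame a -> tame b -> cabs e < 1 ->
  jev (cvl a b) e = jev a e * jev b e.
Proof.
move=> ta tb e1; have ta1 := tame_theta ta; have tb1 := tame_theta tb.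
have ta2 := tame_theta ta1; have tb2 := tame_theta tb1.
apply: jet_eq; rewrite !jE /jev /j0 /j1 /j2/=.
- by rewrite ev_cvl.
- by rewrite (ev_ext _ (theta_cvl a b)) evD ?ev_cvl//; apply: tame_cvl.
- have -> : ev (theta (theta (cvl a b))) e = ev (fun n =>
     (cvl (theta (theta a)) b n + cvl (theta a) (theta b) n) +
     (cvl (theta a) (theta b) n + cvl a (theta (theta b)) n)) e.
    by apply: ev_ext => n; rewrite -!theta_cvl /theta -mulrDr; congr (_ * _); exact: theta_cvl.
  have h x y : tame x -> tame y -> tame (cvl x y) by exact: tame_cvl.
  rewrite !evD ?ev_cvl//; try (by do ?[apply: tameD|apply: tame_cvl]).
  by ring.
Qed.

Lemma je_sqr e : jdil (je (e ^+ 2)) = je e * je e.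
Proof. by apply: jet_eq; rewrite /jdil !jE /je /j0 /j1 /j2/=; ring. Qed.

(** The first n + 1 coefficients of the convolution inverse, computed together because
    each one uses all the previous ones. *)
Fixpoint cinv_seq d n : seq R :=
  if n is m.+1 then
    let l := cinv_seq d m in
    rcons l (- (d 0%N)^-1 * \sum_(0 <= i < m.+1) d i.+1 * nth 0 l (m - i)%N)
  else [:: (d 0%N)^-1].

Definition cinv d n := nth 0 (cinv_seq d n) n.

Lemma size_cinv_seq d n : size (cinv_seq d n) = n.+1.
Proof. by elim: n => //= n IH; rewrite size_rcons IH. Qed.

Lemma nth_cinv_seq d m n : (m <= n)%N -> nth 0 (cinv_seq d n) m = cinv d m.
Proof.
elim: n => [|n IH]; first by rewrite leqn0 => /eqP ->.
rewrite leq_eqVlt => /orP[/eqP->//|mn]; rewrite /= nth_rcons size_cinv_seq mn IH//.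
Qed.

Lemma cinv0 d : cinv d 0 = (d 0%N)^-1. Proof. by []. Qed.

Lemma cinvS d n : cinv d n.+1 =
  - (d 0%N)^-1 * \sum_(0 <= i < n.+1) d i.+1 * cinv d (n - i)%N.
Proof.
rewrite {1}/cinv /= nth_rcons size_cinv_seq ltnn eqxx; congr (_ * _).
by apply: eq_big_nat => i /andP[_ iN]; rewrite nth_cinv_seq// leq_subr.
Qed.

Lemma cvl_cinv d : d 0%N != 0 -> cvl d (cinv d) =1 dlt0.
Proof.
move=> d0 [|n]; first by rewrite /cvl big_nat1 cinv0 mulfV.
rewrite /cvl big_nat_recl// subn0 cinvS mulrA mulrN mulfV// mulN1r.
by apply/eqP; rewrite addrC subr_eq0.
Qed.

End sequences.

(** * The Crank-Nicolson generating function *)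

Section stretch.
Context {R : realType}.
Implicit Types (a : nat -> R) (e : R[i]).

(** The coefficients of f(xi^2). *)
Definition stretch a n : R := if odd n then 0 else a n./2.

Lemma tame_stretch a : tame a -> tame (stretch a).
Proof.
move=> ta r /andP[r0 r1].
have r01 : 0 <= r ^+ 2 < 1 by rewrite exprn_ge0//= expr_lt1.
have [C hC] := ta _ r01; exists (Num.max C 0) => n; rewrite le_max /stretch.
case: ifP => on; first by rewrite normr0 mul0r lexx orbT.
by rewrite -{2}(odd_double_half n) on add0n -mul2n exprM hC.
Qed.

Lemma sqr_lt1 e : cabs e < 1 -> cabs (e ^+ 2) < 1.
Proof. by move=> e1; rewrite cabsX expr_lt1// cabs_ge0. Qed.

Lemma ev_stretch a e : tame a -> cabs e < 1 -> ev (stretch a) e = ev a (e ^+ 2).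
Proof.
move=> ta e1; have ts := tame_stretch ta.
have dbl : n.*2 @[n --> \oo] --> \oo.
  move=> A [N _ hN]; exists N => // n /= Nn; apply: hN => /=.
  by rewrite (leq_trans Nn)// -addnn leq_addr.
have h : ccvg (fun n => psum (stretch a) e n.*2) (ev (stretch a) e).
  exact: (cvg_comp _ _ dbl (ev_ccvg ts e1)).
apply: ccvg_unique h _.
apply: ccvg_ext (ev_ccvg ta (sqr_lt1 e1)) => N; rewrite /psum.
elim: N => [|N IH]; first by rewrite !big_nil.
rewrite doubleS !big_nat_recr//= IH /stretch/= odd_double doubleK /= mul0r addr0.
by rewrite -mul2n exprM.
Qed.

Lemma theta_stretch a : theta (stretch a) =1 stretch (fun n => 2 * theta a n).
Proof.
move=> n; rewrite /theta /stretch; case: ifP => on; rewrite ?mulr0//.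
by rewrite -{1}(odd_double_half n) on add0n -mul2n natrM mulrA.
Qed.

Lemma jev_stretch a e : tame a -> cabs e < 1 -> jev (stretch a) e = jdil (jev a (e ^+ 2)).
Proof.
move=> ta e1; have t1 := tame_theta ta; have t2 := tame_theta t1; have e2 := sqr_lt1 e1.
have s1 := tameZ 2 t1; have s2 := tameZ 4 t2.
apply: jet_eq; rewrite /jdil /jev /j0 /j1 /j2/=.
- by rewrite ev_stretch.
- by rewrite (ev_ext _ (theta_stretch a)) ev_stretch// evZ// rmorph_nat.
- have -> : ev (theta (theta (stretch a))) e = ev (stretch (fun n => 4 * theta (theta a) n)) e.
    apply: ev_ext => n; rewrite {1}/theta theta_stretch /stretch; case: ifP => on; rewrite ?mulr0//.
    by rewrite -{1}(odd_double_half n) on add0n -mul2n natrM /theta; ring.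
  by rewrite ev_stretch// evZ// rmorph_nat.
Qed.

End stretch.

Section scheme.
Context {R : realType} (alpha : R) (b : nat -> R).
Hypotheses (alpha01 : 0 < alpha < 1) (hb : cq_weights alpha b).

Let a0 : 0 < alpha. Proof. by case/andP: alpha01. Qed.
Let a1 : alpha < 1. Proof. by case/andP: alpha01. Qed.

(** The coefficients of beta. *)
Definition cnb n : R := (1 - alpha / 2) * dlt0 n + alpha / 2 * pre dlt0 n.
(** The coefficients of B + z beta, the operator that the scheme inverts. *)
Definition den z n : R := b n + z * cnb n.
(** The source term of the scheme for 2 (1 - C_n / c(0)). Its generating function
    2 xi / (1 - xi) + (1 - 3 alpha/2) xi + (alpha/2) xi^2 differs from the one of the
    uncorrected scheme by the corrections in the first two steps. *)
Definition kap2 n : R :=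
  2 * pre (fun=> 1) n + ((1 - 3 * alpha / 2) * pre dlt0 n + alpha / 2 * pre (pre dlt0) n).
(** The fundamental solution of the scheme. *)
Definition fundsol z := cinv (den z).
(** C_n = c(0) (1 - deficit z n / 2) is the solution of the scheme for the relaxation
    equation with z = lam tau^alpha; see [scalar_schemeE]. *)
Definition deficit z n : R := z * cvl kap2 (fundsol z) n.

Lemma tame_cnb : tame cnb.
Proof.
have t1 := @tame_one R; have t2 := tame_pre t1.
by apply: tameD; apply: tameZ.
Qed.

Lemma tame_den z : tame (den z).
Proof. by apply: tameD; [exact: cq_tame hb|apply: tameZ; exact: tame_cnb]. Qed.

Lemma tame_kap2 : tame kap2.
Proof.
have t1 := @tame_one R; have t2 := tame_pre t1; have t3 := tame_pre t2.
have t4 := tame_pre (@tame_cst R 1).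
by apply: tameD; [|apply: tameD]; apply: tameZ.
Qed.

Lemma den0 z : den z 0 = 1 + z * (1 - alpha / 2).
Proof. by rewrite /den /cnb /= /dlt0/= (cq_weights0 hb) mulr0 addr0 mulr1. Qed.

Lemma den0_gt0 z : 0 <= z -> 0 < den z 0.
Proof.
move=> z0; have c : 0 <= 1 - alpha / 2 by have := a1; lra.
by rewrite den0 ltr_pwDl// mulr_ge0.
Qed.

Lemma cvl_den_fundsol z : 0 <= z -> cvl (den z) (fundsol z) =1 dlt0.
Proof. by move=> z0; apply: cvl_cinv; rewrite gt_eqF ?den0_gt0. Qed.

(** The off-diagonal weights are nonpositive with total mass at most 1 = b_0, so
    the quadratic form is diagonally dominant. *)
Lemma cq_energy_ge0 (w : nat -> R) N : 0 <= \sum_(0 <= n < N) w n * cvl b w n.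
Proof.
pose W := \sum_(0 <= n < N) w n ^+ 2.
have tail M : \sum_(1 <= i < M) `|b i| <= 1.
  case: M => [|M]; first by rewrite big_geq.
  have := sum_norm_cq alpha01 hb M; rewrite big_ltn// (cq_weights0 hb) normr1.
  have := cq_sum_gt0 alpha01 hb M; lra.
have h1 : W - W / 2 - W / 2 <= \sum_(0 <= n < N) w n * cvl b w n.
  have s1 : \sum_(0 <= n < N) \sum_(1 <= i < n.+1) `|b i| * w n ^+ 2 <= W.
    apply: ler_sum => n _; rewrite -mulr_suml -[leRHS]mul1r ler_wpM2r ?sqr_ge0//.
  have s2 : \sum_(0 <= n < N) \sum_(1 <= i < n.+1) `|b i| * w (n - i)%N ^+ 2 <= W.
    pose c i := if i == 0%N then 0 else `|b i|.
    have c1 (F : nat -> R) M : \sum_(1 <= i < M.+1) `|b i| * F i = \sum_(0 <= i < M.+1) c i * F i.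
      rewrite [RHS]big_nat_recl//= mul0r add0r big_add1/=; apply: eq_bigr => i _//.
    under eq_bigr do rewrite (c1 (fun i => w (_ - i)%N ^+ 2)).
    have -> : \sum_(0 <= n < N) \sum_(0 <= i < n.+1) c i * w (n - i)%N ^+ 2 =
       \sum_(0 <= n < N) \sum_(0 <= i < n.+1) w i ^+ 2 * c (n - i)%N.
      apply: eq_bigr => n _; rewrite big_nat_rev/= add0n; apply: eq_big_nat => i /andP[_ iN].
      by rewrite subSS subKn// mulrC.
    rewrite (sum_triangle (fun i j => w i ^+ 2 * c j)).
    apply: ler_sum_nat => i /andP[_ iN]; rewrite -mulr_sumr -[leRHS]mulr1 ler_wpM2l ?sqr_ge0//.
    apply: le_trans (tail (N - i)%N).
    have : (0 < N - i)%N by rewrite subn_gt0.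
    case: (N - i)%N => // M _; rewrite big_ltn// add0r le_eqVlt; apply/orP; left; apply/eqP.
    by apply: eq_big_nat => j /andP[j1 _]; rewrite /c gtn_eqF.
  have key : \sum_(0 <= n < N) (w n ^+ 2 - \sum_(1 <= i < n.+1) `|b i| * w n ^+ 2 / 2
     - \sum_(1 <= i < n.+1) `|b i| * w (n - i)%N ^+ 2 / 2)
     <= \sum_(0 <= n < N) w n * cvl b w n.
    apply: ler_sum => n _; rewrite /cvl [\sum_(0 <= _ < _) _]big_ltn// subn0 (cq_weights0 hb) mul1r mulrDr -expr2.
    rewrite -addrA lerD2l -opprD -big_split/= mulr_sumr -sumrN; apply: ler_sum => i _.
    set x := w n; set y := w (n - i)%N.
    have : 0 <= `|b i| * (`|x| - `|y|) ^+ 2 by rewrite mulr_ge0// sqr_ge0.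
    have : - (`|x| * (`|b i| * `|y|)) <= x * (b i * y).
      by rewrite -!normrM lerNl -normrN ler_norm.
    rewrite sqrrB !real_normK ?num_real//; lra.
  apply: le_trans key.
  rewrite !sumrB -/W.
  have e1 : \sum_(0 <= n < N) \sum_(1 <= i < n.+1) `|b i| * w n ^+ 2 / 2 =
     (\sum_(0 <= n < N) \sum_(1 <= i < n.+1) `|b i| * w n ^+ 2) / 2.
    by rewrite mulr_suml; apply: eq_bigr => n _; rewrite mulr_suml.
  have e2 : \sum_(0 <= n < N) \sum_(1 <= i < n.+1) `|b i| * w (n - i)%N ^+ 2 / 2 =
     (\sum_(0 <= n < N) \sum_(1 <= i < n.+1) `|b i| * w (n - i)%N ^+ 2) / 2.
    by rewrite mulr_suml; apply: eq_bigr => n _; rewrite mulr_suml.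
  rewrite e1 e2; lra.
apply: le_trans h1; lra.
Qed.

Lemma cvl_cnb w n : cvl cnb w n = (1 - alpha / 2) * w n + alpha / 2 * pre w n.
Proof.
case: n => [|n]; rewrite /cvl.
  by rewrite big_nat1 /cnb /dlt0/=; ring.
rewrite big_nat_recl// big_nat_recl// big1_seq ?addr0.
  by rewrite /cnb /dlt0/= subSS !subn0; ring.
by move=> i _; rewrite /cnb /dlt0/=; ring.
Qed.

Lemma cnb_energy_ge (w : nat -> R) N :
  (1 - alpha) * \sum_(0 <= n < N) w n ^+ 2 <= \sum_(0 <= n < N) w n * cvl cnb w n.
Proof.
have sh : \sum_(0 <= n < N) pre w n ^+ 2 <= \sum_(0 <= n < N) w n ^+ 2.
  case: N => [|N]; first by rewrite !big_nil.
  rewrite big_nat_recl//= expr0n/= add0r big_nat_recr//= lerDl sqr_ge0//.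
apply: (@le_trans _ _ (\sum_(0 <= n < N) ((1 - alpha / 2) * w n ^+ 2 - alpha / 4 * w n ^+ 2 - alpha / 4 * pre w n ^+ 2))).
  rewrite !sumrB -!mulr_sumr.
  have := ler_wpM2l (ltW a0) sh; lra.
apply: ler_sum => n _; rewrite cvl_cnb.
have : 0 <= alpha * (w n + pre w n) ^+ 2 by rewrite mulr_ge0 ?sqr_ge0 ?(ltW a0).
rewrite sqrrD; lra.
Qed.

(** Testing den * fundsol = delta with fundsol bounds the sum of squares of fundsol, because the
    averaging is coercive and B is nonnegative. This bound degenerates as z -> 0;
    it serves only to make the generating function analytic in the disc. *)
Lemma fundsol_bounded z : 0 < z -> exists K, forall n, `|fundsol z n| <= K.
Proof.
move=> z0; pose K := fundsol z 0%N / (z * (1 - alpha)).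
have p0 : 0 < fundsol z 0 by rewrite /fundsol cinv0 invr_gt0 den0_gt0// ltW.
have c0 : 0 < z * (1 - alpha) by rewrite mulr_gt0// subr_gt0.
exists (K + 1) => n.
have h : \sum_(0 <= m < n.+1) fundsol z m ^+ 2 <= K.
  rewrite /K ler_pdivlMr// mulrC -mulrA.
  have e : \sum_(0 <= m < n.+1) fundsol z m * cvl (den z) (fundsol z) m = fundsol z 0%N.
    rewrite big_nat_recl// (cvl_den_fundsol (ltW z0)) /dlt0/= mulr1 big1 ?addr0// => i _.
    by rewrite (cvl_den_fundsol (ltW z0)) /dlt0/= mulr0.
  have e2 : \sum_(0 <= m < n.+1) fundsol z m * cvl (den z) (fundsol z) m =
    \sum_(0 <= m < n.+1) fundsol z m * cvl b (fundsol z) m + z * \sum_(0 <= m < n.+1) fundsol z m * cvl cnb (fundsol z) m.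
    rewrite mulr_sumr -big_split/=; apply: eq_bigr => m _.
    rewrite /cvl /den mulrCA -mulrDr; congr (_ * _); rewrite mulr_sumr -big_split/=.
    by apply: eq_bigr => i _; ring.
  rewrite -e e2; have := cq_energy_ge0 (fundsol z) n.+1.
  have := ler_wpM2l (ltW z0) (cnb_energy_ge (fundsol z) n.+1); lra.
have h2 : fundsol z n ^+ 2 <= K.
  by apply: le_trans h; rewrite big_nat_recr//= lerDr sumr_ge0// => i _; rewrite sqr_ge0.
have : 0 <= (`|fundsol z n| - 1) ^+ 2 by rewrite sqr_ge0.
have q : `|fundsol z n| ^+ 2 = fundsol z n ^+ 2 by rewrite real_normK ?num_real.
have : 0 <= `|fundsol z n| by [].
rewrite sqrrB expr1n mulr1 q; lra.
Qed.

Lemma tame_fundsol z : 0 < z -> tame (fundsol z).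
Proof. by move=> /fundsol_bounded[K hK]; exact: tame_bounded hK. Qed.

Lemma tame_deficit z : 0 < z -> tame (deficit z).
Proof. by move=> z0; apply: tameZ; apply: tame_cvl; [exact: tame_kap2|exact: tame_fundsol]. Qed.

Local Notation c4 := (jcst (alpha / 4)%:C).

Definition jbeta (e : R[i]) : jet R[i] := 1 - 2 * c4 * (1 - je e).
(** The jet of the generating function of [kap2]. *)
Definition jkap2 (e : R[i]) : jet R[i] :=
  2 * (je e * jinv (1 - je e)) + ((1 - 6 * c4) * je e + 2 * c4 * (je e * je e)).

Lemma c4E : 2 * c4 = jcst (alpha / 2)%:C.
Proof.
have -> : (2 : jet R[i]) = jcst 2%:R%:C.
  have -> : (2%:R)%:C = 1 + 1 :> R[i] by rewrite rmorph_nat mulr2n.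
  by rewrite jcstD jcst1 mulr2n.
by rewrite -jcstM -rmorphM; congr (jcst _%:C); field.
Qed.

Lemma jev_cnb e : cabs e < 1 -> jev cnb e = jbeta e.
Proof.
move=> e1; have t1 := @tame_one R; have t2 := tame_pre t1.
have t3 := tameZ (1 - alpha / 2) t1; have t4 := tameZ (alpha / 2) t2.
rewrite jevD// !jevZ// jev_pre// jev_one// rmorphB jcstD jcstN -c4E /jbeta rmorph1 jcst1.
ring.
Qed.

Lemma jev_den z e : cabs e < 1 -> jev (den z) e = jev b e + jcst z%:C * jbeta e.
Proof.
move=> e1; have t1 := tame_cnb.
by rewrite jevD ?jevZ ?jev_cnb//; [exact: cq_tame hb|exact: tameZ].
Qed.

Lemma j1Be_neq0 (e : R[i]) : cabs e < 1 -> j0 (1 - je e) != 0.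
Proof.
move=> e1; rewrite !jE /je /j0/= -cabs_eq0 gt_eqF//; exact: cabs_1B_gt0.
Qed.

Lemma jev_cst1 (e : R[i]) : cabs e < 1 -> jev (fun=> 1) e = jinv (1 - je e).
Proof.
move=> e1.
have t := @tame_cst R 1; have t1 := @tame_one R.
have E : jev (fun=> 1) e = 1 + je e * jev (fun=> 1) e.
  rewrite -jev_pre// -[X in X + _](jev_one e1) -jevD//; last exact: tame_pre.
  by apply: jev_ext => -[|n]; rewrite /dlt0/= ?addr0 ?add0r.
transitivity (jev (fun=> 1) e * ((1 - je e) * jinv (1 - je e))).
  by rewrite (jmulV (j1Be_neq0 e1)) mulr1.
rewrite mulrA.
have -> : jev (fun=> 1) e * (1 - je e) = 1 by rewrite mulrBr mulr1 {1}E; ring.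
by rewrite mul1r.
Qed.

Lemma jev_kap2 e : cabs e < 1 -> jev kap2 e = jkap2 e.
Proof.
move=> e1; have t1 := @tame_one R; have t2 := tame_pre t1; have t3 := tame_pre t2.
have t4 := tame_pre (@tame_cst R 1).
have t0 := @tame_cst R 1.
have s1 := tameZ (1 - 3 * alpha / 2) t2; have s2 := tameZ (alpha / 2) t3.
have s3 := tameZ 2 t4; have s4 := tameD s1 s2.
rewrite jevD// jevD// !jevZ// !jev_pre// jev_one// jev_cst1//.
have -> : (1 - 3 * alpha / 2)%:C = 1 - ((alpha / 2)%:C + (alpha / 2)%:C + (alpha / 2)%:C).
  by rewrite -!rmorphD -(rmorph1 (real_complex R)) -rmorphB; congr (_%:C); field.
have -> : (2%:R)%:C = 1 + 1 :> R[i] by rewrite rmorph_nat mulr2n.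
rewrite /jkap2 !(jcstD, jcstN, jcst1) -c4E; ring.
Qed.

Lemma jet_two : (2 : jet R[i]) = jcst (2%:R)%:C.
Proof.
have -> : (2%:R)%:C = 1 + 1 :> R[i] by rewrite rmorph_nat mulr2n.
by rewrite jcstD jcst1 mulr2n.
Qed.

Lemma jev_deficit z (e : R[i]) : 0 < z -> cabs e < 1 ->
  jev (deficit z) e * (jev b e + jcst z%:C * jbeta e) = jcst z%:C * jkap2 e.
Proof.
move=> z0 e1; have tk := tame_kap2; have tp := tame_fundsol z0.
rewrite jevZ//; last exact: tame_cvl.
rewrite jev_cvl// jev_kap2// -jev_den// -!mulrA; congr (_ * _).
rewrite [jev (fundsol z) e * _]mulrC -jev_cvl//; last exact: tame_den.
by rewrite (jev_ext _ (cvl_den_fundsol (ltW z0))) jev_one// mulr1.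
Qed.

Let b' := alt b.

(** The differential equation of (1 - xi)^alpha and its theta-derivative: they reduce
    the bounds on the derivatives of B to the one on B. *)
Lemma theta_cq_jets (e : R[i]) : cabs e < 1 ->
  (1 - e) * j1 (jev b e) = - (alpha%:C * e) * j0 (jev b e) /\
  (1 - e) * j2 (jev b e) = e * j1 (jev b e) - alpha%:C * e * (j1 (jev b e) + j0 (jev b e)).
Proof.
move=> e1; have tb := cq_tame hb; have t1 := tame_theta tb; have t2 := tame_theta t1.
have E : theta b =1 pre (fun n => theta b n + - alpha * b n).
  by case=> [|n]; rewrite /theta/= ?mul0r// (cq_weightsS hb); ring.
have s1 := tameZ (- alpha) tb; have s2 := tameZ (- alpha) t1.
have ts := tameD t1 s1.
have E1 : ev (theta b) e = e * (ev (theta b) e - alpha%:C * ev b e).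
  by rewrite {1}(ev_ext _ E) ev_pre// evD// evZ// rmorphN mulNr.
have E2 : ev (theta (theta b)) e = e * (ev (theta (theta b)) e - alpha%:C * ev (theta b) e
     + (ev (theta b) e - alpha%:C * ev b e)).
  have E' : ev (theta (theta b)) e = ev (pre (fun n => theta (fun n => theta b n + - alpha * b n) n +
      (theta b n + - alpha * b n))) e.
    by apply: ev_ext => n; rewrite -theta_pre /theta -E.
  rewrite {1}E' ev_pre; [|by apply: tameD => //; exact: tame_theta|by []].
  rewrite evD//; last exact: tame_theta.
  have -> : ev (theta (fun n => theta b n + - alpha * b n)) e =
     ev (fun n => theta (theta b) n + - alpha * theta b n) e.
    by apply: ev_ext => n; rewrite /theta; ring.
  by rewrite !evD// !evZ// rmorphN !mulNr.
rewrite /jev /j0 /j1 /j2/=; split.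
- rewrite mulrBl mul1r {1}E1; ring.
- rewrite mulrBl mul1r {1}E2; ring.
Qed.

Lemma b'_tame : tame b'. Proof. exact: tame_alt (cq_tame hb). Qed.

(** (1 - xi)^alpha (1 + xi)^alpha = (1 - xi^2)^alpha, verified on coefficients by
    comparing both sides on the real interval. *)
Lemma cvl_alt_cq : cvl b b' =1 stretch b.
Proof.
move=> n; have tb := cq_tame hb; have tb' := b'_tame.
have tc := tame_cvl tb tb'; have ts := tame_stretch tb; have tn := tameZ (-1) ts.
have td := tameD tc tn.
suff : cvl b b' n + -1 * stretch b n = 0 by rewrite mulN1r => /eqP; rewrite subr_eq0 => /eqP.
apply: (@pseries_eq0 _ (fun n => cvl b b' n + -1 * stretch b n)) => x x1.
have := tame_cvg td x1.
have x1' : cabs x%:C < 1 by rewrite cabs_real.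
suff -> : limn (pseries (fun n => cvl b b' n + -1 * stretch b n) x) = 0 by [].
apply: complexI; rewrite -ev_real// evD// evZ// ev_cvl// ev_stretch//.
rewrite /b' ev_alt// -rmorphN -rmorphXn !(ev_cq_real hb) ?normrN//; last first.
  by rewrite normrX expr_lt1.
rewrite rmorphN1 mulN1r -!rmorphM -rmorphB -powRM.
- by rewrite opprK -subr_sqr expr1n subrr.
- by rewrite subr_ge0 ltW// (le_lt_trans (ler_norm _)).
- by rewrite opprK -lerBlDl sub0r lerNl (le_trans (ler_norm _))// normrN ltW.
Qed.

Lemma cq_dil (e : R[i]) : cabs e < 1 -> jdil (jev b (e ^+ 2)) = jev b e * jev b' e.
Proof.
move=> e1; have tb := cq_tame hb; have tb' := b'_tame.
by rewrite -jev_cvl// (jev_ext _ cvl_alt_cq) jev_stretch.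
Qed.

End scheme.

Section cq_jets.
Context {R : realType} (alpha : R) (b : nat -> R).
Hypotheses (alpha01 : 0 < alpha < 1) (hb : cq_weights alpha b).

Let a0 : 0 < alpha. Proof. by case/andP: alpha01. Qed.
Let a1 : alpha < 1. Proof. by case/andP: alpha01. Qed.

Local Notation P := (R * R[i])%type.
Local Notation S := (fun p : P => cabs (1 - p.2)).
(** The domain of the estimates: pairs (z, eta). Treating z as a variable makes all
    constants uniform in it. *)
Definition disc (p : P) := 0 < p.1 /\ cabs p.2 < 1.
Definition half_disc (p : P) := disc p /\ 0 <= complex.Re p.2.
Local Notation sy := (sym S).

Lemma disc_s p : disc p -> 0 < S p /\ S p <= 2.
Proof. by move=> [_ p1]; split; [exact: cabs_1B_gt0|apply: cabs_1B_le2; exact: ltW]. Qed.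

Lemma sym_const (c : R[i]) : sy disc (fun=> 1) (fun=> jcst c).
Proof.
exists (cabs c); first exact: cabs_ge0.
move=> p Dp; have [s0 s2] := disc_s Dp.
by split; rewrite ?j0c ?j1c ?j2c ?cabs0 ?mul0r ?mulr1 ?cabs_ge0.
Qed.

Lemma sym_1 : sy disc (fun=> 1) (fun=> 1).
Proof. exact: (sym_const 1). Qed.

Lemma sym_z : sy disc (fun p => p.1) (fun p => jcst p.1%:C).
Proof.
exists 1 => // p Dp; have [s0 s2] := disc_s Dp; case: Dp => z0 _.
split; rewrite ?j0c ?j1c ?j2c ?cabs0 ?mul0r ?mul1r ?cabs_real ?ger0_norm ?(ltW z0)//.
Qed.

Lemma sym_e : sy disc (fun=> 1) (fun p => je p.2).
Proof.
exists 4 => // p Dp; have [s0 s2] := disc_s Dp; case: Dp => z0 /ltW e1.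
have e0 := cabs_ge0 p.2.
split; rewrite // /je /j0 /j1 /j2/= ?mulr1.
- by rewrite (le_trans e1)// ler1n.
- rewrite (@le_trans _ _ (1 * 2))// ?ler_pM ?cabs_ge0//; lra.
- rewrite (@le_trans _ _ (1 * 4))// ?ler_pM ?cabs_ge0 ?sqr_ge0//; last lra.
  by rewrite (_ : 4 = 2 ^+ 2) ?lerXn2r ?nnegrE ?cabs_ge0//; rewrite -natrX.
Qed.

Lemma sym_y : sy disc S (fun p => 1 - je p.2).
Proof.
exists 2 => // p Dp; have [s0 s2] := disc_s Dp; case: Dp => z0 /ltW e1.
have e0 := cabs_ge0 p.2.
have E1 : j1 (1 - je p.2) = - p.2 by rewrite !jE /je /j1/= sub0r.
have E2 : j2 (1 - je p.2) = - p.2 by rewrite !jE /je /j2/= sub0r.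
split; rewrite ?cabs_ge0// ?E1 ?E2 ?cabsN.
- by rewrite !jE /je /j0/= ler_peMl ?cabs_ge0// ler1n.
- by rewrite ler_pM2r//; lra.
- rewrite expr2 mulrA ler_pM2r//; rewrite (@le_trans _ _ (1 * 2)) ?ler_pM ?cabs_ge0//; lra.
Qed.

Lemma symMw D w v u J H : (forall p, w p * v p = u p) -> sy D w J -> sy D v H ->
  sy D u (fun p => J p * H p).
Proof. by move=> /funext <- hJ hH; exact: symM. Qed.

Lemma symM1 D w J H : sy D w J -> sy D (fun=> 1) H -> sy D w (fun p => J p * H p).
Proof. by apply: symMw => p; rewrite mulr1. Qed.

End cq_jets.

(** * Cancellation between two step sizes *)

(** In the next two identities E stands for eta, Y for 1 / (1 - eta), Yp for
    1 / (1 + eta) and c for alpha/4. They exhibit the factor 1 - eta in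
    2 kappa(eta^2) - kappa(eta) beta(eta) and in
    2 kappa(eta^2) beta(eta) - kappa(eta) beta(eta^2): the poles of the two terms
    cancel and a zero is left, thanks to the choice of the corrections. *)
Lemma kappa_beta_id (A : comNzRingType) (E Y Yp c : A) :
  (1 - E) * Y = 1 -> (1 + E) * Yp = 1 ->
  2 * (2 * (E * E * (Y * Yp)) + ((1 - 6 * c) * (E * E) + 2 * c * (E * E * (E * E))))
   - (2 * (E * Y) + ((1 - 6 * c) * E + 2 * c * (E * E))) * (1 - 2 * c * (1 - E)) =
  (1 - E) * (Yp * (E * ((- 3 + 12 * c - 12 * c * c) + E * ((- 2 + 8 * c - 8 * c * c)
    + E * ((- 8 * c + 4 * c * c) + E * (- 4 * c)))))).
Proof.
move=> hY hYp; set L := LHS; set Rh := RHS.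
suff h : (1 - E) * (1 + E) * L = (1 - E) * (1 + E) * Rh.
  have u : (Y * Yp) * ((1 - E) * (1 + E)) = 1.
    by rewrite mulrACA [Y * _]mulrC hY mul1r mulrC.
  by rewrite -[L]mul1r -[Rh]mul1r -u -!mulrA !mulrA -2!(mulrA (Y * Yp)) h !mulrA.
have -> : (1 - E) * (1 + E) * L = 4 * (E * E) * ((1 - E) * Y) * ((1 + E) * Yp)
   + 2 * ((1 - 6 * c) * (E * E) + 2 * c * (E * E * (E * E))) * ((1 - E) * (1 + E))
   - (2 * E * (1 + E) * ((1 - E) * Y) + ((1 - 6 * c) * E + 2 * c * (E * E)) * ((1 - E) * (1 + E)))
     * (1 - 2 * c * (1 - E)) by rewrite /L; ring.
have -> : (1 - E) * (1 + E) * Rh = ((1 + E) * Yp) * ((1 - E) * (1 - E) *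
  (E * ((- 3 + 12 * c - 12 * c * c) + E * ((- 2 + 8 * c - 8 * c * c)
    + E * ((- 8 * c + 4 * c * c) + E * (- 4 * c)))))) by rewrite /Rh; ring.
rewrite hY hYp; ring.
Qed.

Lemma kappa_beta2_id (A : comNzRingType) (E Y Yp c : A) :
  (1 - E) * Y = 1 -> (1 + E) * Yp = 1 ->
  2 * (2 * (E * E * (Y * Yp)) + ((1 - 6 * c) * (E * E) + 2 * c * (E * E * (E * E)))) * (1 - 2 * c * (1 - E))
   - (2 * (E * Y) + ((1 - 6 * c) * E + 2 * c * (E * E))) * (1 - 2 * c * (1 - E * E)) =
  (1 - E) * (Yp * (E * ((- 3 + 12 * c - 12 * c * c) + E * ((- 2 + 2 * c + 4 * c * c)
    + E * ((- 10 * c + 20 * c * c) + E * ((- 4 * c - 4 * c * c) + E * (- 8 * c * c))))))).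
Proof.
move=> hY hYp; set L := LHS; set Rh := RHS.
suff h : (1 - E) * (1 + E) * L = (1 - E) * (1 + E) * Rh.
  have u : (Y * Yp) * ((1 - E) * (1 + E)) = 1.
    by rewrite mulrACA [Y * _]mulrC hY mul1r mulrC.
  by rewrite -[L]mul1r -[Rh]mul1r -u -!mulrA !mulrA -2!(mulrA (Y * Yp)) h !mulrA.
have -> : (1 - E) * (1 + E) * L = (4 * (E * E) * ((1 - E) * Y) * ((1 + E) * Yp)
   + 2 * ((1 - 6 * c) * (E * E) + 2 * c * (E * E * (E * E))) * ((1 - E) * (1 + E))) * (1 - 2 * c * (1 - E))
   - (2 * E * (1 + E) * ((1 - E) * Y) + ((1 - 6 * c) * E + 2 * c * (E * E)) * ((1 - E) * (1 + E)))
     * (1 - 2 * c * (1 - E * E)) by rewrite /L; ring.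
have -> : (1 - E) * (1 + E) * Rh = ((1 + E) * Yp) * ((1 - E) * (1 - E) *
  (E * ((- 3 + 12 * c - 12 * c * c) + E * ((- 2 + 2 * c + 4 * c * c)
    + E * ((- 10 * c + 20 * c * c) + E * ((- 4 * c - 4 * c * c) + E * (- 8 * c * c))))))) by rewrite /Rh; ring.
rewrite hY hYp; ring.
Qed.

(** The difference over the common denominator. *)
Lemma two_scale_id (A : comNzRingType) (G G' coarse_den fine_den Q1 Q2 z k k2 : A) :
  G * coarse_den = z * k2 -> G' * fine_den = z * k -> coarse_den * Q1 = 1 -> fine_den * Q2 = 1 ->
  2 * G - G' = z * ((2 * k2 * fine_den - k * coarse_den) * (Q1 * Q2)).
Proof.
move=> h1 h2 q1 q2.
transitivity (2 * (G * coarse_den) * Q1 * (fine_den * Q2) - (G' * fine_den) * Q2 * (coarse_den * Q1)).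
  rewrite q1 q2 !mulr1 -!mulrA q1 q2 !mulr1//.
by rewrite h1 h2; ring.
Qed.

Lemma sqr_le4 (R : realType) (s : R) : 0 <= s -> s <= 2 -> s ^+ 2 <= 4.
Proof.
move=> s0 s2; have : s * s <= 2 * 2 by rewrite ler_pM.
by rewrite expr2; lra.
Qed.

Lemma eq_sym_dom (R : realType) (P : Type) (s : P -> R) (D : P -> Prop) w (J H : P -> jet R[i]) :
  (forall p, D p -> J p = H p) -> sym s D w J -> sym s D w H.
Proof.
by move=> JH [K K0 h]; exists K => // p Dp; rewrite -(JH p Dp); exact: h.
Qed.

Lemma eq_sym_fun (R : realType) (P : Type) (s : P -> R) D w (J H : P -> jet R[i]) :
  J =1 H -> sym s D w J -> sym s D w H.
Proof. by move=> /funext ->. Qed.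

Section estimates.
Context {R : realType} (alpha : R) (b : nat -> R).
Hypotheses (alpha01 : 0 < alpha < 1) (hb : cq_weights alpha b).

Let a0 : 0 < alpha. Proof. by case/andP: alpha01. Qed.
Let a1 : alpha < 1. Proof. by case/andP: alpha01. Qed.

Local Notation P := (R * R[i])%type.
Local Notation S := (fun p : P => cabs (1 - p.2)).
Local Notation sy := (sym S).
Let t : R := 2 `^ alpha.
Let t0 : 0 < t. Proof. by rewrite powR_gt0. Qed.
Local Notation disc := (@disc R).
Local Notation half_disc := (@half_disc R).
Let w (p : P) := S p `^ alpha + p.1.

Lemma half_disc_disc p : half_disc p -> disc p. Proof. by case. Qed.

Lemma w_gt0 p : disc p -> 0 < w p.
Proof. by move=> [z0 _]; rewrite ltr_wpDl ?powR_ge0. Qed.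

Lemma sym_A : sy disc (fun p => S p `^ alpha) (fun p => jev b p.2).
Proof.
have [C C0 hC] := cq_symbol_le alpha01 hb; exists (4 * C); first exact: mulr_ge0.
move=> p Dp; have [s0 s2] := disc_s Dp; case: Dp => z0 e1.
have [h1 h2] := theta_cq_jets hb e1; have h0 := hC _ e1.
set s := cabs (1 - p.2) in s0 s2 h0 *; set J := jev b p.2 in h1 h2 *.
have w0 : 0 <= s `^ alpha by exact: powR_ge0.
have c0 : 0 <= cabs (j0 J) by exact: cabs_ge0.
have c1 : 0 <= cabs (j1 J) by exact: cabs_ge0.
have k0 : cabs (j0 J) <= C * s `^ alpha by [].
have e0 := cabs_ge0 p.2.
have k1 : cabs (j1 J) * s <= cabs (j0 J).
  rewrite mulrC -cabsM h1 cabsM cabsN cabsM cabs_real ger0_norm ?(ltW a0)//.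
  rewrite -[leRHS]mul1r ler_wpM2r// -[leRHS]mulr1 ler_pM ?(ltW a0) ?(ltW a1) ?(ltW e1)//.
have k2 : cabs (j2 J) * s <= 2 * cabs (j1 J) + cabs (j0 J).
  rewrite mulrC -cabsM h2 (le_trans (cabsB _ _))// cabsM.
  have : cabs p.2 * cabs (j1 J) <= cabs (j1 J) by rewrite ler_piMl// ltW.
  have : cabs (alpha%:C * p.2 * (j1 J + j0 J)) <= cabs (j1 J) + cabs (j0 J).
    rewrite !cabsM cabs_real ger0_norm ?(ltW a0)//.
    apply: (@le_trans _ _ (1 * cabs (j1 J + j0 J))); last by rewrite mul1r cabsD.
    by rewrite ler_wpM2r ?cabs_ge0// -[leRHS]mulr1 ler_pM ?(ltW a0) ?(ltW a1) ?(ltW e1).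
  lra.
split=> //.
- rewrite -mulrA; lra.
- rewrite -mulrA; lra.
- apply: (@le_trans _ _ ((2 * cabs (j1 J) + cabs (j0 J)) * s)).
    by rewrite expr2 mulrA ler_wpM2r// ltW.
  have : cabs (j0 J) * s <= cabs (j0 J) * 2 by rewrite ler_wpM2l.
  rewrite mulrDl -!mulrA; lra.
Qed.

Lemma jev_alt (e : R[i]) : cabs e < 1 -> jev (alt b) e = jev b (- e).
Proof.
move=> e1; have tb := cq_tame hb; have t1 := tame_theta tb; have t2 := tame_theta t1.
have E a : theta (alt a) =1 alt (theta a) :> (nat -> R) by move=> n; rewrite /theta /alt; ring.
have e1' : cabs (- e) < 1 by rewrite cabsN.
apply: jet_eq; rewrite /jev /j0 /j1 /j2/=.
- by rewrite ev_alt.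
- by rewrite (ev_ext _ (E b)) ev_alt.
- have -> : ev (theta (theta (alt b))) e = ev (alt (theta (theta b))) e.
    by apply: ev_ext => n; rewrite -E /theta -E.
  by rewrite ev_alt.
Qed.

(** The value is [cq_at_minus1]; the derivatives follow from the differential
    equation of B(- eta), which is regular at eta = 1. *)
Lemma sym_remainder : sy half_disc (fun p => S p ^+ 2)
  (fun p => jev (alt b) p.2 - jcst t%:C * jbeta alpha p.2).
Proof.
have [C C0 hC] := cq_at_minus1 alpha01 hb; rewrite -/t in hC.
have t0l : 0 <= t := ltW t0; have a0l : 0 < alpha := a0; have a1l : alpha < 1 := a1.
pose M := 4 * C + 2 * t.
have M0 : 0 <= M by rewrite /M; lra.
exists (4 * M + 2 * C + 4 * t); first by lra.
move=> p [Dp Re0]; have [s0 s2] := disc_s Dp; case: Dp => z0 e1.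
have e1' : cabs (- p.2) < 1 by rewrite cabsN.
have [h1 h2] := theta_cq_jets hb e1'; have h0 := hC _ e1 Re0.
rewrite -jev_alt// opprK in h1 h2.
have A0E : j0 (jev (alt b) p.2) = ev (alt b) p.2 by [].
rewrite -A0E in h0.
set s := cabs (1 - p.2) in s0 s2 h0 *; set J := jev (alt b) p.2 in h0 h1 h2 *.
set e := p.2 in e1 h0 h1 h2 *.
have ce := cabs_ge0 e.
have n1 : 1 <= cabs (1 + e).
  apply: le_trans (Re_le_cabs _); apply: le_trans (ler_norm _).
  by rewrite raddfD/= lerDl.
have divn x : cabs x <= cabs ((1 + e) * x) by rewrite cabsM ler_peMl ?cabs_ge0.
have a2 : 0 <= alpha / 2 by rewrite divr_ge0// (ltW a0).
set u := (alpha / 2)%:C in h0 *.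
have B0 : j0 (jbeta alpha e) = 1 - u * (1 - e).
  by rewrite /jbeta c4E !jE j0c /je /j0/=.
have B1 : j1 (jbeta alpha e) = u * e.
  by rewrite /jbeta c4E !jE j0c j1c /je /j1/=; ring.
have B2 : j2 (jbeta alpha e) = u * e.
  by rewrite /jbeta c4E !jE j0c j1c j2c /je /j1 /j2/=; ring.
have au : cabs u = alpha / 2 by rewrite cabs_real ger0_norm.
have ct : cabs t%:C = t by rewrite cabs_real ger0_norm// (ltW t0).
have ss : s ^+ 2 <= 4 by exact: sqr_le4 (ltW s0) s2.
have bJ : cabs (j0 J) <= M.
  have -> : j0 J = (j0 J - t%:C * (1 - u * (1 - e))) + t%:C * (1 - u * (1 - e)) by ring.
  rewrite (le_trans (cabsD _ _))// lerD//.
    by rewrite (le_trans h0)// mulrC ler_wpM2r.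
  rewrite cabsM ct mulrC ler_wpM2r ?(ltW t0)// (le_trans (cabsB _ _))// cabs1 cabsM au.
  have : alpha / 2 * s <= alpha / 2 * 2 by rewrite ler_wpM2l.
  have := a1; rewrite -/s; lra.
have bJ1 : cabs (j1 J) <= cabs (j0 J).
  rewrite (le_trans (divn _))// h1 cabsM cabsN cabsM cabsN cabs_real ger0_norm ?(ltW a0)//.
  rewrite -[leRHS]mul1r ler_wpM2r ?cabs_ge0// -[leRHS]mulr1 ler_pM ?(ltW a0) ?(ltW a1) ?(ltW e1)//.
have bJ2 : cabs (j2 J) <= 3 * cabs (j0 J).
  rewrite (le_trans (divn _))// h2 (le_trans (cabsB _ _))// cabsM cabsN.
  have : cabs e * cabs (j1 J) <= cabs (j1 J) by rewrite ler_piMl ?cabs_ge0// ltW.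
  have : cabs (alpha%:C * - e * (j1 J + j0 J)) <= cabs (j1 J) + cabs (j0 J).
    rewrite !cabsM cabsN cabs_real ger0_norm ?(ltW a0)//.
    apply: (@le_trans _ _ (1 * cabs (j1 J + j0 J))); last by rewrite mul1r cabsD.
    by rewrite ler_wpM2r ?cabs_ge0// -[leRHS]mulr1 ler_pM ?(ltW a0) ?(ltW a1) ?(ltW e1).
  lra.
have R1 : cabs (j1 J - t%:C * (u * e)) <= (2 * C + t) * s.
  rewrite (le_trans (divn _))//.
  have -> : (1 + e) * (j1 J - t%:C * (u * e)) =
     (alpha%:C * e) * ((j0 J - t%:C * (1 - u * (1 - e))) + t%:C * (1 - alpha%:C) / 2 * (1 - e)).
    have -> : (1 + e) * (j1 J - t%:C * (u * e)) = (1 + e) * j1 J - (1 + e) * (t%:C * (u * e)) by ring.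
    rewrite h1 /u rmorphM fmorphV rmorph_nat.
    by field.
  apply: (@le_trans _ _ (1 * (C * s ^+ 2 + t * s))).
    rewrite cabsM ler_pM ?cabs_ge0//.
      rewrite cabsM cabs_real ger0_norm ?(ltW a0)//.
      by rewrite -[leRHS]mulr1 ler_pM ?(ltW a0) ?(ltW a1) ?(ltW e1).
    rewrite (le_trans (cabsD _ _))// lerD// cabsM ler_wpM2r ?cabs_ge0//.
    rewrite -mulrA cabsM ct -[leRHS]mulr1 ler_wpM2l ?(ltW t0)// cabsM cabsV cabs_nat.
    rewrite -(rmorph1 (real_complex R)) -rmorphB cabs_real ger0_norm ?subr_ge0 ?(ltW a1)//.
    by rewrite ler_pdivrMr//; have := a0; lra.
  rewrite mul1r mulrDl lerD2r expr2 mulrA ler_wpM2r ?(ltW s0)// mulrC ler_wpM2r//.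
have cs2 : 0 <= s ^+ 2 by exact: sqr_ge0.
have E0 : j0 (J - jcst t%:C * jbeta alpha e) = j0 J - t%:C * (1 - u * (1 - e)).
  by rewrite j0D j0N j0M j0c B0.
have E1 : j1 (J - jcst t%:C * jbeta alpha e) = j1 J - t%:C * (u * e).
  by rewrite j1D j1N j1M j0c j1c B1 mul0r add0r.
have E2 : j2 (J - jcst t%:C * jbeta alpha e) = j2 J - t%:C * (u * e).
  by rewrite j2D j2N j2M j0c j1c j2c B2 mulr0 !mul0r !add0r.
rewrite E0 E1 E2.
split=> //.
- by rewrite (le_trans h0)// ler_wpM2r//; have := ltW t0; lra.
- rewrite (le_trans (ler_wpM2r (ltW s0) R1))// -mulrA -expr2 ler_wpM2r//.
  by have := ltW t0; lra.
- rewrite ler_wpM2r// (le_trans (cabsB _ _))// cabsM ct cabsM au.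
  have : t * (alpha / 2 * cabs e) <= t * 1.
    rewrite ler_wpM2l ?(ltW t0)//; apply: (@le_trans _ _ (1 * 1)); last by rewrite mulr1.
    by rewrite ler_pM ?cabs_ge0 ?(ltW e1)//; have := a1; lra.
  have := ltW t0; lra.
Qed.

Lemma symZ1 D v J : (forall p, D p -> disc p) -> sy D v J ->
  forall c : R[i], sy D v (fun p => jcst c * J p).
Proof.
move=> hD hJ c; apply: (@symMw _ D (fun=> 1) v) => //; first by move=> p; rewrite mul1r.
exact: symW hD (sym_const c).
Qed.

Lemma sym_beta : sy disc (fun=> 1) (fun p => jbeta alpha p.2).
Proof.
apply: symD; first exact: sym_1.
apply: symN.
have h : sy disc (fun=> 1) (fun p => 1 - je p.2).
  by apply: symD; [exact: sym_1|apply: symN; exact: sym_e].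
have := symM1 (symM1 (sym_const 2%:R) (sym_const (alpha / 4)%:C)) h.
apply: eq_sym_fun => p; congr (_ * _ * _).
by rewrite jet_two rmorph_nat.
Qed.

Lemma sym_nat n : sy disc (fun=> 1) (fun=> (n%:R : jet R[i])).
Proof.
elim: n => [|n IH]; first by exists 1 => // p Dp; have [s0 s2] := disc_s Dp;
  split; rewrite /j0 /j1 /j2 /= ?cabs0 ?mul0r ?mulr1.
apply: (eq_sym_fun (J := fun=> n%:R + 1)) => [p|]; first by rewrite natr1.
by apply: symD => //; exact: sym_1.
Qed.

Lemma sym_Y : sy disc (fun p => (S p)^-1) (fun p => jinv (1 - je p.2)).
Proof.
apply: (sym_inv (c := 1)) => //; last exact: sym_y.
by move=> p Dp; have [s0 s2] := disc_s Dp; rewrite mul1r !jE /je /j0/=.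
Qed.

Lemma Re_1De (e : R[i]) : 0 <= complex.Re e -> 1 <= cabs (1 + e).
Proof.
move=> Re0; apply: le_trans (Re_le_cabs _); apply: le_trans (ler_norm _).
by rewrite raddfD/= lerDl.
Qed.

Lemma sym_Yp : sy half_disc (fun=> 1) (fun p => jinv (1 + je p.2)).
Proof.
have h : sy half_disc (fun p => 1^-1) (fun p => jinv (1 + je p.2)).
  apply: (sym_inv (c := 1)) => //.
    by move=> p [Dp Re0]; rewrite mul1r !jE /je /j0/=; split => //; exact: Re_1De.
  apply: (symW half_disc_disc); apply: symD; [exact: sym_1|exact: sym_e].
have E : (fun _ : P => (1 : R)^-1) = fun=> 1 by apply/funext => p; rewrite invr1.
by rewrite E in h.
Qed.

Local Notation c4 := (jcst (alpha / 4)%:C).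

Lemma sym_kap2 : sy disc (fun p => (S p)^-1) (fun p => jkap2 alpha p.2).
Proof.
apply: symD.
  apply: (symMw (w := fun=> 1)); [by move=> p; rewrite mul1r|exact: (sym_nat 2)|].
  by apply: (symMw (w := fun=> 1)); [by move=> p; rewrite mul1r|exact: sym_e|exact: sym_Y].
apply: (@sym_le _ _ _ _ (fun=> 1)).
- exists 2 => // p Dp; have [s0 s2] := disc_s Dp.
  by rewrite ler_pdivlMr// mul1r.
- by move=> p _; rewrite invr_ge0 cabs_ge0.
have e := sym_e (R := R); have c := sym_const (alpha / 4)%:C.
have n := sym_nat; have o := sym_1 (R := R).
by apply: symD; [apply: symM1 => //; apply: symD => //; apply: symN; apply: symM1|
  apply: symM1; apply: symM1].
Qed.

Lemma z_le_w p : disc p -> p.1 <= w p.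
Proof. by move=> Dp; rewrite lerDr powR_ge0. Qed.

Lemma symw_z D J : (forall p, D p -> disc p) -> sy D (fun p => p.1) J -> sy D w J.
Proof.
move=> hD; apply: sym_le.
  by exists 1 => // p /hD Dp; rewrite mul1r z_le_w.
by move=> p /hD Dp; rewrite ltW// w_gt0.
Qed.

Lemma symw_A D J : (forall p, D p -> disc p) -> sy D (fun p => S p `^ alpha) J -> sy D w J.
Proof.
move=> hD; apply: sym_le.
  by exists 1 => // p /hD [z0 _]; rewrite mul1r lerDl ltW.
by move=> p /hD Dp; rewrite ltW// w_gt0.
Qed.

Lemma cabs_cn_symbol (z : R) (e : R[i]) :
  j0 (jev b e + jcst z%:C * jbeta alpha e) = ev b e + z%:C * cn_beta alpha e.
Proof. by rewrite /jbeta /cn_beta c4E !jE !j0c /je /j0/=. Qed.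

(** 2^alpha times the denominator of the fine scheme at eta. *)
Definition fine_den (p : P) := jcst t%:C * jev b p.2 + jcst p.1%:C * jbeta alpha p.2.
(** The denominator of the coarse scheme at eta^2, with B(eta^2) factored. *)
Definition coarse_den (p : P) := jev b p.2 * jev (alt b) p.2 + jcst p.1%:C * jdil (jbeta alpha (p.2 ^+ 2)).

Lemma sym_fine_den : sy disc w fine_den.
Proof.
apply: symD.
  by apply: symw_A => //; apply: symZ1 => //; exact: sym_A.
apply: symw_z => //; apply: (symMw (w := fun p => p.1) (v := fun=> 1)).
- by move=> p; rewrite mulr1.
- exact: sym_z.
- exact: sym_beta.
Qed.

Lemma fine_den_ge : exists2 c, 0 < c & forall p, disc p -> 0 < w p /\ c * w p <= cabs (j0 (fine_den p)).
Proof.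
have [c c0 hc] := cn_symbol_ge alpha01 hb; exists c => // p Dp.
split; first exact: w_gt0.
case: (Dp) => z0 e1.
have zt : 0 <= p.1 / t by rewrite divr_ge0 ?(ltW z0) ?(ltW t0).
have t1 : 1 <= t.
  have : 2 `^ 0 <= 2 `^ alpha :> R by rewrite ler_powR ?ler1n ?(ltW a0).
  by rewrite powRr0.
have -> : j0 (fine_den p) = t%:C * (ev b p.2 + (p.1 / t)%:C * cn_beta alpha p.2).
  have tn : t%:C != 0 by rewrite fmorph_eq0 gt_eqF.
  rewrite mulrDr mulrA -rmorphM [t * _]mulrC divfK ?gt_eqF//.
  have -> : cn_beta alpha p.2 = j0 (jbeta alpha p.2).
    by rewrite /jbeta /cn_beta c4E !jE !j0c /je /j0/=.
  by rewrite /fine_den j0D !j0M !j0c.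
rewrite cabsM cabs_real ger0_norm ?(ltW t0)//.
apply: (@le_trans _ _ (t * (c * (S p `^ alpha + p.1 / t)))); last first.
  by rewrite ler_wpM2l ?(ltW t0)// hc.
rewrite mulrCA ler_wpM2l ?(ltW c0)// mulrDr [t * (_ / _)]mulrC divfK ?gt_eqF//.
by rewrite lerD2r ler_peMl ?powR_ge0.
Qed.

Lemma jdil_beta (e : R[i]) : jdil (jbeta alpha (e ^+ 2)) = 1 - 2 * c4 * (1 - je e * je e).
Proof.
by rewrite /jbeta c4E -je_sqr; apply: jet_eq; rewrite /jdil !jE ?j0c ?j1c ?j2c
  /je /j0 /j1 /j2/=; ring.
Qed.

Lemma sym_alt : sy half_disc (fun=> 1) (fun p => jev (alt b) p.2).
Proof.
have h : sy half_disc (fun=> 1) (fun p => (jev (alt b) p.2 - jcst t%:C * jbeta alpha p.2) + jcst t%:C * jbeta alpha p.2).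
  apply: symD; last by apply: symZ1; [exact: half_disc_disc|exact: symW half_disc_disc sym_beta].
  apply: sym_le sym_remainder => //.
  exists 4 => // p [Dp _]; have [s0 s2] := disc_s Dp; rewrite mulr1.
  exact: sqr_le4 (ltW s0) s2.
by apply: eq_sym_fun h => p; rewrite subrK.
Qed.

Lemma sym_coarse_den : sy half_disc w coarse_den.
Proof.
apply: symD.
  apply: symw_A; first exact: half_disc_disc.
  by apply: symM1; [exact: symW half_disc_disc sym_A|exact: sym_alt].
apply: symw_z; first exact: half_disc_disc.
apply: symM1; first exact: symW half_disc_disc (sym_z (R := R)).
apply: (symW half_disc_disc); apply: (eq_sym_fun (fun p => esym (jdil_beta p.2))).
have e := sym_e (R := R); have c := sym_const (alpha / 4)%:C.
have n := sym_nat; have o := sym_1 (R := R).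
apply: symD => //; apply: symN; apply: symM1; first exact: symM1.
by apply: symD => //; apply: symN; exact: symM1.
Qed.

Lemma coarse_den_ge : exists2 c, 0 < c & forall p, half_disc p -> 0 < w p /\ c * w p <= cabs (j0 (coarse_den p)).
Proof.
have [c c0 hc] := cn_symbol_ge alpha01 hb; exists c => // p [Dp Re0].
split; first exact: w_gt0.
case: (Dp) => z0 e1; have e2 := sqr_lt1 e1.
have -> : j0 (coarse_den p) = ev b (p.2 ^+ 2) + p.1%:C * cn_beta alpha (p.2 ^+ 2).
  rewrite /coarse_den -(cq_dil hb e1) -cabs_cn_symbol !jE j0c /jdil /j0/=//.
apply: le_trans (hc _ _ (ltW z0) e2); rewrite ler_wpM2l ?(ltW c0)// lerD2r.
have -> : 1 - p.2 ^+ 2 = (1 - p.2) * (1 + p.2) by ring.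
rewrite cabsM ge0_ler_powR ?(ltW a0) ?nnegrE ?mulr_ge0 ?cabs_ge0//.
by rewrite ler_peMr ?cabs_ge0// Re_1De.
Qed.

Lemma jdil_nat n : jdil (n%:R : jet R[i]) = n%:R.
Proof.
elim: n => [|n IH]; first by rewrite /jdil /j0 /j1 /j2/= !mulr0.
by rewrite -natr1 jdilD IH; congr (_ + _); rewrite -[1]jcst1 jdil_cst.
Qed.

Lemma jdilN (J : jet R[i]) : jdil (- J) = - jdil J.
Proof. by apply: jet_eq; rewrite /jdil !jE /j0 /j1 /j2/= ?mulrN. Qed.

Lemma jdil_kap2 (e : R[i]) Y Yp : (1 - je e) * Y = 1 -> (1 + je e) * Yp = 1 -> cabs e < 1 ->
  jdil (jkap2 alpha (e ^+ 2)) =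
      2 * (je e * je e * (Y * Yp)) +
      ((1 - 6 * c4) * (je e * je e) + 2 * c4 * (je e * je e * (je e * je e))).
Proof.
move=> hY hYp e1.
have V : jdil (jinv (1 - je (e ^+ 2))) = Y * Yp.
  set V := LHS.
  have h : V * (1 - je e * je e) = 1.
    rewrite /V -je_sqr mulrC -[1 in X in X * _](jdil_nat 1) -jdilN -jdilD -jdilM jmulV ?(jdil_nat 1)//.
    exact: j1Be_neq0 (sqr_lt1 e1).
  transitivity (V * ((1 - je e) * Y) * ((1 + je e) * Yp)); first by rewrite hY hYp !mulr1.
  transitivity (V * (1 - je e * je e) * (Y * Yp)); first by ring.
  by rewrite h mul1r.
rewrite /jkap2 !(jdilD, jdilM, jdilN, jdil_cst, jdil_nat, je_sqr) V.
by rewrite !jcst1; ring.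
Qed.

(** The contribution to the mean over the circle of the pair eta, - eta, where the
    coarse term occurs twice; the fine term at - eta is left to [fine_bound]. *)
Definition two_scale (z : R) (e : R[i]) : jet R[i] :=
  2 * jdil (jev (deficit alpha b z) (e ^+ 2)) - jev (deficit alpha b (z / t)) e.

Lemma jev_deficit_fine (z : R) (e : R[i]) : 0 < z -> cabs e < 1 ->
  jev (deficit alpha b (z / t)) e * fine_den (z, e) = jcst z%:C * jkap2 alpha e.
Proof.
move=> z0 e1; have zt : 0 < z / t by rewrite divr_gt0.
have h := jev_deficit alpha01 hb zt e1.
have zE : jcst z%:C = jcst t%:C * jcst (z / t)%:C.
  by rewrite -jcstM -rmorphM [t * _]mulrC divfK ?gt_eqF.
rewrite /fine_den/= zE -mulrA -mulrDr mulrCA h; ring.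
Qed.

Lemma jev_deficit_coarse (z : R) (e : R[i]) : 0 < z -> cabs e < 1 ->
  jdil (jev (deficit alpha b z) (e ^+ 2)) * coarse_den (z, e) = jcst z%:C * jdil (jkap2 alpha (e ^+ 2)).
Proof.
move=> z0 e1; have h := jev_deficit alpha01 hb z0 (sqr_lt1 e1).
by rewrite /coarse_den/= -(cq_dil hb e1) -(jdil_cst z%:C) -!jdilM -jdilD -jdilM h.
Qed.

(** Over the common denominator, of size w^2 with w = s^alpha + z, the numerator is
      B (2^alpha N1 - kappa (B(- eta) - 2^alpha beta)) + z N2,
    where N1 and N2 are the combinations of [kappa_beta_id] and [kappa_beta2_id],
    of size s. The remainder is of size s^2 and kappa of size 1/s, so the numerator
    has size w s, and the quotient z s / w <= z s^(1 - alpha). *)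
Lemma two_scale_bound : exists2 K, 0 <= K & forall (z : R) (e : R[i]), 0 < z -> cabs e < 1 ->
  0 <= complex.Re e ->
  cabs (j2 (two_scale z e)) * cabs (1 - e) ^+ 2 <= K * (z * (cabs (1 - e) * cabs (1 - e) `^ (- alpha))).
Proof.
have [c1 c10 h1] := coarse_den_ge; have [c2 c20 h2] := fine_den_ge.
have Q1 := sym_inv c10 h1 sym_coarse_den; have Q2 := sym_inv c20 h2 sym_fine_den.
pose L1 (E : jet R[i]) := E * ((- 3 + 12 * c4 - 12 * c4 * c4) + E * ((- 2 + 8 * c4 - 8 * c4 * c4)
    + E * ((- 8 * c4 + 4 * c4 * c4) + E * (- 4 * c4)))).
pose L2 (E : jet R[i]) := E * ((- 3 + 12 * c4 - 12 * c4 * c4) + E * ((- 2 + 2 * c4 + 4 * c4 * c4)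
    + E * ((- 10 * c4 + 20 * c4 * c4) + E * ((- 4 * c4 - 4 * c4 * c4) + E * (- 8 * c4 * c4))))).
have e := sym_e (R := R); have c := sym_const (alpha / 4)%:C.
have n := sym_nat; have o := sym_1 (R := R).
have nN k : sy disc (fun=> 1) (fun=> - (k%:R : jet R[i])) by apply: symN.
have cc k : sy disc (fun=> 1) (fun=> (k%:R : jet R[i]) * c4) by apply: symM1.
have ccc k : sy disc (fun=> 1) (fun=> (k%:R : jet R[i]) * c4 * c4) by apply: symM1.
have ccN k : sy disc (fun=> 1) (fun=> - (k%:R : jet R[i]) * c4) by apply: symM1.
have cccN k : sy disc (fun=> 1) (fun=> - (k%:R : jet R[i]) * c4 * c4) by apply: symM1.
have sL1 : sy disc (fun=> 1) (fun p => L1 (je p.2)).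
  rewrite /L1; do ?[apply: symM1 => //; apply: symD => //];
    do ?[apply: symD => //]; do ?[exact: symN | exact: symM1].
have sL2 : sy disc (fun=> 1) (fun p => L2 (je p.2)).
  rewrite /L2; do ?[apply: symM1 => //; apply: symD => //];
    do ?[apply: symD => //]; do ?[exact: symN | exact: symM1].
have toH v J : sy disc v J -> sy half_disc v J by exact: symW half_disc_disc.
have s1 : sy half_disc S (fun p => (1 - je p.2) * (jinv (1 + je p.2) * L1 (je p.2))).
  apply: symM1; first exact: toH (sym_y (R := R)).
  by apply: symM1; [exact: sym_Yp|exact: toH].
have s2 : sy half_disc S (fun p => (1 - je p.2) * (jinv (1 + je p.2) * L2 (je p.2))).
  apply: symM1; first exact: toH (sym_y (R := R)).
  by apply: symM1; [exact: sym_Yp|exact: toH].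
have kR : sy half_disc S (fun p => jkap2 alpha p.2 * (jev (alt b) p.2 - jcst t%:C * jbeta alpha p.2)).
  apply: (sym_le _ _ (symM (toH _ _ sym_kap2) sym_remainder)).
    exists 1 => // p [Dp _]; have [s0 _] := disc_s Dp.
    by rewrite mul1r expr2 mulrA mulVf ?gt_eqF// mul1r.
  by move=> p _; exact: cabs_ge0.
have X1 : sy half_disc S (fun p => jcst t%:C * ((1 - je p.2) * (jinv (1 + je p.2) * L1 (je p.2)))
   - jkap2 alpha p.2 * (jev (alt b) p.2 - jcst t%:C * jbeta alpha p.2)).
  apply: symD; last exact: symN.
  by apply: symZ1 => //; exact: half_disc_disc.
have wS p : half_disc p -> 0 <= w p * S p by move=> [Dp _]; rewrite mulr_ge0 ?cabs_ge0// ltW// w_gt0.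
have AX1 : sy half_disc (fun p => w p * S p) (fun p => jev b p.2 * (jcst t%:C * ((1 - je p.2) * (jinv (1 + je p.2) * L1 (je p.2)))
   - jkap2 alpha p.2 * (jev (alt b) p.2 - jcst t%:C * jbeta alpha p.2))).
  by apply: symM => //; apply: symw_A; [exact: half_disc_disc|exact: toH sym_A].
have zX2 : sy half_disc (fun p => w p * S p) (fun p => jcst p.1%:C * ((1 - je p.2) * (jinv (1 + je p.2) * L2 (je p.2)))).
  by apply: symM => //; apply: symw_z; [exact: half_disc_disc|exact: toH (sym_z (R := R))].
have tot := symM (toH _ _ (sym_z (R := R))) (symM (symD AX1 zX2) (symM Q1 (toH _ _ Q2))).
have {tot}[K K0 hK] : sy half_disc (fun p => p.1 * (S p * S p `^ (- alpha))) (fun p => two_scale p.1 p.2).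
  apply: (eq_sym_dom _ (sym_le _ _ tot)).
  - move=> p [Dp Re0]; have [s0 _] := disc_s Dp; case: (Dp) => z0 e1.
    symmetry; rewrite /two_scale.
    have q1 : coarse_den p * jinv (coarse_den p) = 1.
      have [w0 hh] := h1 p (conj Dp Re0); apply: jmulV; rewrite -cabs_eq0 gt_eqF//.
      by apply: lt_le_trans hh; rewrite mulr_gt0.
    have q2 : fine_den p * jinv (fine_den p) = 1.
      have [w0 hh] := h2 p Dp; apply: jmulV; rewrite -cabs_eq0 gt_eqF//.
      by apply: lt_le_trans hh; rewrite mulr_gt0.
    have pE : p = (p.1, p.2) by case: (p).
    rewrite pE in q1 q2.
    rewrite (two_scale_id (jev_deficit_coarse z0 e1) (jev_deficit_fine z0 e1) q1 q2) -pE.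
    congr (_ * (_ * _)).
    have hY : (1 - je p.2) * jinv (1 - je p.2) = 1 by apply: jmulV; exact: j1Be_neq0.
    have hYp : (1 + je p.2) * jinv (1 + je p.2) = 1.
      apply: jmulV; rewrite !jE /je /j0/= -cabs_eq0 gt_eqF//.
      by apply: lt_le_trans (Re_1De Re0).
    have k2E : jdil (jkap2 alpha (p.2 ^+ 2)) =
      2 * (je p.2 * je p.2 * (jinv (1 - je p.2) * jinv (1 + je p.2))) +
      ((1 - 6 * c4) * (je p.2 * je p.2) + 2 * c4 * (je p.2 * je p.2 * (je p.2 * je p.2))).
      exact: jdil_kap2 hY hYp e1.
    have I1 := kappa_beta_id c4 hY hYp; have I2 := kappa_beta2_id c4 hY hYp.
    rewrite -/(L1 (je p.2)) in I1; rewrite -/(L2 (je p.2)) in I2.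
    rewrite -I1 -I2 -k2E -/(jkap2 alpha p.2) -/(jbeta alpha p.2) -jdil_beta /coarse_den /fine_den; ring.
  - exists 1 => // p [Dp _]; have [s0 _] := disc_s Dp; case: (Dp) => z0 e1; have w0 := w_gt0 Dp.
    rewrite mul1r ler_wpM2l ?(ltW z0)//.
    have -> : w p * S p * ((w p)^-1 * (w p)^-1) = S p * (w p)^-1 by field; rewrite gt_eqF.
    rewrite ler_wpM2l ?cabs_ge0// powRN lef_pV2 ?posrE ?powR_gt0//.
    by rewrite lerDl ltW.
  - by move=> p [[z0 _] _]; rewrite !mulr_ge0 ?powR_ge0 ?cabs_ge0// ltW.
exists K => // z e0 z0 e1 Re0.
by have [_ _ _ _] := hK (z, e0) (conj (conj z0 e1) Re0).
Qed.

(** Away from 1 there is no singularity, and the denominator is bounded below. *)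
Lemma fine_bound : exists2 K, 0 <= K & forall (z : R) (e : R[i]), 0 < z -> cabs e < 1 ->
  complex.Re e <= 0 -> cabs (j2 (jev (deficit alpha b (z / t)) e)) <= K * z.
Proof.
have [c2 c20 h2] := fine_den_ge.
have Q2 := sym_inv c20 h2 sym_fine_den.
have [K K0 hK] := symM (sym_z (R := R)) (symM sym_kap2 Q2).
exists K => // z e z0 e1 Re0.
have Dp : disc (z, e) by [].
pose J := jcst z%:C * (jkap2 alpha e * jinv (fine_den (z, e))); pose s := cabs (1 - e).
have [s0 _ _ _] := hK _ Dp.
change (cabs (j2 J) * s ^+ 2 <= K * (z * (s^-1 * (w (z, e))^-1)) ->
  cabs (j2 (jev (deficit alpha b (z / t)) e)) <= K * z) => h.
have {}s0 : 0 < s by [].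
have s1 : 1 <= s.
  apply: le_trans (Re_le_cabs _); apply: le_trans (ler_norm _).
  by rewrite raddfB/= lerBrDl gerDr.
have JE : jev (deficit alpha b (z / t)) e = J.
  have q2 : fine_den (z, e) * jinv (fine_den (z, e)) = 1.
    have [w0 hh] := h2 _ Dp; apply: jmulV; rewrite -cabs_eq0 gt_eqF//.
    by apply: lt_le_trans hh; rewrite mulr_gt0.
  by rewrite -[LHS]mulr1 -q2 mulrA jev_deficit_fine// /J mulrA.
rewrite JE; have s2 : 1 <= s ^+ 2 by rewrite expr_ge1// ltW.
apply: (@le_trans _ _ (cabs (j2 J) * s ^+ 2)); first by rewrite ler_peMr ?cabs_ge0.
apply: (le_trans h); rewrite ler_wpM2l// ler_piMr ?(ltW z0)//.
have w1 : 1 <= w (z, e).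
  rewrite /w/= -/s (le_trans (_ : 1 <= s `^ alpha)) ?lerDl ?(ltW z0)//.
  have : s `^ 0 <= s `^ alpha by rewrite ler_powR// (ltW a0).
  by rewrite powRr0.
have w0 : 0 < w (z, e) by apply: lt_le_trans w1.
rewrite mulr_ile1 ?invr_ge0 ?(ltW s0) ?(ltW w0)// invf_le1//.
Qed.

End estimates.

(** * Coefficients as means over a circle *)

Section circle.
Context {R : realType}.
Implicit Types (x y : R).

Definition cis x : R[i] := cos x +i* sin x.

Lemma cisD x y : cis (x + y) = cis x * cis y.
Proof. by rewrite /cis cosD sinD; simpc; congr (_ +i* _); rewrite addrC. Qed.

Lemma cis0 : cis 0 = 1. Proof. by rewrite /cis cos0 sin0. Qed.

Lemma cisX x n : cis x ^+ n = cis (n%:R * x).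
Proof.
elim: n => [|n IH]; first by rewrite mul0r cis0.
by rewrite exprS IH -cisD -natr1; congr cis; ring.
Qed.

Lemma cabs_cis x : cabs (cis x) = 1.
Proof. by rewrite /cabs normc_def/= cos2Dsin2 sqrtr1. Qed.

Lemma cis_pi : cis pi = -1.
Proof. by rewrite /cis cospi sinpi; apply/eqP; rewrite eq_complex/= oppr0 !eqxx. Qed.

Lemma cis_neq1 x : 0 < x < 2 * pi -> cis x != 1.
Proof.
move=> /andP[x0 x2]; apply/eqP => -[] c1 _.
have s0 : 0 < sin (x / 2) by apply: sin_gt0_pi; rewrite divr_gt0//= ltr_pdivrMr// mulrC.
have := cosD (x / 2) (x / 2); rewrite -splitr c1.
have := cos2Dsin2 (x / 2); rewrite -!expr2 => h1 h2.
have : 0 < sin (x / 2) ^+ 2 by rewrite exprn_gt0.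
lra.
Qed.

(** sin y = 2 sin(y/2) cos(y/2), where sin(y/2) >= (y/2) cos(y/2) by the mean value
    theorem and 2 cos(y/2)^2 >= 1. *)
Lemma sin_ge_half y : 0 <= y <= pi / 2 -> y / 2 <= sin y.
Proof.
move=> /andP[y0 y1].
have y2 : 0 <= y / 2 by rewrite divr_ge0.
have [|c /andP[c0 cy]] := MVT_segment y2 (fun x _ => is_derive_sin x).
  by apply: continuous_subspaceT => x; exact: continuous_sin.
rewrite !bnd_simp in c0 cy.
rewrite sin0 !subr0 => sE.
have pi0 := pi_ge0 R.
have cc : cos (y / 2) <= cos c.
  rewrite leNgt; apply/negP; rewrite ltr_cos ?in_itv/=; first by rewrite ltNge cy.
  - by apply/andP; split; lra.
  - by apply/andP; split; lra.
have cy0 : 0 <= cos (y / 2) by apply: cos_ge0_pihalf; apply/andP; split; lra.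
have cy1 : 0 <= cos y by apply: cos_ge0_pihalf; apply/andP; split; lra.
have h1 := cosD (y / 2) (y / 2); have h2 := sinD (y / 2) (y / 2).
rewrite -splitr in h1 h2; have h3 := cos2Dsin2 (y / 2).
rewrite h2 sE [cos c * _]mulrC.
have : (y / 2) * cos (y / 2) * cos (y / 2) <= (y / 2) * cos c * cos (y / 2).
  by rewrite ler_wpM2r// ler_wpM2l.
have : (y / 2) * (1 / 2) <= (y / 2) * (cos (y / 2) * cos (y / 2)).
  by rewrite ler_wpM2l//; rewrite !expr2 in h3; lra.
rewrite !mulrA; lra.
Qed.

End circle.

Section extraction.
Context {R : realType}.
Implicit Types (a : nat -> R).

Lemma geometric_sum_root (w : R[i]) M : w != 1 -> w ^+ M = 1 ->
  \sum_(0 <= k < M) w ^+ k = 0.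
Proof.
move=> w1 wM; have := subrX1 w M; rewrite wM subrr big_mkord => /esym/eqP.
by rewrite mulf_eq0 subr_eq0 (negbTE w1)/= => /eqP.
Qed.

(** The mean over M roots of unity picks the coefficients with index congruent to n
    modulo M. The aliases form a tail, bounded by T; a finite mean thus replaces
    Cauchy's integral, and M is sent to infinity afterwards. *)
Lemma coefficient_mean a (r : R) (M n : nat) (c : R[i]) (B T : R) :
  tame a -> 0 <= r < 1 -> cabs c = 1 -> (n < M)%N ->
  (forall N, \sum_(M <= m < N) `|a m| * r ^+ m <= T) ->
  cabs (\sum_(0 <= k < M) ev a (r%:C * (c * cis (2 * pi / M%:R * k%:R))) *
     (c * cis (2 * pi / M%:R * k%:R)) ^- n) <= B ->
  `|a n| * r ^+ n <= M%:R^-1 * B + T.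
Proof.
move=> ta r01 c1 nM hT hB.
pose u k := c * cis (2 * pi / M%:R * k%:R).
have M0 : 0 < M%:R :> R by rewrite ltr0n (leq_ltn_trans _ nM).
have cu k : cabs (u k) = 1 by rewrite /u cabsM cabs_cis c1 mulr1.
have un0 k : u k != 0 by rewrite -cabs_eq0 cu oner_eq0.
have e1 k : cabs (r%:C * u k) < 1.
  by rewrite cabsM cu mulr1 cabs_real ger0_norm; case/andP: r01.
have uk k : u k = c * cis (2 * pi / M%:R) ^+ k by rewrite /u cisX; congr (_ * cis _); rewrite mulrC.
have orth m : (m < M)%N -> \sum_(0 <= k < M) u k ^+ m * u k ^- n = (m == n)%:R * M%:R.
  move=> mM; have [->|mn] := eqVneq m n.
    under eq_bigr do rewrite mulfV ?expf_neq0//.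
    by rewrite sumr_const_nat subn0 mul1r.
  rewrite mul0r; pose w : R[i] := cis (2 * pi / M%:R).
  have w0 : w != 0 by rewrite -cabs_eq0 cabs_cis oner_eq0.
  have wM : w ^+ M = 1.
    by rewrite /w cisX mulrCA mulfV ?gt_eqF// mulr1 mulr_natl cisD cis_pi mulN1r opprK.
  have wd d : (0 < d < M)%N -> w ^+ d != 1.
    move=> /andP[d0 dM]; rewrite /w cisX; apply: cis_neq1.
    rewrite mulr_gt0 ?divr_gt0 ?mulr_gt0 ?pi_gt0 ?ltr0n ?(leq_ltn_trans _ dM)//=.
    have pi0 := pi_gt0 R.
    rewrite (_ : _ * _ = 2 * pi * (d%:R / M%:R)); last by ring.
    rewrite gtr_pMr ?mulr_gt0//.
    by rewrite ltr_pdivrMr// mul1r ltr_nat.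
  have Wn1 : w ^+ m * w ^- n != 1.
    apply/eqP => /(congr1 ( *%R^~ (w ^+ n))); rewrite mul1r mulfVK ?expf_neq0// => E.
    have [mn'|nm] := ltnP m n.
      have /negP := wd (n - m)%N ltac:(lia); apply; apply/eqP/(@mulfI _ (w ^+ m)); first exact: expf_neq0.
      by rewrite -exprD subnKC ?mulr1 ?E// ltnW.
    have /negP := wd (m - n)%N ltac:(lia); apply; apply/eqP/(@mulfI _ (w ^+ n)); first exact: expf_neq0.
    by rewrite -exprD subnKC ?mulr1 ?E.
  rewrite (eq_bigr (fun k => (c ^+ m * c ^- n) * (w ^+ m * w ^- n) ^+ k)); last first.
    by move=> k _; rewrite uk !exprMn invfM -!exprVn -!exprM [(k * m)%N]mulnC [(k * n)%N]mulnC; ring.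
  rewrite -mulr_sumr geometric_sum_root ?mulr0// exprMn -exprM mulnC exprM wM expr1n mul1r.
  by rewrite exprVn -exprM mulnC exprM wM expr1n invr1.
have L K : ccvg (fun N => \sum_(0 <= k < K) psum a (r%:C * u k) N * u k ^- n)
   (\sum_(0 <= k < K) ev a (r%:C * u k) * u k ^- n).
  elim: K => [|K IH].
    by under eq_fun do rewrite big_nil; rewrite big_nil; exact: ccvg_cst.
  under eq_fun do rewrite big_nat_recr//=; rewrite big_nat_recr//=.
  by apply: ccvgD => //; apply: ccvgM; [exact: ev_ccvg|exact: ccvg_cst].
have D : ccvg (fun N => M%:R * ((a n)%:C * r%:C ^+ n) - \sum_(0 <= k < M) psum a (r%:C * u k) N * u k ^- n)
   (M%:R * ((a n)%:C * r%:C ^+ n) - \sum_(0 <= k < M) ev a (r%:C * u k) * u k ^- n).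
  rewrite -[X in ccvg _ (_ - X)]mul1r -mulNr.
  have := ccvgD (ccvg_cst (M%:R * ((a n)%:C * r%:C ^+ n))) (ccvgM (ccvg_cst (-1)) (L M)).
  by apply: ccvg_ext => N; rewrite mulN1r.
have b1 : cabs (M%:R * ((a n)%:C * r%:C ^+ n) - \sum_(0 <= k < M) ev a (r%:C * u k) * u k ^- n) <= M%:R * T.
  apply: (ccvg_bound_near (N := M) D) => N MN.
  have -> : \sum_(0 <= k < M) psum a (r%:C * u k) N * u k ^- n =
     \sum_(0 <= m < N) (a m)%:C * r%:C ^+ m * \sum_(0 <= k < M) u k ^+ m * u k ^- n.
    under eq_bigr do rewrite /psum mulr_suml.
    rewrite exchange_big_nat/=; apply: eq_bigr => m _; rewrite mulr_sumr; apply: eq_bigr => k _.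
    by rewrite exprMn; ring.
  rewrite (big_cat_nat (leq0n M) MN)/=.
  have -> : \sum_(0 <= m < M) (a m)%:C * r%:C ^+ m * \sum_(0 <= k < M) u k ^+ m * u k ^- n =
     M%:R * ((a n)%:C * r%:C ^+ n).
    rewrite (bigD1_seq n) ?mem_index_iota ?iota_uniq//= orth// eqxx mul1r.
    rewrite big_nat_cond big1 ?addr0; first by rewrite mulrC.
    by move=> m /andP[/andP[_ mM] mn]; rewrite orth// (negbTE mn) mul0r mulr0.
  rewrite opprD addrA subrr sub0r cabsN (le_trans (cabs_sum _ _ _))//.
  apply: (@le_trans _ _ (M%:R * \sum_(M <= m < N) `|a m| * r ^+ m)); last by rewrite ler_wpM2l// ltW.
  rewrite mulr_sumr; apply: ler_sum => m _.
  rewrite cabsM cabsM cabsX !cabs_real (ger0_norm (_ : 0 <= r)); last by case/andP: r01.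
  rewrite mulrC ler_wpM2r ?mulr_ge0 ?exprn_ge0//; first by case/andP: r01.
  rewrite (le_trans (cabs_sum _ _ _))//.
  apply: (@le_trans _ _ (\sum_(0 <= k < M) 1)); last by rewrite sumr_const_nat subn0.
  by apply: ler_sum => k _; rewrite cabsM cabsV !cabsX cu !expr1n invr1 mulr1.
have b2 : cabs (M%:R * ((a n)%:C * r%:C ^+ n)) <= M%:R * T + B.
  rewrite -(subrK (\sum_(0 <= k < M) ev a (r%:C * u k) * u k ^- n) (M%:R * _)).
  by rewrite (le_trans (cabsD _ _))// lerD.
move: b2; rewrite cabsM cabs_nat cabsM cabsX !cabs_real (ger0_norm (_ : 0 <= r)); last by case/andP: r01.
by rewrite mulrC -ler_pdivlMr// => /le_trans; apply; rewrite mulrDl mulrC mulKf ?gt_eqF// addrC mulrC.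
Qed.

Lemma tame_tail a (r : R) : tame a -> 0 <= r < 1 ->
  exists2 q, 0 <= q < 1 & exists C, forall M N, \sum_(M <= m < N) `|a m| * r ^+ m <= C * q ^+ M.
Proof.
move=> ta /andP[r0 r1]; pose r' := (1 + r) / 2.
have r'0 : 0 < r' by rewrite /r'; lra.
have r'1 : r' < 1 by rewrite /r'; lra.
have rr' : r < r' by rewrite /r'; lra.
have r'01 : 0 <= r' < 1 by rewrite (ltW r'0) r'1.
have [C hC] := tame_summable ta r'01.
pose q := r / r'; have q0 : 0 <= q by rewrite divr_ge0// ltW.
have q1 : q < 1 by rewrite ltr_pdivrMr// mul1r.
exists q; first by rewrite q0.
exists C => M N.
have C0 : 0 <= C by apply: le_trans (hC 0%N); rewrite big_nil.
have [NM|MN] := leqP N M; first by rewrite big_geq// mulr_ge0// exprn_ge0.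
apply: (@le_trans _ _ (\sum_(M <= m < N) (`|a m| * r' ^+ m) * q ^+ M)).
  apply: ler_sum_nat => m /andP[Mm _]; rewrite -mulrA ler_wpM2l//.
  have -> : r = r' * q by rewrite mulrC divfK// gt_eqF.
  rewrite exprMn ler_wpM2l ?exprn_ge0 ?(ltW r'0)//.
  by rewrite -(subnKC Mm) exprD ler_piMr ?exprn_ge0// exprn_ile1// ltW.
rewrite -mulr_suml ler_wpM2r ?exprn_ge0//; apply: le_trans (hC N).
rewrite [leRHS](big_cat_nat (leq0n M) (ltnW MN))/= lerDr sumr_ge0// => i _.
by rewrite mulr_ge0// exprn_ge0// ltW.
Qed.

End extraction.

Section coarse_fine.
Context {R : realType} (alpha : R) (b : nat -> R).
Hypothesis alpha01 : 0 < alpha < 1.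
Hypothesis hb : cq_weights alpha b.
Local Notation t := (2 `^ alpha).
Let a0 : 0 < alpha. Proof. by case/andP: alpha01. Qed.
Let a1 : alpha < 1. Proof. by case/andP: alpha01. Qed.
Let t0 : 0 < t. Proof. by rewrite powR_gt0. Qed.

Lemma le_of_geometric (x y c q : R) : 0 <= q < 1 ->
  (forall L, (0 < L)%N -> x <= y + c * q ^+ L) -> x <= y.
Proof.
move=> /andP[q0 q1] h.
have : (fun L => y + c * q ^+ L) @ \oo --> y + c * 0.
  apply: cvgD; first exact: cvg_cst.
  by apply: cvgM; [exact: cvg_cst|apply: cvg_expr; rewrite ger0_norm].
rewrite mulr0 addr0 => /cvgr_to_ge; apply.
by exists 1%N => // L /= L0; exact: h.
Qed.

Lemma cq_tail_sum : exists2 S, 0 <= S & forall n,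
  \sum_(0 <= i < n) i.+1%:R `^ (- (1 + alpha)) <= S.
Proof.
have [l l0 hl] := cq_sum_asymp alpha01 hb.
have al0 : 0 < alpha * l by rewrite mulr_gt0.
exists (2 / (alpha * l)) => [|n]; first by rewrite divr_ge0// ltW.
rewrite ler_pdivlMr//; apply: le_trans (sum_norm_cq_le2 alpha01 hb n.+1).
rewrite [leRHS]big_ltn// big_add1/= mulr_suml.
apply: (@le_trans _ _ (\sum_(0 <= i < n) `|b i.+1|)); last by rewrite lerDr.
apply: ler_sum => i _; rewrite (cq_weights_sum alpha01 hb) mulNr normrN.
have [h _] := hl i.
rewrite ger0_norm ?mulr_ge0 ?divr_ge0 ?(ltW a0)//; last exact: ltW (cq_sum_gt0 alpha01 hb i).
rewrite opprD powRD ?pnatr_eq0 ?implybT// powR_inv1//.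
have -> : i.+1%:R^-1 * i.+1%:R `^ (- alpha) * (alpha * l) = alpha / i.+1%:R * (l * i.+1%:R `^ (- alpha)) by ring.
by rewrite ler_wpM2l// divr_ge0 ?(ltW a0).
Qed.

Lemma block_sum_le (f : nat -> R) n L : (forall i j, (i <= j)%N -> f j <= f i) ->
  \sum_(0 <= j < n * L) f j <= L%:R * \sum_(0 <= i < n) f (i * L)%N.
Proof.
move=> df; elim: n => [|n IH]; first by rewrite mul0n !big_nil mulr0.
rewrite big_nat_recr//= mulrDr mulSn addnC (big_cat_nat (n := (n * L)%N)) ?leq_addr//=.
apply: lerD => //; rewrite -{1}[(n * L)%N]add0n big_addn addKn.
apply: (@le_trans _ _ (\sum_(0 <= i < L) f (n * L)%N)).
  by apply: ler_sum => i _; apply: df; rewrite leq_addl.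
by rewrite sumr_const_nat subn0 mulr_natl.
Qed.

(** The points of the right half circle, counted by their distance to eta = 1. *)
Lemma symmetric_sum_le (f : nat -> R) m : (forall i j, (i <= j)%N -> f j <= f i) ->
  \sum_(0 <= k < 2 * m) f (`|m - k|)%N <= 2 * \sum_(0 <= j < m) f j.
Proof.
move=> df; rewrite mul2n -addnn (big_cat_nat (n := m)) ?leq_addr//= mulr_natl mulr2n.
apply: lerD.
  rewrite big_nat_rev/= big_nat_cond [leRHS]big_nat_cond.
  by apply: ler_sum => i /andP[/andP[_ im] _]; apply: df; lia.
rewrite -{1}[m]add0n big_addn addKn; apply: ler_sum => i _; apply: df; lia.
Qed.

(** With rho = 1 - 1/(4n), |1 - rho u| is at least 1/(4n), and at least rho times
    the imaginary part, which grows linearly with the distance of the index to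
    the middle one. *)
Lemma circle_distance (n L k : nat) : (0 < n)%N -> (0 < L)%N -> (k < 2 * (n * L))%N ->
  (1 + (`|n * L - k|)%N%:R / L%:R) / (8 * n%:R) <=
  cabs (1 - (1 - (4 * n%:R)^-1)%:C * (- 'i * cis (pi / (2 * (n * L))%:R * k%:R)) : R[i]).
Proof.
move=> n0 L0 kQ.
have N0 : 0 < n%:R :> R by rewrite ltr0n.
have N1 : 1 <= n%:R :> R by rewrite ler1n.
have LL0 : 0 < L%:R :> R by rewrite ltr0n.
set x := pi / _ * _; set rho : R := 1 - (4 * n%:R)^-1; set j := (`|_|)%N.
have r34 : 3 / 4 <= rho.
  have : (4 * n%:R)^-1 <= 4^-1 :> R by rewrite lef_pV2 ?posrE ?mulr_gt0// ler_peMr.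
  rewrite /rho; lra.
have r1 : rho <= 1 by rewrite /rho gerBl invr_ge0 mulr_ge0// ltW.
have x0 : 0 <= x by rewrite /x mulr_ge0// divr_ge0// pi_ge0.
have uE : - 'i * cis x = sin x +i* (- cos x) :> R[i].
  by rewrite /cis; simpc.
rewrite uE; set s := cabs _.
have s1 : (4 * n%:R)^-1 <= s.
  apply: le_trans (Re_le_cabs _); apply: le_trans (ler_norm _).
  rewrite raddfB/= mul0r subr0.
  have := sin_le1 x; have : 0 <= rho by lra.
  rewrite /rho => h1 h2; have := ler_wpM2l h1 h2; lra.
have s2 : rho * `|cos x| <= s.
  apply: le_trans (Im_le_cabs _); rewrite raddfB/= mul0r addr0 sub0r mulrN opprK normrM.
  by rewrite ler_wpM2r// ler_norm.
have c1 : j%:R / (2 * (n * L)%:R) <= `|cos x|.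
  have Q0 : 0 < (2 * (n * L))%:R :> R by rewrite ltr0n !muln_gt0 n0 L0.
  have nL0 : 0 < (n * L)%:R :> R by rewrite ltr0n muln_gt0 n0 L0.
  have pi2 : 2 <= pi :> R by have := pi_ge2 R.
  have pi0 := pi_gt0 R.
  have hx : `|pi / 2 - x| = pi / 2 * (j%:R / (n * L)%:R).
    have -> : pi / 2 - x = pi / 2 * (((n * L)%:R - k%:R) / (n * L)%:R).
      by rewrite /x natrM; field; rewrite ?(gt_eqF N0) ?(gt_eqF LL0) ?(gt_eqF nL0).
    have -> : j%:R = `|(n * L)%:R - k%:R| :> R.
      rewrite /j; case: (leqP k (n * L)) => [kn|/ltnW kn].
        by rewrite distnEl// natrB// ger0_norm// subr_ge0 ler_nat.
      by rewrite distnEr// natrB// distrC ger0_norm// subr_ge0 ler_nat.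
    by rewrite normrM [X in _ * X]normrM normfV (ger0_norm (ltW nL0)) ger0_norm// divr_ge0// ltW.
  have hj : j%:R / (n * L)%:R <= 1 :> R.
    by rewrite ler_pdivrMr// mul1r ler_nat /j; move: kQ; clear; lia.
  have h := @sin_ge_half R `|pi / 2 - x|.
  have : sin `|pi / 2 - x| <= `|cos x|.
    have c0 : sin (pi / 2 - x) = cos x by rewrite sinB sin_pihalf cos_pihalf mul1r mul0r subr0.
    have [_|_] := ger0P (pi / 2 - x); first by rewrite c0 ler_norm.
    by rewrite sinN c0 -normrN ler_norm.
  apply: le_trans; apply: le_trans (h _); rewrite hx.
    rewrite natrM; have := divr_ge0 (ler0n R j) (ltW nL0).
    rewrite invfM; nra.
  by rewrite mulr_ge0 ?divr_ge0 ?(ltW pi0)//= ler_piMr// divr_ge0// ltW.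
have c2 : 3 / 4 * (j%:R / (2 * (n * L)%:R)) <= s.
  apply: le_trans s2; apply: ler_pM => //.
have : (1 + j%:R / L%:R) / (8 * n%:R) = 2^-1 * (4 * n%:R)^-1 + 4^-1 * (j%:R / (2 * (n * L)%:R)) :> R.
  by rewrite natrM; field; rewrite !gt_eqF.
move=> ->; have : 0 <= j%:R / (2 * (n * L)%:R) :> R by rewrite divr_ge0// mulr_ge0.
lra.
Qed.

(** See the introduction. The circle has 4 n L points starting at - i, so that the
    first half lies in Re eta >= 0; the mean is estimated by blocks of L points,
    which give sum_i (1 + i)^(-1-alpha), and L tends to infinity. *)
Lemma deficit_two_scale : exists2 K, 0 <= K & forall (z : R) (n : nat), 0 < z -> (0 < n)%N ->
  `|deficit alpha b z n - deficit alpha b (z / t) (2 * n)| <= K * z * n%:R `^ (alpha - 2).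
Proof.
have [K1 K10 h1] := two_scale_bound alpha01 hb.
have [K2 K20 h2] := fine_bound alpha01 hb.
have [S S0 hS] := cq_tail_sum.
exists (16 * K1 * S + K2) => [|z n z0 n0]; first by rewrite addr_ge0// !mulr_ge0.
have N0 : 0 < n%:R :> R by rewrite ltr0n.
have N1 : 1 <= n%:R :> R by rewrite ler1n.
pose G := deficit alpha b z; pose F := deficit alpha b (z / t).
have zt0 : 0 < z / t by rewrite divr_gt0.
have tG : tame G := tame_deficit alpha01 hb z0.
have tF : tame F := tame_deficit alpha01 hb zt0.
pose H k := stretch G k + (-1) * F k.
have tF' : tame (fun k => (-1) * F k) by exact: tameZ.
have tH : tame H by apply: tameD => //; exact: tame_stretch.
(* theta^2 supplies the factor (2n)^2 on the coefficient of xi^(2n) *)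
pose a := theta (theta H).
have ta : tame a by do 2!apply: tame_theta.
(* close enough to 1 to keep rho^(2n) >= 1/2, and at distance 1/(4n) from the singularity *)
pose rho := 1 - (4 * n%:R)^-1 : R.
have r0 : 0 <= rho.
  by rewrite subr_ge0 invf_le1 ?mulr_gt0//; lra.
have r1 : rho < 1 by rewrite /rho gtrBl invr_gt0 mulr_gt0.
have r01 : 0 <= rho < 1 by rewrite r0.
have [q q01 [C hC]] := tame_tail ta r01.
have q0 : 0 <= q by case/andP: q01.
have q1 : q <= 1 by case/andP: q01 => _ /ltW.
have rn : 2^-1 <= rho ^+ (2 * n).
  have : 1 + (2 * n)%:R * (- (4 * n%:R)^-1) <= rho ^+ (2 * n).
    have x0 : 0 <= (4 * n%:R)^-1 :> R by rewrite invr_ge0 mulr_ge0.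
    rewrite mulrN; elim: (2 * n)%N => [|i IH]; first by rewrite mul0r subr0.
    rewrite exprSr; apply: le_trans (ler_wpM2r r0 IH); rewrite /rho -natr1.
    have := mulr_ge0 (ler0n R i) (mulr_ge0 x0 x0); lra.
  by apply: le_trans; rewrite natrM le_eqVlt; apply/orP; left; apply/eqP; field; rewrite gt_eqF.
have key L : (0 < L)%N -> 4 * n%:R ^+ 2 * `|G n - F (2 * n)%N| * 2^-1 <=
   z * (32 * K1 * S * n%:R `^ alpha + 2^-1 * K2) + `|C| * q ^+ L.
  move=> L0.
  have LL0 : 0 < L%:R :> R by rewrite ltr0n.
  have nL0 : 0 < (n * L)%:R :> R by rewrite ltr0n muln_gt0 n0 L0.
  pose Q := (2 * (n * L))%N; pose M := (2 * Q)%N.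
  have Q0 : 0 < Q%:R :> R by rewrite ltr0n /Q !muln_gt0 n0 L0.
  have nM : (2 * n < M)%N by rewrite /M /Q; move: (n * L)%N (leq_pmulr n L0) n0; clear; lia.
  pose c : R[i] := - 'i.
  pose u k : R[i] := c * cis (2 * pi / M%:R * k%:R).
  have c1 : cabs c = 1 by rewrite cabsN /cabs normc_def/= expr0n expr1n add0r sqrtr1.
  have cu k : cabs (u k) = 1 by rewrite /u cabsM c1 cabs_cis mulr1.
  have uQ k : u (k + Q)%N = - u k.
    rewrite /u natrD mulrDr cisD (_ : 2 * pi / M%:R * Q%:R = pi) ?cis_pi; first by rewrite mulrN1 mulrN.
    by rewrite /M natrM; field; rewrite ?(gt_eqF Q0) ?(gt_eqF N0) ?(gt_eqF LL0).
  have uE k : u k = - 'i * cis (pi / Q%:R * k%:R).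
    by rewrite /u /c; congr (_ * cis _); rewrite /M natrM; field; rewrite gt_eqF.
  have e1 k : cabs (rho%:C * u k) < 1 by rewrite cabsM cu mulr1 cabs_real ger0_norm.
  pose f j := (8 * n%:R) `^ (1 + alpha) * (1 + j%:R / L%:R) `^ (- (1 + alpha)) : R.
  have df i j : (i <= j)%N -> f j <= f i.
    have p0 m : 0 < 1 + m%:R / L%:R :> R by rewrite ltr_pwDl// divr_ge0// ltW.
    move=> ij; rewrite /f ler_wpM2l ?powR_ge0// !powRN lef_pV2 ?posrE ?powR_gt0//.
    rewrite ge0_ler_powR ?nnegrE ?addr_ge0 ?divr_ge0 ?(ltW a0) ?(ltW LL0)//.
    by rewrite lerD2l ler_wpM2r ?invr_ge0 ?(ltW LL0)// ler_nat.
  (* the points u (k + Q) = - u k are paired; the first half lies in Re >= 0 *)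
  have pairb k : (k < Q)%N -> cabs (ev a (rho%:C * u k) + ev a (rho%:C * u (k + Q)%N)) <=
     K1 * z * f (`|n * L - k|)%N + K2 * z.
    move=> kQ; rewrite uQ mulrN; set e := rho%:C * u k.
    have e1' : cabs e < 1 by exact: e1.
    have eN1 : cabs (- e) < 1 by rewrite cabsN.
    have jH e' : cabs e' < 1 -> ev a e' = j2 (jdil (jev G (e' ^+ 2))) - j2 (jev F e').
      move=> he'; have := jevD (tame_stretch tG) tF' he'.
      rewrite jevZ// jev_stretch// => /(congr1 (@j2 _)); rewrite !jE /j2/= => ->.
      have -> : j1 (jcst ((-1)%:C : R[i])) = 0 by [].
      have -> : j0 (jcst ((-1)%:C : R[i])) = -1 by rewrite /jcst /j0/= rmorphN1.
      by rewrite mulr0 mul0r mul0r add0r add0r mulN1r.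
    have -> : ev a e + ev a (- e) = j2 (two_scale alpha b z e) - j2 (jev F (- e)).
      rewrite (jH _ e1') (jH _ eN1) sqrrN /two_scale -/G -/F mulr_natl mulr2n.
      by rewrite j2D j2N j2D addrACA addrA.
    have Re0 : 0 <= complex.Re e.
      rewrite /e uE /cis; simpc; rewrite /= mulr_ge0// sin_ge0_pi// mulr_ge0 ?divr_ge0 ?pi_ge0//=.
      by rewrite mulrAC ler_pdivrMr// ler_wpM2l ?pi_ge0// ler_nat ltnW.
    apply: (le_trans (cabsB _ _)); apply: lerD; last first.
      by apply: h2 => //; rewrite raddfN/= oppr_le0.
    have sB := circle_distance n0 L0 kQ; rewrite -/rho -/Q -uE -/e in sB.
    have h := h1 z e z0 e1' Re0.
    set s := cabs (1 - e) in sB h.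
    have sl0 : 0 < (1 + (`|n * L - k|)%N%:R / L%:R) / (8 * n%:R) :> R.
      by rewrite divr_gt0 ?mulr_gt0// ltr_pwDl// divr_ge0// ltW.
    have s0 : 0 < s by apply: lt_le_trans sB.
    rewrite -(ler_pM2r (_ : 0 < s ^+ 2)) ?exprn_gt0//; apply: (le_trans h).
    have -> : K1 * (z * (s * s `^ (- alpha))) = K1 * z * (s `^ (- (1 + alpha))) * s ^+ 2.
      have -> : s `^ (- (1 + alpha)) = s^-1 * s `^ (- alpha).
        have sn0 : s != 0 by rewrite gt_eqF.
        by rewrite opprD powRD ?sn0 ?implybT// powR_inv1 ?(ltW s0).
      by field; rewrite gt_eqF.
    rewrite ler_wpM2r ?exprn_ge0 ?(ltW s0)// ler_wpM2l ?mulr_ge0 ?(ltW z0)//.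
    have -> : f (`|n * L - k|)%N = ((1 + (`|n * L - k|)%N%:R / L%:R) / (8 * n%:R)) `^ (- (1 + alpha)).
      rewrite powRM ?invr_ge0 ?mulr_ge0 ?addr_ge0 ?divr_ge0 ?(ltW N0) ?(ltW LL0)//.
      rewrite /f mulrC; congr (_ * _).
      by rewrite -powR_inv1 ?mulr_ge0 ?(ltW N0)// -powRrM mulN1r opprK.
    rewrite !powRN lef_pV2 ?posrE ?powR_gt0// ge0_ler_powR ?nnegrE ?(ltW s0) ?(ltW sl0)//.
    by rewrite addr_ge0// ltW.
  have sumf : \sum_(0 <= k < Q) f (`|n * L - k|)%N <= 2 * (L%:R * ((8 * n%:R) `^ (1 + alpha) * S)).
    apply: (le_trans (symmetric_sum_le _ df)); rewrite ler_wpM2l//.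
    apply: (le_trans (block_sum_le _ _ df)); rewrite ler_wpM2l// ?(ltW LL0)//.
    rewrite /f -mulr_sumr ler_wpM2l ?powR_ge0//; apply: le_trans (hS n).
    by apply: ler_sum => i _; rewrite natrM mulfK ?gt_eqF// nat1r.
  have hB : cabs (\sum_(0 <= k < M) ev a (rho%:C * u k) * u k ^- (2 * n)) <=
     K1 * z * (2 * (L%:R * ((8 * n%:R) `^ (1 + alpha) * S))) + Q%:R * (K2 * z).
    have -> : \sum_(0 <= k < M) ev a (rho%:C * u k) * u k ^- (2 * n) =
       \sum_(0 <= k < Q) (ev a (rho%:C * u k) + ev a (rho%:C * u (k + Q)%N)) * u k ^- (2 * n).
      rewrite /M mul2n -addnn (big_cat_nat (n := Q)) ?leq_addr//=.
      rewrite -[X in \sum_(X <= _ < Q + Q) _]add0n big_addn addKn -big_split/=.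
      apply: eq_bigr => k _; rewrite mulrDl; congr (_ + _ * _ ^-1).
      by rewrite uQ exprM sqrrN -exprM.
    apply: (le_trans (cabs_sum _ _ _)).
    apply: (@le_trans _ _ (\sum_(0 <= k < Q) (K1 * z * f (`|n * L - k|)%N + K2 * z))).
      apply: ler_sum_nat => k /andP[_ kQ].
      by rewrite cabsM cabsV cabsX cu expr1n invr1 mulr1; exact: pairb.
    rewrite big_split/= sumr_const_nat subn0 -[_ *+ Q]mulr_natl lerD2r -mulr_sumr.
    by rewrite ler_wpM2l// mulr_ge0// ltW.
  have := coefficient_mean (c := c) (T := `|C| * q ^+ L) ta r01 c1 nM _ hB.
  have tail N : \sum_(M <= m < N) `|a m| * rho ^+ m <= `|C| * q ^+ L.
    apply: (le_trans (hC _ _)); apply: (@le_trans _ _ (`|C| * q ^+ M)).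
      by rewrite ler_wpM2r ?exprn_ge0// ler_norm.
    by rewrite ler_wpM2l// ler_wiXn2l// /M /Q; move: (n * L)%N (leq_pmull L n0); clear; lia.
  move=> /(_ tail) X.
  have aE : `|a (2 * n)%N| = 4 * n%:R ^+ 2 * `|G n - F (2 * n)%N|.
    rewrite /a /theta /H /stretch mul2n odd_double doubleK mulN1r mulrA normrM -expr2 normrX.
    by rewrite ger0_norm// -mul2n natrM exprMn; congr (_ * _ * _); ring.
  rewrite aE in X; apply: le_trans (le_trans _ X) _.
    by rewrite ler_wpM2l// !mulr_ge0.
  rewrite lerD2r.
  have e8 : (8 * n%:R) `^ (1 + alpha) <= 64 * (n%:R * n%:R `^ alpha) :> R.
    have Nn0 : n%:R != 0 :> R by rewrite gt_eqF.
    rewrite powRM// ?(ltW N0)// [n%:R `^ (1 + alpha)]powRD ?Nn0 ?implybT// powRr1 ?(ltW N0)//.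
    rewrite ler_wpM2r ?mulr_ge0 ?powR_ge0 ?(ltW N0)//.
    apply: (@le_trans _ _ (8 `^ 2)); last by rewrite powR_mulrn// expr2 -natrM.
    by rewrite ler_powR ?ler1n//; have := a1; lra.
  set E := (8 * n%:R) `^ (1 + alpha) in e8 *.
  have -> : M%:R^-1 * (K1 * z * (2 * (L%:R * (E * S))) + Q%:R * (K2 * z)) =
     z * (K1 * S * (E / (2 * n%:R)) + 2^-1 * K2).
    by rewrite /M /Q !natrM; field; rewrite (gt_eqF N0) (gt_eqF LL0).
  rewrite ler_wpM2l ?(ltW z0)// lerD2r.
  rewrite (_ : 32 * K1 * S * _ = K1 * S * (32 * n%:R `^ alpha)); last by ring.
  rewrite ler_wpM2l ?mulr_ge0// ler_pdivrMr ?mulr_gt0//; lra.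
have {key}Y := le_of_geometric q01 key.
have p1 : 1 <= n%:R `^ alpha :> R.
  have : n%:R `^ 0 <= n%:R `^ alpha :> R by rewrite ler_powR// (ltW a0).
  by rewrite powRr0.
have Nn0 : n%:R != 0 :> R by rewrite gt_eqF.
rewrite -/G -/F powRD ?Nn0 ?implybT//.
have -> : n%:R `^ (-2) = (n%:R ^+ 2)^-1 :> R by rewrite powRN powR_mulrn ?(ltW N0).
rewrite mulrA ler_pdivlMr ?exprn_gt0//.
have : z * (32 * K1 * S * n%:R `^ alpha + 2^-1 * K2) <= z * ((32 * K1 * S + 2^-1 * K2) * n%:R `^ alpha).
  by rewrite ler_wpM2l ?(ltW z0)// [leRHS]mulrDl lerD2l ler_peMr// mulr_ge0.
have := mulr_ge0 (mulr_ge0 K20 (ltW z0)) (powR_ge0 n%:R alpha).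
lra.
Qed.

End coarse_fine.

Local Close Scope complex_scope.

(** * Stability of the scalar scheme *)

Section convolution.
Context {R : realType}.
Implicit Types a b c x y : nat -> R.

Lemma cvlC a b : cvl a b = cvl b a.
Proof.
apply/funext => n; rewrite /cvl big_nat_rev/= add0n; apply: eq_big_nat => i /andP[_ iN].
by rewrite subSS subKn// mulrC.
Qed.

Lemma cvlA a b c : cvl (cvl a b) c = cvl a (cvl b c).
Proof.
apply/funext => n; rewrite /cvl.
transitivity (\sum_(0 <= m < n.+1) \sum_(0 <= i < m.+1)
   (fun i j => a i * b j * c (n - (i + j))%N) i (m - i)%N).
  apply: eq_bigr => m _; rewrite mulr_suml; apply: eq_big_nat => i /andP[_ im].
  by rewrite subnKC.
rewrite (sum_triangle (fun i j => a i * b j * c (n - (i + j))%N)); apply: eq_big_nat => i /andP[_ iN]; rewrite subSn// mulr_sumr.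
by apply: eq_bigr => j _; rewrite mulrA subnDA.
Qed.

Lemma cvl_pre a b : cvl a (pre b) = pre (cvl a b).
Proof.
rewrite cvlC [in RHS]cvlC; apply/funext => -[|n]; rewrite /cvl; first by rewrite big_nat1 /= mul0r.
by rewrite big_nat_recl//= mul0r add0r; apply: eq_bigr => i _; rewrite subSS.
Qed.

Lemma cvlDr a b c : cvl a (fun n => b n + c n) = (fun n => cvl a b n + cvl a c n).
Proof.
by apply/funext => n; rewrite /cvl -big_split/=; apply: eq_bigr => i _; rewrite mulrDr.
Qed.

Lemma cvlZr k a b : cvl a (fun n => k * b n) = (fun n => k * cvl a b n).
Proof.
by apply/funext => n; rewrite /cvl mulr_sumr; apply: eq_bigr => i _; rewrite mulrCA.
Qed.

Lemma cvl_dlt0 a : cvl a dlt0 = a.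
Proof.
apply/funext => n; rewrite cvlC /cvl big_nat_recl// big1 ?addr0 => [|i _].
  by rewrite /dlt0 mul1r subn0.
by rewrite /dlt0 mul0r.
Qed.

Lemma cvl_one a n : cvl (fun=> 1) a n = \sum_(0 <= i < n.+1) a i.
Proof. by rewrite cvlC /cvl; apply: eq_bigr => i _; rewrite mulr1. Qed.

Lemma pre_sum a n : pre (cvl (fun=> 1) a) n = \sum_(0 <= i < n) a i.
Proof. by case: n => [|n] /=; rewrite ?big_nil ?cvl_one. Qed.

End convolution.

Section scheme.
Context {R : realType} (alpha : R) (b : nat -> R).
Hypotheses (alpha01 : 0 < alpha < 1) (hb : cq_weights alpha b).
Local Notation den := (den alpha b).
Local Notation fundsol := (fundsol alpha b).
Local Notation deficit := (deficit alpha b).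
Local Notation a := (cq_sum b).
Local Notation t := (2 `^ alpha).
Let a0 : 0 < alpha. Proof. by case/andP: alpha01. Qed.
Let a1 : alpha < 1. Proof. by case/andP: alpha01. Qed.
Let t0 : 0 < t. Proof. by rewrite powR_gt0. Qed.

(** Each halving multiplies z by 2^(-alpha) and n^(alpha - 2) by 2^(alpha - 2), hence
    the bound by 1/4. *)
Lemma deficit_telescope : exists2 K, 0 <= K & forall (z : R) (n k : nat), 0 < z -> (0 < n)%N ->
  `|deficit z n - deficit (z / t ^+ k) (2 ^ k * n)| <= K * z * n%:R `^ (alpha - 2).
Proof.
have [K K0 hK] := deficit_two_scale alpha01 hb.
exists (2 * K) => [|z n k z0 n0]; first by rewrite mulr_ge0.
have P0 : 0 <= K * z * n%:R `^ (alpha - 2) by rewrite !mulr_ge0 ?powR_ge0// ltW.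
suff h : `|deficit z n - deficit (z / t ^+ k) (2 ^ k * n)| <= 2 * (K * z * n%:R `^ (alpha - 2)) * (1 - 4^-1 ^+ k).
  apply: (le_trans h); rewrite -!mulrA ler_wpM2l// !mulrA ler_piMr// lerBlDr lerDl exprn_ge0//.
elim: k => [|k IH]; first by rewrite expr0 divr1 expn0 mul1n subrr normr0 expr0 subrr mulr0.
have zk : 0 < z / t ^+ k by rewrite divr_gt0// exprn_gt0.
have nk : (0 < 2 ^ k * n)%N by rewrite muln_gt0 expn_gt0.
have := hK _ _ zk nk; rewrite mulnA -expnS -mulrA -invfM -exprSr.
have -> : K * (z / t ^+ k) * (2 ^ k * n)%:R `^ (alpha - 2) = K * z * n%:R `^ (alpha - 2) * 4^-1 ^+ k.
  have e2 : (2 ^ k)%:R `^ (alpha - 2) = t ^+ k * 4^-1 ^+ k :> R.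
    rewrite natrX -powR_mulrn// -powRrM mulrC powRrM powRD ?pnatr_eq0 ?implybT//.
    rewrite powRM ?powR_ge0// !powR_mulrn ?powR_ge0//; congr (_ * _ ^+ _).
    by rewrite powRN powR_mulrn// -natrX.
  rewrite natrM powRM// e2; field; by rewrite expf_neq0// gt_eqF.
move=> hk; apply: (le_trans (ler_distD (deficit (z / t ^+ k) (2 ^ k * n)) _ _)).
apply: (le_trans (lerD IH hk)); rewrite exprS.
have : 0 <= 4^-1 ^+ k :> R by rewrite exprn_ge0.
move=> /(mulr_ge0 P0); lra.
Qed.

Lemma den_split z x n : cvl (den z) x n =
  den z 0 * x n + \sum_(0 <= i < n) den z i.+1 * x (n - i.+1)%N.
Proof. by rewrite /cvl big_nat_recl// subn0. Qed.

Lemma den_unique z x y M : 0 <= z ->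
  (forall n, (n <= M)%N -> cvl (den z) x n = cvl (den z) y n) ->
  forall n, (n <= M)%N -> x n = y n.
Proof.
move=> z0 h n; elim/ltn_ind: n => n IH nM.
have := h n nM; rewrite !den_split => /eqP.
rewrite (_ : \sum_(0 <= i < n) den z i.+1 * y (n - i.+1)%N = \sum_(0 <= i < n) den z i.+1 * x (n - i.+1)%N).
  by rewrite -subr_eq addrK => /eqP /mulfI; apply; rewrite gt_eqF// den0_gt0.
by apply: eq_big_nat => i /andP[_ iN]; rewrite IH//; lia.
Qed.

Lemma cvl_den_deficit z : 0 <= z -> cvl (den z) (deficit z) = (fun n => z * kap2 alpha n).
Proof.
move=> z0; rewrite /deficit cvlZr; apply/funext => n; congr (_ * _).
have E : cvl (den z) (fundsol z) = dlt0 by apply/funext; exact: cvl_den_fundsol.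
by rewrite [cvl (kap2 _) _]cvlC -cvlA E cvlC cvl_dlt0.
Qed.

(** The corrected scheme for the relaxation equation, multiplied by tau^alpha. *)
Definition scalar_scheme (z : R) (N : nat) (U : nat -> R) :=
  let bW n := \sum_(0 <= j < n.+1) b (n - j)%N * (U j - U 0%N) in
  [/\ (1 <= N)%N -> bW 1%N + z * ((1 - alpha / 2) * U 1%N + (1 / 2 - alpha / 4) * U 0%N) = 0,
      (2 <= N)%N -> bW 2%N + z * ((1 - alpha / 2) * U 2%N + alpha / 2 * U 1%N + alpha / 4 * U 0%N) = 0 &
      forall n, (3 <= n <= N)%N -> bW n + z * ((1 - alpha / 2) * U n + alpha / 2 * U n.-1) = 0].

Lemma scalar_schemeE z N U : 0 <= z -> scalar_scheme z N U ->
  forall n, (n <= N)%N -> U n = U 0%N * (1 - deficit z n / 2).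
Proof.
move=> z0 [h1 h2 h3].
pose W n := U n - U 0%N; pose V n := (- U 0%N / 2) * deficit z n.
suff E n : (n <= N)%N -> W n = V n.
  by move=> n nN; have := E n nN; rewrite /W /V => /eqP; rewrite subr_eq => /eqP ->; ring.
apply: (den_unique z0) => {}n nN; rewrite /V cvlZr cvl_den_deficit//.
have bE : cvl b W n = \sum_(0 <= j < n.+1) b (n - j)%N * (U j - U 0%N).
  by rewrite cvlC /cvl; apply: eq_bigr => i _; rewrite mulrC.
have -> : cvl (den z) W n = cvl b W n + z * cvl (cnb alpha) W n.
  by rewrite cvlC /den cvlDr cvlZr ![cvl W _]cvlC.
rewrite cvl_cnb bE; case: n nN bE => [|[|[|n]]] nN bE.
- by rewrite big_nat1 /W subrr /kap2/=; ring.
- by have := h1 nN; rewrite /W /kap2 /dlt0/=; lra.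
- by have := h2 nN; rewrite /W /kap2 /dlt0/=; lra.
- by have := h3 n.+3 nN; rewrite /W /kap2 /dlt0/=; lra.
Qed.

Section positivity.
Variable z : R.
Hypotheses (z0 : 0 <= z) (z2 : z <= 2).

(** For z <= 2 the operator of the scheme is an M-matrix: the only weight that could
    be positive is - alpha + z alpha/2. *)
Lemma den_le0 n : den z n.+1 <= 0.
Proof.
case: n => [|n]; rewrite /den /cnb /dlt0/=; last first.
  by rewrite !mulr0 addr0 mulr0 addr0; exact: cq_weights_le0 alpha01 hb _.
rewrite (cq_weights_sum alpha01 hb) (cq_sum0 hb) divr1 !mulr0 add0r !mulr1.
have := ler_wpM2r (ltW a0) z2; lra.
Qed.

Lemma cvl_den_one n : cvl (fun=> 1) (den z) n = a n + z * (1 - alpha / 2 * (n == 0%N)%:R).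
Proof.
rewrite /den cvlDr cvlZr cvl_one -/(a n); congr (_ + _ * _).
rewrite cvlC cvl_cnb; case: n => [|n] /=; lra.
Qed.

Lemma cnb_sum_ge0 n : 0 <= z * (1 - alpha / 2 * (n == 0%N)%:R).
Proof. by rewrite mulr_ge0//; case: (n == 0%N) => /=; have := a1; lra. Qed.

(** Maximum principle for the M-matrix den z, whose row sums are at least the weight
    sums a_n. *)
Lemma den_max_principle (x e : nat -> R) (E : R) M :
  (forall n, (n <= M)%N -> cvl (den z) x n = e n /\ `|e n| <= E) ->
  forall n, (n <= M)%N -> `|x n| <= E / a M.
Proof.
move=> h n; elim/ltn_ind: n => n IH nM.
have aM := cq_sum_gt0 alpha01 hb M.
have d0 := den0_gt0 alpha01 hb z0.
have [hx he] := h n nM.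
rewrite den_split in hx.
have {}hx : den z 0 * x n = e n - \sum_(0 <= i < n) den z i.+1 * x (n - i.+1)%N by rewrite -hx addrK.
rewrite -(ler_pM2l d0) -{1}(gtr0_norm d0) -normrM hx.
apply: (le_trans (ler_normB _ _)).
have s1 : `|\sum_(0 <= i < n) den z i.+1 * x (n - i.+1)%N| <= (\sum_(0 <= i < n) - den z i.+1) * (E / a M).
  apply: (le_trans (ler_norm_sum _ _ _)); rewrite mulr_suml; apply: ler_sum_nat => i /andP[_ iN].
  by rewrite normrM (ler0_norm (den_le0 i)) ler_wpM2l ?oppr_ge0 ?den_le0// IH//; lia.
apply: (le_trans (lerD he s1)).
have E0 : 0 <= E / a M by rewrite divr_ge0 ?(ltW aM)// (le_trans _ he).
have : (\sum_(0 <= i < n) - den z i.+1) <= den z 0 - a M.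
  have := cvl_den_one n; rewrite cvl_one big_nat_recl// sumrN.
  have := cnb_sum_ge0 n; have := cq_sum_nincr alpha01 hb nM; lra.
move=> /(ler_wpM2r E0); rewrite mulrBl.
have : a M * (E / a M) = E by rewrite mulrC divfK// gt_eqF.
lra.
Qed.

Lemma fundsol_ge0 n : 0 <= fundsol z n.
Proof.
elim/ltn_ind: n => -[_|n IH]; rewrite /fundsol.
  by rewrite cinv0 invr_ge0 ltW// den0_gt0.
have d0 := den0_gt0 alpha01 hb z0.
rewrite cinvS mulNr -mulrN -sumrN mulr_ge0 ?invr_ge0 ?(ltW d0)//.
rewrite big_nat_cond; apply: sumr_ge0 => i /andP[/andP[_ iN] _]; rewrite -mulNr mulr_ge0 ?oppr_ge0 ?den_le0// IH//; lia.
Qed.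

(** den dominates B, so that fundsol is dominated by the inverse of B: summing
    den * fundsol = delta gives a * fundsol <= 1. *)
Lemma cq_fundsol_le1 n : cvl a (fundsol z) n <= 1.
Proof.
apply: (@le_trans _ _ (cvl (cvl (fun=> 1) (den z)) (fundsol z) n)); last first.
  rewrite cvlA (_ : cvl (den z) (fundsol z) = dlt0) ?cvl_dlt0//.
  by apply/funext; exact: cvl_den_fundsol.
rewrite /cvl; apply: ler_sum => i _; rewrite ler_wpM2r ?fundsol_ge0//.
by have := cvl_den_one i; rewrite /cvl => ->; rewrite lerDl cnb_sum_ge0.
Qed.

Lemma fundsol_le1 n : fundsol z n <= 1.
Proof.
apply: le_trans (cq_fundsol_le1 n); rewrite /cvl big_nat_recl// subn0 (cq_sum0 hb) mul1r lerDl sumr_ge0// => i _.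
by rewrite mulr_ge0 ?fundsol_ge0// ltW// (cq_sum_gt0 alpha01 hb).
Qed.

(** Over a window of k steps the decreasing weights a are at least a_k. *)
Lemma fundsol_window m k : (k <= m)%N -> \sum_(m - k <= i < m) fundsol z i <= (a k)^-1.
Proof.
move=> km; have ak := cq_sum_gt0 alpha01 hb k.
case: m km => [|m] km.
  by rewrite big_geq// invr_ge0 ltW.
rewrite -[leRHS]mul1r ler_pdivlMr// mulr_suml; apply: le_trans (cq_fundsol_le1 m).
rewrite cvlC /cvl [leRHS](big_cat_nat (n := (m.+1 - k)%N)) ?leq_subr//=.
rewrite -[leLHS]add0r; apply: lerD.
  by apply: sumr_ge0 => i _; rewrite mulr_ge0 ?fundsol_ge0// ltW// (cq_sum_gt0 alpha01 hb).
apply: ler_sum_nat => i /andP[i1 i2]; rewrite ler_wpM2l ?fundsol_ge0//.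
apply: (cq_sum_nincr alpha01 hb); lia.
Qed.

Lemma deficitE m : deficit z m = z * (2 * (\sum_(0 <= i < m) fundsol z i) +
   ((1 - 3 * alpha / 2) * pre (fundsol z) m + alpha / 2 * pre (pre (fundsol z)) m)).
Proof.
rewrite /deficit cvlC /kap2 cvlDr cvlDr !cvlZr !cvl_pre !cvl_dlt0 [cvl (fundsol z) _]cvlC pre_sum.
by [].
Qed.

(** Equicontinuity of the discrete solutions. *)
Lemma deficit_modulus m k : (k <= m)%N -> `|deficit z m - deficit z (m - k)| <= z * (4 + 2 / a k).
Proof.
move=> km; rewrite !deficitE -mulrBr normrM ger0_norm// ler_wpM2l//.
have S : \sum_(0 <= i < m) fundsol z i = \sum_(0 <= i < (m - k)%N) fundsol z i + \sum_(m - k <= i < m) fundsol z i.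
  by rewrite -big_cat_nat// leq_subr.
have w := fundsol_window km.
have w0 : 0 <= \sum_(m - k <= i < m) fundsol z i by rewrite sumr_ge0// => i _; exact: fundsol_ge0.
have P (f : nat -> R) j : (forall i, 0 <= f i <= 1) -> 0 <= pre f j <= 1.
  by move=> hf; case: j => [|j] /=; rewrite ?lexx ?ler01.
have p1 i : 0 <= fundsol z i <= 1 by rewrite fundsol_ge0 fundsol_le1.
have /andP[q1 q2] := P _ m p1; have /andP[q3 q4] := P _ (m - k)%N p1.
have /andP[q5 q6] := P _ m (fun i => P _ i p1); have /andP[q7 q8] := P _ (m - k)%N (fun i => P _ i p1).
rewrite S; set w1 := \sum_(0 <= i < (m - k)%N) _ in S *; set w2 := \sum_(m - k <= i < m) _ in S w w0 *.
set x1 := pre _ _ in q1 q2 *; set x3 := pre (fundsol z) _ in q3 q4 *.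
set x5 := pre _ _ in q5 q6 *; set x7 := pre _ _ in q7 q8 *.
have -> : 2 * (w1 + w2) + ((1 - 3 * alpha / 2) * x1 + alpha / 2 * x5) -
  (2 * w1 + ((1 - 3 * alpha / 2) * x3 + alpha / 2 * x7)) =
  2 * w2 + ((1 - 3 * alpha / 2) * (x1 - x3) + alpha / 2 * (x5 - x7)) by ring.
apply: (le_trans (ler_normD _ _)); rewrite addrC; apply: lerD; last by rewrite normrM !ger0_norm//; lra.
apply: (le_trans (ler_normD _ _)); rewrite normrM [X in _ + X]normrM.
have n1 : `|1 - 3 * alpha / 2| <= 2 by rewrite ler_norml; have := a0; have := a1; lra.
have n2 : `|alpha / 2| <= 1 by rewrite ler_norml; have := a0; have := a1; lra.
have n3 : `|x1 - x3| <= 1 by rewrite ler_norml; lra.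
have n4 : `|x5 - x7| <= 1 by rewrite ler_norml; lra.
have := ler_pM (normr_ge0 _) (normr_ge0 _) n1 n3; have := ler_pM (normr_ge0 _) (normr_ge0 _) n2 n4.
by set u := `|_| * _; set v := `|_| * _; lra.
Qed.

(** The second cumulative sum of the denominator weights. *)
Definition den2 n := (n.+1%:R - alpha) / (1 - alpha) * a n + z * (n.+1%:R - alpha / 2).

Lemma den2E : cvl (fun=> 1) (cvl (fun=> 1) (den z)) = den2.
Proof.
apply/funext => n; rewrite cvl_one.
under eq_bigr do rewrite cvl_den_one.
rewrite big_split/= (sum_cq_sum alpha01 hb) /den2; congr (_ + _).
rewrite -mulr_sumr sumrB sumr_const_nat subn0 -mulr_natl mulr1 -mulr_sumr.
rewrite big_nat_recl//= big1 ?addr0 ?mulr1// => [] _; by rewrite mulr0n.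
Qed.

(** When p_i is the increment of c over the i-th step, the cumulative sums x of the
    error satisfy den * x = e, where e is bounded by the hypothesis up to the
    starting terms of the scheme. *)
Lemma cumulative_error (p : nat -> R) (c E : R) M :
  (forall m, (m <= M)%N -> `|\sum_(0 <= i < m) p i * den2 (m - i.+1)%N + c * z * m%:R| <= E) ->
  forall m, (m <= M)%N ->
  `|\sum_(0 <= j < m.+1) (\sum_(0 <= i < j) p i + c / 2 * deficit z j)| <= (E + 2 * z * `|c|) / a M.
Proof.
move=> h m mM.
pose x j := \sum_(0 <= i < j) p i + c / 2 * deficit z j.
rewrite -(cvl_one x).
pose e n := \sum_(0 <= i < n) p i * den2 (n - i.+1)%N + c * (z * (n%:R
  + ((1 - 3 * alpha / 2) * (n != 0%N)%:R + alpha / 2 * (1 < n)%N%:R) / 2)).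
apply: (den_max_principle (e := e)) mM => n nM; split.
  have -> : x = (fun j => pre (cvl (fun=> 1) p) j + c / 2 * deficit z j).
    by apply/funext => j; rewrite pre_sum.
  rewrite -cvlA [cvl (den z) _]cvlC cvlDr cvlZr cvl_pre /e; congr (_ + _).
    rewrite -cvlA [cvl _ (fun=> 1)]cvlC den2E cvlC; case: n {nM} => [|n] /=; first by rewrite big_nil.
    by rewrite /cvl; apply: eq_bigr => i _; rewrite subSS.
  rewrite cvlA cvl_den_deficit// cvlZr /kap2 !cvlDr !cvlZr !cvl_pre !cvl_dlt0 pre_sum sumr_const_nat subn0.
  by case: n nM => [|[|n]] nM /=; field.
have th : `|((1 - 3 * alpha / 2) * (n != 0%N)%:R + alpha / 2 * (1 < n)%N%:R) / 2| <= 2.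
  by case: n {nM} => [|[|n]]; rewrite ler_norml/= ?mulr0 ?mulr1; have := a0; have := a1; lra.
rewrite /e mulrDr mulrDr addrA mulrA; apply: (le_trans (ler_normD _ _)); apply: lerD; first exact: h.
rewrite !normrM (ger0_norm z0) -normrM.
have := ler_wpM2l (mulr_ge0 (normr_ge0 c) z0) th.
rewrite normrM; lra.
Qed.

(** The value at M is the mean over the last k steps plus the oscillation over them.
    The mean is a difference of two cumulative sums divided by k; the oscillation
    is controlled by the continuity of c and by [deficit_modulus]. *)
Lemma pointwise_error (p : nat -> R) (c E d : R) M k :
  (forall m, (m <= M)%N -> `|\sum_(0 <= i < m) p i * den2 (m - i.+1)%N + c * z * m%:R| <= E) ->
  (0 < k <= M)%N ->
  (forall j, (j < k)%N -> `|\sum_(M - j <= i < M) p i| <= d) ->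
  `|\sum_(0 <= i < M) p i + c / 2 * deficit z M| <=
     2 * (E + 2 * z * `|c|) / (a M * k%:R) + d + `|c| * z * (2 + (a k)^-1).
Proof.
move=> h /andP[k0 kM] hd.
have K0 : 0 < k%:R :> R by rewrite ltr0n.
have aM := cq_sum_gt0 alpha01 hb M.
pose x j := \sum_(0 <= i < j) p i + c / 2 * deficit z j.
have H := cumulative_error h.
have h1 := H M (leqnn M).
have h2 : `|\sum_(0 <= j < (M - k).+1) x j| <= (E + 2 * z * `|c|) / a M by apply: H; rewrite leq_subr.
have S : k%:R * x M = (\sum_(0 <= j < M.+1) x j - \sum_(0 <= j < (M - k).+1) x j) +
    \sum_(0 <= j < k) (x M - x (M - j)%N).
  have -> : \sum_(0 <= j < M.+1) x j - \sum_(0 <= j < (M - k).+1) x j = \sum_(0 <= j < k) x (M - j)%N.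
    rewrite [X in X - _](big_cat_nat (n := (M - k).+1)) ?ltnS ?leq_subr//= addrAC subrr add0r.
    rewrite -[(M - k).+1]add0n big_addn (_ : M.+1 - (M - k).+1 = k)%N; last by lia.
    by rewrite big_nat_rev/=; apply: eq_big_nat => i /andP[_ ik]; congr x; lia.
  by rewrite -big_split/= (eq_bigr (fun=> x M)) ?sumr_const_nat ?subn0 ?mulr_natl// => i _; rewrite addrC subrK.
have dx j : (j < k)%N -> `|x M - x (M - j)%N| <= d + `|c| * z * (2 + (a k)^-1).
  move=> jk; have jM : (j <= M)%N by lia.
  have -> : x M - x (M - j)%N = \sum_(M - j <= i < M) p i + c / 2 * (deficit z M - deficit z (M - j)).
    by rewrite /x (big_cat_nat (leq0n _) (leq_subr j M))/=; ring.
  apply: (le_trans (ler_normD _ _)); apply: lerD; first exact: hd.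
  rewrite normrM normrM (ger0_norm (_ : 0 <= 2^-1))//.
  have := ler_wpM2l (normr_ge0 c) (deficit_modulus jM).
  have : (a j)^-1 <= (a k)^-1.
    by rewrite lef_pV2 ?posrE ?(cq_sum_gt0 alpha01 hb)//; apply: (cq_sum_nincr alpha01 hb); exact: ltnW.
  move=> /(ler_wpM2l (mulr_ge0 (normr_ge0 c) z0)); lra.
have s3 : `|\sum_(0 <= j < k) (x M - x (M - j)%N)| <= k%:R * (d + `|c| * z * (2 + (a k)^-1)).
  apply: (le_trans (ler_norm_sum _ _ _)); rewrite mulr_natl.
  rewrite -[X in _ <= _ *+ X]subn0 -sumr_const_nat.
  by apply: ler_sum_nat => j /andP[_ jk]; exact: dx.
rewrite -/(x M) -(ler_pM2l K0) -{1}(ger0_norm (ltW K0)) -normrM S.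
apply: (le_trans (ler_normD _ _)).
apply: (le_trans (lerD (ler_normB _ _) (lexx _))).
have -> : k%:R * (2 * (E + 2 * z * `|c|) / (a M * k%:R) + d + `|c| * z * (2 + (a k)^-1)) =
  ((E + 2 * z * `|c|) / a M + (E + 2 * z * `|c|) / a M) + k%:R * (d + `|c| * z * (2 + (a k)^-1)).
  by field; rewrite !gt_eqF// (cq_sum_gt0 alpha01 hb).
by rewrite !lerD.
Qed.

End positivity.
End scheme.

(** * Convergence of the scalar scheme on fine grids *)

Section interval_integrals.
Context {R : realType}.
Local Notation mu := (@lebesgue_measure R).
Implicit Types f g : R -> R.

Lemma integrable_subitv f (a b c d : R) : mu.-integrable `]a, b[ (EFin \o f) ->
  a <= c -> d <= b -> mu.-integrable `]c, d[ (EFin \o f).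
Proof.
move=> fi ac db; apply: integrableS fi => //.
by apply: subset_itv; rewrite bnd_simp.
Qed.

Lemma Rintegral_split f (a b c : R) : a <= b -> b <= c -> mu.-integrable `]a, c[ (EFin \o f) ->
  \int[mu]_(x in `]a, c[) f x = \int[mu]_(x in `]a, b[) f x + \int[mu]_(x in `]b, c[) f x.
Proof.
move=> ab; rewrite le_eqVlt => /predU1P[-> fi|bc fi].
  by rewrite [X in _ + X](_ : _ = 0) ?addr0// set_itv_ge ?Rintegral_set0// bnd_simp ltxx.
rewrite -(Rintegral_itvB (a := BRight a) (b := BLeft c) (x := b) fi) ?bnd_simp//.
have fab : mu.-integrable `]a, b[ (EFin \o f) by apply: (integrable_subitv fi (lexx a)); exact: ltW.
by rewrite (Rintegral_itv_bndo_bndc fab) addrC subrK.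
Qed.

Lemma Rintegral_cells f (tau : R) m : 0 <= tau -> mu.-integrable `]0, m%:R * tau[ (EFin \o f) ->
  \int[mu]_(x in `]0, m%:R * tau[) f x =
  \sum_(0 <= i < m) \int[mu]_(x in `]i%:R * tau, i.+1%:R * tau[) f x.
Proof.
move=> tau0; elim: m => [|m IH] fi.
  by rewrite big_nil mul0r set_itv_ge ?Rintegral_set0// bnd_simp ltxx.
have m1 : m%:R * tau <= m.+1%:R * tau by rewrite ler_wpM2r// ler_nat.
have m0 : 0 <= m%:R * tau by rewrite mulr_ge0.
rewrite (Rintegral_split m0 m1 fi) IH; last exact: integrable_subitv fi _ m1.
by rewrite big_nat_recr.
Qed.

Lemma integrable_mul_bounded f g (D : set (measurableTypeR R)) (K : R) : measurable D ->
  mu.-integrable D (EFin \o f) -> measurable_fun D g -> (forall x, D x -> `|g x| <= K) ->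
  mu.-integrable D (EFin \o (fun x => f x * g x)).
Proof.
move=> mD fi mg gK; rewrite (_ : EFin \o _ = ((EFin \o f) \* (EFin \o g))%E).
  apply: integrableMl => //; exists K; split; first exact: num_real.
  by move=> M KM x Dx /=; rewrite (le_trans (gK x Dx))// ltW.
by apply/funext => x /=; rewrite EFinM.
Qed.

(** Hoelder's inequality between L1 and bounded functions. *)
Lemma le_Rintegral_mul_bounded f g (D : set (measurableTypeR R)) (K : R) : measurable D ->
  mu.-integrable D (EFin \o f) -> measurable_fun D g -> (forall x, D x -> `|g x| <= K) ->
  `|\int[mu]_(x in D) (f x * g x)| <= K * \int[mu]_(x in D) `|f x|.
Proof.
move=> mD fi mg gK; have fgi := integrable_mul_bounded mD fi mg gK.
apply: (le_trans (le_normr_Rintegral mD fgi)).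
have nfi : mu.-integrable D (EFin \o (fun x => `|f x|)) by exact: integrable_norm.
rewrite -RintegralZl//; apply: le_Rintegral => //.
- exact: integrable_norm fgi.
- have := integrableZl mD K nfi; apply: eq_integrable => // x _ /=; by rewrite EFinM.
- by move=> x Dx; rewrite normrM mulrC ler_wpM2r// gK.
Qed.

Lemma Rintegral_norm_subitv f (a b c d : R) : mu.-integrable `]a, b[ (EFin \o f) ->
  a <= c -> d <= b -> \int[mu]_(x in `]c, d[) `|f x| <= \int[mu]_(x in `]a, b[) `|f x|.
Proof.
move=> fi ac db.
have nfi : mu.-integrable `]a, b[ (EFin \o (fun x => `|f x|)) by exact: integrable_norm.
have sub : [set` `]c, d[] `<=` [set` `]a, b[] by apply: subset_itv; rewrite bnd_simp.
rewrite /Rintegral fine_le//.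
- by apply: integrable_fin_num => //; exact: integrableS nfi.
- exact: integrable_fin_num.
- by apply: ge0_subset_integral => //; exact: measurable_int nfi.
Qed.

(** Continuity of the primitive at t, from the left. *)
Lemma Rintegral_left_modulus f (T t e : R) : mu.-integrable `]0, T[ (EFin \o f) ->
  0 <= t <= T -> 0 < e ->
  exists2 d : R, 0 < d & forall s, 0 <= s <= t -> t - s < d -> `|\int[mu]_(x in `]s, t[) f x| <= e.
Proof.
move=> fi /andP[t0 tT] e0.
pose g := f \_ `]0, T[.
have gi : mu.-integrable setT (EFin \o g).
  by rewrite -restrict_EFin; apply/integrable_restrict => //=; rewrite setTI.
have [d [d0 hd]] := integral_normr_continuous gi e0.
exists d => // s /andP[s0 st] std.
have fi' : mu.-integrable `]s, t[ (EFin \o f) by exact: integrable_subitv fi s0 tT.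
apply: (le_trans (le_normr_Rintegral _ fi')) => //.
have mst : (mu `]s, t[ < d%:E)%E.
  by rewrite lebesgue_measure_itv/= lte_fin; case: ifP => _; rewrite ?lte_fin// EFinB lte_fin.
apply: ltW; apply: le_lt_trans (hd `]s, t[%classic _ mst) => //.
rewrite le_eqVlt; apply/orP; left; apply/eqP; apply: eq_Rintegral => x; rewrite inE/= in_itv/= => /andP[sx xt].
by rewrite /g patchE mem_set//= in_itv/= (le_lt_trans s0 sx) (lt_le_trans xt tT).
Qed.

End interval_integrals.

Section scalar.
Context {R : realType} (alpha : R) (b : nat -> R) (l : R).
Hypotheses (alpha01 : 0 < alpha < 1) (hb : cq_weights alpha b).
Local Notation mu := (@lebesgue_measure R).
Local Notation a := (cq_sum b).
Local Notation t := (2 `^ alpha).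
Local Notation deficit := (deficit alpha b).
Hypothesis l0 : 0 < l.
Hypothesis hl : forall j, l * j.+1%:R `^ (- alpha) <= a j /\ a j.+1 <= l * j.+1%:R `^ (- alpha).
Let a0 : 0 < alpha. Proof. by case/andP: alpha01. Qed.
Let a1 : alpha < 1. Proof. by case/andP: alpha01. Qed.

(** The kernel of the equation integrated once: l x^(1 - alpha) / (1 - alpha) comes
    from the fractional derivative and lam x from the reaction term. *)
Definition prim (lam x : R) := l * x `^ (1 - alpha) / (1 - alpha) + lam * x.

(** The discrete kernel agrees with the continuous one up to a constant on every cell,
    because (n + 1 - alpha) a_n ~ l n^(1 - alpha) with a bounded error. *)
Lemma den2_approx z n u : 0 <= z -> n%:R <= u <= n.+1%:R ->
  `|den2 alpha b z n - prim z u| <= (l + 1) / (1 - alpha) + z.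
Proof.
move=> z0 /andP[nu un].
have b0 : 0 < 1 - alpha by rewrite subr_gt0.
have u0 : 0 <= u by apply: le_trans nu.
have N0 : 0 < n.+1%:R :> R by [].
have S1 : n.+1%:R = n%:R + 1 :> R by rewrite -natr1.
have -> : den2 alpha b z n - prim z u =
   ((n.+1%:R - alpha) * a n - l * u `^ (1 - alpha)) / (1 - alpha) + z * (n.+1%:R - alpha / 2 - u).
  by rewrite /den2 /prim; field; rewrite gt_eqF.
apply: (le_trans (ler_normD _ _)); apply: lerD; last first.
  rewrite normrM (ger0_norm z0) ler_piMr// ler_norml; have := a0; have := a1; lra.
rewrite normrM normfV (gtr0_norm b0) ler_wpM2r ?invr_ge0 ?(ltW b0)//.
have pw k : k.+1%:R * k.+1%:R `^ (- alpha) = k.+1%:R `^ (1 - alpha) :> R.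
  by rewrite -{1}[k.+1%:R]powRr1// -powRD// pnatr_eq0 implybT.
have mono x y : 0 <= x -> x <= y -> x `^ (1 - alpha) <= y `^ (1 - alpha).
  by move=> x0 xy; rewrite ge0_ler_powR ?nnegrE ?(ltW b0)// (le_trans x0).
have m1 := mono _ _ u0 un.
have p1 k : k.+1%:R `^ (- alpha) <= 1 :> R.
  by rewrite powRN invf_le1 ?powR_gt0// -[leLHS](powRr0 k.+1%:R) ler_powR ?ler1n// ltW.
rewrite ler_norml; apply/andP; split.
  have [h _] := hl n.
  have c0 : 0 <= n.+1%:R - alpha by have := a1; have := ler0n R n; lra.
  have := ler_wpM2l c0 h.
  have -> : (n.+1%:R - alpha) * (l * n.+1%:R `^ (- alpha)) =
     l * n.+1%:R `^ (1 - alpha) - l * (alpha * n.+1%:R `^ (- alpha)) by rewrite -pw; ring.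
  have := ler_wpM2l (ltW l0) m1.
  have : l * (alpha * n.+1%:R `^ (- alpha)) <= l * 1.
    by rewrite ler_wpM2l ?(ltW l0)// mulr_ile1 ?(ltW a0) ?(ltW a1)// powR_ge0.
  lra.
case: n nu un N0 S1 m1 => [|n] nu un N0 S1 m1.
  have := mulr_ge0 (ltW l0) (powR_ge0 u (1 - alpha)); rewrite (cq_sum0 hb) mulr1.
  have := a0; have := l0; lra.
have [_ h] := hl n.
have c0 : 0 <= n.+2%:R - alpha by have := a1; have := ler0n R n.+1; lra.
have := ler_wpM2l c0 h.
have -> : (n.+2%:R - alpha) * (l * n.+1%:R `^ (- alpha)) =
   l * n.+1%:R `^ (1 - alpha) + l * ((1 - alpha) * n.+1%:R `^ (- alpha)) by rewrite -pw S1; ring.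
have := ler_wpM2l (ltW l0) (mono _ _ (ler0n R n.+1) nu).
have : l * ((1 - alpha) * n.+1%:R `^ (- alpha)) <= l * 1.
  by rewrite ler_wpM2l ?(ltW l0)// mulr_ile1 ?(ltW b0) ?powR_ge0//; have := a0; lra.
lra.
Qed.

Lemma measurable_prim lam r (D : set (measurableTypeR R)) : measurable_fun D (fun s => prim lam (r - s)).
Proof.
have mB : measurable_fun D (fun s => r - s : R) by apply: measurable_funB.
apply: measurable_funD; last by apply: measurable_funM.
apply: measurable_funM => //; apply: measurable_funM => //.
by apply: (measurableT_comp (measurable_powR _)); exact: mB.
Qed.

Lemma prim_bounded lam r s : 0 <= lam -> 0 <= s <= r -> `|prim lam (r - s)| <= prim lam r.
Proof.
move=> lam0 /andP[s0 sr]; have b0 : 0 < 1 - alpha by rewrite subr_gt0.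
have [[l0' b0'] a1'] := (ltW l0, ltW b0, ltW a1).
rewrite ger0_norm /prim; last by rewrite addr_ge0 ?mulr_ge0 ?invr_ge0 ?powR_ge0 ?subr_ge0.
apply: lerD; last by rewrite ler_wpM2l// gerBl.
rewrite ler_wpM2r ?invr_ge0 ?(ltW b0)// ler_wpM2l ?(ltW l0)//.
by rewrite ge0_ler_powR ?nnegrE ?subr_ge0 ?gerBl ?(le_trans s0 sr)// ltW.
Qed.

Variables (T lam c : R) (phi : R -> R).
Hypotheses (T0 : 0 < T) (lam0 : 0 <= lam).
Hypothesis phii : mu.-integrable `]0, T[ (EFin \o phi).
(* the relaxation equation with initial value c and derivative phi, integrated once *)
Hypothesis relax : forall r, 0 < r <= T ->
  \int[mu]_(s in `]0, r[) (phi s * prim lam (r - s)) = - (lam * c * r).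

(** Cell by cell, phi is integrated against the difference of the two kernels, which
    is bounded; no smoothness of phi is used. *)
Lemma consistency tau M m : 0 < tau -> M%:R * tau <= T -> (m <= M)%N ->
  `|\sum_(0 <= i < m) (\int[mu]_(s in `]i%:R * tau, i.+1%:R * tau[) phi s) *
      den2 alpha b (lam * tau `^ alpha) (m - i.+1)%N + c * (lam * tau `^ alpha) * m%:R|
  <= ((l + 1) / (1 - alpha) + lam * tau `^ alpha) * \int[mu]_(s in `]0, T[) `|phi s|.
Proof.
move=> tau0 MT mM; set z := lam * tau `^ alpha; set V := \int[mu]_(s in _) `|_|.
have b0 : 0 < 1 - alpha by rewrite subr_gt0.
have z0 : 0 <= z by rewrite mulr_ge0// powR_ge0.
have K0 : 0 <= (l + 1) / (1 - alpha) + z by rewrite addr_ge0// divr_ge0 ?(ltW b0)// addr_ge0// ltW.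
have V0 : 0 <= V by apply: Rintegral_ge0.
case: m mM => [|m'] mM; first by rewrite big_nil mulr0 addr0 normr0 mulr_ge0.
set m := m'.+1 in mM *; pose r := m%:R * tau.
have r0 : 0 < r by rewrite mulr_gt0// ltr0n.
have rT : r <= T by apply: le_trans MT; rewrite ler_wpM2r ?(ltW tau0)// ler_nat.
have phir : mu.-integrable `]0, r[ (EFin \o phi) by exact: integrable_subitv phii _ rT.
have bnd s : [set` `]0, r[] s -> `|prim lam (r - s)| <= prim lam r.
  by rewrite /= in_itv/= => /andP[s0 sr]; rewrite prim_bounded// !ltW.
have cell_in i : (i < m)%N -> 0 <= i%:R * tau /\ i.+1%:R * tau <= r.
  by move=> im; rewrite mulr_ge0 ?(ltW tau0)// ler_wpM2r ?(ltW tau0)// ler_nat.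
pose g := tau `^ (alpha - 1).
have gtau : tau `^ alpha = g * tau.
  have tn0 : tau != 0 by rewrite gt_eqF.
  by rewrite /g -{3}[tau]powRr1 ?(ltW tau0)// -powRD ?subrK// tn0 implybT.
have cE : c * z * m%:R = - (g * \int[mu]_(s in `]0, r[) (phi s * prim lam (r - s))).
  by rewrite relax ?r0// /z /r gtau; ring.
have pi : mu.-integrable `]0, r[ (EFin \o (fun s => phi s * prim lam (r - s))).
  by apply: (integrable_mul_bounded (K := prim lam r) _ phir) => //; exact: measurable_prim.
rewrite cE {1}/r (Rintegral_cells (ltW tau0))//.
rewrite mulr_sumr -sumrB; apply: (le_trans (ler_norm_sum _ _ _)).
have VE : V >= \sum_(0 <= i < m) \int[mu]_(s in `]i%:R * tau, i.+1%:R * tau[) `|phi s|.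
  rewrite -(Rintegral_cells (ltW tau0)); last exact: integrable_norm.
  exact: Rintegral_norm_subitv phii _ rT.
apply: le_trans (ler_wpM2l K0 VE); rewrite mulr_sumr; apply: ler_sum_nat => i /andP[_ im].
have [i0 ir] := cell_in i im.
set D := [set` _].
have mD : measurable (D : set (measurableTypeR R)) by exact: measurable_itv.
have Di s : D s -> 0 < s < r.
  by rewrite /D/= in_itv/= => /andP[s1 s2]; rewrite (le_lt_trans i0 s1) (lt_le_trans s2 ir).
have phiD : mu.-integrable D (EFin \o phi) by exact: integrable_subitv phir i0 ir.
pose psi s := den2 alpha b z (m - i.+1)%N - g * prim lam (r - s).
have mpsi : measurable_fun D psi.
  by apply: measurable_funB => //; apply: measurable_funM => //; exact: measurable_prim.
have gE s : 0 <= s <= r -> g * prim lam (r - s) = prim z ((r - s) / tau).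
  move=> /andP[s0 sr]; rewrite /prim /g /z.
  have -> : (r - s) = tau * ((r - s) / tau) by field; rewrite gt_eqF.
  have u0 : 0 <= (r - s) / tau by rewrite divr_ge0 ?subr_ge0// ltW.
  rewrite [tau * _ / tau]mulrAC divff ?gt_eqF// mul1r.
  rewrite powRM ?(ltW tau0)// mulrDr; congr (_ + _).
    have : tau `^ (alpha - 1) * tau `^ (1 - alpha) = 1.
      have tn0 : tau != 0 by rewrite gt_eqF.
      by rewrite -powRD ?tn0 ?implybT// addrA subrK subrr powRr0.
    move=> h; transitivity ((tau `^ (alpha - 1) * tau `^ (1 - alpha)) * (l * ((r - s) / tau) `^ (1 - alpha) / (1 - alpha))); first by ring.
    by rewrite h mul1r.
  by rewrite gtau /g; ring.
have psib s : D s -> `|psi s| <= (l + 1) / (1 - alpha) + z.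
  move=> Ds; have /andP[s0 sr] := Di s Ds; rewrite /psi gE ?(ltW s0) ?(ltW sr)//.
  apply: den2_approx => //; move: Ds; rewrite /D/= in_itv/= => /andP[s1 s2].
  have mi : m%:R = (m - i.+1)%:R + i.+1%:R :> R by rewrite -natrD subnK.
  rewrite ler_pdivlMr// ler_pdivrMr// -[(m - i.+1).+1%:R]natr1 /r mi -natr1.
  move: s1 s2; rewrite -natr1; set A := i%:R * tau; set B := (m - i.+1)%:R * tau.
  rewrite !mulrDl !mul1r -/A -/B; lra.
have -> : (\int[mu]_(s in D) phi s) * den2 alpha b z (m - i.+1) - g * \int[mu]_(s in D) (phi s * prim lam (r - s)) =
   \int[mu]_(s in D) (phi s * psi s).
  have piD : mu.-integrable D (EFin \o (fun s => phi s * prim lam (r - s))) by exact: integrable_subitv pi i0 ir.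
  rewrite -RintegralZr// -RintegralZl// -RintegralB//.
  - by apply: eq_Rintegral => s _; rewrite /psi; ring.
  - by have := integrableZr mD (den2 alpha b z (m - i.+1)) phiD; apply: eq_integrable => // x _ /=; rewrite EFinM.
  - by have := integrableZl mD g piD; apply: eq_integrable => // x _ /=; rewrite EFinM.
exact: le_Rintegral_mul_bounded.
Qed.

Lemma small_pow (q C e : R) : 0 <= q < 1 -> 0 < e -> exists i0, forall i, (i0 <= i)%N -> C * q ^+ i <= e.
Proof.
move=> /andP[q0 q1] e0.
have : (fun i => C * q ^+ i) @ \oo --> C * 0.
  by apply: cvgM; [exact: cvg_cst|apply: cvg_expr; rewrite ger0_norm].
rewrite mulr0 => /cvgrPdist_le /(_ e e0) [i0 _ h]; exists i0 => i i0i.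
by have := h i i0i; rewrite sub0r normrN; apply: le_trans; exact: ler_norm.
Qed.

Lemma cq_sum_inv k : (0 < k)%N -> (a k)^-1 <= 2 / l * k%:R `^ alpha.
Proof.
move=> k0; have [h _] := hl k; have K0 : 0 < k%:R :> R by rewrite ltr0n.
have ak := cq_sum_gt0 alpha01 hb k.
rewrite -[leLHS]mul1r ler_pdivrMr//.
have : 2 / l * k%:R `^ alpha * (l * k.+1%:R `^ (- alpha)) <= 2 / l * k%:R `^ alpha * a k.
  by rewrite ler_wpM2l// mulr_ge0 ?powR_ge0// divr_ge0// ltW.
apply: le_trans.
have -> : 2 / l * k%:R `^ alpha * (l * k.+1%:R `^ (- alpha)) = 2 * k%:R `^ alpha * k.+1%:R `^ (- alpha).
  by field; rewrite gt_eqF.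
rewrite powRN ler_pdivlMr ?powR_gt0// mul1r.
apply: (@le_trans _ _ ((2 * k%:R) `^ alpha)).
  by rewrite ge0_ler_powR ?nnegrE ?mulr_ge0 ?(ltW a0) ?(ltW K0)// -natrM ler_nat; lia.
rewrite powRM ?(ltW K0)// ler_wpM2r ?powR_ge0//.
by rewrite -[leRHS](powRr1 (_ : 0 <= 2 :> R))// ler_powR ?ler1n ?(ltW a1).
Qed.

(** On the grid of step tau / 2^i the window has length tau n / 2^i0, fixed by the
    continuity of c, and comprises 2^j n steps. The first term of [pointwise_error]
    is O((M^alpha) / k) = O((2^alpha / 2)^j) and z is O(2^(- alpha j)). *)
Lemma fine_limit tau n e : 0 < tau -> (0 < n)%N -> n%:R * tau <= T -> 0 < e ->
  exists2 q, 0 <= q < 1 & exists C i0, forall j,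
   `|\int[mu]_(s in `]0, n%:R * tau[) phi s + c / 2 * deficit (lam * tau `^ alpha / t ^+ (i0 + j)) (2 ^ (i0 + j) * n)|
    <= e + C * q ^+ j.
Proof.
move=> tau0 n0 nT e0; pose x := n%:R * tau; pose z := lam * tau `^ alpha.
have N0 : 0 < n%:R :> R by rewrite ltr0n.
have x0 : 0 < x by rewrite mulr_gt0.
have z0 : 0 <= z by rewrite mulr_ge0// powR_ge0.
have t1 : 1 < t.
  apply: (@le_lt_trans _ _ (1 `^ alpha)); first by rewrite powR1.
  by rewrite gt0_ltr_powR ?nnegrE// ltr1n.
have tp : 0 < t by apply: lt_trans t1.
have q1 : 0 <= t^-1 < 1 by rewrite invr_ge0 (ltW tp)/= invf_lt1.
pose q2 : R := 2 `^ alpha / 2.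
have q2b : 0 <= q2 < 1.
  rewrite /q2 divr_ge0 ?powR_ge0//= ltr_pdivrMr// mul1r.
  rewrite -[ltRHS](powRr1 (_ : 0 <= 2 :> R))// /powR ?pnatr_eq0/= ltr_expR.
  by rewrite ltr_pM2r// ln_gt0// ltr1n.
(* two rates occur: z decays like 2^(- alpha j), the averaging error like (2^alpha / 2)^j *)
pose q := Num.max t^-1 q2.
have q01 : 0 <= q < 1 by rewrite /q le_max gt_max; case/andP: q1 => -> ->; case/andP: q2b => _ ->.
exists q => //.
have e2 : 0 < e / 2 by rewrite divr_gt0.
have xT : 0 <= x <= T by rewrite ltW.
have [d d0 hd] := Rintegral_left_modulus phii xT e2.
have [i1 h1] := small_pow z q1 (ltr0n R 2 : 0 < 2).
have [i2 h2] := small_pow (`|c| * (2 / l) * (z * n%:R `^ alpha)) q1 e2.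
have half : 0 <= (2^-1 : R) < 1 by apply/andP; split; lra.
have d2 : 0 < d / 2 by rewrite divr_gt0.
have [i3 h3] := small_pow x half d2.
(* from level i0 on, z <= 2, the window is shorter than d, and the oscillation of the
   discrete solution over it is at most e / 2 *)
pose i0 := maxn i1 (maxn i2 i3).
pose K : R := (l + 1) / (1 - alpha); pose V := \int[mu]_(s in `]0, T[) `|phi s|.
have V0 : 0 <= V by apply: Rintegral_ge0.
have K0 : 0 <= K by rewrite divr_ge0 ?subr_ge0 ?(ltW a1)// addr_ge0// ltW.
have tpi k : t ^- k = t^-1 ^+ k by rewrite exprVn.
exists (2 * ((K + 2) * V + 4 * `|c|) * (2 / l) * (n%:R `^ alpha / n%:R) * t ^+ i0 + 2 * `|c| * z), i0 => j.
pose M := (2 ^ (i0 + j) * n)%N; pose k := (2 ^ j * n)%N; pose tauj := tau / 2 ^+ (i0 + j).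
have P0 m : 0 < 2 ^+ m :> R by rewrite exprn_gt0.
have tau0' : 0 < tauj by rewrite divr_gt0.
have k0 : (0 < k)%N by rewrite muln_gt0 expn_gt0.
have M0 : (0 < M)%N by rewrite muln_gt0 expn_gt0.
have kM : (k <= M)%N by rewrite /k /M expnD -mulnA leq_pmull ?expn_gt0.
have MR : M%:R = 2 ^+ (i0 + j) * n%:R :> R by rewrite natrM natrX.
have kR : k%:R = 2 ^+ j * n%:R :> R by rewrite natrM natrX.
have Mx : M%:R * tauj = x by rewrite MR /tauj /x; field; rewrite gt_eqF.
have pX m : (2 ^+ m) `^ alpha = t ^+ m :> R by rewrite -powR_mulrn// -powRrM mulrC powRrM powR_mulrn ?powR_ge0.
have zE : lam * tauj `^ alpha = z / t ^+ (i0 + j).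
  rewrite /tauj /z powRM ?(ltW tau0) ?invr_ge0 ?(ltW (P0 _))// -mulrA; congr (_ * (_ * _)).
  by rewrite -[2 ^- (i0 + j)](powR_inv1 (ltW (P0 _))) -powRrM mulN1r powRN pX.
set zj := z / _ in zE *.
have zj0 : 0 <= zj by rewrite divr_ge0// exprn_ge0// ltW.
have zj2 : zj <= 2 by rewrite /zj tpi; apply: h1; rewrite /i0; clear; lia.
pose p i := \int[mu]_(s in `]i%:R * tauj, i.+1%:R * tauj[) phi s.
have phix : mu.-integrable `]0, x[ (EFin \o phi) by exact: integrable_subitv phii _ nT.
have pm m : (m <= M)%N -> \sum_(0 <= i < m) p i = \int[mu]_(s in `]0, m%:R * tauj[) phi s.
  move=> mM; rewrite Rintegral_cells// ?(ltW tau0')//; apply: integrable_subitv phix _ _ => //.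
  by rewrite -Mx ler_wpM2r ?(ltW tau0')// ler_nat.
have h m : (m <= M)%N -> `|\sum_(0 <= i < m) p i * den2 alpha b zj (m - i.+1)%N + c * zj * m%:R| <= (K + zj) * V.
  move=> mM; have MT : M%:R * tauj <= T by rewrite Mx.
  by have := consistency tau0' MT mM; rewrite zE.
have hd' i : (i < k)%N -> `|\sum_(M - i <= i' < M) p i'| <= e / 2.
  move=> ik.
  have iM : (i <= M)%N := leq_trans (ltnW ik) kM.
  have s0 : 0 <= (M - i)%:R * tauj by rewrite mulr_ge0// ltW.
  have sx : (M - i)%:R * tauj <= x by rewrite -Mx ler_wpM2r ?(ltW tau0')// ler_nat leq_subr.
  have -> : \sum_(M - i <= i' < M) p i' = \int[mu]_(s in `](M - i)%:R * tauj, x[) phi s.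
    have := pm M (leqnn M); rewrite Mx (Rintegral_split s0 sx phix) -pm ?leq_subr//.
    by rewrite (big_cat_nat (leq0n _) (leq_subr i M))/= => /addrI.
  apply: hd; first by rewrite s0.
  rewrite -Mx -mulrBl natrB// opprB addrC subrK.
  apply: (@le_lt_trans _ _ (d / 2)); last by rewrite ltr_pdivrMr// ltr_pMr// ltr1n.
  apply: (@le_trans _ _ (k%:R * tauj)); first by rewrite ler_wpM2r ?(ltW tau0')// ler_nat ltnW.
  apply: le_trans (h3 i0 _); last by rewrite /i0; clear; lia.
  rewrite kR /tauj /x exprVn exprD le_eqVlt; apply/orP; left; apply/eqP; field.
  by rewrite !gt_eqF.
have kM' : (0 < k <= M)%N by rewrite k0.
have := pointwise_error alpha01 hb zj0 zj2 h kM' hd'.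
rewrite pm// Mx => /le_trans; apply.
have tj : 0 < t ^+ j by rewrite exprn_gt0.
have ti : 0 < t ^+ i0 by rewrite exprn_gt0.
have qj1 : t^-1 ^+ j <= q ^+ j.
  by rewrite lerXn2r ?nnegrE ?invr_ge0 ?(ltW tp)//; rewrite /q ?le_max ?lexx// invr_ge0 (ltW tp).
have qj2 : q2 ^+ j <= q ^+ j.
  by case/andP: q2b => q20 _; rewrite lerXn2r ?nnegrE// /q ?le_max ?lexx ?q20 ?orbT.
have qj0 : 0 <= q ^+ j by case/andP: q01 => ? _; rewrite exprn_ge0.
have B1 : 2 * ((K + zj) * V + 2 * zj * `|c|) / (a M * k%:R) <=
   2 * ((K + 2) * V + 4 * `|c|) * (2 / l) * (n%:R `^ alpha / n%:R) * t ^+ i0 * q ^+ j.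
  have K1 : 0 < k%:R :> R by rewrite ltr0n.
  have aM := cq_sum_gt0 alpha01 hb M.
  have A0 : 0 <= (a M * k%:R)^-1 by rewrite invr_ge0 mulr_ge0// ltW.
  have W0 : 0 <= 2 * ((K + 2) * V + 4 * `|c|) by rewrite mulr_ge0// addr_ge0// mulr_ge0// addr_ge0.
  apply: (@le_trans _ _ (2 * ((K + 2) * V + 4 * `|c|) * (a M * k%:R)^-1)).
    rewrite ler_wpM2r// ler_wpM2l// lerD// ?ler_wpM2r// ?lerD2l//.
    by rewrite (_ : 4 = 2 * 2) ?ler_wpM2l// -natrM.
  rewrite -!mulrA ler_wpM2l// ler_wpM2l//; first by move: W0; rewrite pmulr_rge0.
  rewrite invfM; apply: (@le_trans _ _ ((2 / l * M%:R `^ alpha) / k%:R)).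
    by rewrite ler_wpM2r ?invr_ge0 ?(ltW K1)// cq_sum_inv.
  rewrite MR kR powRM ?(ltW N0) ?(ltW (P0 _))// pX exprD invfM.
  have -> : 2 / l * (t ^+ i0 * t ^+ j * n%:R `^ alpha) * (2 ^- j / n%:R) =
     2 / l * (n%:R `^ alpha / n%:R * (t ^+ i0 * (t ^+ j / 2 ^+ j))) by ring.
  have l2 : 0 <= 2 / l by rewrite divr_ge0// ltW.
  rewrite (_ : 2 * (_ * _) = 2 / l * (n%:R `^ alpha / n%:R * (t ^+ i0 * q ^+ j))); last by ring.
  rewrite ler_wpM2l// ler_wpM2l ?divr_ge0 ?powR_ge0 ?(ltW N0)// ler_wpM2l ?(ltW ti)//.
  by apply: le_trans qj2; rewrite /q2 exprMn exprVn.
have B2 : `|c| * zj * 2 <= 2 * `|c| * z * q ^+ j.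
  rewrite (_ : _ * _ * 2 = 2 * `|c| * zj); last by ring.
  rewrite -[leRHS]mulrA ler_wpM2l ?mulr_ge0// /zj tpi exprD mulrA.
  have p0 m : 0 <= t^-1 ^+ m by rewrite exprn_ge0// invr_ge0 ltW.
  apply: ler_pM => //; first exact: mulr_ge0.
  by rewrite ler_piMr// exprn_ile1 ?invr_ge0 ?(ltW tp)//; case/andP: q1 => _ /ltW.
have B3 : `|c| * zj * (a k)^-1 <= e / 2.
  apply: (@le_trans _ _ (`|c| * zj * (2 / l * k%:R `^ alpha))).
    by apply: ler_wpM2l; [exact: (mulr_ge0 (normr_ge0 c) zj0)|exact: cq_sum_inv].
  apply: le_trans (h2 i0 _); last by rewrite /i0; clear; lia.
  rewrite kR powRM ?(ltW N0) ?(ltW (P0 _))// pX /zj exprD exprVn le_eqVlt; apply/orP; left; apply/eqP; field.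
  by rewrite !gt_eqF.
lra.
Qed.

(** The error is at most the distance to a finer level, bounded uniformly in that
    level, plus the error of the finer level, which tends to 0. *)
Lemma scalar_convergence K tau n : 0 < tau -> (0 < n)%N -> n%:R * tau <= T -> 0 <= K ->
  (forall (z : R) (k : nat), 0 < z ->
    `|deficit z n - deficit (z / t ^+ k) (2 ^ k * n)| <= K * z * n%:R `^ (alpha - 2)) ->
  `|\int[mu]_(s in `]0, n%:R * tau[) phi s + c / 2 * deficit (lam * tau `^ alpha) n| <=
    `|c| * K * (lam * tau `^ alpha) * n%:R `^ (alpha - 2).
Proof.
move=> tau0 n0 nT K0 hK; set z := lam * _.
have z0 : 0 <= z by rewrite mulr_ge0// powR_ge0.
apply/ler_addgt0Pr => e e0.
have [q q01 [C [i0 h]]] := fine_limit tau0 n0 nT e0.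
apply: (le_of_geometric (c := C) q01) => j _.
set I := \int[mu]_(s in _) _.
have hz : `|deficit z n - deficit (z / t ^+ (i0 + j)) (2 ^ (i0 + j) * n)| <= K * z * n%:R `^ (alpha - 2).
  move: z0; rewrite le_eqVlt => /predU1P[<-|z0]; last exact: hK.
  by rewrite mul0r /deficit !mul0r subrr normr0 mulr0 mul0r.
have -> : I + c / 2 * deficit z n = (I + c / 2 * deficit (z / t ^+ (i0 + j)) (2 ^ (i0 + j) * n)) +
   c / 2 * (deficit z n - deficit (z / t ^+ (i0 + j)) (2 ^ (i0 + j) * n)) by ring.
apply: (le_trans (ler_normD _ _)).
have : `|c / 2 * (deficit z n - deficit (z / t ^+ (i0 + j)) (2 ^ (i0 + j) * n))| <= `|c| * K * z * n%:R `^ (alpha - 2).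
  rewrite normrM (_ : `|c| * K * z * _ = `|c| * (K * z * n%:R `^ (alpha - 2))); last by ring.
  apply: ler_pM => //.
  by rewrite normrM ler_piMr// ger0_norm// invf_le1// ler1n.
have := h j; rewrite -/z -/I; lra.
Qed.

End scalar.

(** * The integrated fractional derivative and the Gamma constant *)

Section power.
Context {R : realType}.
Local Notation mu := (@lebesgue_measure R).

Lemma mem_itv_oo (x y s : R) : (s \in [set` `]x, y[]) = (x < s < y).
Proof. by apply/idP/idP; rewrite inE/= in_itv. Qed.

Lemma measurable_shift_powR (s p : R) (D : set (measurableTypeR R)) :
  measurable_fun D (fun t => (t - s) `^ p).
Proof.
by apply: (measurableT_comp (measurable_powR _)); apply: measurable_funB.
Qed.

Lemma is_derive_shift_powR (s p x : R) : s < x -> p != 0 ->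
  is_derive x 1 (fun t => (t - s) `^ p / p) ((x - s) `^ (p - 1)).
Proof.
move=> sx p0.
have xs : 0 < x - s by rewrite subr_gt0.
have h1 : is_derive x 1 (fun t => t - s : R) 1 by apply: is_derive_eq; rewrite subr0.
have h2 := @is_derive1_comp R (@powR R ^~ p) (fun t => t - s) x _ _ (is_derive1_powR p xs) h1.
have h3 := is_deriveZ p^-1 h2.
have -> : (fun t => (t - s) `^ p / p) = p^-1 *: ((@powR R ^~ p) \o (fun t => t - s)).
  by apply/funext => t; rewrite /= mulrC.
apply: (is_derive_eq h3).
by rewrite /GRing.scale/= mulr1 mulrA mulVf// mul1r.
Qed.

(** The singular interval is exhausted by closed ones, to which the fundamental theorem
    of calculus applies. *)
Lemma integral_shift_powR (s r be : R) : s <= r -> 0 <= be < 1 ->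
  (\int[mu]_(t in `]s, r[) ((t - s) `^ (- be))%:E = ((r - s) `^ (1 - be) / (1 - be))%:E)%E.
Proof.
move=> sr /andP[be0 be1].
have p0 : 0 < 1 - be by rewrite subr_gt0.
have pn0 : 1 - be != 0 by rewrite gt_eqF.
move: sr; rewrite le_eqVlt => /predU1P[<-|sr].
  by rewrite subrr powR0// mul0r set_itv_ge ?integral_set0// bnd_simp ltxx.
have mf (D : set (measurableTypeR R)) : measurable_fun D (fun t => ((t - s) `^ (- be))%:E).
  by apply/measurable_EFinP; exact: measurable_shift_powR.
rewrite integral_itv_bndo_bndc//; last exact: mf.
have half : 0 <= (2^-1 : R) < 1 by apply/andP; split; lra.
have h0 n : 0 < 2^-1 ^+ n :> R by rewrite exprn_gt0// invr_gt0.
pose a n : R := s + (r - s) * 2^-1 ^+ n.+1.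
have rs0 : 0 < r - s by rewrite subr_gt0.
have sa n : s < a n by rewrite /a ltrDl mulr_gt0.
have ar n : a n < r.
  rewrite /a -ltrBrDl gtr_pMr// exprn_ilt1//; lra.
have da n m : (n <= m)%N -> a m <= a n.
  move=> nm; rewrite /a lerD2l ler_wpM2l ?(ltW rs0)// ler_wiXn2l//; lra.
have cup : \bigcup_n [set` `[a n, r]] = [set` `]s, r]].
  apply/seteqP; split => x /=.
    by move=> [n _] /=; rewrite !in_itv/= => /andP[anx ->]; rewrite (lt_le_trans (sa n) anx).
  rewrite in_itv/= => /andP[sx xr]; have xs : 0 < x - s by rewrite subr_gt0.
  have [n hn] := small_pow (r - s) half xs.
  by exists n => //=; rewrite in_itv/= xr andbT /a -lerBrDl; apply: hn.
have nd : nondecreasing_seq (fun n => [set` `[a n, r]] : set (measurableTypeR R)).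
  apply/nondecreasing_seqP => n; rewrite subsetEset; apply: subset_itv; rewrite bnd_simp//.
  exact: da.
have := @ge0_nondecreasing_set_cvg_integral _ _ R (fun n => [set` `[a n, r]] : set (measurableTypeR R))
  (fun t => ((t - s) `^ (- be))%:E) mu nd (fun=> measurable_itv _) (fun=> mf _)
  (fun i x _ => powR_ge0 _ _).
rewrite cup => cv.
have ftc n : (\int[mu]_(x in `[a n, r]) ((x - s) `^ (- be))%:E =
   ((r - s) `^ (1 - be) / (1 - be) - (a n - s) `^ (1 - be) / (1 - be))%:E)%E.
  have D x : a n <= x -> is_derive x 1 (fun t => (t - s) `^ (1 - be) / (1 - be)) ((x - s) `^ (- be)).
    move=> ax; have sx : s < x by apply: lt_le_trans ax.
    by have := is_derive_shift_powR sx pn0; rewrite addrAC subrr add0r.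
  have D2 x : a n <= x -> is_derive x 1 (fun t => (t - s) `^ (- be)) (- be * (x - s) `^ (- be - 1)).
    move=> ax; have sx : 0 < x - s by rewrite subr_gt0 (lt_le_trans _ ax).
    have h1 : is_derive x 1 (fun t => t - s : R) 1 by apply: is_derive_eq; rewrite subr0.
    have := @is_derive1_comp R (@powR R ^~ (- be)) (fun t => t - s) x _ _ (is_derive1_powR (- be) sx) h1.
    by move=> h; apply: is_derive_eq; rewrite mulr1.
  have C x : a n <= x -> {for x, continuous (fun t => (t - s) `^ (1 - be) / (1 - be))}.
    by move=> /D [d _]; apply: differentiable_continuous; exact/derivable1_diffP.
  rewrite (@continuous_FTC2 _ _ (fun t => (t - s) `^ (1 - be) / (1 - be)))//.
  - apply/continuous_in_subspaceT => x; rewrite inE/= in_itv/= => /andP[ax _].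
    by have [d _] := D2 x ax; apply: differentiable_continuous; exact/derivable1_diffP.
  - split.
    + by move=> x; rewrite in_itv/= => /andP[/ltW ax _]; have [d _] := D x ax.
    + by apply: cvg_at_right_filter; exact: C.
    + by apply: cvg_at_left_filter; apply: C; rewrite ltW.
  - move=> x; rewrite in_itv/= => /andP[/ltW ax _]; rewrite derive1E.
    by have [_ ->] := D x ax.
have lim : (fun n => \int[mu]_(x in `[a n, r]) ((x - s) `^ (- be))%:E)%E @ \oo -->
   ((r - s) `^ (1 - be) / (1 - be))%:E.
  under eq_fun do rewrite ftc.
  apply: cvg_EFin; first by apply: nearW.
  rewrite -[X in _ --> X]subr0; apply: cvgB; first exact: cvg_cst.
  pose q : R := 2^-1 `^ (1 - be).
  have q1 : `|q| < 1.
    rewrite ger0_norm ?powR_ge0// /q /powR; have -> : 2^-1 == 0 :> R = false by rewrite gt_eqF.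
    rewrite expR_lt1 pmulr_rlt0// ln_lt0// invr_gt0 ltr0n invf_lt1//= ltr1n//.
  have -> : (fun n => (a n - s) `^ (1 - be) / (1 - be)) =
     (fun n => (r - s) `^ (1 - be) / (1 - be) * q * q ^+ n).
    apply/funext => n; rewrite /a addrAC subrr add0r powRM ?(ltW rs0) ?(ltW (h0 _))//.
    have -> : (2^-1 ^+ n.+1) `^ (1 - be) = q ^+ n.+1 :> R.
      by rewrite -[2^-1 ^+ n.+1]powR_mulrn ?invr_ge0// -powRrM mulrC powRrM powR_mulrn ?powR_ge0.
    by rewrite exprS; ring.
  rewrite -(mulr0 ((r - s) `^ (1 - be) / (1 - be) * q)).
  by apply: cvgM; [exact: cvg_cst|exact: cvg_expr].
exact: (cvg_unique _ cv lim).
Qed.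

End power.

Section integrated.
Context {R : realType}.
Local Notation mu := (@lebesgue_measure R).
Variables (T be : R) (phi : R -> R).
Hypothesis be01 : 0 <= be < 1.
Hypothesis phii : mu.-integrable `]0, T[ (EFin \o phi).

(** The fractional integral, up to the factor Gamma(1 - be). *)
Definition abel t := \int[mu]_(s in `]0, t[) (phi s * (t - s) `^ (- be)).

(** Fubini's theorem on the triangle 0 < s < t < r. *)
Lemma abel_integral r : 0 <= r <= T ->
  mu.-integrable `]0, r[ (EFin \o abel) /\
  \int[mu]_(t in `]0, r[) abel t =
  \int[mu]_(s in `]0, r[) (phi s * ((r - s) `^ (1 - be) / (1 - be))).
Proof.
move=> /andP[r0 rT]; have /andP[be0 be1] := be01.
have p0 : 0 < 1 - be by rewrite subr_gt0.
pose ph := phi \_ `]0, r[ : measurableTypeR R -> R.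
have phir : mu.-integrable `]0, r[ (EFin \o phi) by exact: integrable_subitv phii _ rT.
have ph_i : mu.-integrable setT (EFin \o ph).
  by rewrite -restrict_EFin; apply/integrable_restrict => //=; rewrite setTI.
have mph : measurable_fun setT ph by apply/measurable_EFinP; exact: measurable_int ph_i.
pose k (t s : measurableTypeR R) : R := if (0 < s) && (s < t) && (t < r) then (t - s) `^ (- be) else 0.
pose ka (s : measurableTypeR R) : R := if (0 < s) && (s < r) then (r - s) `^ (1 - be) / (1 - be) else 0.
have k0 t s : 0 <= k t s by rewrite /k; case: ifP => // _; exact: powR_ge0.
have ka0 s : 0 <= ka s.
  by rewrite /ka; case: ifP => // _; rewrite divr_ge0 ?powR_ge0// ltW.
have kint s : (\int[mu]_t (k t s)%:E = (ka s)%:E)%E.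
  rewrite /ka; case: ifPn => [/andP[s0 sr]|nsr].
    rewrite -(integral_shift_powR (ltW sr) be01) [RHS]integral_mkcond; apply: eq_integral => t _.
    rewrite patchE /k s0/=; case: ifPn => [h|]; first by rewrite mem_set//= in_itv.
    by move=> h; rewrite memNset//= in_itv/=; exact/negP.
  rewrite integral0_eq// => t _; rewrite /k; case: ifP => // /andP[/andP[s0 st] tr].
  by rewrite s0 (lt_trans st tr) in nsr.
have mk : measurable_fun setT (fun x : measurableTypeR R * measurableTypeR R => k x.1 x.2).
  rewrite /k; apply: measurable_fun_ifT => //.
    apply: measurable_and; first apply: measurable_and.
    - by apply: measurable_fun_ltr.
    - by apply: measurable_fun_ltr.
    - by apply: measurable_fun_ltr.
  by apply: (measurableT_comp (measurable_powR _)); apply: measurable_funB.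
have mk1 s : measurable_fun setT (k ^~ s).
  by apply: (measurableT_comp mk (g := fun t => (t, s))); exact: measurable_pair2.
have ki s : mu.-integrable setT (EFin \o k ^~ s).
  apply/integrableP; split; first exact/measurable_EFinP.
  under eq_integral do rewrite /= ger0_norm//.
  by rewrite kint ltry.
have mka : measurable_fun setT ka.
  rewrite /ka; apply: measurable_fun_ifT => //.
    by apply: measurable_and; apply: measurable_fun_ltr.
  apply: measurable_funM => //; apply: (measurableT_comp (measurable_powR _)).
  by apply: measurable_funB.
have phka : mu.-integrable setT (EFin \o (fun s => ph s * ka s)).
  apply: (integrable_mul_bounded (K := r `^ (1 - be) / (1 - be))) => // s _.
  rewrite ger0_norm// /ka; case: ifP => [/andP[s0 sr]|_]; last by rewrite divr_ge0 ?powR_ge0// ltW.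
  rewrite ler_wpM2r ?invr_ge0 ?(ltW p0)//; apply: ge0_ler_powR => //; first exact: ltW.
  - by rewrite nnegrE subr_ge0 ltW.
  - by rewrite gerBl ltW.
pose f (x : measurableTypeR R * measurableTypeR R) := (ph x.2 * k x.1 x.2)%:E.
have mf : measurable_fun setT f.
  by apply/measurable_EFinP; apply: measurable_funM => //; exact: measurableT_comp.
have fi : (mu \x mu)%E.-integrable setT f.
  apply/integrable21ltyP => //.
  under eq_integral => s _.
    rewrite (eq_integral (fun t => `|ph s|%:E * (k t s)%:E)%E); last first.
      by move=> t _; rewrite /f/= normrM (ger0_norm (k0 _ _)) EFinM.
    rewrite ge0_integralZl//; last 2 first.
    - exact/measurable_EFinP.
    - by move=> t _; rewrite lee_fin.
    rewrite kint -EFinM.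
    over.
  move/integrableP : phka => [_]; apply: le_lt_trans; rewrite le_eqVlt; apply/orP; left; apply/eqP.
  by apply: eq_integral => s _; rewrite /= normrM (ger0_norm (ka0 s)).
have GE s : fubini_G mu f s = (ph s * ka s)%:E.
  rewrite /fubini_G.
  rewrite EFinM -kint -integralZl//; last exact: ki.
pose F := fubini_F mu f.
have Fi : mu.-integrable setT F := integrable_fubini_F fi.
have FE t : 0 < t < r -> abel t = fine (F t).
  move=> /andP[t0 tr]; rewrite /abel /Rintegral; congr fine; rewrite integral_mkcond.
  rewrite /F /fubini_F; apply: eq_integral => s _; rewrite patchE /f /ph /k/= patchE.
  rewrite !mem_itv_oo tr andbT; case: ifPn => [/andP[s0 st]|_]; last by rewrite mulr0.
  by rewrite s0 (lt_trans st tr).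
have mF : measurable_fun setT F by exact: measurable_int Fi.
have fFi : mu.-integrable setT (EFin \o (fine \o F)).
  apply: le_integrable Fi => //.
    by apply/measurable_EFinP; exact: (measurableT_comp _ mF).
  by move=> t _ /=; case: (F t) => [x| |]//=; rewrite ?normr0 ?leey.
have abE : {in `]0, r[%classic, EFin \o abel =1 EFin \o (fine \o F)}.
  by move=> t; rewrite inE/= in_itv/= => /FE ->.
split.
  have : mu.-integrable `]0, r[ (EFin \o (fine \o F)) by exact: integrableS fFi.
  by apply: eq_integrable => // t ht; rewrite abE.
have F0 t : ~ (0 < t < r) -> F t = 0%E.
  move=> nt; rewrite /F /fubini_F integral0_eq// => s _; rewrite /f /k/=.
  case: ifP => // [/andP[/andP[s0 st] tr]|_]; last by rewrite mulr0.
  by exfalso; apply: nt; rewrite tr (lt_trans s0 st).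
have -> : \int[mu]_(t in `]0, r[) abel t = \int[mu]_(t in `]0, r[) (fine \o F) t.
  by apply: eq_Rintegral => t; rewrite mem_itv_oo => /FE ->.
rewrite /Rintegral.
have -> : (\int[mu]_(t in `]0%R, r[) ((fine \o F) t)%:E = \int[mu]_t F t)%E.
  rewrite integral_mkcond; apply: ae_eq_integral => //.
  - by apply/(measurable_restrict _ _ _).1 => //; rewrite setTI; apply: measurable_funTS; exact: measurable_int fFi.
  - have := integrable_ae measurableT Fi; apply: filterS => t h _; rewrite patchE.
    rewrite mem_itv_oo; case: ifPn => [_|/negP/F0 ->//].
    by rewrite fineK// h.
rewrite (integral12_prod_meas1 fi) -(integral21_prod_meas1 fi).
congr fine; transitivity (\int[mu]_s (ph s * ka s)%:E)%E; first by apply: eq_integral => s _; exact: GE.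
rewrite [RHS]integral_mkcond; apply: eq_integral => s _; rewrite patchE /ph /ka patchE.
by rewrite mem_itv_oo; case: ifPn => // _; rewrite mul0r.
Qed.

End integrated.

Section gamma.
Context {R : realType} (alpha : R) (b : nat -> R) (l : R).
Hypotheses (alpha01 : 0 < alpha < 1) (hb : cq_weights alpha b).
Local Notation mu := (@lebesgue_measure R).
Local Notation a := (cq_sum b).
Hypothesis l0 : 0 < l.
Hypothesis hl : forall j, l * j.+1%:R `^ (- alpha) <= a j /\ a j.+1 <= l * j.+1%:R `^ (- alpha).
Let a0 : 0 < alpha. Proof. by case/andP: alpha01. Qed.
Let a1 : alpha < 1. Proof. by case/andP: alpha01. Qed.
Let al01 : 0 <= alpha < 1. Proof. by rewrite (ltW a0) a1. Qed.

Lemma cq_sum_generating x : 0 < x < 1 ->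
  (fun N => \sum_(0 <= i < N) a i * x ^+ i) @ \oo --> (1 - x) `^ alpha / (1 - x).
Proof.
move=> /andP[x0 x1]; have y0 : 0 < 1 - x by rewrite subr_gt0.
have xn : `|x| < 1 by rewrite gtr0_norm.
have E N : \sum_(0 <= i < N) a i * x ^+ i =
   (series (fun j => b j * x ^+ j) N - pre a N * x ^+ N) / (1 - x).
  have y1 : 1 - x != 0 by rewrite gt_eqF.
  apply: (mulIf y1); rewrite divfK//.
  rewrite /series/=; elim: N => [|N IH]; first by rewrite !big_nil mul0r mul0r subr0.
  rewrite !big_nat_recr//= mulrDl IH; case: N {IH} => [|N] /=.
    by rewrite !expr0 (cq_sum0 hb) (cq_weights0 hb) !mul0r; ring.
  by rewrite (cq_sumS b N) !exprS; ring.
under eq_fun do rewrite E.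
apply: cvgM; last exact: cvg_cst.
rewrite -[X in _ --> X]subr0; apply: cvgB; first exact: hb.
apply: (@squeeze_cvgr _ _ _ _ (cst 0) (fun N => x ^+ N)); last 2 first.
- exact: cvg_cst.
- exact: cvg_expr.
apply: nearW => N; have X0 : 0 <= x ^+ N by rewrite exprn_ge0// ltW.
have : 0 <= pre a N <= 1.
  by case: N {X0} => [|N] /=; rewrite ?lexx ?ler01// (cq_sum_le1 alpha01 hb) ltW// (cq_sum_gt0 alpha01 hb).
by move=> /andP[p0 p1]; rewrite mulr_ge0//= ler_piMl.
Qed.

Let f t := t `^ (- alpha) * expR (- t).

Lemma power_integrable (r : R) : 0 <= r -> mu.-integrable `]0, r[ (EFin \o (fun t => t `^ (- alpha))).
Proof.
move=> r0; apply/integrableP; split.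
  by apply/measurable_EFinP; apply: measurable_funTS; exact: measurable_powR.
rewrite (eq_integral (fun t : measurableTypeR R => ((t - 0) `^ (- alpha))%:E)); last first.
  by move=> t _ /=; rewrite subr0 ger0_norm// powR_ge0.
by rewrite integral_shift_powR// ltry.
Qed.

Lemma measurable_expRN (D : set (measurableTypeR R)) : measurable_fun D (fun t : R => expR (- t)).
Proof. by apply: measurable_funTS; apply: measurableT_comp => //; exact: measurable_expR. Qed.

Lemma expRN_bounded t : 0 < t -> `|expR (- t)| <= 1 :> R.
Proof. by move=> t0; rewrite ger0_norm ?expR_ge0// -[leRHS]expR0 ler_expR oppr_le0 ltW. Qed.

Lemma gamma_integrable (r : R) : 0 <= r -> mu.-integrable `]0, r[ (EFin \o f).
Proof.
move=> r0; apply: (integrable_mul_bounded (K := 1) _ (power_integrable r0)) => //.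
- exact: measurable_expRN.
- by move=> t; rewrite /= in_itv/= => /andP[t0 _]; exact: expRN_bounded.
Qed.

Lemma Rintegral_cst_itv (c x y : R) : x <= y -> \int[mu]_(t in `]x, y[) c = c * (y - x).
Proof.
move=> xy; rewrite Rintegral_cst//= lebesgue_measure_itv/= lte_fin.
by move: xy; rewrite le_eqVlt => /predU1P[->|->]//=; rewrite ltxx subrr.
Qed.

(** The integrand t^(-alpha) e^(-t) decreases, so each cell lies between its end
    values. *)
Lemma gamma_cell_bounds (h : R) i : 0 < h ->
  h `^ (1 - alpha) * (i.+1%:R `^ (- alpha) * expR (- h) ^+ i.+1) <=
    \int[mu]_(t in `]i%:R * h, i.+1%:R * h[) f t /\
  ((0 < i)%N -> \int[mu]_(t in `]i%:R * h, i.+1%:R * h[) f t <=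
    h `^ (1 - alpha) * (i%:R `^ (- alpha) * expR (- h) ^+ i)).
Proof.
move=> h0.
have hp : h `^ (1 - alpha) = h `^ (- alpha) * h.
  have hn0 : h != 0 by rewrite gt_eqF.
  by rewrite -{3}[h]powRr1 ?(ltW h0)// -powRD ?hn0 ?implybT// addrC.
have ih0 : 0 <= i%:R * h by rewrite mulr_ge0// ltW.
have ih1 : i%:R * h <= i.+1%:R * h by rewrite ler_wpM2r ?(ltW h0)// ler_nat.
have i1h : 0 <= i.+1%:R * h by apply: le_trans ih1.
have fi : mu.-integrable `]i%:R * h, i.+1%:R * h[ (EFin \o f).
  exact: integrable_subitv (gamma_integrable i1h) ih0 (lexx _).
have ci c : mu.-integrable `]i%:R * h, i.+1%:R * h[ (EFin \o (fun=> c : R)).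
  apply: (@measurable_bounded_integrable _ _ R mu (fun=> c)) => //.
    by rewrite /= lebesgue_measure_itv/=; case: ifP => _; rewrite ?ltry// -EFinB ltry.
  by exists `|c|; split => // M cM x _; exact: ltW.
have ex k : expR (- h) ^+ k = expR (- (k%:R * h)) by rewrite -expRM_natl mulrN mulr_natl.
have pm x y : 0 < x -> x <= y -> y `^ (- alpha) <= x `^ (- alpha).
  move=> x0 xy; rewrite !powRN lef_pV2 ?posrE ?powR_gt0 ?(lt_le_trans x0)//.
  by rewrite ge0_ler_powR ?nnegrE ?(ltW a0) ?(ltW x0)// (le_trans (ltW x0)).
have len : i.+1%:R * h - i%:R * h = h by rewrite -mulrBl -natrB// subSnn mul1r.
split=> [|i0].
  have -> : h `^ (1 - alpha) * (i.+1%:R `^ (- alpha) * expR (- h) ^+ i.+1) =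
     \int[mu]_(t in `]i%:R * h, i.+1%:R * h[) ((i.+1%:R * h) `^ (- alpha) * expR (- (i.+1%:R * h))).
    by rewrite Rintegral_cst_itv// len ex powRM ?(ltW h0)// hp; ring.
  apply: le_Rintegral => // t; rewrite /= in_itv/= => /andP[t1 t2].
  have t0 : 0 < t by apply: le_lt_trans t1.
  by rewrite /f ler_pM ?powR_ge0 ?expR_ge0 ?ler_expR ?lerN2 ?(ltW t2)// pm// ltW.
have -> : h `^ (1 - alpha) * (i%:R `^ (- alpha) * expR (- h) ^+ i) =
   \int[mu]_(t in `]i%:R * h, i.+1%:R * h[) ((i%:R * h) `^ (- alpha) * expR (- (i%:R * h))).
  by rewrite Rintegral_cst_itv// len ex powRM ?(ltW h0)// hp; ring.
have ihp : 0 < i%:R * h by rewrite mulr_gt0// ltr0n.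
apply: le_Rintegral => // t; rewrite /= in_itv/= => /andP[t1 t2].
by rewrite /f ler_pM ?powR_ge0 ?expR_ge0 ?ler_expR ?lerN2 ?(ltW t1)// pm// ltW.
Qed.

(** The cell bounds are Riemann sums of i^(-alpha) x^i with x = e^(-h). Replacing
    l i^(-alpha) by the neighbouring partial sums of the weights turns them into
    the generating function of those sums at x. *)
Lemma gamma_partial_bounds (h : R) N : 0 < h ->
  h `^ (1 - alpha) * (\sum_(0 <= i < N.+1) a i * expR (- h) ^+ i - 1) <=
    l * \int[mu]_(t in `]0, N%:R * h[) f t <=
  h `^ (1 - alpha) * (\sum_(0 <= i < N) a i * expR (- h) ^+ i + l / (1 - alpha)).
Proof.
move=> h0; have x0 : 0 <= expR (- h) by exact: expR_ge0.
have x1 : expR (- h) <= 1 by rewrite -[leRHS]expR0 ler_expR oppr_le0 ltW.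
have Nh : 0 <= N%:R * h by rewrite mulr_ge0// ltW.
have H0 : 0 <= h `^ (1 - alpha) by exact: powR_ge0.
rewrite (Rintegral_cells (ltW h0)); last exact: gamma_integrable.
apply/andP; split.
  rewrite big_nat_recl// (cq_sum0 hb) expr0 mulr1 addrAC subrr add0r !mulr_sumr.
  apply: ler_sum => i _; have [h1 _] := gamma_cell_bounds i h0; have [_ h2] := hl i.
  apply: le_trans (ler_wpM2l (ltW l0) h1); rewrite [leRHS]mulrCA ler_wpM2l// mulrA.
  by rewrite ler_wpM2r ?exprn_ge0.
case: N Nh => [_|N Nh].
  by rewrite !big_nil mulr0 add0r mulr_ge0// divr_ge0 ?(ltW l0)// subr_ge0 ltW.
rewrite big_nat_recl// mulrDr mulrDr addrC; apply: lerD.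
  rewrite [leRHS]mulr_sumr big_nat_recr//= -[leLHS]addr0; apply: lerD; last first.
    by rewrite !mulr_ge0 ?exprn_ge0// ltW// (cq_sum_gt0 alpha01 hb).
  rewrite mulr_sumr; apply: ler_sum => i _; have [_ h1] := gamma_cell_bounds i.+1 h0; have [h2 _] := hl i.
  apply: (le_trans (ler_wpM2l (ltW l0) (h1 isT))); rewrite [leLHS]mulrCA ler_wpM2l// mulrA.
  apply: ler_pM => //; rewrite ?mulr_ge0 ?powR_ge0 ?exprn_ge0 ?(ltW l0)//.
  by rewrite exprS ler_piMl ?exprn_ge0.
rewrite [leRHS]mulrCA ler_wpM2l ?(ltW l0)//.
have hh : 0 <= 1%:R * h by rewrite mul1r ltW.
have -> : h `^ (1 - alpha) / (1 - alpha) = \int[mu]_(t in `]0%:R * h, 1%:R * h[) (t `^ (- alpha)).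
  rewrite mul0r mul1r /Rintegral (eq_integral (fun t : measurableTypeR R => ((t - 0) `^ (- alpha))%:E)); last first.
    by move=> t _; rewrite subr0.
  by rewrite integral_shift_powR ?(ltW h0)// subr0.
rewrite mul0r; apply: le_Rintegral => //.
- exact: gamma_integrable.
- exact: power_integrable.
- move=> t; rewrite /= in_itv/= => /andP[t0 _]; rewrite /f ler_piMr ?powR_ge0//.
  by rewrite -[leRHS]expR0 ler_expR oppr_le0 ltW.
Qed.

(** 1 - e^(-h) lies between h / (1 + h) and h. *)
Lemma exp_ratio_bound (h : R) : 0 < h <= 1 ->
  1 <= h `^ (1 - alpha) * ((1 - expR (- h)) `^ alpha / (1 - expR (- h))) <= 1 + h.
Proof.
move=> /andP[h0 h1]; set y := 1 - expR (- h).
have yh : y <= h by rewrite /y lerBlDr -lerBlDl; apply: expR_ge1Dx.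
have y0 : 0 < y by rewrite /y subr_gt0 -[ltRHS]expR0 ltr_expR oppr_lt0.
have hy : h <= (1 + h) * y.
  have e1 : 1 + h <= expR h by exact: expR_ge1Dx.
  have : (1 + h) * expR (- h) <= 1.
    by rewrite expRN ler_pdivrMr ?expR_gt0// mul1r.
  rewrite /y; lra.
have yn0 : y != 0 by rewrite gt_eqF.
have b0 : 0 < 1 - alpha by rewrite subr_gt0.
have -> : y `^ alpha / y = y `^ (- (1 - alpha)).
  by rewrite opprB powRD ?yn0 ?implybT// powR_inv1 ?(ltW y0).
rewrite powRN; apply/andP; split.
  by rewrite ler_pdivlMr ?powR_gt0// mul1r ge0_ler_powR ?nnegrE ?(ltW b0) ?(ltW y0) ?(ltW h0).
rewrite ler_pdivrMr ?powR_gt0//.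
have h10 : 0 <= 1 + h by rewrite addr_ge0// ltW.
apply: (@le_trans _ _ (((1 + h) * y) `^ (1 - alpha))).
  by rewrite ge0_ler_powR ?nnegrE ?(ltW b0) ?mulr_ge0 ?(ltW y0) ?(ltW h0).
rewrite powRM ?(ltW y0)// ler_wpM2r ?powR_ge0//.
by rewrite -[leRHS](powRr1 h10) ler_powR ?lerDl ?(ltW h0)//; have := a0; lra.
Qed.

(** h^(1 - alpha) (1 - e^(-h))^(alpha - 1) -> 1 as h -> 0. *)
Lemma gamma_bounds (h : R) : 0 < h <= 1 ->
  1 - h `^ (1 - alpha) <= l * Gamma (1 - alpha) <= 1 + h + h `^ (1 - alpha) * (l / (1 - alpha)).
Proof.
move=> h01; have /andP[h0 h1] := h01.
set x := expR (- h); set S := (1 - x) `^ alpha / (1 - x).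
have x01 : 0 < x < 1 by rewrite /x expR_gt0/= -[ltRHS]expR0 ltr_expR oppr_lt0.
have cS := cq_sum_generating x01; rewrite -/S in cS.
have /andP[S1 S2] := exp_ratio_bound h01; rewrite -/x -/S in S1 S2.
have H0 : 0 <= h `^ (1 - alpha) by exact: powR_ge0.
pose I N := \int[mu]_(t in `]0, N%:R * h[) f t.
have SN N : \sum_(0 <= i < N) a i * x ^+ i <= S.
  have nd : nondecreasing_seq (fun N => \sum_(0 <= i < N) a i * x ^+ i).
    apply/nondecreasing_seqP => n; rewrite big_nat_recr//= lerDl mulr_ge0 ?exprn_ge0 ?expR_ge0//.
    by rewrite ltW// (cq_sum_gt0 alpha01 hb).
  rewrite -(cvg_lim _ cS)//; apply: nondecreasing_cvgn_le => //.
  by apply: cvgP cS.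
have Nh N : 0 <= N%:R * h by rewrite mulr_ge0// ltW.
pose U : R := h `^ (1 - alpha) * (S + l / (1 - alpha)).
have IU N : l * I N <= U.
  have /andP[_] := gamma_partial_bounds N h0; move=> /le_trans; apply.
  by rewrite ler_wpM2l// lerD2r.
have mf (D : set (measurableTypeR R)) : measurable_fun D (EFin \o f).
  apply/measurable_EFinP; apply: measurable_funTS; apply: measurable_funM; first exact: measurable_powR.
  exact: measurable_expRN.
have f0 t : 0 <= f t by rewrite mulr_ge0 ?powR_ge0 ?expR_ge0.
have IE N : (\int[mu]_(t in `]0%R, (N%:R * h)%R[) (EFin \o f) t = (I N)%:E)%E.
  by rewrite /I /Rintegral fineK// integrable_fin_num//; exact: gamma_integrable.
have nd : nondecreasing_seq (fun N => [set` `]0, N%:R * h[] : set (measurableTypeR R)).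
  apply/nondecreasing_seqP => n; rewrite subsetEset; apply: subset_itv; rewrite bnd_simp//.
  by rewrite ler_wpM2r ?(ltW h0)// ler_nat.
have := @ge0_nondecreasing_set_cvg_integral _ _ R (fun N => [set` `]0, N%:R * h[] : set (measurableTypeR R)) (EFin \o f) mu nd (fun=> measurable_itv _)
  (fun=> mf _) (fun i x _ => f0 x).
have -> : \bigcup_N [set` `]0, N%:R * h[] = [set` `]0, +oo[] :> set R.
  apply/seteqP; split => t /=; first by move=> [n _] /=; rewrite !in_itv/= => /andP[-> _].
  rewrite in_itv/= andbT => t0; exists (Num.truncn (t / h)).+1 => //=; rewrite in_itv/= t0/=.
  by rewrite -ltr_pdivrMr// truncnS_gt.
set E := (\int[mu]_(_ in _) _)%E => cE.
have El : (E <= (U / l)%:E)%E.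
  by apply: (cvge_to_le cE); apply: nearW => N; rewrite IE lee_fin ler_pdivlMr// mulrC.
have E0 : (0 <= E)%E by apply: integral_ge0 => t _; rewrite lee_fin.
have GE : Gamma (1 - alpha) = fine E.
  rewrite /Gamma /Rintegral /E; congr fine; apply: eq_integral => t _; rewrite /= /f.
  by congr ((_ `^ _ * _)%:E); ring.
have EE : E = (Gamma (1 - alpha))%:E.
  by rewrite GE fineK// ge0_fin_numE// (le_lt_trans El) ?ltry.
apply/andP; split; last first.
  move: El; rewrite EE lee_fin ler_pdivlMr// mulrC => /le_trans; apply.
  by rewrite /U mulrDr lerD2r.
have IG N : I N <= Gamma (1 - alpha).
  rewrite -lee_fin -IE -EE; apply: ge0_subset_integral => //.
    by move=> t _; rewrite lee_fin; exact: f0.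
  by apply: subset_itvl; rewrite bnd_simp.
have LG N : h `^ (1 - alpha) * (\sum_(0 <= i < N.+1) a i * x ^+ i - 1) <= l * Gamma (1 - alpha).
  have /andP[+ _] := gamma_partial_bounds N h0; move=> /le_trans; apply.
  by rewrite ler_wpM2l ?(ltW l0)//; exact: IG.
have cL : (fun N => h `^ (1 - alpha) * (\sum_(0 <= i < N.+1) a i * x ^+ i - 1)) @ \oo --> h `^ (1 - alpha) * (S - 1).
  apply: cvgM; first exact: cvg_cst.
  apply: cvgB; last exact: cvg_cst.
  by have := cS; rewrite -(cvg_shiftS _).
apply: le_trans (cvgr_to_le cL _); last by apply: nearW => N; exact: LG.
by rewrite mulrBr mulr1 lerB.
Qed.

Lemma gamma_cq_limit : l * Gamma (1 - alpha) = 1.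
Proof.
have b0 : 0 < 1 - alpha by rewrite subr_gt0.
pose q : R := 2^-1 `^ (1 - alpha).
have hq : 2^-1 <= q.
  rewrite /q -{1}[2^-1](powRr1 (_ : 0 <= 2^-1)) ?invr_ge0//.
  rewrite /powR; have -> : 2^-1 == 0 :> R = false by rewrite gt_eqF.
  rewrite ler_expR ler_wnM2r//; last by have := a0; lra.
  by rewrite ln_le0// invf_le1// ler1n.
have q01 : 0 <= q < 1.
  rewrite powR_ge0/= /q /powR; have -> : 2^-1 == 0 :> R = false by rewrite gt_eqF.
  rewrite expR_lt1 pmulr_rlt0// ln_lt0// invr_gt0 ltr0n invf_lt1//= ltr1n//.
have qX m : (2^-1 ^+ m) `^ (1 - alpha) = q ^+ m :> R.
  by rewrite -[2^-1 ^+ m]powR_mulrn ?invr_ge0// -powRrM mulrC powRrM powR_mulrn ?powR_ge0.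
have hm m : 0 < (2^-1 ^+ m : R) <= 1.
  by rewrite exprn_gt0 ?invr_gt0//= exprn_ile1 ?invr_ge0// invf_le1// ler1n.
have qm m : 2^-1 ^+ m <= q ^+ m :> R by rewrite lerXn2r ?nnegrE ?invr_ge0//; case/andP: q01.
apply/eqP; rewrite eq_le; apply/andP; split.
  apply: (le_of_geometric (c := 1 + l / (1 - alpha)) q01) => m _.
  have /andP[_] := gamma_bounds (hm m); rewrite qX => /le_trans; apply.
  by rewrite -addrA lerD2l mulrDl mul1r [l / _ * _]mulrC lerD2r.
apply: (le_of_geometric (c := 1) q01) => m _.
by have /andP[+ _] := gamma_bounds (hm m); rewrite qX; lra.
Qed.

End gamma.

(** * The error of a scalar functional *)

Section lincomb.
Context {R : realType}.
Local Notation mu := (@lebesgue_measure R).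

Lemma Rintegral_lincomb (I : Type) (s : seq I) (w : I -> R) (f : I -> R -> R)
    (D : set (measurableTypeR R)) : measurable D ->
  (forall i, mu.-integrable D (EFin \o f i)) ->
  mu.-integrable D (EFin \o (fun x => \sum_(i <- s) w i * f i x)) /\
  \int[mu]_(x in D) (\sum_(i <- s) w i * f i x) = \sum_(i <- s) w i * \int[mu]_(x in D) f i x.
Proof.
move=> mD fi; elim: s => [|i s [IH1 IH2]].
  have E : (fun x : R => \sum_(i <- [::]) w i * f i x) = cst 0 by apply/funext => x; rewrite big_nil.
  rewrite E big_nil; split; last by rewrite Rintegral_cst// mul0r.
  exact: integrable0.
have E : (fun x : R => \sum_(j <- i :: s) w j * f j x) = (fun x => w i * f i x + \sum_(j <- s) w j * f j x).
  by apply/funext => x; rewrite big_cons.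
have wi : mu.-integrable D (EFin \o (fun x => w i * f i x)).
  by have := integrableZl mD (w i) (fi i); apply: eq_integrable => // x _ /=; rewrite EFinM.
rewrite E big_cons; split.
  by have := integrableD mD wi IH1; apply: eq_integrable => // x _ /=; rewrite EFinD.
by rewrite RintegralD// IH2 RintegralZl.
Qed.

End lincomb.

Section functional.
Context {R : realType} (alpha : R) (b : nat -> R).
Hypotheses (alpha01 : 0 < alpha < 1) (hb : cq_weights alpha b).
Local Notation mu := (@lebesgue_measure R).
Let a0 : 0 < alpha. Proof. by case/andP: alpha01. Qed.
Let a1 : alpha < 1. Proof. by case/andP: alpha01. Qed.

Section relaxation.
Variables (l : R) (p : nat) (T lam : R) (u D : 'I_p -> R -> R) (w : 'I_p -> R).
Hypotheses (l0 : 0 < l) (lG : l * Gamma (1 - alpha) = 1).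
Hypothesis acu : forall i, abs_continuous T (u i).
Hypothesis eqn : forall i t, 0 < t < T -> caputo alpha (u i) t = D i t.
Hypothesis eig : forall t, 0 <= t <= T -> \sum_i w i * D i t = - lam * \sum_i w i * u i t.

Let phi s := \sum_i w i * derive1 (u i) s.
Let c := \sum_i w i * u i 0.

Lemma functional_phi_integrable : mu.-integrable `]0, T[ (EFin \o phi).
Proof.
have [h _] := Rintegral_lincomb (index_enum 'I_p) w (measurable_itv `]0, T[) (fun i => (acu i).1).
exact: h.
Qed.

Lemma functional_primitive t : 0 <= t <= T ->
  \sum_i w i * u i t = c + \int[mu]_(s in `]0, t[) phi s.
Proof.
move=> t0T; have /andP[t0 tT] := t0T.
have fi i : mu.-integrable `]0, t[ (EFin \o derive1 (u i)).
  exact: integrable_subitv (acu i).1 (lexx _) tT.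
have [_ ->] := Rintegral_lincomb (index_enum 'I_p) w (measurable_itv _) fi.
rewrite /c -big_split/=; apply: eq_bigr => i _; rewrite -mulrDr; congr (_ * _).
by have [_ ->] := acu i.
Qed.

(** The equation is integrated over time and the order of integration exchanged.
    The fractional derivative is exchanged for each point value separately, where
    its integrability is known, and only then are the values combined. *)
Lemma functional_relax r : 0 < r <= T ->
  \int[mu]_(s in `]0, r[) (phi s * prim alpha l lam (r - s)) = - (lam * c * r).
Proof.
move=> /andP[r0 rT].
have al01 : 0 <= alpha < 1 by rewrite (ltW a0) a1.
have z01 : 0 <= (0 : R) < 1 by rewrite lexx ltr01.
have r0T : 0 <= r <= T by rewrite ltW.
have mI := measurable_itv `]0, r[ : measurable (`]0, r[%classic : set (measurableTypeR R)).
have fi := functional_phi_integrable.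
have fr : mu.-integrable `]0, r[ (EFin \o phi) by exact: integrable_subitv fi (lexx _) rT.
have A i := abel_integral al01 (acu i).1 r0T.
(* with exponent 0 the same exchange of integrals gives the primitive of the primitive *)
have A0 := abel_integral z01 fi r0T.
have abE i t : 0 < t < T -> abel alpha (derive1 (u i)) t = Gamma (1 - alpha) * D i t.
  move=> t0T; rewrite -eqn// /caputo mulrA mulfV ?mul1r; last first.
    by apply/eqP => G0; move: lG; rewrite G0 mulr0 => /esym/eqP; rewrite oner_eq0.
  by rewrite /abel; apply: eq_Rintegral => s _; rewrite mulrC.
have Di i : mu.-integrable `]0, r[ (EFin \o D i).
  have [Ai _] := A i; have := integrableZl mI l Ai; apply: eq_integrable => // t.
  rewrite mem_itv_oo => /andP[t0 tr] /=; rewrite abE ?t0 ?(lt_le_trans tr)// -EFinM mulrA lG mul1r//.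
have IA i : \int[mu]_(s in `]0, r[) (derive1 (u i) s * ((r - s) `^ (1 - alpha) / (1 - alpha))) =
  Gamma (1 - alpha) * \int[mu]_(t in `]0, r[) D i t.
  have [_ <-] := A i; rewrite -RintegralZl//; apply: eq_Rintegral => t.
  by rewrite mem_itv_oo => /andP[t0 tr]; rewrite abE// t0 (lt_le_trans tr).
have b0 : 0 < 1 - alpha by rewrite subr_gt0.
have ker_i (g : R -> R) (q : R) : 0 <= q -> mu.-integrable `]0, r[ (EFin \o g) ->
   mu.-integrable `]0, r[ (EFin \o (fun s => g s * ((r - s) `^ q / q))).
  move=> q0 gi; apply: (integrable_mul_bounded (K := r `^ q / q)) => //.
    apply: measurable_funM => //; apply: (measurableT_comp (measurable_powR _)); exact: measurable_funB.
  move=> s; rewrite /= in_itv/= => /andP[s0 sr].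
  rewrite ger0_norm ?divr_ge0 ?powR_ge0// ler_wpM2r ?invr_ge0//.
  by apply: ge0_ler_powR => //; rewrite ?nnegrE ?subr_ge0 ?gerBl// ltW.
have di i : mu.-integrable `]0, r[ (EFin \o derive1 (u i)).
  exact: integrable_subitv (acu i).1 (lexx _) rT.
have S1 : \int[mu]_(s in `]0, r[) (phi s * ((r - s) `^ (1 - alpha) / (1 - alpha))) =
   Gamma (1 - alpha) * (- lam * \int[mu]_(t in `]0, r[) (\sum_i w i * u i t)).
  have -> : \int[mu]_(s in `]0, r[) (phi s * ((r - s) `^ (1 - alpha) / (1 - alpha))) =
     \sum_i w i * \int[mu]_(s in `]0, r[) (derive1 (u i) s * ((r - s) `^ (1 - alpha) / (1 - alpha))).
    have [_ <-] := Rintegral_lincomb (index_enum 'I_p) w mI (fun i => ker_i _ _ (ltW b0) (di i)).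
    apply: eq_Rintegral => s _; rewrite /phi mulr_suml; apply: eq_bigr => i _; ring.
  under eq_bigr do rewrite IA.
  under eq_bigr do rewrite mulrCA.
  rewrite -mulr_sumr; congr (_ * _).
  have [_ <-] := Rintegral_lincomb (index_enum 'I_p) w mI Di.
  rewrite -RintegralZl//.
    by apply: eq_Rintegral => t; rewrite mem_itv_oo => /andP[t0 tr]; rewrite eig// ltW//= (le_trans (ltW tr)).
  have [A0i _] := A0.
  have ci : mu.-integrable `]0, r[ (EFin \o (cst c : R -> R)).
    apply: (@measurable_bounded_integrable _ _ R mu (fun=> c)) => //.
      by rewrite /= lebesgue_measure_itv/=; case: ifP => _; rewrite ?ltry// -EFinB ltry.
    by exists `|c|; split => // M cM x _; exact: ltW.
  have := integrableD mI ci A0i; apply: eq_integrable => // t; rewrite mem_itv_oo => /andP[t0 tr] /=.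
  rewrite functional_primitive ?(ltW t0) ?(le_trans (ltW tr))// EFinD; congr (_ + (_%:E))%E.
  by rewrite /abel; apply: eq_Rintegral => s _; rewrite oppr0 powRr0 mulr1.
have S2 : \int[mu]_(t in `]0, r[) (\sum_i w i * u i t) =
   c * r + \int[mu]_(s in `]0, r[) (phi s * (r - s)).
  have [A0i A0e] := A0.
  have -> : \int[mu]_(s in `]0, r[) (phi s * (r - s)) = \int[mu]_(t in `]0, r[) abel 0 phi t.
    rewrite A0e; apply: eq_Rintegral => s; rewrite mem_itv_oo => /andP[s0 sr].
    by rewrite subr0 divr1 powRr1// subr_ge0 ltW.
  have ci : mu.-integrable `]0, r[ (EFin \o (cst c : R -> R)).
    apply: (@measurable_bounded_integrable _ _ R mu (fun=> c)) => //.
      by rewrite /= lebesgue_measure_itv/=; case: ifP => _; rewrite ?ltry// -EFinB ltry.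
    by exists `|c|; split => // M cM x _; exact: ltW.
  rewrite -[c * r](_ : \int[mu]_(t in `]0, r[) c = _); last first.
    by rewrite (Rintegral_cst_itv c (ltW r0)) subr0.
  rewrite -RintegralD//; apply: eq_Rintegral => t; rewrite mem_itv_oo => /andP[t0 tr].
  rewrite functional_primitive ?(ltW t0) ?(le_trans (ltW tr))//; congr (_ + _).
  by rewrite /abel; apply: eq_Rintegral => s _; rewrite oppr0 powRr0 mulr1.
have ri : mu.-integrable `]0, r[ (EFin \o (fun s => phi s * (r - s))).
  have := ker_i _ 1 ler01 fr; apply: eq_integrable => // s; rewrite mem_itv_oo => /andP[s0 sr] /=.
  by rewrite divr1 powRr1// subr_ge0 ltW.
have si := ker_i _ _ (ltW b0) fr.
have -> : \int[mu]_(s in `]0, r[) (phi s * prim alpha l lam (r - s)) =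
   l * \int[mu]_(s in `]0, r[) (phi s * ((r - s) `^ (1 - alpha) / (1 - alpha))) +
   lam * \int[mu]_(s in `]0, r[) (phi s * (r - s)).
  rewrite -RintegralZl// -RintegralZl// -RintegralD//.
  - by apply: eq_Rintegral => s _; rewrite /prim; ring.
  - by have := integrableZl mI l si; apply: eq_integrable => // x _ /=; rewrite EFinM.
  - by have := integrableZl mI lam ri; apply: eq_integrable => // x _ /=; rewrite EFinM.
rewrite S1 mulrA lG mul1r S2; ring.
Qed.

End relaxation.

(** The points of evaluation and their weights are arbitrary: only the combination
    has to satisfy the eigenvalue relation. *)
Lemma functional_error : exists2 K, 0 <= K & forall (p : nat) (T lam tau : R) (N : nat)
    (u D : 'I_p -> R -> R) (w : 'I_p -> R) (U : nat -> R),
  0 < T -> 0 <= lam -> 0 < tau -> N%:R * tau = T ->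
  (forall i, abs_continuous T (u i)) ->
  (forall i t, 0 < t < T -> caputo alpha (u i) t = D i t) ->
  (forall t, 0 <= t <= T -> \sum_i w i * D i t = - lam * \sum_i w i * u i t) ->
  U 0%N = \sum_i w i * u i 0 ->
  scalar_scheme alpha b (lam * tau `^ alpha) N U ->
  forall n, (1 <= n <= N)%N ->
  `|\sum_i w i * u i (n%:R * tau) - U n| <=
    K * (tau `^ alpha * n%:R `^ (alpha - 2)) * `|lam * \sum_i w i * u i 0|.
Proof.
have [l l0 hl] := cq_sum_asymp alpha01 hb.
have lG := gamma_cq_limit alpha01 hb l0 hl.
have [K K0 hK] := deficit_telescope alpha01 hb.
exists K => // p T lam tau N u D w U T0 lam0 tau0 NT acu eqn eig U0 sch n /andP[n1 nN].
have nT : n%:R * tau <= T by rewrite -NT ler_wpM2r ?(ltW tau0)// ler_nat.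
have z0 : 0 <= lam * tau `^ alpha by rewrite mulr_ge0// powR_ge0.
have nt0 : 0 <= n%:R * tau <= T by rewrite mulr_ge0// ltW.
rewrite (functional_primitive w acu nt0) (scalar_schemeE alpha01 hb z0 sch nN) U0.
set c := \sum_i _.
have hKn (z : R) (k : nat) : 0 < z -> `|deficit alpha b z n - deficit alpha b (z / (2 `^ alpha) ^+ k) (2 ^ k * n)|
   <= K * z * n%:R `^ (alpha - 2) by move=> zp; exact: hK.
have := scalar_convergence alpha01 hb l0 hl T0 lam0 (functional_phi_integrable w acu)
  (functional_relax lG acu eqn eig) tau0 n1 nT K0 hKn.
set I := \int[mu]_(s in _) _.
have -> : c + I - c * (1 - deficit alpha b (lam * tau `^ alpha) n / 2) = I + c / 2 * deficit alpha b (lam * tau `^ alpha) n by ring.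
move=> /le_trans; apply; rewrite -/c normrM (ger0_norm lam0) le_eqVlt; apply/orP; left; apply/eqP; ring.
Qed.

End functional.

(** * Square integrability and weak derivatives *)

Section boxes.
Context {R : realType} {d : nat}.
Local Notation mu := (lebesgue_rV R d).

Lemma box_measurable (A : 'I_d -> set (measurableTypeR R)) : (forall i, measurable (A i)) ->
  measurable [set x : 'rV[R]_d | forall i, A i (x ord0 i)].
Proof.
move=> mA; rewrite (_ : [set x | _] = \bigcap_(i in [set: 'I_d]) (rV_coord i @^-1` A i)).
  apply: fin_bigcap_measurable => //= i _; rewrite -[X in measurable X]setTI.
  by apply: measurable_rV_coord => //; exact: mA.
apply/seteqP; split => x Bx i; first by move=> _; exact: Bx.
exact: (Bx i Logic.I).
Qed.

Lemma rV_ballP (x : 'rV[R]_d) (e : R) y : 0 < e ->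
  ball x e y <-> forall i, `|x ord0 i - y ord0 i| < e.
Proof.
move=> e0; split=> [[_ h] i|h]; first exact: h.
by split=> // i j; rewrite (ord1 i); exact: h.
Qed.

(** The sigma-algebra is generated by the coordinates; an open set is a countable
    union of rational cubes. *)
Lemma open_rV_measurable (U : set 'rV[R]_d) : open U -> measurable U.
Proof.
move=> oU.
pose B (p : 'rV[rat]_d * nat) : set 'rV[R]_d :=
  [set y | forall i, `](ratr (p.1 ord0 i) - p.2.+1%:R^-1 : R), (ratr (p.1 ord0 i) + p.2.+1%:R^-1)[%classic (y ord0 i)].
pose F p := if `[< B p `<=` U >] then B p else set0.
have -> : U = \bigcup_p F p.
  apply/seteqP; split => x; last by move=> [p _]; rewrite /F; case: asboolP => // h; exact: h.
  move=> Ux; have : nbhs x U by exact: open_nbhs_nbhs.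
  move=> /nbhs_ballP[e /= e0 eU].
  have [n hn] : exists n : nat, n.+1%:R^-1 < e / 2.
    exists (Num.truncn (e / 2)^-1); rewrite invf_plt ?posrE ?divr_gt0//.
    exact: truncnS_gt.
  have n0 : 0 < n.+1%:R^-1 :> R by rewrite invr_gt0.
  have hq i : exists q : rat, `|x ord0 i - ratr q| < n.+1%:R^-1.
    have [|q] := @rat_in_itvoo R (x ord0 i - n.+1%:R^-1) (x ord0 i + n.+1%:R^-1).
      by rewrite ltrD2l gtrN.
    rewrite in_itv/= => /andP[q1 q2]; exists q; rewrite ltr_norml.
    by move: q1 q2; move: (n.+1%:R^-1 : R) => r q1 q2; apply/andP; split; lra.
  have [q hq'] := choice hq.
  pose p := (\row_i q i, n); exists p => //.
  have BU : B p `<=` U.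
    move=> y By; apply: eU; apply/rV_ballP => // i.
    have := By i; rewrite /p/= mxE in_itv/= => /andP[y1 y2].
    have := hq' i; rewrite !ltr_norml => /andP[x1 x2].
    move: n0 hn y1 y2 x1 x2; move: (n.+1%:R^-1 : R) (ratr _ : R) => r t n0 hn y1 y2 x1 x2.
    apply/andP; split; lra.
  rewrite /F; case: asboolP => // _ i; rewrite /p/= mxE in_itv/=.
  have := hq' i; rewrite ltr_norml => /andP[x1 x2].
  by move: n0 x1 x2; move: (n.+1%:R^-1 : R) (ratr _ : R) => r t n0 x1 x2; apply/andP; split; lra.
apply: countable_bigcupT_measurable; first exact: countableP.
move=> p; rewrite /F; case: asboolP => // _.
pose A (i : 'I_d) : set (measurableTypeR R) :=
  `](ratr (p.1 ord0 i) - p.2.+1%:R^-1 : R), (ratr (p.1 ord0 i) + p.2.+1%:R^-1)[%classic.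
have mA i : measurable (A i) by exact: measurable_itv.
exact: box_measurable mA.
Qed.

Lemma continuous_rV_measurable (f : 'rV[R]_d -> R) : continuous f -> measurable_fun setT f.
Proof.
move=> cf _; apply: (measurability _ (RGenOInfty.measurableE R)) => //.
move=> /= _ [_ [a ->] <-]; rewrite setTI.
by apply: open_rV_measurable; move/continuousP: cf; apply; exact: interval_open.
Qed.

Lemma coord_le_norm (x : 'rV[R]_d) i : `|x ord0 i| <= `|x|.
Proof.
rewrite leNgt; apply/negP => h.
have n0 : 0 < `|x ord0 i| by apply: le_lt_trans h.
have : ball (0 : 'rV[R]_d) `|x ord0 i| x by rewrite mx_norm_ball /ball_/= sub0r normrN.
by move=> /(rV_ballP _ _ n0)/(_ i); rewrite mxE sub0r normrN ltxx.
Qed.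

Lemma bounded_rV_measure_lty (Om : set 'rV[R]_d) : measurable Om -> bounded_set Om -> (mu Om < +oo)%E.
Proof.
move=> mO [M [_ hM]].
have Mlt : M < `|M| + 1 by rewrite (le_lt_trans (ler_norm _))// ltrDl.
have {hM}hM := hM _ Mlt.
pose c := `|M| + 1; have c0 : 0 <= c by rewrite addr_ge0.
pose A (i : 'I_d) : set (measurableTypeR R) := `[-c, c]%classic.
have mA i : measurable (A i) by exact: measurable_itv.
apply: (@le_lt_trans _ _ (mu [set x | forall i, A i (x ord0 i)])).
  apply: le_measure; rewrite ?inE//; first exact: box_measurable.
  move=> x Ox i; rewrite /A/= in_itv/= -ler_norml.
  by apply: le_trans (hM x Ox); exact: coord_le_norm.
rewrite lebesgue_rV_prod// /A; elim: (index_enum _) => [|i s IH]; first by rewrite big_nil ltry.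
rewrite big_cons lte_mul_pinfty//; rewrite /= lebesgue_measure_itv/=; case: ifP => _ //; rewrite -?EFinB//.
Qed.

End boxes.

Section L2.
Context {R : realType} {d : nat}.
Variable Om : set 'rV[R]_d.
Local Notation mu := (lebesgue_rV R d).
Hypothesis mO : measurable Om.
Implicit Types u v w : 'rV[R]_d -> R.

Lemma L2D u w : L2 Om u -> L2 Om w -> L2 Om (u + w).
Proof.
move=> Lu Lw; rewrite /L2 (_ : (u + w) \_ Om = u \_ Om + w \_ Om).
  by have [_] := Lfun_addr_closed mu (lee1n 2 : (1 <= 2%:E)%E); apply.
by apply/funext => x; rewrite [RHS]/GRing.add/= !patchE; case: ifP => //; rewrite addr0.
Qed.

Lemma L2Z k u : L2 Om u -> L2 Om (k *: u).
Proof.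
move=> Lu; rewrite /L2 (_ : (k *: u) \_ Om = k \o* (u \_ Om)).
  by apply: Lfun_scale => //; rewrite ler1n.
by apply/funext => x; rewrite /= !patchE; case: ifP => _; rewrite ?mul0r// mulrC.
Qed.

Lemma L2B u w : L2 Om u -> L2 Om w -> L2 Om (u - w).
Proof. by move=> Lu Lw; rewrite -scaleN1r; apply: L2D => //; exact: L2Z. Qed.

Lemma L2_sum (I : Type) (s : seq I) (f : I -> 'rV[R]_d -> R) :
  (forall i, L2 Om (f i)) -> L2 Om (\sum_(i <- s) f i).
Proof.
move=> h; elim: s => [|i s IH]; last by rewrite big_cons; exact: L2D.
rewrite big_nil /L2 (_ : 0 \_ Om = 0).
  by have [+ _] := Lfun_addr_closed mu (lee1n 2 : (1 <= 2%:E)%E).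
by apply/funext => x; rewrite patchE; case: ifP.
Qed.

Lemma L2_integrable u w : L2 Om u -> L2 Om w -> mu.-integrable Om (EFin \o (fun x => u x * w x)).
Proof.
move=> Lu Lw; have := Lfun2_mul_Lfun1 Lu Lw => /Lfun1_integrable h.
rewrite -[Om in X in mu.-integrable X]setIT setIC.
by apply/integrable_restrict => //; apply: eq_integrable h => // x _ /=; rewrite !patchE; case: ifP => //; rewrite mulr0.
Qed.

Lemma L2dotC u w : L2dot Om u w = L2dot Om w u.
Proof. by apply: eq_Rintegral => x _; rewrite mulrC. Qed.

Lemma L2dotDl u v w : L2 Om u -> L2 Om v -> L2 Om w -> L2dot Om (u + v) w = L2dot Om u w + L2dot Om v w.
Proof.
move=> Lu Lv Lw; rewrite /L2dot -RintegralD//; [|exact: L2_integrable|exact: L2_integrable].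
by apply: eq_Rintegral => x _; rewrite mulrDl.
Qed.

Lemma L2dotZl k u w : L2 Om u -> L2 Om w -> L2dot Om (k *: u) w = k * L2dot Om u w.
Proof.
move=> Lu Lw; rewrite /L2dot -RintegralZl//; last exact: L2_integrable.
by apply: eq_Rintegral => x _; rewrite mulrA.
Qed.

Lemma L2dotDr u v w : L2 Om u -> L2 Om v -> L2 Om w -> L2dot Om w (u + v) = L2dot Om w u + L2dot Om w v.
Proof. by move=> *; rewrite L2dotC L2dotDl// ![L2dot Om w _]L2dotC. Qed.

Lemma L2dotZr k u w : L2 Om u -> L2 Om w -> L2dot Om w (k *: u) = k * L2dot Om w u.
Proof. by move=> *; rewrite L2dotC L2dotZl// L2dotC. Qed.

Lemma L2dotBl u v w : L2 Om u -> L2 Om v -> L2 Om w -> L2dot Om (u - v) w = L2dot Om u w - L2dot Om v w.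
Proof. by move=> Lu Lv Lw; rewrite -scaleN1r L2dotDl ?L2dotZl ?mulN1r//; exact: L2Z. Qed.

Lemma L2dot0l w : L2dot Om 0 w = 0.
Proof.
rewrite /L2dot (@eq_Rintegral _ _ _ mu Om (cst 0)) ?Rintegral_cst ?mul0r// => x _.
by rewrite mul0r.
Qed.

Lemma L2dot_suml (I : Type) (s : seq I) (c : I -> R) (f : I -> 'rV[R]_d -> R) w :
  (forall i, L2 Om (f i)) -> L2 Om w ->
  L2dot Om (\sum_(i <- s) c i *: f i) w = \sum_(i <- s) c i * L2dot Om (f i) w.
Proof.
move=> h Lw; elim: s => [|i s IH]; first by rewrite !big_nil L2dot0l.
by rewrite !big_cons L2dotDl ?L2dotZl ?IH//; [exact: L2Z|apply: L2_sum => j; exact: L2Z].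
Qed.

Lemma L2norm_ge0 u : 0 <= L2norm Om u.
Proof. by rewrite fine_ge0// Lnorm_ge0. Qed.

Lemma L2norm_sqr u : L2 Om u -> L2norm Om u ^+ 2 = L2dot Om u u.
Proof.
move=> Lu; have fu : ('N[mu]_2%:E [EFin \o (u \_ Om)] < +oo)%E.
  by move: Lu => /andP[_]; rewrite inE.
have nu := Lnorm_ge0 mu 2%:E (EFin \o (u \_ Om)).
have := @powR_Lnorm _ _ R mu (EFin \o (u \_ Om)) 2 (lt0r_neq0 (ltr0n R 2 : 0 < 2)).
rewrite -[in X in X -> _](fineK (_ : 'N[mu]_2%:E [EFin \o (u \_ Om)]%E \is a fin_num)); last first.
  by rewrite ge0_fin_numE.
rewrite poweR_EFin => E.
rewrite -powR_mulrn ?L2norm_ge0// /L2norm -[LHS]/(fine (_ `^ _)%:E) E.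
rewrite /L2dot /Rintegral [in RHS]integral_mkcond; congr fine; apply: eq_integral => x _.
rewrite [RHS]patchE /=; have -> : (u \_ Om) x = if x \in Om then u x else 0 by rewrite patchE.
case: ifP => _; first by rewrite powR_mulrn// real_normK ?num_real// expr2.
by rewrite normr0 powR0// pnatr_eq0.
Qed.

Lemma L2dot_ge0 u : L2 Om u -> 0 <= L2dot Om u u.
Proof. by move=> Lu; rewrite -L2norm_sqr// sqr_ge0. Qed.

(** From the sign of the quadratic polynomial t |-> |u + t w|^2. *)
Lemma L2_cauchy_schwarz u w : L2 Om u -> L2 Om w -> `|L2dot Om u w| <= L2norm Om u * L2norm Om w.
Proof.
move=> Lu Lw.
have q t : 0 <= L2dot Om u u + 2 * t * L2dot Om u w + t ^+ 2 * L2dot Om w w.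
  have Lt : L2 Om (t *: w) by exact: L2Z.
  have := L2dot_ge0 (L2D Lu Lt).
  rewrite L2dotDl//; last exact: L2D.
  by rewrite !L2dotDr// !L2dotZl// !L2dotZr// [L2dot Om w u]L2dotC; lra.
rewrite -(@ler_pXn2r _ 2)// ?nnegrE ?mulr_ge0 ?L2norm_ge0//.
rewrite exprMn !L2norm_sqr// real_normK ?num_real//.
have := L2dot_ge0 Lw; rewrite le_eqVlt => /predU1P[C0|C0].
  rewrite -C0 mulr0 in q *.
  have [->|B0] := eqVneq (L2dot Om u w) 0; first by rewrite expr0n.
  have := q (- (L2dot Om u u + 1) / (2 * L2dot Om u w)).
  rewrite mulr0 addr0 (_ : 2 * _ * _ = - (L2dot Om u u + 1)); last by field.
  by rewrite opprD addrA subrr sub0r ler0N1.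
have := q (- L2dot Om u w / L2dot Om w w).
rewrite (_ : _ + _ + _ = L2dot Om u u - L2dot Om u w ^+ 2 / L2dot Om w w); last by field; rewrite gt_eqF.
by rewrite subr_ge0 ler_pdivrMr.
Qed.

Lemma L2dot_cvg (u : nat -> 'rV[R]_d -> R) v w : (forall n, L2 Om (u n)) -> L2 Om v -> L2 Om w ->
  (fun n => L2norm Om (u n - v)) @ \oo --> (0 : R) ->
  (fun n => L2dot Om w (u n)) @ \oo --> L2dot Om w v.
Proof.
move=> Lu Lv Lw h; apply/cvgrPdist_le => e e0.
have : (fun n => L2norm Om w * L2norm Om (u n - v)) @ \oo --> L2norm Om w * 0.
  by apply: cvgM => //; exact: cvg_cst.
rewrite mulr0 => /cvgrPdist_le/(_ e e0); apply: filterS => n.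
rewrite sub0r normrN ger0_norm ?mulr_ge0 ?L2norm_ge0//; apply: le_trans.
rewrite distrC ![L2dot Om w _]L2dotC -L2dotBl// L2dotC.
by apply: L2_cauchy_schwarz => //; exact: L2B.
Qed.

End L2.

Section weak_derivatives.
Context {R : realType} {d : nat}.
Variable Om : set 'rV[R]_d.
Local Notation mu := (lebesgue_rV R d).
Hypothesis mO : measurable Om.
Hypothesis fO : (mu Om < +oo)%E.
Implicit Types u v w phi chi : 'rV[R]_d -> R.

Lemma test_function_L2 phi : test_function Om phi -> L2 Om phi.
Proof.
move=> [sm [K [cK KO phi0]]].
have [cphi _] := sm [::].
have mphi : measurable_fun setT (phi \_ Om).
  apply/(measurable_restrict _ _ _).1 => //; rewrite setTI; apply: measurable_funTS.
  exact: continuous_rV_measurable.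
have [M [_ hM]] : bounded_set (phi @` K).
  by apply: compact_bounded; apply: continuous_compact => //; exact: continuous_subspaceT.
have Mlt : M < `|M| + 1 by rewrite (le_lt_trans (ler_norm _))// ltrDl.
have {hM}hM := hM _ Mlt.
pose c := `|M| + 1; have c0 : 0 <= c by rewrite addr_ge0.
have bd x : `|phi x| <= c.
  have [Kx|Kx] := pselect (K x); last by rewrite phi0// normr0.
  by apply: hM; exists x.
apply/andP; split; first by rewrite inE.
rewrite inE/= /finite_norm.
apply: (@lty_poweRy _ _ 2); first by rewrite pnatr_eq0.
rewrite powR_Lnorm ?pnatr_eq0//.
have : mu.-integrable Om (EFin \o (fun x => phi x ^+ 2)).
  apply: measurable_bounded_integrable => //.
    apply: measurable_funTS; apply: measurable_funX; exact: continuous_rV_measurable.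
  exists (c ^+ 2); split; first exact: num_real; move=> C cC x _ /=.
  by rewrite normrX (le_trans _ (ltW cC))// lerXn2r ?nnegrE.
move=> /integrableP[_]; apply: le_lt_trans.
rewrite le_eqVlt; apply/orP; left; apply/eqP; rewrite [RHS]integral_mkcond; apply: eq_integral => x _.
rewrite [RHS]patchE /=; have -> : (phi \_ Om) x = if x \in Om then phi x else 0 by rewrite patchE.
case: ifP => _; first by rewrite normrX powR_mulrn.
by rewrite normr0 powR0// pnatr_eq0.
Qed.

Lemma test_function_partial i phi : test_function Om phi -> test_function Om (partial i phi).
Proof.
move=> [sm [K [cK KO phi0]]]; split.
  by move=> s; have := sm (rcons s i); rewrite foldr_rcons.
exists K; split => // x Kx; rewrite /partial.
rewrite (near_eq_derive (g := cst 0)) ?derive_cst//.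
have oK : open (~` K) by apply: closed_openC; apply: compact_closed => //; exact: norm_hausdorff.
have : nbhs x (~` K) by exact: open_nbhs_nbhs.
by apply: filterS => y Ky; rewrite phi0.
Qed.

Lemma weak_partialP i u : H1 Om u -> L2 Om (weak_partial Om i u) /\ is_weak_partial Om i u (weak_partial Om i u).
Proof. by move=> [_ /(_ i)[g hg]]; exact: (@xgetPex _ (cst 0) [set g | L2 Om g /\ is_weak_partial Om i u g] (ex_intro _ g hg)). Qed.

(** The chosen representatives of weak derivatives need not be linear in the
    function. Against weak derivatives of functions of H10 they are, because
    those are limits of test functions, for which one integrates by parts. *)
Lemma weak_partial_dot_lincomb (I : Type) (s : seq I) (c : I -> R) (e : I -> 'rV[R]_d -> R) u chi i :
  H1 Om u -> (forall k, H1 Om (e k)) -> H10 Om chi -> u = \sum_(k <- s) c k *: e k ->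
  L2dot Om (weak_partial Om i u) (weak_partial Om i chi) =
  \sum_(k <- s) c k * L2dot Om (weak_partial Om i (e k)) (weak_partial Om i chi).
Proof.
move=> Hu He [Hchi [phi [tphi _ cphi]]] uE.
have [Lwu wu] := weak_partialP i Hu; have [Lwc _] := weak_partialP i Hchi.
have tp n : test_function Om (partial i (phi n)) by exact: test_function_partial.
have Lp n : L2 Om (partial i (phi n)) by exact: test_function_L2.
have c1 := L2dot_cvg mO Lp Lwc Lwu (cphi i).
have c2 : (fun n => \sum_(k <- s) c k * L2dot Om (weak_partial Om i (e k)) (partial i (phi n))) @ \oo -->
   \sum_(k <- s) c k * L2dot Om (weak_partial Om i (e k)) (weak_partial Om i chi).
  elim: (s) => [|k s' IH].
    by under eq_fun do rewrite big_nil; rewrite big_nil; exact: cvg_cst.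
  under eq_fun do rewrite big_cons; rewrite big_cons; apply: cvgD => //; apply: cvgM; first exact: cvg_cst.
  by have [Lwe _] := weak_partialP i (He k); exact: L2dot_cvg.
apply: (cvg_unique _ c1); first exact: norm_hausdorff.
suff -> : (fun n => L2dot Om (weak_partial Om i u) (partial i (phi n))) =
   (fun n => \sum_(k <- s) c k * L2dot Om (weak_partial Om i (e k)) (partial i (phi n))) by [].
apply/funext => n; apply: oppr_inj; rewrite -wu// uE L2dot_suml//; last first.
- by apply: test_function_L2; exact: test_function_partial.
- by move=> k; have [] := He k.
rewrite -sumrN; apply: eq_bigr => k _; have [_ ->//] := weak_partialP i (He k).
by rewrite mulrN.
Qed.

Lemma grad_dot_lincomb (I : Type) (s : seq I) (c : I -> R) (e : I -> 'rV[R]_d -> R) u chi :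
  H1 Om u -> (forall k, H1 Om (e k)) -> H10 Om chi -> u = \sum_(k <- s) c k *: e k ->
  grad_dot Om u chi = \sum_(k <- s) c k * grad_dot Om (e k) chi.
Proof.
move=> Hu He Hchi uE; rewrite /grad_dot.
transitivity (\sum_(i < d) \sum_(k <- s) c k * L2dot Om (weak_partial Om i (e k)) (weak_partial Om i chi)).
  by apply: eq_bigr => i _; exact: weak_partial_dot_lincomb.
by rewrite exchange_big/=; apply: eq_bigr => k _; rewrite mulr_sumr.
Qed.

Lemma grad_dotC u w : grad_dot Om u w = grad_dot Om w u.
Proof. by apply: eq_bigr => i _; rewrite L2dotC. Qed.

(** Integration by parts against test functions, passed to the limit in both terms. *)
Lemma H2_green v chi : H2 Om v -> H10 Om chi ->
  L2 Om (laplacian Om v) /\ grad_dot Om v chi = - L2dot Om (laplacian Om v) chi.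
Proof.
move=> [Hv Hw] [Hchi [phi [tphi c0 cphi]]].
have L i := weak_partialP i (Hw i).
have LL : L2 Om (laplacian Om v).
  by rewrite /laplacian; apply: L2_sum => // i; have [] := L i.
have Lchi : L2 Om chi by have [] := Hchi.
split=> //; rewrite /laplacian.
have -> : L2dot Om (\sum_(i < d) weak_partial Om i (weak_partial Om i v)) chi =
   \sum_(i < d) L2dot Om (weak_partial Om i (weak_partial Om i v)) chi.
  rewrite (eq_bigr (fun i => 1 *: weak_partial Om i (weak_partial Om i v))); last first.
    by move=> i _; rewrite scale1r.
  rewrite L2dot_suml//; last by move=> i; have [] := L i.
  by apply: eq_bigr => i _; rewrite mul1r.
rewrite -sumrN; apply: eq_bigr => i _.
have [Lv _] := weak_partialP i Hv; have [Lwc _] := weak_partialP i Hchi.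
have [Lvv wv] := L i.
have Lphi n : L2 Om (phi n) by exact: test_function_L2.
have Lp n : L2 Om (partial i (phi n)) by apply: test_function_L2; exact: test_function_partial.
have c1 := L2dot_cvg mO Lp Lwc Lv (cphi i).
have c2 := L2dot_cvg mO Lphi Lchi Lvv c0.
apply: (cvg_unique _ c1); first exact: norm_hausdorff.
have -> : (fun n => L2dot Om (weak_partial Om i v) (partial i (phi n))) =
  (fun n => - L2dot Om (weak_partial Om i (weak_partial Om i v)) (phi n)).
  by apply/funext => n; rewrite wv.
exact: cvgN.
Qed.

End weak_derivatives.

(** * Simultaneous diagonalization of two quadratic forms *)

Section simultaneous_diagonalization.
Context {C : numClosedFieldType} {n : nat}.
Implicit Types A E G K : 'M[C]_n.
Local Notation "A ^h" := (map_mx Num.conj (trmx A)) (at level 2, format "A ^h").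

Lemma trmxC_mul m p q (A : 'M[C]_(m, p)) (B : 'M[C]_(p, q)) : (A *m B)^h = B^h *m A^h.
Proof. by rewrite trmx_mul map_mxM. Qed.

Lemma trmxC_invol m p (A : 'M[C]_(m, p)) : (A^h)^h = A.
Proof. by apply/matrixP => i j; rewrite !mxE conjCK. Qed.

(** The diagonal entries are the values of the form on the rows. *)
Lemma congruence_diag A E lam i : E *m A *m E^h = diag_mx lam ->
  lam ord0 i = (row i E *m A *m (row i E)^h) ord0 ord0.
Proof.
move=> EA; have := congr1 (fun M : 'M[C]_n => M i i) EA; rewrite [RHS]mxE eqxx mulr1n => <-.
rewrite (_ : (row i E)^h = col i E^h); last by apply/colP => j; rewrite !mxE.
by rewrite -!row_mul colE mulmxA -colE !mxE.
Qed.

Lemma hermitian_diag A : A^h = A -> exists P : 'M[C]_n, exists lam : 'rV[C]_n,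
  P *m P^h = 1%:M /\ P *m A *m P^h = diag_mx lam.
Proof.
move=> hA; have /orthomx_spectralP AE : A \is normalmx.
  by apply: hermitian_normalmx; apply/is_hermitianmxP; rewrite expr0 scale1r hA.
have U := spectral_unitarymx A; have PP := unitarymxP U.
exists (spectralmx A), (spectral_diag A); split => //.
move: AE; rewrite invmx_unitary// => AE.
by rewrite [X in _ *m X *m _]AE !mulmxA PP mul1mx -mulmxA PP mulmx1.
Qed.

(** Diagonalize G, rescale its axes to make it the identity, and diagonalize K by a
    unitary change of axes, which preserves the identity. *)
Lemma simultaneous_diagonalization G K :
  G^h = G -> K^h = K ->
  (forall x : 'rV[C]_n, x != 0 -> 0 < (x *m G *m x^h) ord0 ord0) ->
  (forall x : 'rV[C]_n, 0 <= (x *m K *m x^h) ord0 ord0) ->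
  exists E : 'M[C]_n, exists lam : 'rV[C]_n,
    [/\ E *m G *m E^h = 1%:M, E *m K *m E^h = diag_mx lam & forall i, 0 <= lam ord0 i].
Proof.
move=> hG hK posG posK.
have [P [D [PP PG]]] := hermitian_diag hG.
have D0 i : 0 < D ord0 i.
  rewrite (congruence_diag i PG); apply: posG; apply/eqP => r0.
  have := congr1 (fun M : 'M[C]_n => row i M) PP; rewrite row_mul r0 mul0mx => /rowP/(_ i).
  by rewrite !mxE eqxx => /eqP; rewrite eq_sym oner_eq0.
pose S : 'M[C]_n := diag_mx (\row_i sqrtC (D ord0 i)^-1).
have Sh : S^h = S.
  rewrite /S tr_diag_mx map_diag_mx; congr diag_mx; apply/rowP => i; rewrite !mxE.
  by apply: conj_Creal; rewrite ger0_real// sqrtC_ge0 invr_ge0 ltW.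
have E1G : (S *m P) *m G *m (S *m P)^h = 1%:M.
  rewrite trmxC_mul Sh -!mulmxA [P *m (_ *m _)]mulmxA [_ *m (P^h *m _)]mulmxA PG.
  rewrite /S !mulmx_diag -diag_const_mx; congr diag_mx; apply/rowP => i; rewrite !mxE.
  by rewrite mulrCA -expr2 sqrtCK mulfV// gt_eqF.
have [|Q [L [QQ QK]]] := @hermitian_diag ((S *m P) *m K *m (S *m P)^h).
  by move: (S *m P) => Z; rewrite !trmxC_mul hK trmxC_invol mulmxA.
have QK' : (Q *m (S *m P)) *m K *m (Q *m (S *m P))^h = diag_mx L.
  by rewrite -QK trmxC_mul !mulmxA.
exists (Q *m (S *m P)), L; split => //; last by move=> i; rewrite (congruence_diag i QK').
by rewrite trmxC_mul -!mulmxA ![S *m _]mulmxA [(S *m P) *m _]mulmxA [_ *m (_ *m Q^h)]mulmxA E1G mul1mx.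
Qed.

End simultaneous_diagonalization.

Section real_simultaneous_diagonalization.
Context {R : realType} {n : nat}.
Implicit Types (G K B : 'M[R]_n) (x : 'rV[R]_n).
Local Notation C := R[i].
Local Notation toC := (map_mx (real_complex R)).
Local Notation ReM := (map_mx (@complex.Re R)).
Local Notation ImM := (map_mx (@complex.Im R)).
Local Notation "A ^h" := (map_mx Num.conj (trmx A)) (at level 2, format "A ^h").

Lemma toC_symmetric G : G^T = G -> (toC G)^h = toC G.
Proof.
move=> sG; apply/matrixP => i j; rewrite !mxE -[in RHS]sG mxE.
by apply: conj_Creal; rewrite complex_real.
Qed.

Lemma ReM_mul m p q (A : 'M[C]_(m, p)) (D : 'M[C]_(p, q)) :
  ReM (A *m D) = ReM A *m ReM D - ImM A *m ImM D.
Proof.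
apply/matrixP => i j; rewrite !mxE raddf_sum -sumrB; apply: eq_bigr => k _; rewrite !mxE.
by case: (A i k) (D k j) => [a b] [c e].
Qed.

Lemma ImM_mul m p q (A : 'M[C]_(m, p)) (D : 'M[C]_(p, q)) :
  ImM (A *m D) = ReM A *m ImM D + ImM A *m ReM D.
Proof.
apply/matrixP => i j; rewrite !mxE raddf_sum -big_split; apply: eq_bigr => k _; rewrite !mxE.
by case: (A i k) (D k j) => [a b] [c e].
Qed.

Lemma ReM_toC m p (A : 'M[R]_(m, p)) : ReM (toC A) = A.
Proof. by apply/matrixP => i j; rewrite !mxE. Qed.

Lemma ImM_toC m p (A : 'M[R]_(m, p)) : ImM (toC A) = 0.
Proof. by apply/matrixP => i j; rewrite !mxE. Qed.

Lemma ReM_opp m p (A : 'M[C]_(m, p)) : ReM (- A) = - ReM A.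
Proof. by apply/matrixP => i j; rewrite !mxE; case: (A i j). Qed.

Lemma ImM_opp m p (A : 'M[C]_(m, p)) : ImM (- A) = - ImM A.
Proof. by apply/matrixP => i j; rewrite !mxE; case: (A i j). Qed.

Lemma ReM_toCl m p q (A : 'M[R]_(m, p)) (D : 'M[C]_(p, q)) : ReM (toC A *m D) = A *m ReM D.
Proof. by rewrite ReM_mul ReM_toC ImM_toC mul0mx subr0. Qed.

Lemma ImM_toCl m p q (A : 'M[R]_(m, p)) (D : 'M[C]_(p, q)) : ImM (toC A *m D) = A *m ImM D.
Proof. by rewrite ImM_mul ReM_toC ImM_toC mul0mx addr0. Qed.

Lemma ReM_toCr m p q (D : 'M[C]_(m, p)) (A : 'M[R]_(p, q)) : ReM (D *m toC A) = ReM D *m A.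
Proof. by rewrite ReM_mul ReM_toC ImM_toC mulmx0 subr0. Qed.

Lemma ImM_toCr m p q (D : 'M[C]_(m, p)) (A : 'M[R]_(p, q)) : ImM (D *m toC A) = ImM D *m A.
Proof. by rewrite ImM_mul ReM_toC ImM_toC mulmx0 add0r. Qed.

Lemma ReM_h m p (A : 'M[C]_(m, p)) : ReM A^h = (ReM A)^T.
Proof. by apply/matrixP => i j; rewrite !mxE; case: (A j i). Qed.

Lemma ImM_h m p (A : 'M[C]_(m, p)) : ImM A^h = - (ImM A)^T.
Proof. by apply/matrixP => i j; rewrite !mxE; case: (A j i). Qed.

Lemma toC_form G (z : 'rV[C]_n) : G^T = G ->
  (z *m toC G *m z^h) ord0 ord0 =
  ((ReM z *m G *m (ReM z)^T) ord0 ord0 + (ImM z *m G *m (ImM z)^T) ord0 ord0)%:C%C.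
Proof.
move=> sG; set l := LHS.
have -> : l = (complex.Re l +i* complex.Im l)%C by case: l.
have -> : complex.Re l = (ReM (z *m toC G *m z^h)) ord0 ord0 by rewrite mxE.
have -> : complex.Im l = (ImM (z *m toC G *m z^h)) ord0 ord0 by rewrite mxE.
rewrite ReM_mul ReM_toCr ImM_toCr ImM_mul ReM_toCr ImM_toCr ReM_h ImM_h mulmxN opprK mulmxN [in X in (_ +i* X)%C]mxE.
congr (_ +i* _)%C; first by rewrite mxE.
have -> : ImM z *m G *m (ReM z)^T = (ReM z *m G *m (ImM z)^T)^T.
  by rewrite !trmx_mul trmxK sG mulmxA.
by rewrite [in X in _ + X]mxE [in X in X + _]mxE addNr.
Qed.

(** The real and imaginary parts of a complex simultaneous diagonalization serve as
    separate coordinates, so Z has twice as many columns as rows. *)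
Lemma real_simultaneous_diagonalization G K :
  G^T = G -> K^T = K ->
  (forall x, x != 0 -> 0 < (x *m G *m x^T) ord0 ord0) ->
  (forall x, 0 <= (x *m K *m x^T) ord0 ord0) ->
  exists Z : 'M[R]_(n, n + n), exists lam : 'rV[R]_(n + n),
    [/\ forall k, 0 <= lam ord0 k, G = Z *m Z^T &
        forall B, B *m G = - K -> B *m Z = - (Z *m diag_mx lam)].
Proof.
move=> sG sK posG posK.
have [||z z0|z|E [lam [EG EK lam0]]] := @simultaneous_diagonalization C n (toC G) (toC K).
- exact: toC_symmetric.
- exact: toC_symmetric.
- rewrite toC_form// ltcR.
  have nn x : 0 <= (x *m G *m x^T) ord0 ord0.
    by have [->|/posG/ltW//] := eqVneq x 0; rewrite !mul0mx mxE.
  have [r0|/posG h] := eqVneq (ReM z) 0; last by rewrite ltr_wpDr.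
  rewrite ltr_wpDl//; apply: posG; apply: contra z0 => /eqP i0; apply/eqP/rowP => i.
  have := congr1 (fun x : 'rV[R]_n => x ord0 i) r0; have := congr1 (fun x : 'rV[R]_n => x ord0 i) i0.
  by rewrite !mxE; case: (z ord0 i) => a b /= -> ->.
- by rewrite toC_form// lecR addr_ge0.
have uE : E \in unitmx by have [] := mulmx1_unit EG; rewrite unitmx_mul => /andP[].
pose W : 'M[C]_n := invmx E; have WE : W *m E = 1%:M by rewrite mulVmx.
have EW : E *m W = 1%:M by rewrite mulmxV.
have EWh : E^h *m W^h = 1%:M by rewrite -trmxC_mul WE trmx1 map_mx1.
have WhE : W^h *m E^h = 1%:M by rewrite -trmxC_mul EW trmx1 map_mx1.
have congrE A D : E *m A *m E^h = D -> A = W *m D *m W^h.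
  by move=> <-; rewrite !mulmxA WE mul1mx -mulmxA EWh mulmx1.
have GE := congrE _ _ EG; have KE := congrE _ _ EK.
pose X := ReM W; pose Y := ImM W; pose L := \row_i complex.Re (lam ord0 i).
have lamE : lam = toC L.
  apply/rowP => i; rewrite !mxE; have := lam0 i; rewrite lecE => /andP[/eqP/= h _].
  by rewrite [LHS]complexE h /= mulr0 addr0.
exists (row_mx X Y), (row_mx L L); split.
- move=> k; case: (split_ordP k) => j ->; rewrite ?row_mxEl ?row_mxEr mxE.
    by have := lam0 j; rewrite lecE => /andP[].
  by have := lam0 j; rewrite lecE => /andP[].
- rewrite tr_row_mx mul_row_col -[LHS]ReM_toC GE mulmx1 ReM_mul ReM_h ImM_h.
  by rewrite mulmxN opprK.
- move=> B BGK; have BW : toC B *m W = - (W *m diag_mx lam).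
    have : toC B *m toC G = - toC K by rewrite -map_mxM BGK map_mxN.
    rewrite GE KE mulmx1 => /(congr1 (fun M : 'M[C]_n => M *m E^h)).
    by rewrite mulNmx -!mulmxA WhE !mulmx1.
  have dL : diag_mx lam = toC (diag_mx L) by rewrite lamE map_diag_mx.
  rewrite dL in BW.
  rewrite diag_mx_row mul_mx_row mul_row_block !mulmx0 addr0 add0r opp_row_mx.
  congr row_mx.
    by have := congr1 (fun M : 'M[C]_n => ReM M) BW; rewrite ReM_opp ReM_toCl ReM_toCr.
  by have := congr1 (fun M : 'M[C]_n => ImM M) BW; rewrite ImM_opp ImM_toCl ImM_toCr.
Qed.

End real_simultaneous_diagonalization.

(** * Finite element functions and their spectral functionals *)

Section domain.
Context {R : realType} {d : nat}.
Local Notation mu := (lebesgue_rV R d).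
Implicit Types (Om : set 'rV[R]_d) (x : 'rV[R]_d).

Lemma rdot_continuous (a : 'rV[R]_d) : continuous (rdot a).
Proof.
move=> x; rewrite /rdot; elim: (index_enum _) => [|i s IH].
  rewrite (_ : (fun y : 'rV_d => _) = fun=> 0); first exact: cst_continuous.
  by apply/funext => y; rewrite big_nil.
rewrite (_ : (fun y : 'rV_d => _) = (fun y : 'rV[R]_d => a ord0 i * y ord0 i + \sum_(i0 <- s) a ord0 i0 * y ord0 i0)); last first.
  by apply/funext => y; rewrite big_cons.
 apply: (continuousD (f := fun y : 'rV[R]_d => a ord0 i * y ord0 i) _ IH).
apply: (continuousM (s := fun=> a ord0 i) (t := fun y : 'rV[R]_d => y ord0 i)); first exact: cst_continuous.
exact: coord_continuous.
Qed.

Lemma polygonal_open Om : convex_polygonal_domain Om -> open Om.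
Proof.
move=> [_ _ [m [a [c ->]]]]; rewrite openE => x /= xO.
apply: (@filter_forall _ _ (fun k => [set y | rdot (a k) y < c k]) (nbhs x)) => k.
by have := @rdot_continuous (a k) x; move=> /cvgr_lt; apply.
Qed.

(** A continuous function which is nonzero at a point is bounded below on a cube, whose
    measure is positive. *)
Lemma L2dot_gt0 Om f x : open Om -> L2 Om f -> continuous f -> Om x -> f x != 0 -> 0 < L2dot Om f f.
Proof.
move=> oO Lf cf Ox fx0; have mO := open_rV_measurable oO.
have fx2 : 0 < f x ^+ 2 by rewrite exprn_even_gt0.
have cf2 : (fun y => f y * f y) @ x --> f x * f x by exact: (cvgM (cf x) (cf x)).
have : \forall y \near x, Om y /\ f x ^+ 2 / 2 < f y * f y.
  apply: filterI; first exact: open_nbhs_nbhs.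
  by move: cf2 => /cvgr_gt; apply; rewrite -expr2; lra.
move=> /nbhs_ballP[e /= e0 eB].
pose A (i : 'I_d) : set (measurableTypeR R) := `](x ord0 i - e), (x ord0 i + e)[%classic.
have mA i : measurable (A i) by exact: measurable_itv.
pose B := [set y : 'rV[R]_d | forall i, A i (y ord0 i)].
have mB : measurable B by exact: box_measurable.
have Bball y : B y -> Om y /\ f x ^+ 2 / 2 < f y * f y.
  move=> By; apply: eB; apply/rV_ballP => // i; have := By i; rewrite /A/= in_itv/= => /andP[h1 h2].
  by rewrite ltr_norml; apply/andP; split; lra.
have muB : (0 < mu B)%E.
  rewrite lebesgue_rV_prod//; elim: (index_enum _) => [|i s IH]; first by rewrite big_nil lte01.
  rewrite big_cons mule_gt0// /A lebesgue_measure_itv/= lte_fin ifT; last by lra.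
  by rewrite -EFinB lte_fin; lra.
have If := L2_integrable mO Lf Lf.
have If0 := integrable_fin_num mO If.
rewrite /L2dot /Rintegral fine_gt0// -ge0_fin_numE; last first.
  by apply: integral_ge0 => y _; rewrite lee_fin -expr2 sqr_ge0.
rewrite If0 andbT.
apply: (@lt_le_trans _ _ (\int[mu]_(y in B) (f x ^+ 2 / 2)%:E)%E).
  by rewrite integral_cst// mule_gt0// lte_fin divr_gt0.
apply: (@le_trans _ _ (\int[mu]_(y in B) (f y * f y)%:E)%E).
  apply: ge0_le_integral => //.
  - by move=> y _; rewrite lee_fin divr_ge0// ltW.
  - apply/measurable_EFinP; apply: measurable_funTS; apply: measurable_funM; exact: continuous_rV_measurable.
  - by move=> y /Bball[_ h]; rewrite lee_fin ltW.
apply: ge0_subset_integral => //.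
- apply/measurable_EFinP; apply: measurable_funTS; apply: measurable_funM; exact: continuous_rV_measurable.
- by move=> y _; rewrite lee_fin -expr2 sqr_ge0.
- by move=> y /Bball[].
Qed.

End domain.

(** A maximal independent family inside S spans S, whether or not S is a subspace. *)
Lemma maximal_row_free (F : fieldType) p (S : set 'rV[F]_p) :
  exists r, exists E : 'M[F]_(r, p),
    [/\ row_free E, forall i, S (row i E) & forall v, S v -> (v <= E)%MS].
Proof.
pose Q r := `[< exists E : 'M[F]_(r, p), row_free E /\ forall i, S (row i E) >].
have Q0 : exists r, Q r.
  exists 0%N; apply/asboolP; exists 0; split; last by case.
  by rewrite /row_free mxrank0.
have Qp r : Q r -> (r <= p)%N.
  by move=> /asboolP[E [fE _]]; rewrite -(eqP fE) rank_leq_col.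
case: (ex_maxnP Q0 Qp) => r /asboolP[E [fE SE]] rmax.
exists r, E; split => // v Sv; apply: contrapT => /negP vE.
have : Q (r + 1)%N.
  apply/asboolP; exists (col_mx E v); split; last first.
    move=> i; case: (split_ordP i) => j ->; first by rewrite rowKu.
    by rewrite rowKd (_ : row j v = v)//; apply/rowP => k; rewrite mxE ord1.
  have lt : (E < col_mx E v)%MS.
    rewrite ltmxE col_mx_sub negb_and vE orbT andbT; apply/submxP; exists (row_mx 1%:M 0).
    by rewrite mul_row_col mul1mx mul0mx addr0.
  have := rank_ltmx lt; rewrite (eqP fE) => h.
  by rewrite /row_free eqn_leq rank_leq_row [leqLHS]addn1.
by move=> /rmax; rewrite addn1 ltnn.
Qed.

Section finite_elements.
Context {R : realType} {d : nat}.
Local Notation mu := (lebesgue_rV R d).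
Variables (Om : set 'rV[R]_d) (Th : seq 'M[R]_(d.+1, d)).
Hypothesis triOm : triangulation Om Th.

Definition vertices := [seq row k K | K <- Th, k <- enum 'I_d.+1].

Definition vertex (i : 'I_(size vertices)) : 'rV[R]_d := nth 0 vertices i.

(** Values at all the vertices; a vertex common to several simplices is repeated. *)
Definition nodal (u : 'rV[R]_d -> R) : 'rV[R]_(size vertices) := \row_i u (vertex i).

(** Barycentric coordinates with respect to one simplex containing x. *)
Lemma fe_nodal x : exists q : 'cV[R]_(size vertices),
  forall u, fe_space Om Th u -> u x = (nodal u *m q) ord0 ord0.
Proof.
have [Ox|nOx] := pselect (Om x); last first.
  by exists 0 => u [_ _ + _] => /(_ x nOx) ->; rewrite mulmx0 mxE.
have [_ clO _] := triOm.
have := subset_closure Ox; rewrite clO => -[K KTh [l [l0 _ l1 xE]]].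
have vK k : exists i, vertex i = row k K.
  have kin : row k K \in vertices by apply/allpairsP; exists (K, k); rewrite /= mem_enum.
  have lt : (index (row k K) vertices < size vertices)%N by rewrite index_mem.
  by exists (Ordinal lt); rewrite /vertex nth_index.
have [i iE] := choice vK.
exists (\sum_k l ord0 k *: delta_mx (i k) ord0) => u [_ _ _ /(_ K KTh)[a [c uK]]].
have hx : hull K x by exists l.
have hk k : hull K (row k K).
  exists (delta_mx ord0 k); split => //.
  - by move=> m; rewrite mxE ler0n.
  - rewrite (bigD1 k)//= big1 ?addr0 ?mxE ?eqxx// => m mk; rewrite mxE (negbTE mk) andbF.
    by [].
  - by rewrite rowE.
rewrite (uK _ hx) mulmx_sumr summxE.
rewrite (eq_bigr (fun k => l ord0 k * (rdot a (row k K) + c))); last first.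
  by move=> k _; rewrite -scalemxAr mxE -colE !mxE iE -(uK _ (hk k)).
under eq_bigr do rewrite mulrDr; rewrite big_split/= -mulr_suml l1 mul1r; congr (_ + _).
rewrite /rdot; under [RHS]eq_bigr do rewrite mulr_sumr; rewrite exchange_big/=.
apply: eq_bigr => m _; rewrite xE mxE mulr_sumr; apply: eq_bigr => k _; rewrite mxE; ring.
Qed.

(** A maximal family of elements of X_h with independent nodal values; by maximality
    their nodal values span those of all of X_h. *)
Lemma nodal_basis : exists r (e : 'I_r -> 'rV[R]_d -> R) (Q : 'M[R]_(size vertices, r)),
  [/\ forall i, fe_space Om Th (e i),
      forall u, fe_space Om Th u -> u = \sum_i (nodal u *m Q) ord0 i *: e i &
      forall c : 'rV[R]_r, c != 0 -> exists k, (\sum_i c ord0 i *: e i) (vertex k) != 0].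
Proof.
have [r [E [fE SE maxE]]] := @maximal_row_free R _ (nodal @` fe_space Om Th).
have SE' i : exists u, fe_space Om Th u /\ nodal u = row i E.
  by have [u hu uE] := SE i; exists u.
have [e he] := choice SE'.
have hfe i : fe_space Om Th (e i) by have := he i => -[].
have heE i : nodal (e i) = row i E by have := he i => -[].
exists r, e, (pinvmx E); split => //.
- move=> u hu; apply/funext => x; have [q hq] := fe_nodal x.
  rewrite fct_sumE hq//; have /mulmxKpV uE : (nodal u <= E)%MS by apply: maxE; exists u.
  rewrite -{1}uE -[LHS]/((_ *m E *m q) ord0 ord0) -mulmxA mxE; apply: eq_bigr => i _.
  rewrite -[RHS]/((nodal u *m pinvmx E) ord0 i * e i x); congr (_ * _).
  by rewrite hq// heE -row_mul [RHS]mxE.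
- move=> c c0; apply: contrapT => h; move/eqP: c0; apply.
  apply: (row_free_inj fE); rewrite mul0mx; apply/rowP => k.
  rewrite !mxE; apply: contrapT => h'; apply: h; exists k.
  apply/eqP => h0; apply: h'; rewrite -[RHS]h0 fct_sumE; apply: eq_bigr => i _.
  by rewrite -[RHS]/(c ord0 i * e i (vertex k)); congr (_ * _); have := congr1 (fun M : 'rV[R]__ => M ord0 k) (heE i); rewrite !mxE.
Qed.

End finite_elements.

Section spectral.
Context {R : realType} {d : nat}.
Local Notation mu := (lebesgue_rV R d).
Variables (Om : set 'rV[R]_d) (Th : seq 'M[R]_(d.+1, d)) (Dh : ('rV[R]_d -> R) -> ('rV[R]_d -> R)).

Lemma lincomb_continuous r (e : 'I_r -> 'rV[R]_d -> R) (c : 'I_r -> R) :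
  (forall i, continuous (e i)) -> continuous (\sum_i c i *: e i).
Proof.
move=> ce; elim: (index_enum _) => [|i s IH] x.
  by rewrite big_nil; exact: cst_continuous.
rewrite big_cons; apply: (continuousD (f := c i *: e i) (g := \sum_(j <- s) c j *: e j)); last exact: IH.
by apply: (continuousM (s := fun=> c i) (t := e i)); [exact: cst_continuous|exact: ce].
Qed.

Lemma L2dot_lincomb r (e : 'I_r -> 'rV[R]_d -> R) (c c' : 'rV[R]_r) : measurable Om ->
  (forall i, L2 Om (e i)) ->
  L2dot Om (\sum_i c ord0 i *: e i) (\sum_i c' ord0 i *: e i) =
  (c *m (\matrix_(i, j) L2dot Om (e i) (e j)) *m c'^T) ord0 ord0.
Proof.
move=> mO Le.
have Lc : L2 Om (\sum_i c' ord0 i *: e i) by apply: L2_sum => i; exact: L2Z.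
rewrite L2dot_suml// -mulmxA mxE; apply: eq_bigr => i _; congr (_ * _).
rewrite L2dotC L2dot_suml// mxE; apply: eq_bigr => j _.
by rewrite !mxE L2dotC mulrC.
Qed.

Hypotheses (pOm : convex_polygonal_domain Om) (triOm : triangulation Om Th)
  (hDh : discrete_laplacian Om Th Dh).

Let oO : open Om := polygonal_open pOm.
Let mO : measurable Om := open_rV_measurable oO.
Let fO : (mu Om < +oo)%E.
Proof. by have [_ bO _] := pOm; exact: bounded_rV_measure_lty. Qed.

(** In the coordinates of a nodal basis Delta_h is - K G^(-1), with the mass matrix G
    and the stiffness matrix K; diagonalizing both makes it diagonal and turns
    the L2 norm into a sum of squares. *)
Lemma spectral_functionals : exists p (P : 'I_p -> 'rV[R]_d) m (w : 'I_m -> 'I_p -> R) (lam : 'I_m -> R),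
  let l k (u : 'rV[R]_d -> R) := \sum_i w k i * u (P i) in
  [/\ forall k, 0 <= lam k,
      forall u, fe_space Om Th u -> forall k, l k (Dh u) = - lam k * l k u,
      forall u, fe_space Om Th u -> L2norm Om u ^+ 2 = \sum_k l k u ^+ 2 &
      forall u v, fe_space Om Th u -> fe_space Om Th v ->
        L2norm Om (u - v) ^+ 2 = \sum_k (l k u - l k v) ^+ 2].
Proof.
have [r [e [Q [hfe uE nz]]]] := nodal_basis triOm.
have H1e i : H1 Om (e i) by have [[]] := hfe i.
have Le i : L2 Om (e i) by have [] := H1e i.
have H10e i : H10 Om (e i) by have [] := hfe i.
have feL2 u : fe_space Om Th u -> L2 Om u by move=> [[[]]].
pose G := \matrix_(i, j) L2dot Om (e i) (e j).
pose K := \matrix_(i, j) grad_dot Om (e i) (e j).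
have GT : G^T = G by apply/matrixP => i j; rewrite !mxE L2dotC.
have KT : K^T = K by apply/matrixP => i j; rewrite !mxE grad_dotC.
have cont c : continuous (\sum_(i < r) c i *: e i).
  exact: lincomb_continuous (fun i => let: And4 _ cei _ _ := hfe i in cei).
have posG (c : 'rV[R]_r) : c != 0 -> 0 < (c *m G *m c^T) ord0 ord0.
  move=> /nz[k hk]; rewrite -L2dot_lincomb//; apply: (L2dot_gt0 oO _ _ _ hk).
  - by apply: L2_sum => i; exact: L2Z.
  - exact: cont.
  - apply: contrapT => nO; move/eqP: hk; apply; rewrite fct_sumE big1// => i _.
    have [_ _ e0 _] := hfe i.
    by rewrite -[LHS]/(c ord0 i * e i (vertex k)) e0// mulr0.
have posK (c : 'rV[R]_r) : 0 <= (c *m K *m c^T) ord0 ord0.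
  have -> : (c *m K *m c^T) ord0 ord0 =
     \sum_m L2dot Om (\sum_i c ord0 i *: weak_partial Om m (e i)) (\sum_i c ord0 i *: weak_partial Om m (e i)).
    have -> : K = \sum_m (\matrix_(i, j) L2dot Om (weak_partial Om m (e i)) (weak_partial Om m (e j))).
      by apply/matrixP => i j; rewrite summxE mxE; apply: eq_bigr => m _; rewrite mxE.
    rewrite mulmx_sumr mulmx_suml summxE; apply: eq_bigr => m _; rewrite -L2dot_lincomb// => i.
    by have [] := weak_partialP m (H1e i).
  apply: sumr_ge0 => m _; apply: L2dot_ge0 => //; apply: L2_sum => i; apply: L2Z.
  by have [] := weak_partialP m (H1e i).
have [Z [lam [lam0 GZ BZ]]] := real_simultaneous_diagonalization GT KT posG posK.
have uG : G \in unitmx.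
  rewrite -row_free_unit; apply: inj_row_free => c cG0; apply: contrapT => /eqP/posG.
  by rewrite cG0 mul0mx mxE ltxx.
pose co u := nodal Th u *m Q.
have coDh u : fe_space Om Th u -> co (Dh u) *m Z = - (co u *m Z *m diag_mx lam).
  move=> hu; have [hDu DhE] := hDh hu.
  have H1u : H1 Om u by have [[]] := hu.
  have E : co (Dh u) *m G = - (co u *m K).
    apply/rowP => j; have := DhE _ (hfe j).
    rewrite (grad_dot_lincomb (s := index_enum 'I_r) (c := fun i => co u ord0 i) (e := e) mO fO H1u H1e (H10e j) (uE _ hu)).
    rewrite [in LHS](uE _ hDu) L2dot_suml// => E; rewrite !mxE; apply: oppr_inj; rewrite opprK.
    have -> : \sum_k co (Dh u) 0 k * G k j = \sum_i co (Dh u) ord0 i * L2dot Om (e i) (e j).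
      by apply: eq_bigr => i _; rewrite [G i j]mxE.
    by rewrite E; apply: eq_bigr => i _; rewrite [K i j]mxE.
  have := BZ (- (K *m invmx G)); rewrite mulNmx mulmxKV// => /(_ erefl) BZ'.
  rewrite -(mulmxK uG (co (Dh u))) E mulNmx mulNmx -!mulmxA; congr (- _).
  by move: BZ'; rewrite mulNmx -mulmxA => /oppr_inj ->.
have nrm (c : 'rV[R]_r) f : f = \sum_i c ord0 i *: e i -> L2norm Om f ^+ 2 = \sum_k (c *m Z) ord0 k ^+ 2.
  move=> ->; rewrite L2norm_sqr//; last by apply: L2_sum => i; exact: L2Z.
  rewrite L2dot_lincomb// -/G GZ mulmxA -mulmxA -trmx_mul mxE; apply: eq_bigr => k _.
  by rewrite [in X in _ * X]mxE expr2.
exists (size (vertices Th)), (@vertex _ _ Th), (r + r)%N, (fun k i => (Q *m Z) i k), (fun k => lam ord0 k) => l.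
have lE k u : l k u = (co u *m Z) ord0 k.
  rewrite /co -mulmxA [RHS]mxE; apply: eq_bigr => i _; by rewrite [in RHS]mxE mulrC.
split => //.
- by move=> u hu k; rewrite !lE coDh// mxE mul_mx_diag mxE mulNr mulrC.
- move=> u hu; rewrite (nrm (co u))//; last exact: uE.
  by apply: eq_bigr => k _; rewrite lE.
- move=> u v hu hv; rewrite (nrm (co u - co v)).
    by apply: eq_bigr => k _; rewrite !lE mulmxBl !mxE.
  rewrite {1}(uE _ hu) {1}(uE _ hv) -sumrB; apply: eq_bigr => i _.
  by rewrite -scalerBl !mxE.
Qed.

End spectral.

(** * From functionals to the norm *)

Section reduction.
Context {R : realType} {d : nat}.
Variables (Om : set 'rV[R]_d) (Th : seq 'M[R]_(d.+1, d)).
Variables (p : nat) (P : 'I_p -> 'rV[R]_d) (w : 'I_p -> R).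
Implicit Types (f g : 'rV[R]_d -> R).

Definition point_functional f : R := \sum_i w i * f (P i).

Lemma point_functionalD f g : point_functional (f + g) = point_functional f + point_functional g.
Proof. by rewrite -big_split; apply: eq_bigr => i _; rewrite /= -mulrDr. Qed.

Lemma point_functionalZ k f : point_functional (k *: f) = k * point_functional f.
Proof. by rewrite /point_functional mulr_sumr; apply: eq_bigr => i _; rewrite mulrCA. Qed.

Lemma point_functional0 : point_functional 0 = 0.
Proof. by rewrite /point_functional big1// => i _; rewrite mulr0. Qed.

Lemma point_functionalN f : point_functional (- f) = - point_functional f.
Proof. by rewrite -scaleN1r point_functionalZ mulN1r. Qed.

Lemma point_functional_sum (s : seq nat) (F : nat -> 'rV[R]_d -> R) :
  point_functional (\sum_(j <- s) F j) = \sum_(j <- s) point_functional (F j).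
Proof.
elim: s => [|j s IH]; first by rewrite !big_nil point_functional0.
by rewrite !big_cons point_functionalD IH.
Qed.

(** The functional commutes with the time discretization and diagonalizes Delta_h. *)
Lemma scheme_functional Dh (alpha tau lam : R) b N vh (U : nat -> 'rV[R]_d -> R) :
  0 < tau -> fe_space Om Th vh ->
  (forall u, fe_space Om Th u -> point_functional (Dh u) = - lam * point_functional u) ->
  corrected_crank_nicolson Om Th Dh alpha b tau N (fun _ => 0) vh U ->
  scalar_scheme alpha b (lam * tau `^ alpha) N (point_functional \o U).
Proof.
move=> tau0 hv eig [[U0 feU] s1 s2 s3].
have ta : tau `^ alpha * tau `^ (- alpha) = 1 by rewrite powRN mulfV// gt_eqF// powR_gt0.
have cq n : tau `^ alpha * point_functional (cq_derivative alpha b tau (fun n => U n - vh) n) =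
    \sum_(0 <= j < n.+1) b (n - j)%N * (point_functional (U j) - point_functional (U 0%N)).
  rewrite point_functionalZ mulrA ta mul1r point_functional_sum; apply: eq_bigr => j _.
  by rewrite point_functionalZ point_functionalD point_functionalN U0.
have lin := (point_functionalN, point_functionalD, point_functionalZ, point_functional0).
have step n X Y : tau `^ alpha * point_functional (cq_derivative alpha b tau (fun n => U n - vh) n) = X ->
   point_functional (cq_derivative alpha b tau (fun n => U n - vh) n) + lam * Y = 0 ->
   X + lam * tau `^ alpha * Y = 0.
  by move=> <- E; rewrite -(mulrC (tau `^ alpha)) -mulrA -mulrDr E mulr0.
split => [N1|N2|n /andP[n3 nN]].
- have E := congr1 point_functional (s1 N1); apply: (step _ _ _ (cq 1%N)); move: E.
  move: (cq_derivative _ _ _ _ _) => D; rewrite /= U0 !lin !eig//; last exact: feU.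
  by rewrite !(mulr0, addr0) => <-; ring.
- have E := congr1 point_functional (s2 N2); apply: (step _ _ _ (cq 2%N)); move: E.
  move: (cq_derivative _ _ _ _ _) => D; rewrite /= U0 !lin !eig//; [|by apply: feU; exact: ltnW|exact: feU].
  by rewrite !(mulr0, addr0) => <-; ring.
- have E := congr1 point_functional (s3 n (introT andP (conj n3 nN))).
  apply: (step _ _ _ (cq n)); move: E.
  move: (cq_derivative _ _ _ _ _) => D; rewrite /= !lin !eig//; [|by apply: feU; exact: leq_trans (leq_pred n) nN|exact: feU].
  by rewrite !(mulr0, addr0) => <-; ring.
Qed.

End reduction.

(** For w = Delta_h R_h v, |w|^2 = - (grad R_h v, grad w) = - (grad v, grad w)
    = (Delta v, w). *)
Lemma discrete_laplacian_ritz_le (R : realType) d (Om : set 'rV[R]_d) (Th : seq 'M[R]_(d.+1, d)) Rh Dh v :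
  convex_polygonal_domain Om -> ritz_projection Om Th Rh -> discrete_laplacian Om Th Dh ->
  H10 Om v -> H2 Om v -> L2norm Om (Dh (Rh v)) <= L2norm Om (laplacian Om v).
Proof.
move=> pOm hR hD v1 v2.
have mO := open_rV_measurable (polygonal_open pOm).
have fO : (lebesgue_rV R d Om < +oo)%E by have [_ bO _] := pOm; exact: bounded_rV_measure_lty.
have [feR RE] := hR v v1; have [feD DE] := hD _ feR.
have [chi10 _ _ _] := feD; have LD : L2 Om (Dh (Rh v)) by have [[]] := chi10.
have [Llap lapE] := H2_green mO fO v2 chi10.
have E : L2norm Om (Dh (Rh v)) ^+ 2 = L2dot Om (laplacian Om v) (Dh (Rh v)).
  by rewrite (L2norm_sqr LD); apply: oppr_inj; rewrite (DE _ feD) (RE _ feD) lapE.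
have := le_trans (ler_norm _) (L2_cauchy_schwarz mO Llap LD); rewrite -E expr2.
have := L2norm_ge0 Om (Dh (Rh v)); rewrite le_eqVlt => /predU1P[<- _|D0]; first exact: L2norm_ge0.
by rewrite ler_pM2r.
Qed.

Theorem theorem3p1 (R : realType) (d : nat) (Om : set 'rV[R]_d)
    (T alpha : R) (b : nat -> R)
    (I : Type) (Th : I -> seq 'M[R]_(d.+1, d)) :
  (1 <= d <= 3)%N ->
  convex_polygonal_domain Om ->
  0 < T ->
  0 < alpha < 1 ->
  cq_weights alpha b ->
  (forall i, triangulation Om (Th i)) ->
  shape_regular Th ->
  quasi_uniform Th ->
  exists c : R,
    forall (i : I) (N : nat) (Rh Dh : ('rV[R]_d -> R) -> ('rV[R]_d -> R))
      (v : 'rV[R]_d -> R) (uh : R -> 'rV[R]_d -> R)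
      (U : nat -> 'rV[R]_d -> R),
    (0 < N)%N ->
    ritz_projection Om (Th i) Rh ->
    discrete_laplacian Om (Th i) Dh ->
    H10 Om v -> H2 Om v ->
    let tau := T / N%:R in
    let tn (n : nat) := n%:R * tau in
    semidiscrete_solution Om (Th i) Dh alpha T (fun _ => 0) (Rh v) uh ->
    corrected_crank_nicolson Om (Th i) Dh alpha b tau N (fun _ => 0) (Rh v) U ->
    forall n : nat, (1 <= n <= N)%N ->
      L2norm Om (uh (tn n) - U n)
        <= c * tau ^+ 2 * (tn n) `^ (alpha - 2) * L2norm Om (laplacian Om v).
Proof.
move=> _ pOm T0 alpha01 hb triOm _ _.
have [K K0 hK] := functional_error alpha01 hb.
exists K => i N Rh Dh v uh U N0 hR hD v1 v2 tau tn [feu u0 acu equ] sch n nN.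
have [n1 nN'] := andP nN.
have tau0 : 0 < tau by rewrite divr_gt0// ltr0n.
have NT : N%:R * tau = T by rewrite /tau mulrCA mulfV ?mulr1// pnatr_eq0 -lt0n.
have tnT : 0 <= tn n <= T.
  have h : n%:R * tau <= N%:R * tau by apply: ler_wpM2r; [exact: ltW|rewrite ler_nat].
  by rewrite NT in h; rewrite h andbT; apply: mulr_ge0 => //; exact: ltW.
have [p [P [m [w [lam [lam0 leig lnorm ldist]]]]]] := spectral_functionals pOm (triOm i) hD.
have [feR _] := hR v v1; have [feD _] := hD _ feR.
have [[U0 feU] _ _ _] := sch.
pose C := K * (tau `^ alpha * n%:R `^ (alpha - 2)).
have C0 : 0 <= C by rewrite !mulr_ge0// powR_ge0.
have CE : C = K * tau ^+ 2 * (tn n) `^ (alpha - 2).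
  have n0 : (0 : R) <= n%:R by [].
  rewrite /C /tn powRM// ?(ltW tau0)// -powR_mulrn ?(ltW tau0)//.
  have -> : tau `^ alpha = tau `^ 2%:R * tau `^ (alpha - 2) by rewrite -powRD ?(gt_eqF tau0) ?implybT//; congr (_ `^ _); ring.
  ring.
rewrite -CE.
apply: (@le_trans _ _ (C * L2norm Om (Dh (Rh v)))); last first.
  by apply: ler_wpM2l => //; exact: (discrete_laplacian_ritz_le pOm hR hD v1 v2).
rewrite -(@ler_pXn2r _ 2)// ?nnegrE ?L2norm_ge0//; last by rewrite mulr_ge0 ?L2norm_ge0.
rewrite exprMn (ldist _ _ (feu _ tnT) (feU _ nN')) (lnorm _ feD) mulr_sumr.
apply: ler_sum => k _.
have := hK p T (lam k) tau N (fun j t => uh t (P j)) (fun j t => Dh (uh t) (P j)) (w k) (point_functional P (w k) \o U)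
  T0 (lam0 k) tau0 NT (fun j => acu (P j)).
have eqn j t : 0 < t < T -> caputo alpha (fun t0 => uh t0 (P j)) t = Dh (uh t) (P j).
  by move=> tT; apply/eqP; rewrite -subr_eq0; apply/eqP; rewrite equ.
move=> /(_ eqn (fun t tT => leig _ (feu t tT) k)) H.
have U0' : (point_functional P (w k) \o U) 0%N = \sum_j w k j * uh 0 (P j).
  by rewrite /= U0 u0.
have {H} := H U0' (scheme_functional tau0 feR (fun u hu => leig u hu k) sch) n nN.
rewrite u0 -[\sum_j w k j * Rh v (P j)]/(point_functional P (w k) (Rh v)) => H.
rewrite (leig _ feR) -exprMn -[leLHS]real_normK ?num_real// -[leRHS]real_normK ?num_real//.
rewrite ler_pXn2r ?nnegrE// [leRHS]normrM (ger0_norm C0) mulNr normrN.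
exact: H.
Qed.
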